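(* For all $\varepsilon>0$, there exist $c,\eta>0$ such that for any finite set $F\subseteq\mathbb{C}[x]$ of non-constant polynomials of degree $\leq 1/\varepsilon$ which is neither $\varepsilon$-additive nor $\varepsilon$-multiplicative, and any finite set $A\subseteq\mathbb{C}$ with $|F|\geq|A|^{\varepsilon}$, we have $$|F(A)|=|\{f(a): f\in F,\ a\in A\}|\geq c|A|^{1+\eta}.$$
   Context: For a finite set $F\subseteq\mathbb{C}[x]$ and $\varepsilon>0$: $F$ is $\varepsilon$-additive if there are $g,h\in\mathbb{C}[t]$ such that $|F\cap\{g(h(x)+a):a\in\mathbb{C}\}|\geq|F|^{1-\varepsilon}$; $F$ is $\varepsilon$-multiplicative if there are $g,h\in\mathbb{C}[t]$ such that $|F\cap\{g(h(x)\cdot a):a\in\mathbb{C}\}|\geq|F|^{1-\varepsilon}$. *)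

(* Defs.v *)
From mathcomp Require Import all_boot all_order all_algebra.
From mathcomp Require Import finmap complex.
From mathcomp Require Import boolp reals exp.

Set Implicit Arguments.
Unset Strict Implicit.
Unset Printing Implicit Defensive.

Import Order.TTheory GRing.Theory Num.Theory.

Local Open Scope fset_scope.
Local Open Scope ring_scope.

(* The complex numbers are the type [R[i]] over a model [R] of the reals. *)

Definition in_additive_family (R : realType) (g h f : {poly R[i]}) : Prop :=
  exists a : R[i], f = g \Po (h + a%:P).

Definition in_multiplicative_family (R : realType) (g h f : {poly R[i]}) : Prop :=
  exists a : R[i], f = g \Po (h * a%:P).

Definition eps_additive (R : realType) (eps : R) (F : {fset {poly R[i]}}) :
    Prop :=
  exists g h : {poly R[i]},
    (#|` [fset f in F | `[< in_additive_family g h f >]]|%:R : R)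
      >= (#|` F|%:R : R) `^ (1 - eps).

Definition eps_multiplicative (R : realType) (eps : R)
    (F : {fset {poly R[i]}}) : Prop :=
  exists g h : {poly R[i]},
    (#|` [fset f in F | `[< in_multiplicative_family g h f >]]|%:R : R)
      >= (#|` F|%:R : R) `^ (1 - eps).

Definition eval_fset (R : realType) (F : {fset {poly R[i]}}) (A : {fset R[i]}) :
    {fset R[i]} :=
  [fset f.[a] | f in F, a in A].

(* Main.v *)
Require Import Defs.
From HB Require Import structures.
From mathcomp Require Import all_boot all_order all_algebra.
From mathcomp Require Import fingroup perm.
From mathcomp Require Import finmap complex.
From mathcomp Require Import boolp reals exp.
From mathcomp Require Import ring lra zify.

(* Suppose that [|F(A)|] is at most [|A|^(1+eta)].  Iterating Cauchy-Schwarz on the incidences between [F]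
   and tuples of points of [A] lying in a common annulus, chosen so that most [f] map most of these
   tuples to tuples lying in a common sparse annulus, gives many sequences [f1, f2, ...] for which the closed chain
   [f1(x0) = f2(x1), f3(x1) = f4(x2), ...], returning to [x0], has so many solutions [x0] that it is
   solvable for every [x0].  Letting [x0] tend to infinity, the substitutions [S_f : x -> f(x)^(1/d)]
   satisfy a product relation, up to [d]-th roots of unity.  So a random walk in the group of truncated
   substitutions returns often to the identity, and by Balog-Szemeredi-Gowers many of the [S_f] lie in a
   coset of a symmetric set of slow growth.  In this triangular group, slow growth forces the ratios of
   a large subfamily to commute to high order.  A commuting family with many symbols spans a
   one-parameter unipotent group, which gives [f = g(h + a)]; one with many multipliers is
   simultaneously diagonalised, which gives [f = g(h a)]. *)

Set Implicit Arguments.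
Unset Strict Implicit.
Unset Printing Implicit Defensive.

Import Order.TTheory GRing.Theory Num.Theory.

Local Open Scope ring_scope.

(** * Energy and small doubling in groups *)

(** Counting solutions of a closed chain at single points would prove nothing: the chain has an
    elimination polynomial whose degree grows with its length, and the roots of that polynomial
    could account for every solution. Hence tuples of [s + 1] points, with [s] above that degree.
    The price is the number of possible image tuples. Sparse annuli reduce it, with [B = F(A)] and
    [K = |B| / |A|], to [|B|] choices for the first image times a number bounded up to powers of [K]
    for each other one. The resulting return probability is at least [|A| ^ -1], up to constants and
    powers of [K], whatever the length of the walk. Since [K] may be taken to be an arbitrarily
    small power of [|A|], a long walk must at some stage lose only a tiny power of [|A|], and there
    Balog-Szemeredi-Gowers applies. The losses in the group part are thus powers of [|A|] whose
    exponents are fixed at the end, in [structured_subset]. Truncating the substitutions is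
    harmless: polynomials of bounded degree are determined by finitely many coefficients at
    infinity, and every loss of precision is bounded in advance. *)

Lemma size_le_fibre (T : Type) (U : eqType) (X : seq T) (q : T -> U)
    (s : seq U) (m : nat) :
  all (fun t => q t \in s) X ->
  (forall y, y \in s -> (count (fun t => q t == y) X <= m)%N) ->
  (size X <= m * size s)%N.
Proof.
elim: s X => [|y s IH] X.
  by case: X => //= a X.
move=> hX hm; rewrite mulnS -(count_predC (fun t => q t == y) X).
apply: leq_add; first by apply: hm; rewrite mem_head.
rewrite -size_filter; apply: IH.
  rewrite all_filter; apply: sub_all hX => t.
  by rewrite inE /=; case: eqP.
move=> z zs; rewrite count_filter; apply: leq_trans (hm z _); last first.
  by rewrite inE zs orbT.
by apply: sub_count => t /andP[].
Qed.

(** * Paths of length four in dense bipartite graphs *)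

Section Graph.
Variable R : realFieldType.
Variables (J L : finType) (e : J -> L -> bool).

Lemma sum_sqr_ge (I : finType) (F : I -> R) :
  (\sum_i F i) ^+ 2 <= #|I|%:R * \sum_i (F i) ^+ 2.
Proof.
have : 0 <= \sum_i \sum_j (F i - F j) ^+ 2.
  by apply: sumr_ge0 => i _; apply: sumr_ge0 => j _; apply: sqr_ge0.
have -> : \sum_i \sum_j (F i - F j) ^+ 2 =
    \sum_i \sum_j (F i ^+ 2 + F j ^+ 2) - 2 * (\sum_i F i * \sum_j F j).
  rewrite mulr_sumr -sumrB; apply: eq_bigr => i _.
  rewrite mulr_sumr mulr_sumr -sumrB; apply: eq_bigr => j _; ring.
have -> : \sum_i \sum_j (F i ^+ 2 + F j ^+ 2) = 2 * (#|I|%:R * \sum_i F i ^+ 2).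
  transitivity (\sum_i (#|I|%:R * F i ^+ 2 + \sum_j F j ^+ 2)).
    by apply: eq_bigr => i _; rewrite big_split /= sumr_const mulr_natl.
  by rewrite big_split /= -mulr_sumr sumr_const [in RHS]mulr_natl mulr_natl mulr2n.
rewrite -mulr_suml; move=> h.
by rewrite expr2; lra.
Qed.

Definition codeg (j j' : J) := #|[pred l | e j l && e j' l]|.

(** Dependent random choice. Inside the neighbourhood of a well chosen [y] few pairs have a small
    common neighbourhood. Deleting the vertices that lie in many such pairs leaves [A]; for any two
    of its members at least half of the neighbourhood of [y] serves as midpoint of many paths. *)
Lemma path_lemma (alpha : R) : 0 < alpha -> (0 < #|J|)%N -> (0 < #|L|)%N ->
  alpha * #|J|%:R * #|L|%:R <= #|[pred p : J * L | e p.1 p.2]|%:R ->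
  exists A : {set J},
    alpha * #|J|%:R <= 2 * #|A|%:R /\
    forall j j', j \in A -> j' \in A ->
      alpha ^+ 5 * #|J|%:R * #|L|%:R ^+ 2 <=
      4096 * #|[pred p : L * J * L |
         [&& e j p.1.1, e p.1.2 p.1.1, e p.1.2 p.2 & e j' p.2]]|%:R :> R.
Proof.
move=> a0 J0 L0 hE.
pose n : R := #|J|%:R; pose l : R := #|L|%:R.
have n0 : 0 < n by rewrite ltr0n.
have l0 : 0 < l by rewrite ltr0n.
pose be : R := alpha ^+ 2 / 32.
pose bad j j' := (codeg j j')%:R < be * l.
pose X y := [set j | e j y].
pose B y := #|[pred p : J * J | [&& e p.1 y, e p.2 y & bad p.1 p.2]]|.
have sumX : \sum_y (#|X y|%:R : R) = #|[pred p : J * L | e p.1 p.2]|%:R.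
  rewrite -natr_sum; congr (_%:R); rewrite -sum1_card.
  rewrite (eq_bigl (fun p : J * L => true && e p.1 p.2)) //.
  rewrite -(pair_big_dep xpredT (fun j y => e j y) (fun _ _ => 1%N)) /=.
  rewrite (exchange_big_dep xpredT) //=; apply: eq_bigr => y _.
  by rewrite sum1dep_card.
have sumB : \sum_y ((B y)%:R : R) <= n ^+ 2 * (be * l).
  have -> : \sum_y ((B y)%:R : R) =
     \sum_(p : J * J | bad p.1 p.2) (codeg p.1 p.2)%:R.
    rewrite -!natr_sum; congr (_%:R).
    under eq_bigr do rewrite /B -sum1_card.
    rewrite (exchange_big_dep (fun p : J * J => bad p.1 p.2)) /=; last first.
      by move=> y p _ /and3P[].
    apply: eq_bigr => p hp; rewrite /codeg -sum1_card; apply: eq_bigl => y.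
    by rewrite !inE hp andbT.
  apply: le_trans (_ : \sum_(p : J * J | bad p.1 p.2) be * l <= _).
    by apply: ler_sum => p /ltW.
  rewrite sumr_const -[X in X <= _]mulr_natl ler_wpM2r //.
    by rewrite mulr_ge0 ?ltW // divr_gt0 // ?exprn_gt0.
  rewrite -natrX ler_nat (leq_trans (max_card _)) // card_prod.
  by rewrite expnS expn1.
(* Average over [y]: by Cauchy-Schwarz the squares have mean at least [alpha ^+ 2 * n ^+ 2], and a
   bad pair lies in fewer than [be * l] neighbourhoods, so with [be = alpha ^+ 2 / 32] the penalty
   of weight 16 consumes at most half of that. *)
have [y hy] : exists y, alpha ^+ 2 / 2 * n ^+ 2 <=
    #|X y|%:R ^+ 2 - 16 * (B y)%:R.
  apply/existsP; rewrite -[X in is_true X]negbK negb_exists; apply/negP => /forallP h.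
  have : \sum_y (#|X y|%:R ^+ 2 - 16 * (B y)%:R) < \sum_(y : L) alpha ^+ 2 / 2 * n ^+ 2.
    apply: ltr_sum => [|y _]; last by rewrite ltNge h.
    case/card_gt0P: L0 => y _; apply/hasP; exists y => //.
  rewrite sumr_const sumrB -mulr_sumr -[X in _ < X]mulr_natl -/l.
  have := sum_sqr_ge (fun y => #|X y|%:R : R); rewrite sumX -/l.
  have h2 : (alpha * n * l) ^+ 2 <= #|[pred p : J * L | e p.1 p.2]|%:R ^+ 2.
    rewrite ler_sqr ?nnegrE //.
    by rewrite !mulr_ge0 // ltW.
  move=> h3 h4.
  have {h2 h3} h5 : l * (alpha ^+ 2 * n ^+ 2 * l) <= l * \sum_y #|X y|%:R ^+ 2.
    apply: le_trans (le_trans h2 h3); rewrite le_eqVlt; apply/orP; left.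
    by apply/eqP; ring.
  rewrite (ler_pM2l l0) in h5.
  have : n ^+ 2 * (be * l) = alpha ^+ 2 * n ^+ 2 * l / 32.
    by rewrite /be; field.
  pose s1 : R := \sum_y (B y)%:R; pose s2 : R := \sum_y #|X y|%:R ^+ 2.
  have {}h4 : s2 - 16 * s1 < l * (alpha ^+ 2 / 2 * n ^+ 2) := h4.
  have {}h5 : alpha ^+ 2 * n ^+ 2 * l <= s2 := h5.
  have {}sumB : s1 <= n ^+ 2 * (be * l) := sumB.
  by move=> h6; clearbody s1 s2; lra.
pose m : R := #|X y|%:R.
have B0 : 0 <= (B y)%:R :> R by [].
have hm2 : alpha ^+ 2 / 2 * n ^+ 2 <= m ^+ 2 by rewrite /m; lra.
have hbad : 16 * (B y)%:R <= m ^+ 2.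
  have : 0 <= alpha ^+ 2 / 2 * n ^+ 2.
    by rewrite mulr_ge0 ?exprn_ge0 ?divr_ge0 ?exprn_ge0 // ltW.
  rewrite /m; lra.
have m0 : 0 < m.
  rewrite lt_def ler0n andbT; apply: contraTneq hm2 => ->.
  rewrite expr0n /= -ltNge mulr_gt0 ?divr_gt0 ?exprn_gt0 //.
(* Here [2 / 3] is a rational lower bound for the square root of [1 / 2]. *)
have hm : 2 * alpha * n <= 3 * m.
  have p1 : 0 <= 2 * alpha * n by rewrite !mulr_ge0 // ltW.
  have p2 : 0 <= 3 * m by rewrite mulr_ge0 // ltW.
  have p3 : 0 <= alpha ^+ 2 * n ^+ 2 by rewrite mulr_ge0 ?exprn_ge0 // ltW.
  by rewrite -ler_sqr ?nnegrE // !exprMn; lra.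
pose bd j := #|[pred j' | (j' \in X y) && bad j j']|.
pose A := [set j in X y | 4 * (bd j)%:R <= m].
have badsym j j' : bad j j' = bad j' j.
  rewrite /bad /codeg; congr (_%:R < _); apply: eq_card => z.
  by rewrite !inE andbC.
have hA : #|X y :\: A|%:R * 4 <= m.
  have h1 : \sum_(j in X y :\: A) m / 4 <= (B y)%:R.
    apply: le_trans (_ : \sum_(j in X y :\: A) (bd j)%:R <= _).
      apply: ler_sum => j; rewrite !inE => /andP[+ hj]; rewrite hj /= -ltNge.
      by lra.
    rewrite -natr_sum ler_nat /B -sum1_card.
    rewrite (eq_bigl (fun p : J * J => (e p.1 y) && ((p.2 \in X y) && bad p.1 p.2))); last first.
      by move=> p; rewrite !inE.
    rewrite -(pair_big_dep (fun j => e j y) (fun j j' => (j' \in X y) && bad j j') (fun _ _ => 1%N)) /=.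
    rewrite [X in (_ <= X)%N](bigID (fun j => j \in A)) /=.
    apply: leq_trans (leq_addl _ _).
    rewrite (eq_bigl (fun j => e j y && (j \notin A))); last first.
      by move=> j; rewrite !inE andbC; case: (e j y).
    by apply: leq_sum => j _; rewrite /bd -sum1_card.
  move: h1; rewrite sumr_const -mulr_natl => h1.
  have h2 : #|X y :\: A|%:R * (m / 4) <= m ^+ 2 / 16 by lra.
  rewrite -(ler_pM2r m0); lra.
have cA : #|A|%:R = m - #|X y :\: A|%:R.
  rewrite /m -(cardsID A (X y)) natrD addrK; congr (_%:R).
  by apply: eq_card => j; rewrite !inE; case: (e j y).
exists A; split; first by rewrite cA -/n; lra.
move=> j j'; rewrite !inE => /andP[hj hbj] /andP[hj' hbj'].
pose Y := [set j2 in X y | ~~ bad j j2 && ~~ bad j2 j'].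
have hY : m <= 2 * #|Y|%:R.
  have : (#|X y| <= #|Y| + (bd j + bd j'))%N.
    rewrite -(cardsID Y (X y)); apply: leq_add.
      by apply: subset_leq_card; rewrite subsetIr.
    pose P1 := [set j2 in X y | bad j j2].
    pose P2 := [set j2 in X y | bad j' j2].
    apply: leq_trans (_ : #|P1 :|: P2| <= _)%N.
      apply: subset_leq_card; apply/subsetP => z; rewrite !inE.
      by case: (e z y); rewrite ?andbF //= andbT negb_and !negbK (badsym z).
    rewrite cardsU; apply: leq_trans (leq_subr _ _) _.
    apply: leq_add; apply: subset_leq_card; apply/subsetP => z; by rewrite !inE.
  rewrite -(ler_nat R) !natrD -/m.
  lra.
have be0 : 0 < be by rewrite divr_gt0 ?exprn_gt0.
have bel0 : 0 < be * l by rewrite mulr_gt0.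
have h3 : #|Y|%:R * (be * l) ^+ 2 <= #|[pred p : L * J * L |
         [&& e j p.1.1, e p.1.2 p.1.1, e p.1.2 p.2 & e j' p.2]]|%:R.
  have -> : #|[pred p : L * J * L |
         [&& e j p.1.1, e p.1.2 p.1.1, e p.1.2 p.2 & e j' p.2]]| =
     (\sum_(j2 : J) codeg j j2 * codeg j2 j')%N.
    rewrite -sum1_card.
    rewrite (eq_bigl (fun p : L * J * L => (e j p.1.1 && e p.1.2 p.1.1) && (e p.1.2 p.2 && e j' p.2))); last first.
      by move=> p; rewrite !inE -!andbA.
    rewrite -(pair_big_dep (fun p : L * J => e j p.1 && e p.2 p.1) (fun p l' => e p.2 l' && e j' l') (fun _ _ => 1%N)) /=.
    rewrite (eq_bigr (fun p : L * J => codeg p.2 j')); last first.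
      by move=> p _; rewrite /codeg -sum1_card.
    rewrite -(pair_big_dep xpredT (fun l1 j2 => e j l1 && e j2 l1) (fun _ j2 => codeg j2 j')) /=.
    rewrite (exchange_big_dep xpredT) //=; apply: eq_bigr => j2 _.
    by rewrite sum_nat_const.
  rewrite natr_sum mulr_natl -sumr_const.
  apply: le_trans (_ : \sum_(j2 in Y) (codeg j j2 * codeg j2 j')%:R <= _); last first.
    rewrite [X in _ <= X](bigID (mem Y)) /= lerDl; exact: sumr_ge0.
  apply: ler_sum => j2; rewrite !inE => /and3P[_ b1 b2].
  by rewrite natrM expr2; apply: ler_pM => //; rewrite ?(ltW bel0) // leNgt.
apply: le_trans (_ : 4096 * (#|Y|%:R * (be * l) ^+ 2) <= _); last by rewrite ler_wpM2l.
have -> : 4096 * (#|Y|%:R * (be * l) ^+ 2) = 4 * #|Y|%:R * alpha ^+ 4 * l ^+ 2.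
  by rewrite /be; field.
rewrite -/n -/l ler_wpM2r ?exprn_ge0 ?(ltW l0) //.
rewrite [X in X <= _](_ : _ = (alpha * n) * alpha ^+ 4); last by ring.
rewrite ler_wpM2r ?exprn_ge0 ?(ltW a0) //.
by lra.
Qed.
End Graph.

Section Counting.
Variable G : groupType.

Definition cnt (J : finType) (x : J -> G) (g : G) : nat := #|[pred j | x j == g]|.
Definition xmul (J : finType) (x : J -> G) (p : J * J) : G := (x p.1 * x p.2)%g.
Definition symmetric_family (J : finType) (x : J -> G) :=
  exists s : J -> J, involutive s /\ forall j, x (s j) = (x j)^-1%g.

Lemma cnt_mulE (J : finType) (x : J -> G) g :
  cnt (xmul x) g = (\sum_j cnt x ((x j)^-1 * g)%g)%N.
Proof.
rewrite /cnt -sum1_card.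
rewrite (eq_bigl (fun p : J * J => true && (x p.2 == (x p.1)^-1 * g)%g)); last first.
  by move=> p; rewrite !inE /= /xmul; apply/eqP/eqP => [<-|->]; rewrite ?mulKg ?mulVKg.
rewrite -(pair_big_dep xpredT (fun j j' => (x j' == (x j)^-1 * g)%g) (fun _ _ => 1%N)) /=.
by apply: eq_bigr => j _; rewrite sum1_card.
Qed.

Lemma sum_cnt (J : finType) (x : J -> G) (F : G -> nat) (s : seq G) :
  uniq s ->
  (\sum_(u <- s) cnt x u * F u = \sum_(j | x j \in s) F (x j))%N.
Proof.
elim: s => [|u s IH]; first by rewrite big_nil big_pred0.
move=> /andP[us uu]; rewrite big_cons IH // [in RHS](bigID (fun j => x j == u)) /=.
congr (_ + _)%N.
  rewrite (eq_bigl (fun j => x j == u)); last first.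
    by move=> j; rewrite in_cons; case: (x j == u); rewrite ?andbF.
  rewrite (eq_bigr (fun=> F u)); last by move=> j /eqP ->.
  by rewrite sum_nat_const.
apply: eq_bigl => j; rewrite in_cons; case: (x j =P u) => [->|_] /=.
  by rewrite (negbTE us).
by rewrite andbT.
Qed.

Lemma sum_cnt_codom (J : finType) (x : J -> G) (F : G -> nat) :
  (\sum_(u <- undup (codom x)) cnt x u * F u = \sum_j F (x j))%N.
Proof.
rewrite sum_cnt ?undup_uniq //; apply: eq_bigl => j.
by rewrite mem_undup codom_f.
Qed.

Lemma cnt_inv (J : finType) (x : J -> G) g : symmetric_family x ->
  cnt x g^-1%g = cnt x g.
Proof.
case=> s [sK xs]; rewrite /cnt -(card_image (inv_inj sK)).
apply: eq_card => j; apply/imageP/idP => [[j' + ->]|].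
  by rewrite !inE xs => /eqP ->; rewrite invgK.
rewrite !inE => /eqP h; exists (s j); last by rewrite sK.
by rewrite !inE xs h.
Qed.

Lemma symmetric_xmul (J : finType) (x : J -> G) :
  symmetric_family x -> symmetric_family (xmul x).
Proof.
case=> s [sK xs]; exists (fun p => (s p.2, s p.1)); split.
  by case=> j j'; rewrite /= !sK.
by case=> j j'; rewrite /xmul /= !xs invgM.
Qed.

(** Cauchy-Schwarz: the left side is the inner product of the counting function of [x] with a
    translate of it, and by symmetry the value at the identity is its squared norm. *)
Lemma cnt_mul_le1 (J : finType) (x : J -> G) g : symmetric_family x ->
  (cnt (xmul x) g <= cnt (xmul x) 1)%N.
Proof.
move=> sx; rewrite !cnt_mulE.
under [X in (_ <= X)%N]eq_bigr do rewrite mulg1 cnt_inv //.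
rewrite -(sum_cnt_codom x (fun u => cnt x (u^-1 * g)%g)) -(sum_cnt_codom x (cnt x)).
set D := undup _; rewrite -(leq_pmul2l (isT : 0 < 2)%N).
apply: leq_trans (_ : \sum_(u <- D) (cnt x u ^ 2 + cnt x (u^-1 * g)%g ^ 2) <= _)%N.
  rewrite big_distrr /=; apply: leq_sum => u _.
  exact: nat_Cauchy.
rewrite big_split /= mul2n -addnn; apply: leq_add.
  by apply: leq_sum => u _; rewrite expnS expn1.
rewrite -(big_map (fun u => u^-1 * g)%g xpredT (fun u => cnt x u ^ 2)%N).
under eq_bigr do rewrite expnS expn1.
rewrite [X in (X <= _)%N]sum_cnt; last first.
  by rewrite map_inj_uniq ?undup_uniq // => u v /mulIg /invg_inj.
rewrite (sum_cnt_codom x (cnt x)).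
rewrite [X in (_ <= X)%N](bigID (fun j => x j \in [seq (u^-1 * g)%g | u <- D])) /=.
exact: leq_addr.
Qed.
End Counting.

Lemma sum_count_le (T : Type) (U : eqType) (X : seq T) (q : T -> U) (s : seq U) :
  uniq s -> (\sum_(y <- s) count (fun t => q t == y) X <= size X)%N.
Proof.
elim: s X => [|y s IH] X; first by rewrite big_nil.
move=> /andP[ys us]; rewrite big_cons -(count_predC (fun t => q t == y) X) leq_add2l.
rewrite -size_filter; apply: leq_trans (IH _ us).
rewrite big_seq [X in (_ <= X)%N]big_seq; apply: leq_sum => z zs.
rewrite count_filter; apply: sub_count => t /= /eqP ->; rewrite eqxx /=.
by apply: contraNneq ys => <-.
Qed.

Lemma sumr_const_seq (R : pzRingType) (T : Type) (s : seq T) (c : R) :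
  \sum_(i <- s) c = (size s)%:R * c.
Proof. by rewrite big_const_seq count_predT iter_addr_0 mulr_natl. Qed.

Lemma sum_cnt_le (G : groupType) (J : finType) (x : J -> G) (s : seq G) :
  uniq s -> (\sum_(g <- s) cnt x g <= #|J|)%N.
Proof.
move=> us; under eq_bigr do rewrite -[cnt _ _]muln1.
by rewrite (sum_cnt x (fun=> 1%N)) // sum1_card max_card.
Qed.

(** * Product sets and popular quotients *)

Section Products.
Variables (G : groupType).

Definition prodset (X Y : seq G) : seq G := undup [seq (a * b)%g | a <- X, b <- Y].
Fixpoint wset (S : seq G) m : seq G :=
  if m is m'.+1 then prodset S (wset S m') else [:: 1%g].

Lemma prodsetP (X Y : seq G) g :
  reflect (exists a b, [/\ a \in X, b \in Y & g = (a * b)%g]) (g \in prodset X Y).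
Proof.
rewrite mem_undup; apply: (iffP allpairsP) => [[[a b] [h1 h2 ->]]|[a [b [h1 h2 ->]]]].
  by exists a, b.
by exists (a, b).
Qed.

Lemma energy_lower (R : realFieldType) (J : finType) (z : J -> G) (D : seq G) :
  uniq D -> (forall j, z j \in D) ->
  (#|J|%:R ^+ 2 : R) <= (size D)%:R * (\sum_j cnt z (z j))%:R.
Proof.
move=> uD zD.
have h1 : #|J| = (\sum_(u <- D) cnt z u)%N.
  under eq_bigr do rewrite -[cnt _ _]muln1.
  rewrite (sum_cnt z (fun=> 1%N)) // -sum1_card; apply: eq_bigl => j.
  by rewrite zD.
have h2 : (\sum_j cnt z (z j) = \sum_(u <- D) cnt z u * cnt z u)%N.
  by rewrite (sum_cnt z (cnt z)) //; apply: eq_bigl => j; rewrite zD.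
rewrite h1 h2 !(big_nth 1%g) !big_mkord !natr_sum.
have := sum_sqr_ge (fun i : 'I_(size D) => (cnt z (nth 1%g D i))%:R : R).
rewrite card_ord; congr (_ <= _ * _).
by apply: eq_bigr => i _; rewrite natrM expr2.
Qed.

Variable R : realFieldType.

Section Tao.
Variables (I : finType) (a : I -> G) (D : seq G) (K1 : R).
Hypotheses (a_inj : injective a) (uD : uniq D) (I0 : (0 < #|I|)%N).
Hypothesis aD : forall i j, (a i * (a j)^-1)%g \in D.
Hypothesis DK : (size D)%:R <= K1 * #|I|%:R.

Let quo (p : I * I) : G := ((a p.1)^-1 * a p.2)%g.
(** The quotients are taken on the side opposite to that of [aD]. In a nonabelian group the full set
    of them may grow fast; popularity is what allows a member inserted after [a i] to be absorbed,
    see [prod_symset_le]. *)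
Definition symset : seq G :=
  [seq g <- undup (codom quo) | #|I|%:R <= 2 * K1 * (cnt quo g)%:R].

Lemma mem_symset g :
  (g \in symset) = (g \in codom quo) && (#|I|%:R <= 2 * K1 * (cnt quo g)%:R).
Proof. by rewrite mem_filter mem_undup andbC. Qed.

Lemma cnt_quo_sym g : cnt quo g^-1%g = cnt quo g.
Proof.
apply: cnt_inv; exists (fun p => (p.2, p.1)); split; first by case.
by case=> i j; rewrite /quo /= invgM invgK.
Qed.

Lemma symset_inv g : g \in symset -> g^-1%g \in symset.
Proof.
rewrite !mem_symset cnt_quo_sym => /andP[/codomP [[i j] ->] ->]; rewrite andbT.
by apply/codomP; exists (j, i); rewrite /quo /= invgM invgK.
Qed.

Lemma cnt_quo_le g : (cnt quo g <= #|I|)%N.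
Proof.
rewrite /cnt -sum1_card.
rewrite (eq_bigl (fun p : I * I => true && (a p.2 == a p.1 * g)%g)); last first.
  by move=> p; rewrite !inE /= /quo; apply/eqP/eqP => [<-|->]; rewrite ?mulKg ?mulVKg.
rewrite -(pair_big_dep xpredT (fun i j => (a j == a i * g)%g) (fun _ _ => 1%N)) /=.
rewrite -[X in (_ <= X)%N]sum1_card; apply: leq_sum => i _.
rewrite sum1_card; case: (pickP [pred j | (a j == a i * g)%g]) => [j0 /= /eqP h0|h0].
  apply: leq_trans (_ : #|pred1 j0| <= _)%N; last by rewrite card1.
  by apply: subset_leq_card; apply/subsetP => j; rewrite !inE => /eqP h; apply/eqP/a_inj; rewrite h0.
by rewrite eq_card0.
Qed.

Lemma I_pos : 0 < #|I|%:R :> R. Proof. by rewrite ltr0n. Qed.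

Lemma K1_ge1 : 1 <= K1.
Proof.
case/card_gt0P: (I0) => i0 _.
have : (#|I| <= size D)%N.
  rewrite -(size_codom (fun i => a i * (a i0)^-1)%g); apply: uniq_leq_size.
    by apply/injectiveP => i j /mulIg /a_inj.
  by move=> g /codomP [i ->].
rewrite -(ler_nat R) => h; have := le_trans h DK.
by rewrite -{1}[#|I|%:R]mul1r ler_pM2r // I_pos.
Qed.

Lemma symset1 : 1%g \in symset.
Proof.
case/card_gt0P: (I0) => i0 _; rewrite mem_symset; apply/andP; split.
  by apply/codomP; exists (i0, i0); rewrite /quo /= mulVg.
have h : (#|I| <= cnt quo 1)%N.
  rewrite /cnt -(card_codom (f := fun i : I => (i, i))); last by move=> i j [].
  by apply: subset_leq_card; apply/subsetP => p /codomP [i ->]; rewrite !inE /quo /= mulVg.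
have h1 : (#|I|%:R : R) <= (cnt quo 1)%:R by rewrite ler_nat.
have := K1_ge1; have := I_pos; nra.
Qed.

(** The relations [a i * (a j)^-1 = a k * (a l)^-1] and [(a k)^-1 * a i = (a l)^-1 * a j] are the
    same, so both kinds of quotients have the same energy, which is large because [D] is small.
    Unpopular quotients carry at most half of it, and averaging over the first factor of the popular
    ones gives the coset. *)
Lemma symset_coset : exists i, #|I|%:R <= 2 * K1 * #|[pred j | ((a i)^-1 * a j)%g \in symset]|%:R.
Proof.
have h := energy_lower R uD (fun p : I * I => aD p.1 p.2).
set z := (fun p : I * I => _) in h.
have e1 : (\sum_p cnt z (z p) = \sum_p cnt quo (quo p))%N.
  rewrite /cnt; under eq_bigr do rewrite -sum1_card.
  under [RHS]eq_bigr do rewrite -sum1_card.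
  rewrite !pair_big_dep /=.
  rewrite (reindex (fun r : (I * I) * (I * I) => ((r.2.1, r.2.2), (r.1.1, r.1.2)) )) /=; last first.
    by exists (fun r => ((r.2.1, r.2.2), (r.1.1, r.1.2))) => -[[? ?] [? ?]].
  rewrite (reindex (fun r : (I * I) * (I * I) => ((r.1.2, r.2.2), (r.1.1, r.2.1)) )) /=; last first.
    by exists (fun r => ((r.2.1, r.1.1), (r.2.2, r.1.2))) => -[[? ?] [? ?]].
  apply: eq_bigl => -[[i j] [k l]]; rewrite /z /quo !inE /=.
  apply/eqP/eqP => h2.
    by apply: (mulgI (a i)); rewrite mulVKg mulgA -h2 -mulgA mulVg mulg1.
  by apply: (mulIg (a l)); rewrite -!mulgA mulVg mulg1 h2 mulVKg.
rewrite e1 card_prod in h.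
pose S2 : R := #|[pred p | quo p \in symset]|%:R.
have h2 : ((\sum_p cnt quo (quo p))%N)%:R * (2 * K1) <=
    #|I|%:R * S2 * (2 * K1) + #|I|%:R ^+ 3.
  rewrite natr_sum (bigID (fun p => quo p \in symset)) /= mulrDl; apply: lerD.
    rewrite ler_wpM2r; [|have := K1_ge1; lra|].
      by [].
    rewrite /S2 [X in _ <= X]mulrC mulr_natl -sumr_const; apply: ler_sum => p _.
    by rewrite ler_nat cnt_quo_le.
  rewrite mulr_suml; apply: le_trans (_ : \sum_(p : I * I | quo p \notin symset) #|I|%:R <= _).
    apply: ler_sum => p; rewrite mem_symset codom_f /= -ltNge => /ltW h3.
    by apply: le_trans h3; rewrite le_eqVlt; apply/orP; left; apply/eqP; ring.
  rewrite sumr_const -[X in X <= _]mulr_natl [X in _ <= X]exprSr ler_wpM2r //.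
  rewrite -natrX ler_nat (leq_trans (max_card _)) // card_prod.
  by rewrite expnS expn1.
pose n : R := #|I|%:R; have n0 : 0 < n := I_pos.
have h3 : n ^+ 2 <= 2 * K1 * S2.
  have k1 := K1_ge1.
  move: h; rewrite natrM -/n => h.
  pose E : R := (\sum_p cnt quo (quo p))%:R.
  have E0 : 0 <= E by rewrite ler0n.
  have {}h : (n * n) ^+ 2 <= (K1 * n) * E.
    by apply: le_trans h _; apply: ler_wpM2r.
  have {}h2 : E * (2 * K1) <= n * S2 * (2 * K1) + n ^+ 3 := h2.
  have h4 : n * (2 * n ^+ 3) <= n * (n * S2 * (2 * K1) + n ^+ 3).
    rewrite [X in X <= _](_ : _ = 2 * (n * n) ^+ 2); last by ring.
    apply: le_trans (_ : 2 * (K1 * n * E) <= _); first by rewrite ler_pM2l.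
    rewrite [X in X <= _](_ : _ = n * (E * (2 * K1))); last by ring.
    by rewrite ler_pM2l.
  rewrite ler_pM2l // in h4.
  have h5 : n * n ^+ 2 <= n * (2 * K1 * S2) by move: h4; rewrite (exprS n 2); lra.
  by rewrite ler_pM2l in h5.
apply/existsP; rewrite -[X in is_true X]negbK negb_exists; apply/negP => /forallP hno.
have : 2 * K1 * S2 < n ^+ 2; last by rewrite ltNge h3.
have -> : S2 = \sum_i #|[pred j | ((a i)^-1 * a j)%g \in symset]|%:R.
  rewrite /S2 -natr_sum -sum1_card; congr (_%:R).
  rewrite (eq_bigl (fun p : I * I => true && (((a p.1)^-1 * a p.2)%g \in symset))) //.
  rewrite -(pair_big_dep xpredT (fun i j => ((a i)^-1 * a j)%g \in symset) (fun _ _ => 1%N)) /=.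
  by apply: eq_bigr => i _; rewrite sum1_card.
rewrite mulr_sumr; apply: lt_le_trans (_ : \sum_(i : I) n <= _).
  apply: ltr_sum => [|i _]; last by rewrite ltNge hno.
  by case/card_gt0P: I0 => i0 _; apply/hasP; exists i0 => //; rewrite mem_index_enum.
by rewrite sumr_const -mulr_natl expr2.
Qed.

(** If [g = (a p)^-1 * a q], then [a i * (g * y) = (a i * (a p)^-1) * (a q * y)]. So each product
    factors through [D] in as many ways as [g] has representations. *)
Lemma prod_symset_le (Y : seq G) :
  (size (prodset (codom a) (prodset symset Y)))%:R * #|I|%:R <=
  2 * K1 * (size D)%:R * (size (prodset (codom a) Y))%:R.
Proof.
set W := prodset _ (prodset _ _); set AY := prodset _ Y.
pose X := [seq (c, y) | c <- D, y <- AY].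
have h w : w \in W -> #|I|%:R <= 2 * K1 * (count (fun t : G * G => (t.1 * t.2)%g == w) X)%:R.
  case/prodsetP=> u [v [/codomP [i ->] /prodsetP [g [y [gS yY ->]]] ->]].
  move: gS; rewrite mem_symset => /andP[_ /le_trans]; apply.
  rewrite ler_wpM2l ?ler_nat; [|have := K1_ge1; lra|] => //.
  rewrite /cnt -size_filter cardE.
  pose phi (p : I * I) : G * G := ((a i * (a p.1)^-1)%g, (a p.2 * y)%g).
  rewrite -(size_map phi); apply: uniq_leq_size.
    rewrite map_inj_uniq ?enum_uniq // => -[j k] [j' k'] [] /mulgI /invg_inj /a_inj -> .
    by move=> /mulIg /a_inj ->.
  move=> t /mapP [[j k]]; rewrite mem_enum !inE => /eqP hq ->.
  rewrite mem_filter /= !mulgA -hq /quo /= !mulgA eqxx /=.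
  rewrite allpairs_f //; apply/prodsetP; exists (a k), y; split=> //.
  exact: codom_f.
have : \sum_(w <- W) #|I|%:R <= 2 * K1 * (\sum_(w <- W) count (fun t : G * G => (t.1 * t.2)%g == w) X)%:R.
  rewrite natr_sum mulr_sumr big_seq [X in _ <= X]big_seq; apply: ler_sum => w; exact: h.
have -> : \sum_(w <- W) #|I|%:R = (size W)%:R * #|I|%:R :> R.
  by rewrite sumr_const_seq.
move=> h1; apply: le_trans h1 _.
rewrite -[X in _ <= X]mulrA; apply: ler_wpM2l; first by have := K1_ge1; lra.
rewrite -natrM ler_nat -(size_allpairs pair D AY).
by apply: sum_count_le; apply: undup_uniq.
Qed.

Lemma wset_symset_le m : (size (wset symset m))%:R <= (2 * K1 ^+ 2) ^+ m * #|I|%:R :> R.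
Proof.
apply: le_trans (_ : (size (prodset (codom a) (wset symset m)))%:R <= _).
  case/card_gt0P: I0 => i0 _; rewrite ler_nat -(size_map (fun g => a i0 * g)%g).
  apply: uniq_leq_size.
    rewrite map_inj_uniq; last by move=> u v /mulgI.
    by case: m => //= m; apply: undup_uniq.
  move=> g /mapP [u hu ->]; apply/prodsetP; exists (a i0), u; split=> //.
  exact: codom_f.
elim: m => [|m IH].
  rewrite expr0 mul1r ler_nat; apply: leq_trans (size_undup _) _.
  by rewrite size_allpairs muln1 size_codom.
rewrite -(ler_pM2r I_pos); apply: le_trans (prod_symset_le _) _.
apply: le_trans (_ : 2 * K1 * (K1 * #|I|%:R) * ((2 * K1 ^+ 2) ^+ m * #|I|%:R) <= _).
  have k1 := K1_ge1; apply: ler_pM => //; first by rewrite !mulr_ge0 //; lra.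
  by apply: ler_wpM2l => //; lra.
rewrite [(2 * K1 ^+ 2) ^+ m.+1]exprS; move: ((2 * K1 ^+ 2) ^+ m) (#|I|%:R : R) => q N; rewrite le_eqVlt; apply/orP; left; apply/eqP; ring.
Qed.
End Tao.
End Products.

(** * The Balog-Szemeredi-Gowers theorem for symmetric families with repetitions *)

Section BSG.
Variables (R : realFieldType) (G : groupType) (J : finType) (x : J -> G) (K : R).
Variables (n n0 : nat).
Let y := xmul x.
Hypothesis nE : #|J| = n.
Hypotheses (sx : symmetric_family x) (mx : forall g, (cnt x g <= n0)%N).
Hypotheses (K1 : 1 <= K) (npos : (0 < n)%N) (n0pos : (0 < n0)%N).
Hypothesis hK : n0%:R * n%:R ^+ 3 <= K * (cnt (xmul y) 1%g)%:R.

(** The bound [n0] on multiplicities makes [n0 * n ^ 3] the largest possible energy, and [hK] says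
    that it is attained up to [K]. Heavy indices are those whose value has multiplicity close to
    [n0], so that counts of indices and counts of distinct values differ by a controlled factor. *)
Definition heavy j := n0%:R <= 4 * K * (cnt x (x j))%:R.
Definition pop g := n%:R * n0%:R <= 4 * K * (cnt y g)%:R.
Definition edge j l := heavy j && pop (x j * x l)%g.

Lemma cnty_le g : (cnt y g <= n * n0)%N.
Proof.
rewrite /y cnt_mulE; apply: leq_trans (_ : \sum_(j : J) n0 <= _)%N.
  by apply: leq_sum => j _; apply: mx.
by rewrite sum_nat_const nE.
Qed.

(** Light indices and unpopular products carry at most a quarter of the energy each, while one edge
    carries at most [n * n0]. *)
Lemma edges_many : n%:R ^+ 2 <= 2 * K * #|[pred p : J * J | edge p.1 p.2]|%:R.
Proof.
have n0r : 0 < n0%:R :> R by rewrite ltr0n.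
have nr : 0 < n%:R :> R by rewrite ltr0n.
pose E : R := #|[pred p : J * J | edge p.1 p.2]|%:R.
have e1 : (cnt (xmul y) 1 = \sum_p cnt y (y p))%N.
  rewrite cnt_mulE; apply: eq_bigr => p _; rewrite mulg1 cnt_inv //.
  exact: symmetric_xmul.
have h1 : 4 * K * \sum_(p : J * J | ~~ heavy p.1) (cnt y (y p))%:R <= n0%:R * n%:R ^+ 3.
  have -> : \sum_(p : J * J | ~~ heavy p.1) (cnt y (y p))%:R =
     \sum_l \sum_q (#|[pred j | ~~ heavy j && (y q == (x j * x l)%g)]|%:R : R).
    rewrite -natr_sum (_ : \sum_l _ = (\sum_l \sum_q #|[pred j | ~~ heavy j && (y q == (x j * x l)%g)]|)%N%:R); last first.
      by rewrite natr_sum; apply: eq_bigr => l _; rewrite natr_sum.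
    congr (_%:R).
    rewrite (eq_bigl (fun p : J * J => ~~ heavy p.1 && true)); last by move=> p; rewrite andbT.
    rewrite -(pair_big_dep (fun j => ~~ heavy j) (fun _ _ => true) (fun j l => cnt y (x j * x l)%g)) /=.
    rewrite exchange_big /=; apply: eq_bigr => l _.
    rewrite /cnt; under eq_bigr do rewrite -sum1_card.
    under [RHS]eq_bigr do rewrite -sum1_card.
    rewrite (exchange_big_dep xpredT) //=; apply: eq_bigr => q _.
  have -> : n0%:R * n%:R ^+ 3 = \sum_(l : J) \sum_(q : J * J) n0%:R :> R.
    by rewrite !sumr_const card_prod nE -mulrnA -[RHS]mulr_natl !natrM; ring.
  rewrite mulr_sumr; apply: ler_sum => l _; rewrite mulr_sumr; apply: ler_sum => q _.
  case: (pickP [pred j | ~~ heavy j && (y q == (x j * x l)%g)]) => [j0 /andP[hj0 /eqP e0]|h0]; last first.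
    by rewrite eq_card0 // mulr0 ltW.
  move: hj0; rewrite /heavy -ltNge => /ltW; apply: le_trans.
  apply: ler_wpM2l; first by move: K1; lra.
  rewrite ler_nat; apply: subset_leq_card; apply/subsetP => j; rewrite !inE => /andP[_ /eqP e].
  by apply/eqP; apply: (mulIg (x l)); rewrite -e -e0.
have h2 : 4 * K * \sum_(p : J * J | heavy p.1 && ~~ pop (y p)) (cnt y (y p))%:R <= n0%:R * n%:R ^+ 3.
  rewrite mulr_sumr; apply: le_trans (_ : \sum_(p : J * J | heavy p.1 && ~~ pop (y p)) n%:R * n0%:R <= _).
    by apply: ler_sum => p /andP[_]; rewrite /pop -ltNge => /ltW.
  rewrite sumr_const -[X in X <= _]mulr_natl.
  rewrite [X in _ <= X](_ : _ = (n * n)%:R * (n%:R * n0%:R)); last by rewrite natrM; ring.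
  apply: ler_wpM2r; first by rewrite mulr_ge0.
  by rewrite ler_nat (leq_trans (max_card _)) // card_prod nE.
have h3 : \sum_(p : J * J | edge p.1 p.2) (cnt y (y p))%:R <= E * (n%:R * n0%:R).
  apply: le_trans (_ : \sum_(p : J * J | edge p.1 p.2) n%:R * n0%:R <= _).
    by apply: ler_sum => p _; rewrite -natrM ler_nat cnty_le.
  by rewrite sumr_const -[X in X <= _]mulr_natl.
have h4 : (cnt (xmul y) 1)%:R =
   \sum_(p : J * J | edge p.1 p.2) (cnt y (y p))%:R +
   (\sum_(p : J * J | ~~ heavy p.1) (cnt y (y p))%:R +
   \sum_(p : J * J | heavy p.1 && ~~ pop (y p)) (cnt y (y p))%:R) :> R.
  rewrite e1 natr_sum (bigID (fun p : J * J => edge p.1 p.2)) /=; congr (_ + _).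
  rewrite (bigID (fun p : J * J => ~~ heavy p.1)) /=; congr (_ + _); apply: eq_bigl => p.
    by rewrite /edge; case: (heavy p.1); rewrite ?andbF.
  by rewrite /edge /y /xmul; case: (heavy p.1); rewrite //= ?andbT ?andbF.
move: hK; rewrite h4; move: h1 h2 h3.
set s1 := \sum_(p | ~~ _) _; set s2 := \sum_(p | heavy _ && _) _; set s3 := \sum_(p | edge _ _) _.
move=> h1 h2 h3 h5.
have h6 : n0%:R * n%:R ^+ 3 <= 2 * K * s3 by lra.
have h7 : (n%:R * n0%:R) * n%:R ^+ 2 <= (n%:R * n0%:R) * (2 * K * E).
  apply: le_trans (_ : 2 * K * (E * (n%:R * n0%:R)) <= _); last first.
    by rewrite le_eqVlt; apply/orP; left; apply/eqP; ring.
  apply: le_trans (_ : 2 * K * s3 <= _).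
    by apply: le_trans h6; rewrite le_eqVlt; apply/orP; left; apply/eqP; ring.
  by apply: ler_wpM2l => //; move: K1; lra.
by rewrite ler_pM2l // mulr_gt0 in h7.
Qed.

Definition popset : seq G := [seq g <- undup (codom y) | pop g].

Lemma popset_le : (size popset)%:R * n0%:R <= 4 * K * n%:R.
Proof.
have nr : 0 < n%:R :> R by rewrite ltr0n.
have : \sum_(g <- popset) (n%:R * n0%:R) <= 4 * K * \sum_(g <- popset) (cnt y g)%:R.
  rewrite mulr_sumr big_seq [X in _ <= X]big_seq; apply: ler_sum => g.
  by rewrite mem_filter => /andP[].
have -> : \sum_(g <- popset) (n%:R * n0%:R) = (size popset)%:R * (n%:R * n0%:R) :> R.
  by rewrite sumr_const_seq.
have : \sum_(g <- popset) (cnt y g)%:R <= n%:R * n%:R :> R.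
  rewrite -natr_sum -natrM ler_nat.
  by apply: leq_trans (sum_cnt_le y (filter_uniq _ (undup_uniq _))) _; rewrite card_prod nE.
move=> h1 h2.
have : n%:R * ((size popset)%:R * n0%:R) <= n%:R * (4 * K * n%:R).
  apply: le_trans (_ : 4 * K * (n%:R * n%:R) <= _).
    apply: le_trans (_ : 4 * K * \sum_(g <- popset) (cnt y g)%:R <= _).
      by apply: le_trans h2; rewrite le_eqVlt; apply/orP; left; apply/eqP; ring.
    by apply: ler_wpM2l => //; move: K1; lra.
  by rewrite le_eqVlt; apply/orP; left; apply/eqP; ring.
by rewrite ler_pM2l.
Qed.

Lemma cnt3_le u v w :
  (#|[pred p : J * J * J | [&& x p.1.1 == u, x p.1.2 == v & x p.2 == w]]| <= n0 ^ 3)%N.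
Proof.
apply: leq_trans (_ : cnt x u * cnt x v * cnt x w <= _)%N.
  rewrite /cnt -!cardX -[X in (_ <= X)%N]cardsE -[X in (X <= _)%N]cardsE.
  apply: subset_leq_card; apply/subsetP => -[[i j] k]; rewrite !inE /=.
  by case/and3P=> -> -> ->.
by rewrite -mulnA !expnS expn0 muln1 !leq_mul.
Qed.

(** Along a path [j, l, k, l', j'] the quotient [x j * (x j')^-1] telescopes into [(x j * x l) * (x
    k * x l)^-1 * (x k * x l') * (x j' * x l')^-1], built from four popular products. For fixed ends
    a quadruple determines the three inner values, hence at most [n0 ^ 3] paths; many paths for each
    quotient and few quadruples leave few quotients. *)
Lemma bsg_core : exists A : {set J},
  [/\ forall j, j \in A -> heavy j,
      n%:R <= 4 * K * #|A|%:R &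
      (size (undup [seq (x p.1 * (x p.2)^-1)%g | p <- enum [pred p : J * J | (p.1 \in A) && (p.2 \in A)]]))%:R * n0%:R
        <= 2 ^+ 25 * K ^+ 9 * n%:R].
Proof.
have n0r : 0 < n0%:R :> R by rewrite ltr0n.
have nr : 0 < n%:R :> R by rewrite ltr0n.
have K0 : 0 < K by move: K1; lra.
have al0 : 0 < (2 * K)^-1 by rewrite invr_gt0 mulr_gt0.
have [|||A [hA hP]] := @path_lemma R J J edge (2 * K)^-1 al0; rewrite ?nE //.
  rewrite -mulrA mulrC ler_pdivrMr ?mulr_gt0 // -expr2 mulrC; exact: edges_many.
exists A; set D := undup _; pose pm : R := (2 * K)^-1 ^+ 5 * n%:R * n%:R ^+ 2.
have pm0 : 0 < pm by rewrite /pm !mulr_gt0 ?exprn_gt0.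
split.
- move=> j jA; have := hP j j jA jA; rewrite nE -/pm => h.
  have : (0 < #|[pred p : J * J * J | [&& edge j p.1.1, edge p.1.2 p.1.1, edge p.1.2 p.2 & edge j p.2]]|)%N.
    by rewrite -(ltr0n R); have := lt_le_trans pm0 h; rewrite pmulr_rgt0.
  by case/card_gt0P => p; rewrite inE => /and4P[/andP[]].
- move: hA; rewrite nE ler_pdivrMl ?mulr_gt0 //; lra.
have quad g : g \in D -> pm <= 4096 * (n0%:R ^+ 3 *
  (count (fun q : G * G * G * G => (q.1.1.1 * q.1.1.2^-1 * q.1.2 * q.2^-1)%g == g)
   [seq (q, d) | q <- [seq (q, c) | q <- [seq (a, b) | a <- popset, b <- popset], c <- popset], d <- popset])%:R).
  rewrite mem_undup => /mapP [[j j']]; rewrite mem_enum inE /= => /andP[jA j'A] ->.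
  have := hP j j' jA j'A; rewrite nE -/pm => h0; apply: le_trans h0 _; apply: ler_wpM2l => //.
  rewrite -natrX -natrM ler_nat cardE -size_filter.
  pose qq (p : J * J * J) : G * G * G * G :=
    ((x j * x p.1.1)%g, (x p.1.2 * x p.1.1)%g, (x p.1.2 * x p.2)%g, (x j' * x p.2)%g).
  apply: (size_le_fibre (q := qq)).
    apply/allP => p; rewrite mem_enum inE => /and4P[e1 e2 e3 e4].
    have hp k l : edge k l -> (x k * x l)%g \in popset.
      case/andP=> _ hp; rewrite mem_filter hp mem_undup.
      by apply/codomP; exists (k, l).
    have eg (u1 u2 u3 u4 u5 : G) :
        (u1 * u2 * (u3 * u2)^-1 * (u3 * u4) * (u5 * u4)^-1 = u1 * u5^-1)%g.
      by rewrite !invgM !mulgA !mulgK -(mulgA u1) mulVg mulg1.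
    rewrite mem_filter /= eg eqxx /=.
    by do 3?[apply: allpairs_f]; apply: hp.
  move=> [[[a b] c] d] _.
  apply: leq_trans (_ : #|[pred p : J * J * J | [&& edge j p.1.1, edge p.1.2 p.1.1, edge p.1.2 p.2 & edge j' p.2] && (qq p == (a, b, c, d))]| <= _)%N.
    rewrite -size_filter cardE; apply: uniq_leq_size; first by rewrite filter_uniq // enum_uniq.
    by move=> p; rewrite mem_filter !mem_enum !inE => /andP[-> ->].
  apply: leq_trans (cnt3_le ((x j)^-1 * a)%g (b * ((x j)^-1 * a)^-1)%g ((b * ((x j)^-1 * a)^-1)^-1 * c)%g).
  apply: subset_leq_card; apply/subsetP => p; rewrite !inE => /andP[_ /eqP[e1 e2 e3 _]].
  have f1 : x p.1.1 = ((x j)^-1 * a)%g by rewrite -e1 mulKg.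
  have f2 : x p.1.2 = (b * ((x j)^-1 * a)^-1)%g by rewrite -f1 -e2 mulgK.
  by rewrite f1 f2 eqxx -f2 eqxx -e3 mulKg eqxx.
have : \sum_(g <- D) pm <= 4096 * (n0%:R ^+ 3 * (size popset)%:R ^+ 4).
  set P4 := [seq (q, d) | q <- _, d <- _] in quad.
  apply: le_trans (_ : \sum_(g <- D) 4096 * (n0%:R ^+ 3 * (count (fun q : G * G * G * G => (q.1.1.1 * q.1.1.2^-1 * q.1.2 * q.2^-1)%g == g) P4)%:R) <= _).
    by rewrite big_seq [X in _ <= X]big_seq; apply: ler_sum.
  rewrite -!mulr_sumr; do 2![apply: ler_wpM2l; first by rewrite ?exprn_ge0].
  rewrite -natr_sum -natrX ler_nat.
  apply: leq_trans (sum_count_le _ _ (undup_uniq _)) _.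
  by rewrite /P4 !size_allpairs !expnSr expn0 mul1n.
have -> : \sum_(g <- D) pm = (size D)%:R * pm.
  by rewrite sumr_const_seq.
move=> h.
have hpop := popset_le.
have h1 : ((size popset)%:R * n0%:R) ^+ 4 <= (4 * K * n%:R) ^+ 4.
  by apply: lerXn2r => //; rewrite nnegrE !mulr_ge0 // ltW.
have h2 : n%:R ^+ 3 * ((size D)%:R * n0%:R) <= n%:R ^+ 3 * (2 ^+ 25 * K ^+ 9 * n%:R).
  have e1 : n%:R ^+ 3 * ((size D)%:R * n0%:R) = (2 * K) ^+ 5 * n0%:R * ((size D)%:R * pm).
    by rewrite /pm; field; lra.
  rewrite e1.
  apply: le_trans (_ : (2 * K) ^+ 5 * n0%:R * (4096 * (n0%:R ^+ 3 * (size popset)%:R ^+ 4)) <= _).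
    by apply: ler_wpM2l => //; rewrite !mulr_ge0 ?exprn_ge0 ?mulr_ge0 // ltW.
  apply: le_trans (_ : (2 * K) ^+ 5 * 4096 * (4 * K * n%:R) ^+ 4 <= _); last first.
    by rewrite le_eqVlt; apply/orP; left; apply/eqP; ring.
  apply: le_trans (_ : (2 * K) ^+ 5 * 4096 * ((size popset)%:R * n0%:R) ^+ 4 <= _).
    by rewrite le_eqVlt; apply/orP; left; apply/eqP; ring.
  by apply: ler_wpM2l => //; rewrite !mulr_ge0 ?exprn_ge0 ?mulr_ge0 // ltW.
by rewrite ler_pM2l ?exprn_gt0 // in h2.
Qed.

Theorem bsg : exists (S : seq G) (z : G),
  [/\ 1%g \in S, forall g, g \in S -> g^-1%g \in S,
      n%:R <= 2 ^+ 32 * K ^+ 12 * #|[pred j | (z^-1 * x j)%g \in S]|%:R &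
      forall m, (size (wset S m))%:R * n0%:R <= (2 ^+ 55 * K ^+ 20) ^+ m * (4 * K * n%:R)].
Proof.
have n0r : 0 < n0%:R :> R by rewrite ltr0n.
have nr : 0 < n%:R :> R by rewrite ltr0n.
have K0 : 0 < K by move: K1; lra.
have [A [hA cA]] := bsg_core.
set D := undup _ => cD.
pose A0 := undup [seq x j | j <- enum A].
have hA0 g : g \in A0 -> n0%:R <= 4 * K * (cnt x g)%:R.
  by rewrite mem_undup => /mapP [j]; rewrite mem_enum => /hA hj ->.
have c1 : (#|A| <= n0 * size A0)%N.
  rewrite cardE; apply: (size_le_fibre (q := x)).
    by apply/allP => j hj; rewrite mem_undup map_f.
  move=> g _; apply: leq_trans (mx g); rewrite /cnt -size_filter cardE.
  apply: uniq_leq_size; first by rewrite filter_uniq // enum_uniq.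
  by move=> j; rewrite mem_filter => /andP[h _]; rewrite mem_enum inE.
have c2 : n%:R <= 4 * K * n0%:R * (size A0)%:R.
  apply: le_trans cA _; rewrite -!mulrA -natrM.
  apply: ler_wpM2l => //; apply: ler_wpM2l; first exact: ltW.
  by rewrite ler_nat.
have c3 : (size A0)%:R * n0%:R <= 4 * K * n%:R.
  have : \sum_(g <- A0) n0%:R <= 4 * K * \sum_(g <- A0) (cnt x g)%:R.
    rewrite mulr_sumr big_seq [X in _ <= X]big_seq; apply: ler_sum => g; exact: hA0.
  have -> : \sum_(g <- A0) n0%:R = (size A0)%:R * n0%:R :> R.
    by rewrite sumr_const_seq.
  move=> h; apply: le_trans h _; apply: ler_wpM2l; first by rewrite mulr_ge0 // ltW.
  by rewrite -natr_sum ler_nat -nE sum_cnt_le ?undup_uniq.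
have A0pos : (0 < size A0)%N.
  rewrite lt0n; apply: contraTneq c2 => ->; rewrite mulr0 -ltNge //.
have cI : #|'I_(size A0)| = size A0 by rewrite card_ord.
pose a (i : 'I_(size A0)) : G := nth 1%g A0 i.
(* [Kt] is the bound [2 ^+ 25 * K ^+ 9] of [bsg_core] times the factor [4 * K] of [c2]. The
   constants of the conclusion are [8 * K * Kt * (4 * K)] and [2 * Kt ^+ 2]. *)
pose Kt : R := 2 ^+ 27 * K ^+ 10.
have aD i j : (a i * (a j)^-1)%g \in D.
  have := mem_nth 1%g (ltn_ord i); have := mem_nth 1%g (ltn_ord j); rewrite !mem_undup => /mapP [j1 h1 e1] /mapP [j2 h2 e2].
  apply/mapP; exists (j2, j1); last by rewrite /a /= e1 e2.
  by move: h1 h2; rewrite !mem_enum inE /= => -> ->.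
have Ipos : (0 < #|'I_(size A0)|)%N by rewrite cI.
have DK : (size D)%:R <= Kt * #|'I_(size A0)|%:R.
  rewrite cI -(ler_pM2r n0r); apply: le_trans cD _.
  apply: le_trans (_ : 2 ^+ 25 * K ^+ 9 * (4 * K * n0%:R * (size A0)%:R) <= _).
    by apply: ler_wpM2l => //; rewrite mulr_ge0 ?exprn_ge0 // ltW.
  by rewrite le_eqVlt; apply/orP; left; apply/eqP; rewrite /Kt; ring.
have ainj : injective a.
  by move=> i j /eqP; rewrite /a nth_uniq ?undup_uniq // => /eqP /val_inj.
have uD : uniq D := undup_uniq _.
have [i0 hi0] := symset_coset ainj uD Ipos aD DK.
exists (symset a Kt), (a i0); split.
- exact: (symset1 ainj Ipos aD DK).
- by move=> g; apply: symset_inv.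
- rewrite cI in hi0.
  set S := symset a Kt in hi0 *.
  have e1 : (#|[pred j | ((a i0)^-1 * a j)%g \in S]| = size [seq g <- A0 | ((a i0)^-1 * g)%g \in S])%N.
    rewrite cardE -(size_map a); apply/eqP; rewrite eqn_leq.
    apply/andP; split; apply: uniq_leq_size.
    + by rewrite map_inj_uniq ?enum_uniq.
    + move=> g /mapP [j]; rewrite mem_enum inE => hj ->; rewrite mem_filter hj /=.
      exact: mem_nth.
    + by rewrite filter_uniq // undup_uniq.
    + move=> g; rewrite mem_filter => /andP[h1 h2]; apply/mapP.
      have h3 : (index g A0 < size A0)%N by rewrite index_mem.
      exists (Ordinal h3); last by rewrite /a /= nth_index.
      by rewrite mem_enum inE /a /= nth_index.
  rewrite e1 in hi0; set B := filter _ _ in hi0.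
  have h2 : (size B)%:R * n0%:R <= 4 * K * #|[pred j | ((a i0)^-1 * x j)%g \in S]|%:R.
    have : \sum_(g <- B) n0%:R <= 4 * K * \sum_(g <- B) (cnt x g)%:R.
      rewrite mulr_sumr big_seq [X in _ <= X]big_seq; apply: ler_sum => g.
      by rewrite mem_filter => /andP[_]; apply: hA0.
    have -> : \sum_(g <- B) n0%:R = (size B)%:R * n0%:R :> R.
      by rewrite sumr_const_seq.
    move=> h; apply: le_trans h _; apply: ler_wpM2l; first by rewrite mulr_ge0 // ltW.
    rewrite -natr_sum ler_nat cardE.
    have uB : uniq B by rewrite filter_uniq // undup_uniq.
    apply: leq_trans (sum_count_le _ x uB).
    rewrite [X in (X <= _)%N]big_seq [X in (_ <= X)%N]big_seq; apply: leq_sum => g; rewrite mem_filter => /andP[gS _].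
    rewrite /cnt cardE -size_filter; apply: uniq_leq_size; first exact: enum_uniq.
    by move=> j; rewrite mem_enum inE => /eqP hj; rewrite mem_filter mem_enum inE hj eqxx.
  have h3 : n%:R <= 4 * K * n0%:R * (2 * Kt * (size B)%:R).
    by apply: le_trans c2 _; apply: ler_wpM2l => //; rewrite !mulr_ge0 // ltW.
  apply: le_trans h3 _.
  apply: le_trans (_ : 8 * K * Kt * (4 * K * #|[pred j | ((a i0)^-1 * x j)%g \in S]|%:R) <= _); last first.
    by rewrite le_eqVlt; apply/orP; left; apply/eqP; rewrite /Kt; ring.
  apply: le_trans (_ : 8 * K * Kt * ((size B)%:R * n0%:R) <= _).
    by rewrite le_eqVlt; apply/orP; left; apply/eqP; ring.
  by apply: ler_wpM2l => //; rewrite !mulr_ge0 ?exprn_ge0 // ltW.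
move=> m.
have := wset_symset_le ainj Ipos aD DK m; rewrite cI => h.
apply: le_trans (_ : (2 * Kt ^+ 2) ^+ m * (size A0)%:R * n0%:R <= _).
  by apply: ler_wpM2r => //; exact: ltW.
have -> : 2 * Kt ^+ 2 = 2 ^+ 55 * K ^+ 20 by rewrite /Kt; ring.
rewrite -mulrA; apply: ler_wpM2l => //.
by rewrite exprn_ge0 // mulr_ge0 ?exprn_ge0 // ltW.
Qed.
End BSG.

(** * Random walks and their return probabilities *)

Section Walk.
Variables (R : realFieldType) (G : groupType) (I : finType) (th : I -> G).

Fixpoint walk (m : nat) : finType :=
  if m is m'.+1 then ((walk m' * walk m')%type : finType) else ((I * I)%type : finType).

Fixpoint step (m : nat) : walk m -> G :=
  match m with
  | 0 => fun p => ((th p.1)^-1 * th p.2)%g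
  | m'.+1 => xmul (@step m')
  end.

Lemma step_sym m : symmetric_family (@step m).
Proof.
elim: m => [|m IH]; last exact: symmetric_xmul.
exists (fun p => (p.2, p.1)); split; first by case.
by case=> i j /=; rewrite invgM invgK.
Qed.

Lemma card_walk m : #|walk m| = (#|I| ^ (2 ^ m.+1))%N.
Proof.
elim: m => [|m IH] /=; rewrite card_prod; first by rewrite !expnS expn0 muln1.
by rewrite IH -expnD addnn -mul2n -expnS.
Qed.

Let q m : R := (cnt (@step m) 1%g)%:R / #|walk m|%:R.

Hypothesis I0 : (0 < #|I|)%N.

Lemma walk_gt0 m : 0 < #|walk m|%:R :> R.
Proof. by rewrite card_walk ltr0n expn_gt0 I0. Qed.

Lemma step_max m g : (0 < m)%N -> (cnt (@step m) g <= cnt (@step m) 1)%N.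
Proof. by case: m => // m _; apply: cnt_mul_le1; apply: step_sym. Qed.

Lemma q_decr m : (0 < m)%N -> q m.+1 <= q m.
Proof.
move=> m0; rewrite /q ler_pdivrMr ?walk_gt0 //.
have -> : #|walk m.+1|%:R = #|walk m|%:R * #|walk m|%:R :> R.
  by rewrite -natrM; congr (_%:R); rewrite /= card_prod.
rewrite mulrA divfK ?gt_eqF ?walk_gt0 // -natrM ler_nat /= cnt_mulE mulnC.
apply: leq_trans (_ : \sum_(j : walk m) cnt (@step m) 1 <= _)%N.
  by apply: leq_sum => j _; apply: step_max.
by rewrite sum_nat_const.
Qed.

Lemma q_mono m n : (0 < m)%N -> (m <= n)%N -> q n <= q m.
Proof.
move=> m0 /subnKC <-; elim: (n - m)%N => [|k IH]; first by rewrite addn0.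
rewrite addnS; apply: le_trans IH; apply: q_decr; lia.
Qed.

(** Every walk ends in a letter [th i]; averaging freezes the other letters and transfers the
    density of endpoints to single letters. *)
Lemma last_letter m (Q : pred G) (c : R) : 0 <= c ->
  c * #|walk m|%:R <= #|[pred j | Q (@step m j)]|%:R ->
  exists h, c * #|I|%:R <= #|[pred i | Q (h * th i)%g]|%:R.
Proof.
have key (J1 J2 : finType) (P : J1 -> J2 -> bool) : (0 < #|J1|)%N -> 0 <= c ->
    c * (#|J1|%:R * #|J2|%:R) <= #|[pred p : J1 * J2 | P p.1 p.2]|%:R ->
    exists j, c * #|J2|%:R <= #|[pred j2 | P j j2]|%:R.
  move=> J0 c0 h; apply/existsP; rewrite -[X in is_true X]negbK negb_exists; apply/negP => /forallP hno.
  move: h; apply/negP; rewrite -ltNge.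
  have -> : #|[pred p : J1 * J2 | P p.1 p.2]|%:R = \sum_j (#|[pred j2 | P j j2]|%:R : R).
    rewrite -natr_sum -sum1_card; congr (_%:R).
    rewrite (eq_bigl (fun p : J1 * J2 => true && P p.1 p.2)) //.
    rewrite -(pair_big_dep xpredT P (fun _ _ => 1%N)) /=.
    by apply: eq_bigr => i _; rewrite sum1_card.
  apply: lt_le_trans (_ : \sum_(j : J1) c * #|J2|%:R <= _).
    apply: ltr_sum => [|j _]; last by rewrite ltNge hno.
    by case/card_gt0P: J0 => i0 _; apply/hasP; exists i0 => //; rewrite mem_index_enum.
  by rewrite sumr_const -[X in X <= _]mulr_natl le_eqVlt mulrCA eqxx.
move=> c0; elim: m Q => [|m IH] Q /=; rewrite card_prod natrM => h.
  have [i hi] := key _ _ (fun i j => Q ((th i)^-1 * th j)%g) I0 c0 h.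
  by exists (th i)^-1%g.
have [|j hj] := key _ _ (fun j j' => Q (step j * step j')%g) _ c0 h.
  by have := walk_gt0 m; rewrite ltr0n.
have [h' hh'] := IH (fun g => Q (step j * g)%g) hj.
exists (step j * h')%g; apply: le_trans hh' _; rewrite ler_nat.
by apply: subset_leq_card; apply/subsetP => i; rewrite !inE mulgA.
Qed.

(** At the odd levels the return probability starts at most 1 and is still at least the inverse of
    [K ^+ M] after [M] double levels, so some double level loses at most a factor [K]. A double
    level means fourfold products, that is, the energy required by [bsg]. The levels start at 1 so
    that the family is a product of a symmetric one and its multiplicities are largest at the
    identity. *)
Theorem flattening (K : R) (M : nat) : 1 <= K -> (0 < M)%N ->
  #|walk (2 * M).+1|%:R <= K ^+ M * (cnt (@step (2 * M).+1) 1%g)%:R ->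
  exists (S : seq G) (z : G),
  [/\ 1%g \in S, forall g, g \in S -> g^-1%g \in S,
      #|I|%:R <= 2 ^+ 32 * K ^+ 12 * #|[pred i | (z^-1 * th i)%g \in S]|%:R &
      forall m, (size (wset S m))%:R <= (2 ^+ 55 * K ^+ 20) ^+ m * (4 * K * K ^+ M)].
Proof.
move=> K1 M0 hM; have K0 : 0 < K by lra.
have qM : 1 <= K ^+ M * q (2 * M).+1.
  by rewrite /q mulrA ler_pdivlMr ?walk_gt0 // mul1r.
have q1 m : q m <= 1 by rewrite /q ler_pdivrMr ?walk_gt0 // mul1r ler_nat max_card.
have q0 m : 0 <= q m by rewrite /q divr_ge0.
have [t tM ht] : exists2 t, (t < M)%N & q (2 * t).+1 <= K * q (2 * t).+3.
  case: (pickP [pred t : 'I_M | q (2 * t).+1 <= K * q (2 * t).+3]) => [t ht|hno].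
    by exists t.
  exfalso; have h t : (0 < t <= M)%N -> K ^+ t * q (2 * t).+1 < 1.
    elim: t => // t IH /= ht.
    have /= := hno (Ordinal ht); move/negbT; rewrite -ltNge => h1.
    rewrite exprSr -mulrA (_ : (2 * t.+1).+1 = (2 * t).+3); last by lia.
    case: t IH ht h1 => [|t] IH ht h1; first by rewrite expr0 mul1r; apply: lt_le_trans h1 (q1 _).
    apply: lt_trans (IH (ltnW ht)); by rewrite ltr_pM2l // exprn_gt0.
  by have := h M; rewrite M0 leqnn => /(_ isT); rewrite ltNge qM.
set m := (2 * t).+1 in ht.
have n1 := walk_gt0 m; have m0 : (0 < m)%N by [].
have qm : 1 <= K ^+ M * q m.
  apply: le_trans qM _; rewrite ler_pM2l ?exprn_gt0 //; apply: q_mono => //.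
  by rewrite /m; lia.
have n0pos : (0 < cnt (@step m) 1)%N.
  rewrite lt0n; apply: contraTneq qm => h; rewrite /q h mul0r mulr0 -ltNge; exact: ltr01.
have n0r : 0 < (cnt (@step m) 1)%:R :> R by rewrite ltr0n.
have hK : (cnt (@step m) 1)%:R * #|walk m|%:R ^+ 3 <= K * (cnt (xmul (xmul (@step m))) 1)%:R.
  move: ht; rewrite /q ler_pdivrMr // mulrA.
  have -> : #|walk m.+2|%:R = #|walk m|%:R ^+ 4 :> R.
    by rewrite -natrX; congr (_%:R); rewrite /= !card_prod !expnS expn0 muln1 !mulnA.
  move=> h; have {}h := ler_wpM2r (exprn_ge0 3 (ltW n1)) h; apply: le_trans h _.
  rewrite le_eqVlt; apply/orP; left; apply/eqP.
  have : #|walk m|%:R != 0 :> R by rewrite gt_eqF.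
  move: (#|walk m|%:R : R) ((cnt (@step m.+2) 1)%:R : R) => n c nn0; field; exact: nn0.
have npos : (0 < #|walk m|)%N by rewrite -(ltr0n R).
have [S [z [S1 Sinv hz hS]]] :=
  bsg erefl (step_sym m) (fun g => step_max g m0) K1 npos n0pos hK.
have [h hh] : exists h, (2 ^+ 32 * K ^+ 12)^-1 * #|I|%:R <= #|[pred i | (z^-1 * (h * th i))%g \in S]|%:R :> R.
  apply: (@last_letter m (fun g => (z^-1 * g)%g \in S)).
    by rewrite invr_ge0 mulr_ge0 ?exprn_ge0 // ltW.
  by rewrite ler_pdivrMl // mulr_gt0 ?exprn_gt0.
exists S, (h^-1 * z)%g; split=> //.
  rewrite ler_pdivrMl ?mulr_gt0 ?exprn_gt0 // in hh; apply: le_trans hh _.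
  apply: ler_wpM2l; first by rewrite mulr_ge0 ?exprn_ge0 // ltW.
  rewrite ler_nat; apply: subset_leq_card; apply/subsetP => i.
  by rewrite !inE invgM invgK mulgA.
move=> l; rewrite -(ler_pM2r n0r); apply: le_trans (hS l) _.
rewrite -[X in _ <= X]mulrA; apply: ler_wpM2l.
  by rewrite exprn_ge0 // mulr_ge0 ?exprn_ge0 // ltW.
rewrite -[X in _ <= X]mulrA; apply: ler_wpM2l; first by rewrite mulr_ge0 // ltW.
by move: qm; rewrite /q mulrA ler_pdivlMr // mul1r.
Qed.
End Walk.

(** * Substitutions as triangular matrices over truncated power series *)

Section GL.
Variables (C : fieldType) (n : nat).

Record gl := GL { glval :> 'M[C]_n.+1 ; glP : glval \in unitmx }.
HB.instance Definition _ := [isSub for glval].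
HB.instance Definition _ := [Choice of gl by <:].

Lemma glM_subproof (A B : gl) : glval A *m glval B \in unitmx.
Proof. by rewrite unitmx_mul !glP. Qed.
Lemma glV_subproof (A : gl) : invmx (glval A) \in unitmx.
Proof. by rewrite unitmx_inv glP. Qed.
Lemma gl1_subproof : 1%:M \in @unitmx C n.+1.
Proof. exact: unitmx1. Qed.

Definition glmul A B := GL (glM_subproof A B).
Definition glinv A := GL (glV_subproof A).
Definition glone := GL gl1_subproof.

Lemma glmulA : associative glmul.
Proof. by move=> A B D; apply: val_inj; rewrite /= mulmxA. Qed.
Lemma glmul1 : left_id glone glmul.
Proof. by move=> A; apply: val_inj; rewrite /= mul1mx. Qed.
Lemma glmulr1 : right_id glone glmul.
Proof. by move=> A; apply: val_inj; rewrite /= mulmx1. Qed.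
Lemma glmulV : left_inverse glone glinv glmul.
Proof. by move=> A; apply: val_inj; rewrite /= mulVmx ?glP. Qed.
Lemma glmulVr : right_inverse glone glinv glmul.
Proof. by move=> A; apply: val_inj; rewrite /= mulmxV ?glP. Qed.

HB.instance Definition _ := isGroup.Build gl glmulA glmul1 glmulr1 glmulV glmulVr.

Lemma glME (A B : gl) : glval (A * B)%g = glval A *m glval B.
Proof. by []. Qed.
Lemma glVE (A : gl) : glval (A^-1)%g = invmx (glval A).
Proof. by []. Qed.
Lemma gl1E : glval 1%g = 1%:M.
Proof. by []. Qed.
End GL.

Section EqX.
Variable C : fieldType.
Implicit Types p q r : {poly C}.

Definition eqX (N : nat) p q := forall i, (i < N)%N -> p`_i = q`_i.

Lemma eqX_refl N p : eqX N p p. Proof. by []. Qed.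
Lemma eqX_sym N p q : eqX N p q -> eqX N q p.
Proof. by move=> h i iN; rewrite h. Qed.
Lemma eqX_trans N p q r : eqX N p q -> eqX N q r -> eqX N p r.
Proof. by move=> h1 h2 i iN; rewrite h1 // h2. Qed.
Lemma eqX_le N M p q : (M <= N)%N -> eqX N p q -> eqX M p q.
Proof. by move=> MN h i iM; apply: h; apply: leq_trans MN. Qed.

Lemma eqXP N p q : eqX N p q <-> exists s, p = q + s * 'X^N.
Proof.
split=> [h|[s ->] i iN]; last by rewrite coefD coefMXn iN addr0.
exists (drop_poly N (p - q)); rewrite -[LHS](subrK q) addrC; congr (_ + _).
rewrite -{1}(poly_take_drop N (p - q)) (_ : take_poly N _ = 0) ?add0r //.
apply/polyP=> i; rewrite coef_take_poly coef0; case: ltnP => // iN.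
by rewrite coefB h // subrr.
Qed.

Lemma eqXD N p q p' q' : eqX N p p' -> eqX N q q' -> eqX N (p + q) (p' + q').
Proof. by move=> h1 h2 i iN; rewrite !coefD h1 // h2. Qed.

Lemma eqXB N p q p' q' : eqX N p p' -> eqX N q q' -> eqX N (p - q) (p' - q').
Proof. by move=> h1 h2 i iN; rewrite !coefB h1 // h2. Qed.

Lemma eqXZ N c p p' : eqX N p p' -> eqX N (c *: p) (c *: p').
Proof. by move=> h1 i iN; rewrite !coefZ h1. Qed.

Lemma eqXM N p q p' q' : eqX N p p' -> eqX N q q' -> eqX N (p * q) (p' * q').
Proof.
move=> /eqXP [s ->] /eqXP [t ->]; apply/eqXP.
by exists (s * q' + p' * t + s * t * 'X^N); ring.
Qed.

Lemma eqXX N k p q : eqX N p q -> eqX N (p ^+ k) (q ^+ k).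
Proof.
move=> h; elim: k => [|k IH]; first by rewrite !expr0; apply: eqX_refl.
by rewrite !exprS; apply: eqXM.
Qed.

Lemma eqX_MXn N k p q : eqX N p q <-> eqX (N + k) (p * 'X^k) (q * 'X^k).
Proof.
split=> h i hi.
  rewrite !coefMXn; case: ltnP => // ki; apply: h; lia.
have := h (i + k)%N ltac:(lia); rewrite !coefMXn ltnNge leq_addl /= addnK; exact.
Qed.

Lemma eqX_unit N (u p q : {poly C}) : u`_0 != 0 -> eqX N (u * p) (u * q) -> eqX N p q.
Proof.
move=> u0 h; suff: forall i, (i < N)%N -> (p - q)`_i = 0.
  by move=> h1 i iN; apply/eqP; rewrite -subr_eq0 -coefB h1.
elim/ltn_ind => i IH iN.
have := h i iN; move/eqP; rewrite -subr_eq0 -coefB -mulrBr coefM.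
rewrite big_ord_recl big1 ?addr0; last first.
  move=> j _; have hj := ltn_ord j.
  by rewrite (IH (i - lift ord0 j)%N) ?mulr0 //= /bump /=; lia.
by rewrite subn0 mulf_eq0 (negbTE u0) => /eqP.
Qed.

Lemma eqX_comp N p q r : eqX N p q -> eqX N (p \Po (r * 'X)) (q \Po (r * 'X)).
Proof.
move=> /eqXP [s ->]; apply/eqXP; exists ((s \Po (r * 'X)) * r ^+ N).
by rewrite comp_polyD comp_polyM comp_Xn_poly exprMn mulrA.
Qed.
End EqX.

(** * Truncated substitutions and their symbols *)

Section Triangular.
Variables (C : numClosedFieldType) (n W : nat).
Local Notation N := n.+1.
Implicit Types (A B E : 'M[C]_N) (p q : {poly C}).

(** Under the action [act] on polynomials such a matrix raises the order of vanishing at 0 by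
    [i]. *)
Definition shifted (i : nat) A := forall a b : 'I_N, (b < a + i)%N -> A a b = 0.

Lemma shiftedW i j A : (j <= i)%N -> shifted i A -> shifted j A.
Proof. by move=> ji h a b ab; apply: h; apply: leq_trans ab _; rewrite leq_add2l. Qed.

Lemma shiftedM i j A B : shifted i A -> shifted j B -> shifted (i + j) (A *m B).
Proof.
move=> hA hB a b ab; rewrite mxE big1 // => k _.
case: (ltnP k (a + i)) => h; first by rewrite hA ?mul0r.
by rewrite hB ?mulr0 //; lia.
Qed.

Lemma shiftedD i A B : shifted i A -> shifted i B -> shifted i (A + B).
Proof. by move=> hA hB a b ab; rewrite mxE hA // hB // addr0. Qed.

Lemma shiftedN i A : shifted i A -> shifted i (- A).
Proof. by move=> hA a b ab; rewrite mxE hA // oppr0. Qed.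

Lemma shiftedB i A B : shifted i A -> shifted i B -> shifted i (A - B).
Proof. by move=> hA hB; apply: shiftedD => //; apply: shiftedN. Qed.

Lemma shifted1 : shifted 0 (1%:M : 'M[C]_N).
Proof. by move=> a b; rewrite addn0 mxE; case: eqP => // ->; rewrite ltnn. Qed.

Lemma shifted_big A : shifted N A -> A = 0.
Proof. by move=> h; apply/matrixP => a b; rewrite h ?mxE //; move: (ltn_ord b); lia. Qed.

Lemma coef_shiftedM i j A B (a b : 'I_N) : shifted i A -> shifted j B ->
  (b = a + i + j :> nat)%N -> forall k : 'I_N, (k = a + i :> nat)%N ->
  (A *m B) a b = A a k * B k b.
Proof.
move=> hA hB hb k hk; rewrite mxE (bigD1 k) //= big1 ?addr0 // => l lk.
have {}lk : (l != k :> nat)%N by [].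
case: (ltnP l (a + i)) => h; first by rewrite hA ?mul0r.
by rewrite hB ?mulr0 //; lia.
Qed.

Lemma tri_diag A : A \in unitmx -> shifted 0 A -> forall a, A a a != 0.
Proof.
move=> uA tA a; rewrite unitmxE -det_tr det_trig ?unitfE in uA; last first.
  apply/is_trig_mxP => i j ij; rewrite mxE tA // addn0 //.
by move: uA; rewrite prodf_seq_neq0 => /allP /(_ a); rewrite mem_index_enum mxE => /(_ isT).
Qed.

Lemma tri_inv A : A \in unitmx -> shifted 0 A -> shifted 0 (invmx A).
Proof.
move=> uA tA a b; rewrite addn0; elim/ltn_ind: {b}(nat_of_ord b) {-2}b (erefl (nat_of_ord b)) => m IH b bm ba.
have := congr1 (fun M : 'M[C]_N => M a b) (mulVmx uA).
rewrite !mxE (bigD1 b) //= big1 ?addr0; last first.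
  move=> l lb; have {}lb : (l != b :> nat)%N by [].
  case: (ltnP l b) => h; first by rewrite (IH l) ?mul0r //; lia.
  by rewrite tA ?mulr0 // addn0; lia.
rewrite (_ : (a == b) = false); last by apply/eqP => e; move: ba; rewrite e ltnn.
by move/eqP; rewrite mulf_eq0 (negbTE (tri_diag uA tA b)) orbF => /eqP.
Qed.

Definition act A p : {poly C} := rVpoly (poly_rV p *m A).

Lemma coef_act A p (b : 'I_N) : (act A p)`_b = \sum_(a < N) p`_a * A a b.
Proof. by rewrite /act coef_rVpoly_ord mxE; apply: eq_bigr => a _; rewrite mxE. Qed.

Lemma coef_act_ge A p b : (N <= b)%N -> (act A p)`_b = 0.
Proof. by move=> h; rewrite coef_rVpoly insubF // ltnNge h. Qed.

Lemma act_is_linear A : linear (act A).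
Proof. by move=> k p q; rewrite /act linearP mulmxDl -scalemxAl linearP. Qed.
HB.instance Definition _ A := GRing.isLinear.Build C {poly C} {poly C} _ (act A) (act_is_linear A).

Lemma poly_rVK_eqX p : eqX N (rVpoly (poly_rV p : 'rV[C]_N)) p.
Proof. by move=> i iN; rewrite (coef_rVpoly_ord _ (Ordinal iN)) mxE. Qed.

Lemma eqX_poly_rV p q : eqX N p q -> poly_rV p = poly_rV q :> 'rV[C]_N.
Proof. by move=> h; apply/rowP => i; rewrite !mxE h. Qed.

Lemma act_eqN A p q : eqX N p q -> act A p = act A q.
Proof. by move=> h; rewrite /act (eqX_poly_rV h). Qed.

Lemma act_comp A B p : act (A *m B) p = act B (act A p).
Proof. by rewrite /act rVpolyK mulmxA. Qed.

Lemma act1 p : eqX N (act 1%:M p) p.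
Proof. by rewrite /act mulmx1; apply: poly_rVK_eqX. Qed.

Lemma act_eqX A i k p q : (k <= N)%N -> shifted i A -> eqX k p q -> eqX (minn (k + i) N) (act A p) (act A q).
Proof.
move=> kN tA h b; rewrite leq_min => /andP[bk bN]; rewrite !(coef_act _ _ (Ordinal bN)).
apply: eq_bigr => a _; case: (ltnP a k) => ak; first by rewrite h.
by rewrite tA ?mulr0 //=; lia.
Qed.

Lemma act_Xn A (a b : 'I_N) : (act A 'X^a)`_b = A a b.
Proof.
rewrite coef_act (bigD1 a) //= big1 ?addr0; first by rewrite coefXn eqxx mul1r.
by move=> c ca; rewrite coefXn (_ : (c == a :> nat) = false) ?mul0r //; apply: negbTE.
Qed.

(** Think of ['X^a] as [x^(W - a)]. A ring homomorphism in [x] satisfies the last clause, where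
    [act A 1] is the image of [x^W], and fixes the constant 1, which is ['X^W]. This homogeneous
    form lets positive and negative powers of [x] share one space of truncated series. *)
Definition isG A := [/\ A \in unitmx, shifted 0 A, eqX N (act A 'X^W) 'X^W &
  forall p q, eqX N (act A p * act A q) (act A 1 * act A (p * q))].

Lemma isG1 : isG 1%:M.
Proof.
split; [exact: unitmx1|exact: shifted1|exact: act1|move=> p q].
apply: eqX_trans (eqXM (act1 p) (act1 q)) _.
by apply: eqX_sym; apply: eqX_trans (eqXM (act1 1) (act1 _)) _; rewrite mul1r.
Qed.

Lemma isGM A B : isG A -> isG B -> isG (A *m B).
Proof.
move=> [uA tA wA mA] [uB tB wB mB]; split.
- by rewrite unitmx_mul uA uB.
- exact: (@shiftedM 0 0).
- by rewrite act_comp (act_eqN _ wA).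
- move=> p q; rewrite !act_comp; apply: eqX_trans (mB _ _) _.
  rewrite (act_eqN _ (mA p q)); apply: eqX_sym; exact: mB.
Qed.

Lemma isG_act1 A : isG A -> (act A 1)`_0 != 0.
Proof.
move=> [uA tA _ _]; have := tri_diag uA tA ord0.
by rewrite -act_Xn /= expr0.
Qed.

Lemma isGV A : isG A -> isG (invmx A).
Proof.
move=> gA; case: (gA) => uA tA wA mA.
have K1 p : eqX N (act A (act (invmx A) p)) p by rewrite -act_comp mulVmx //; apply: act1.
have K2 p : eqX N (act (invmx A) (act A p)) p by rewrite -act_comp mulmxV //; apply: act1.
split.
- by rewrite unitmx_inv.
- exact: tri_inv.
- by rewrite -(act_eqN _ wA).
- move=> p q; set P := act _ p; set Q := act _ q; set T := act _ (p * q); set r := act _ 1.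
  have h1 : eqX N (act A 1 * act A (P * Q)) (p * q).
    by apply: eqX_trans (eqX_sym (mA P Q)) _; apply: eqXM; apply: K1.
  have h2 : eqX N (act A 1 * act A (r * T)) (p * q).
    apply: eqX_trans (eqX_sym (mA r T)) _; rewrite -[X in eqX _ _ X]mul1r.
    by apply: eqXM; apply: K1.
  have h3 := eqX_unit (isG_act1 gA) (eqX_trans h1 (eqX_sym h2)).
  apply: eqX_trans (eqX_sym (K2 _)) _; rewrite (act_eqN _ h3); exact: K2.
Qed.

Hypotheses (W0 : (0 < W)%N).

(* [usym i c A] : [A] is the substitution x -> x (1 + c x^-i + ..) (up to sign conventions),
   row [a] standing for the monomial x^(W - a). *)
Definition usym (i : nat) (c : C) A := shifted i (A - 1%:M) /\
  forall a b : 'I_N, (b = a + i :> nat)%N -> (A - 1%:M) a b = (a%:R - W%:R) * c.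

Lemma usym0 i A : usym i 0 A -> shifted i.+1 (A - 1%:M).
Proof.
move=> [h1 h2] a b; rewrite addnS ltnS leq_eqVlt => /orP[/eqP ab|]; last exact: h1.
by rewrite h2 // mulr0.
Qed.

Lemma usym_inj i c c' A : (i < N)%N -> usym i c A -> usym i c' A -> c = c'.
Proof.
move=> iN [_ h] [_ h']; have := h ord0 (Ordinal iN) erefl; rewrite h' // sub0r.
by move/(mulfI (_ : - W%:R != 0)) => -> //; rewrite oppr_eq0 pnatr_eq0 -lt0n.
Qed.

Lemma row_shift A (a : 'I_N) i : (0 < i)%N -> shifted i (A - 1%:M) ->
  exists r, act A 'X^a = 'X^a * (1 + 'X^i * r) /\ forall b : 'I_N, (b = a + i :> nat)%N -> A a b = r`_0.
Proof.
move=> i0 h; exists (drop_poly (a + i) (act A 'X^a)); split.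
  rewrite mulrDr mulr1 mulrA -exprD; apply/polyP => b.
  rewrite coefD coefXn coefXnM coef_drop_poly; case: ltnP => bi; last first.
    rewrite subnK // (_ : (b == a)%N = false) ?add0r //; last by apply/eqP; lia.
  rewrite addr0; case: (ltnP b N) => bN; last first.
    by rewrite coef_act_ge // (_ : (b == a)%N = false) //; apply/eqP; move: (ltn_ord a); lia.
  have := h a (Ordinal bN) bi; rewrite !mxE -act_Xn => /eqP; rewrite subr_eq0 => /eqP /= ->.
  by rewrite -val_eqE /= eq_sym.
by move=> b hb; rewrite coef_drop_poly add0n -hb act_Xn.
Qed.

(** Multiplicativity makes the first nonzero diagonal of [A - 1] an affine function of the row
    index, and it vanishes at row [W] because ['X^W] is fixed. Only the slope is left free, hence
    the form [(a - W) * c]. *)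
Lemma isG_usym A i : isG A -> (0 < i)%N -> (W + i <= n)%N ->
  shifted i (A - 1%:M) -> exists c, usym i c A.
Proof.
move=> [uA tA wA mA] i0 hi h.
have rowE (a : nat) : (a + i <= n)%N -> exists r,
    act A 'X^a = 'X^a * (1 + 'X^i * r) /\ forall a' b : 'I_N, a = a' :> nat -> (b = a + i :> nat)%N -> A a' b = r`_0.
  move=> ha; have aN : (a < N)%N by lia.
  have [r [h1 h2]] := row_shift (Ordinal aN) i0 h; exists r; split=> // a' b ea eb.
  by rewrite -(h2 b eb); congr (A _ _); apply: val_inj.
have [r0 [e0 f0]] := rowE 0%N ltac:(lia); have [r1 [e1 f1]] := rowE 1%N ltac:(lia).
have add a b ra rb rab : (a + b + i <= n)%N ->
   act A 'X^a = 'X^a * (1 + 'X^i * ra) -> act A 'X^b = 'X^b * (1 + 'X^i * rb) ->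
   act A 'X^(a + b) = 'X^(a + b) * (1 + 'X^i * rab) -> ra`_0 + rb`_0 = r0`_0 + rab`_0.
  move=> hab ea eb eab; have := mA 'X^a 'X^b (i + (a + b))%N ltac:(lia).
  rewrite -exprD -{1}(expr0 'X) ea eb eab e0 expr0 mul1r.
  have -> : 'X^a * (1 + 'X^i * ra) * ('X^b * (1 + 'X^i * rb)) =
     (1 + (ra + rb + ra * rb * 'X^i) * 'X^i) * 'X^(a + b) :> {poly C} by rewrite exprD; ring.
  have -> : (1 + 'X^i * r0) * ('X^(a + b) * (1 + 'X^i * rab)) =
     (1 + (r0 + rab + r0 * rab * 'X^i) * 'X^i) * 'X^(a + b) :> {poly C} by ring.
  rewrite !coefMXn ltnNge leq_addl /= !addnK !coefD !coef1 !coefMXn ltnn subnn !coefD !coefMXn i0.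
  by rewrite !addr0 => /addrI.
have lin a r : (a + i <= n)%N -> act A 'X^a = 'X^a * (1 + 'X^i * r) -> r`_0 = r0`_0 + a%:R * (r1`_0 - r0`_0).
  elim: a r => [|a IH] r ha er.
    rewrite mul0r addr0; move: er; rewrite e0 expr0 !mul1r => /addrI er.
    by have := congr1 (fun p : {poly C} => p`_i) er; rewrite !coefXnM ltnn subnn.
  have [r' [er' _]] := rowE a ltac:(lia).
  have := add a 1%N r' r1 r ltac:(lia) er' e1; rewrite addn1 => /(_ er).
  rewrite (IH r' ltac:(lia) er') -natr1 => hh.
  by rewrite -[LHS](addKr r0`_0) -hh; ring.
have [rW [eW _]] := rowE W hi.
have rW0 : rW`_0 = 0.
  have := wA (i + W)%N ltac:(lia); rewrite eW mulrC coefMXn ltnNge leq_addl /= addnK coefXn.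
  rewrite coefD coef1 coefXnM ltnn subnn (_ : (i == 0)%N = false); last by lia.
  by rewrite add0r => ->; rewrite (_ : (i + W == W)%N = false) //; lia.
exists (r1`_0 - r0`_0); split=> // a b hb.
have [ra [ea fa]] := rowE a ltac:(move: (ltn_ord b); lia).
rewrite !mxE (fa a b erefl hb) (lin a ra ltac:(move: (ltn_ord b); lia) ea).
rewrite (_ : (a == b) = false); last by apply/eqP => e; move: hb; rewrite e; lia.
have := lin W rW hi eW; rewrite rW0 subr0 => hh.
move: hh; set d := _ - _ => hh; have -> : r0`_0 = - (W%:R * d) by apply/eqP; rewrite -addr_eq0 -hh.
ring.
Qed.

Lemma usym1 i c A B : isG A -> isG B -> (0 < i)%N -> usym i c A -> forall c', usym i c' B ->
  usym i (c + c') (A *m B).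
Proof.
move=> gA gB i0 [h1 h2] c' [h1' h2'].
have e : A *m B - 1%:M = (A - 1%:M) + (B - 1%:M) + (A - 1%:M) *m (B - 1%:M).
  rewrite mulmxBl mulmxBr mulmx1 mul1mx; apply/matrixP => a b; rewrite !mxE; ring.
have h3 := shiftedM h1 h1'.
rewrite /usym e; split.
  by apply: shiftedD; [apply: shiftedD|apply: shiftedW h3; rewrite leq_addr].
move=> a b hb; rewrite mxE (h3 a b) ?addr0; last by rewrite hb; lia.
by rewrite mxE h2 // h2' // mulrDr.
Qed.

Lemma shifted_inv i A : isG A -> shifted i (A - 1%:M) -> shifted i (invmx A - 1%:M).
Proof.
move=> gA h; have [uA _ _ _] := gA; have [_ t _ _] := isGV gA.
have -> : invmx A - 1%:M = - (invmx A *m (A - 1%:M)).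
  by rewrite mulmxBr mulVmx // mulmx1 opprB.
by apply: shiftedN; apply: (@shiftedM 0).
Qed.

Lemma usymV i c A : isG A -> (0 < i)%N -> usym i c A -> usym i (- c) (invmx A).
Proof.
move=> gA i0 [h1 h2]; have h3 := shifted_inv gA h1; split=> // a b hb.
have [uA _ _ _] := gA.
have e : invmx A - 1%:M = - (A - 1%:M) - (invmx A - 1%:M) *m (A - 1%:M).
  rewrite mulmxBl mulmxBr mulVmx // mulmx1 mul1mx; apply/matrixP => k l; rewrite !mxE; ring.
rewrite e mxE [X in _ + X]mxE (shiftedM h3 h1) ?subr0; last by rewrite hb; lia.
by rewrite mxE h2 // mulrN.
Qed.

Definition mcomm A B := invmx A *m invmx B *m A *m B.

(** The bracket of the Witt algebra: [(a - W) * (a + i - W) - (a - W) * (a + j - W) = (i - j) * (a -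
    W)]. The factor [invmx (B *m A)] is unipotent and does not affect the leading diagonal. *)
Lemma usym_comm i j c c' A B : isG A -> isG B -> (0 < i)%N -> (0 < j)%N ->
  usym i c A -> usym j c' B -> usym (i + j) ((i%:R - j%:R) * c * c') (mcomm A B).
Proof.
move=> gA gB i0 j0 [h1 h2] [h1' h2'].
have [uA tA _ _] := gA; have [uB tB _ _] := gB.
set E := A - 1%:M in h1 h2 *; set F := B - 1%:M in h1' h2' *.
pose D := E *m F - F *m E.
have hD : shifted (i + j) D.
  by apply: shiftedB; [apply: shiftedM|rewrite addnC; apply: shiftedM].
have eD : A *m B - B *m A = D.
  rewrite /D /E /F !mulmxBl !mulmxBr !mul1mx !mulmx1.
  by apply/matrixP => a b; rewrite !mxE; ring.
have gBA := isGV (isGM gB gA).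
have sBA : shifted 1 (invmx (B *m A) - 1%:M).
  apply: shifted_inv; first exact: isGM.
  have -> : B *m A - 1%:M = F *m A + E by rewrite /F /E mulmxBl mul1mx addrA subrK.
  apply: shiftedD; last exact: shiftedW h1.
  by rewrite -[1%N]addn0; apply: shiftedM tA; apply: shiftedW h1'.
have e : mcomm A B - 1%:M = D + (invmx (B *m A) - 1%:M) *m D.
  have -> : invmx (B *m A) = invmx A *m invmx B.
    have h : (B *m A) *m (invmx A *m invmx B) = 1%:M by rewrite mulmxA mulmxK // mulmxV.
    by rewrite -[LHS]mulmx1 -h mulmxA mulVmx ?mul1mx // unitmx_mul uB uA.
  rewrite mulmxBl mul1mx addrCA subrr addr0 -eD mulmxBr /mcomm !mulmxA.
  by rewrite -[X in _ = _ - X]mulmxA -[X in _ = _ - X](mulmxA (invmx A)) mulKmx // mulVmx // mulmxA.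
have h3 := shiftedM sBA hD.
rewrite /usym e; split.
  by apply: shiftedD => //; apply: shiftedW h3; rewrite leq_addl.
move=> a b hb; rewrite mxE (h3 a b) ?addr0; last by rewrite hb; lia.
have ki : (a + i < N)%N by move: (ltn_ord b); lia.
have kj : (a + j < N)%N by move: (ltn_ord b); lia.
rewrite /D mxE (coef_shiftedM h1 h1' (_ : (b = a + i + j :> nat)%N) (k := Ordinal ki)) //; last by rewrite hb addnA.
rewrite [(- (F *m E)) a b]mxE (coef_shiftedM h1' h1 (_ : (b = a + j + i :> nat)%N) (k := Ordinal kj)) //; last by rewrite hb; lia.
rewrite h2 // h2' ?h2' ?h2 //=; try by rewrite hb; lia.
by rewrite !natrD; ring.
Qed.

(** For [g] satisfying [isG] the ratio [mu] is the [i]-th power of its multiplier; this is how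
    multipliers act on symbols. *)
Lemma usym_conj i c A g (mu : C) : isG A -> isG g -> (0 < i)%N -> usym i c A ->
  (forall a b : 'I_N, (b = a + i :> nat)%N -> g b b = mu * g a a) ->
  usym i (c * mu) (invmx g *m A *m g).
Proof.
move=> gA gg i0 [h1 h2] hmu; have [ug tg _ _] := gg; have [_ tgV _ _] := isGV gg.
have e : invmx g *m A *m g - 1%:M = invmx g *m (A - 1%:M) *m g.
  by rewrite mulmxBr mulmx1 mulmxBl mulVmx.
have h3 := shiftedM tgV h1; rewrite add0n in h3.
have h4 := shiftedM h3 tg; rewrite addn0 in h4.
rewrite /usym e; split=> // a b hb.
rewrite (coef_shiftedM h3 tg (_ : (b = a + i + 0 :> nat)%N) (k := b)) ?addn0 //.
rewrite (coef_shiftedM tgV h1 (_ : (b = a + 0 + i :> nat)%N) (k := a)) ?addn0 //.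
rewrite h2 // (hmu a b hb).
have h5 : invmx g a a * g a a = 1.
  have := congr1 (fun M : 'M[C]_N => M a a) (mulVmx ug).
  rewrite (coef_shiftedM tgV tg (_ : (a = a + 0 + 0 :> nat)%N) (k := a)) ?addn0 //.
  by rewrite mxE eqxx.
by rewrite -[RHS]mul1r -h5; ring.
Qed.
End Triangular.

Section Series.
Variable C : numClosedFieldType.
Implicit Types (p q v w F : {poly C}).

Lemma expD_first_order v w d : exists q, (v + w) ^+ d.+1 = v ^+ d.+1 + d.+1%:R * v ^+ d * w + w ^+ 2 * q.
Proof.
elim: d => [|d [q hq]]; first by exists 0; rewrite !expr1 expr0 mulr0 addr0 !mul1r.
exists (d.+1%:R * v ^+ d + v * q + w * q); rewrite exprSr hq -(natr1 d.+1) !exprS.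
by move: (v ^+ d) (d.+1%:R : {poly C}) => V k; ring.
Qed.

(** Hensel lifting, one coefficient at a time: the derivative [d.+1 * v ^+ d] does not vanish at 0,
    so the correction [e] can cancel the next error term. *)
Lemma root_series F d N : F`_0 != 0 -> exists v, v`_0 != 0 /\ eqX N (v ^+ d.+1) F.
Proof.
move=> F0; case: N => [|N]; first by exists 1; rewrite coef1 oner_eq0.
elim: N => [|N [v [v0 hv]]].
  have : exists x : C, root ('X^(d.+1) - (F`_0)%:P : {poly C}) x by apply/closed_rootP; rewrite size_XnsubC.
  case=> x; rewrite /root !hornerE subr_eq0 => /eqP hx; exists x%:P.
  rewrite coefC /=; split; first by apply: contraNneq F0 => x0; rewrite -hx x0 expr0n.
  by case=> // _; rewrite -rmorphXn coefC /= hx.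
move/eqXP: hv => [r hr].
pose e := - r`_0 / (d.+1%:R * v`_0 ^+ d).
have [q hq] := expD_first_order v (e%:P * 'X^(N.+1)) d.
exists (v + e%:P * 'X^(N.+1)); split; first by rewrite coefD coefMXn /= addr0.
rewrite hq hr; apply/eqXP.
have h0 : exists s, r + d.+1%:R * v ^+ d * e%:P = s * ('X - 0%:P).
  apply/factor_theorem; rewrite /root hornerD !hornerM horner_exp hornerC -(rmorph_nat polyC) hornerC !horner_coef0 /e.
  by rewrite mulrA mulrAC divff ?mulf_neq0 ?expf_neq0 ?pnatr_eq0 // mul1r subrr.
case: h0 => s; rewrite subr0 => hs.
exists (s + e%:P ^+ 2 * 'X^N * q).
rewrite exprMn mulrDl -(exprM 'X) (_ : s * _ = (r + d.+1%:R * v ^+ d * e%:P) * 'X^(N.+1)); last by rewrite hs (exprS 'X N.+1) mulrA.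
rewrite (_ : N.+1 * 2 = N + N.+2)%N; last by lia.
rewrite exprD; move: (v ^+ d) (d.+1%:R : {poly C}) ('X^(N.+2) : {poly C}) ('X^N : {poly C}) ('X^(N.+1) : {poly C}) => V k x1 x2 x3.
by ring.
Qed.

Lemma inv_series v N : v`_0 != 0 -> exists w, eqX N (v * w) 1.
Proof.
move=> v0; have : coprimep v 'X^N.
  apply: coprimep_expr; rewrite (_ : 'X = 'X - 0%:P); last by rewrite subr0.
  rewrite coprimep_XsubC.
  by rewrite /root horner_coef0.
case/Bezout_eq1_coprimepP => -[u w] /= h; exists u; apply/eqXP; exists (- w).
by rewrite -h; ring.
Qed.
End Series.

Section Subst.
Variables (C : numClosedFieldType) (n W : nat).
Local Notation N := n.+1.
Implicit Types (A B : 'M[C]_N) (p q v w : {poly C}).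

(** With [w = 1 / v] and [x = 1 / 'X], row [a] is [(x * v) ^ (W - a)] divided by [x ^ W]: the matrix
    is the substitution of [x * v(1/x)] for [x]. Keeping [w] as a separate argument avoids inverting
    series. *)
Definition smx v w : 'M[C]_N := \matrix_(a, b) (v ^+ W * (w * 'X) ^+ a)`_b.

Lemma act_smx v w p : eqX N (act (smx v w) p) (v ^+ W * (p \Po (w * 'X))).
Proof.
pose P := \poly_(i < N) p`_i.
have hP : eqX N p P by move=> i iN; rewrite coef_poly iN.
apply: eqX_trans (_ : eqX N _ (v ^+ W * (P \Po (w * 'X)))) _; last first.
  by apply: eqXM => //; apply: eqX_comp; apply: eqX_sym.
move=> b bN; rewrite (coef_act _ _ (Ordinal bN)) /P poly_def linear_sum /= mulr_sumr coef_sum.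
by apply: eq_bigr => i _; rewrite mxE linearZ /= comp_Xn_poly -scalerAr coefZ.
Qed.

Lemma smx_tri v w : shifted 0 (smx v w).
Proof. by move=> a b; rewrite addn0 => ba; rewrite mxE exprMn mulrA coefMXn ba. Qed.

Lemma smx_diag v w a : smx v w a a = v`_0 ^+ W * w`_0 ^+ a.
Proof.
rewrite mxE exprMn mulrA coefMXn ltnn subnn coefM big_ord1 subnn.
by rewrite -!horner_coef0 !horner_exp.
Qed.

Lemma isG_smx v w : eqX N (v * w) 1 -> (W <= n)%N -> isG W (smx v w).
Proof.
move=> vw Wn.
have /eqP vw0 : v`_0 * w`_0 == 1.
  by have := vw 0%N isT; rewrite coefM big_ord1 subnn coef1 => ->.
split.
- rewrite unitmxE -det_tr det_trig; last first.
    by apply/is_trig_mxP => i j ij; rewrite mxE smx_tri // addn0.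
  rewrite unitfE prodf_seq_neq0; apply/allP => a _; rewrite mxE smx_diag.
  have : v`_0 * w`_0 != 0 by rewrite vw0 oner_eq0.
  by rewrite !mulf_eq0 !negb_or => /andP[h1 h2]; rewrite !expf_neq0.
- exact: smx_tri.
- apply: eqX_trans (act_smx _ _ _) _; rewrite comp_Xn_poly !exprMn mulrA -exprMn.
  apply: eqX_trans (_ : eqX N _ (1 ^+ W * 'X^W)) _; last by rewrite expr1n mul1r.
  by apply: eqXM => //; apply: eqXX.
- move=> p q.
  apply: eqX_trans (eqXM (act_smx v w p) (act_smx v w q)) _; apply: eqX_sym.
  apply: eqX_trans (eqXM (act_smx v w 1) (act_smx v w (p * q))) _.
  by rewrite comp_polyM -[1]polyC1 comp_polyC polyC1; rewrite (_ : forall a b c : {poly C}, a * 1 * (a * (b * c)) = a * b * (a * c)) // => a b c; ring.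
Qed.

(** The reversal ['X^W * p(1 / 'X)], that is, the coordinates of a polynomial in [x] when ['X^a]
    stands for [x^(W - a)]. *)
Definition vecp p : {poly C} := \poly_(i < W.+1) p`_(W - i).

Lemma coef_vecp p i : (vecp p)`_i = if (i <= W)%N then p`_(W - i) else 0.
Proof. by rewrite coef_poly ltnS. Qed.

Lemma vecp_is_linear : linear vecp.
Proof.
move=> k p q; apply/polyP => i; rewrite coefD coefZ !coef_vecp coefD coefZ.
by case: leqP => // _; rewrite mulr0 addr0.
Qed.
HB.instance Definition _ := GRing.isLinear.Build C {poly C} {poly C} _ vecp vecp_is_linear.

Lemma vecpXn k : (k <= W)%N -> vecp 'X^k = 'X^(W - k).
Proof.
move=> kW; apply/polyP => i; rewrite coef_vecp !coefXn; case: leqP => iW; last first.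
  by rewrite (_ : (i == W - k)%N = false) //; lia.
by congr (_%:R); congr nat_of_bool; apply/eqP/eqP; lia.
Qed.

Lemma vecpM p q e e' : (size p <= e.+1)%N -> (size q <= e'.+1)%N -> (e + e' <= W)%N ->
  vecp p * vecp q = 'X^W * vecp (p * q).
Proof.
move=> hp hq he.
have ep : p = \sum_(k < e.+1) p`_k *: 'X^k by rewrite -poly_def -{1}(take_poly_id hp).
have eq' : q = \sum_(k < e'.+1) q`_k *: 'X^k by rewrite -poly_def -{1}(take_poly_id hq).
rewrite [in RHS]ep [in RHS]eq' {1}ep {1}eq'.
rewrite mulr_suml !linear_sum /= mulr_suml mulr_sumr; apply: eq_bigr => k _.
rewrite !mulr_sumr linear_sum /= mulr_sumr; apply: eq_bigr => l _.
rewrite -scalerAl -scalerAr -exprD !linearZ /= -!scalerAl -!scalerAr.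
have kl : (k + l <= W)%N by have := ltn_ord k; have := ltn_ord l; lia.
rewrite !vecpXn; try by lia.
rewrite -!exprD; by do 2!congr (_ *: _); congr ('X^_); lia.
Qed.

Lemma vecp_inj k p q : (size p <= W.+1)%N -> (size q <= W.+1)%N -> (W < k)%N ->
  eqX k (vecp p) (vecp q) -> p = q.
Proof.
move=> hp hq Wk h; apply/polyP => i; case: (leqP i W) => iW; last first.
  by rewrite !nth_default //; apply: leq_trans iW.
have := h (W - i)%N ltac:(lia); rewrite !coef_vecp leq_subr.
by rewrite (_ : W - (W - i) = i)%N //; lia.
Qed.

Lemma act_vecpM A p q e e' : isG W A -> (size p <= e.+1)%N -> (size q <= e'.+1)%N -> (e + e' <= W)%N ->
  eqX N (act A (vecp p) * act A (vecp q)) ('X^W * act A (vecp (p * q))).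
Proof.
move=> [_ _ wA mA] hp hq he; apply: eqX_trans (mA _ _) _; rewrite (vecpM hp hq he).
by apply: eqX_trans (eqX_sym (mA _ _)) _; apply: eqXM.
Qed.

(** The series [x * v] is a [d]-th root of [f], so substituting it in [x^d], whose coordinate is
    ['X^(W - d)], gives back [f]. *)
Lemma vecp_root (f : {poly C}) d v w L : size f = d.+1 -> (d <= W)%N -> (N <= L)%N ->
  eqX L (v ^+ d) (\poly_(i < d.+1) f`_(d - i)) -> eqX L (v * w) 1 ->
  eqX N (act (smx v w) 'X^(W - d)) (vecp f).
Proof.
move=> sf dW NL hv hw; apply: eqX_trans (act_smx _ _ _) _.
rewrite comp_Xn_poly exprMn mulrA.
have -> : v ^+ W = v ^+ d * v ^+ (W - d) by rewrite -exprD subnKC.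
rewrite -mulrA -mulrA (mulrA (v ^+ (W - d))) -exprMn.
apply: eqX_trans (_ : eqX N _ ((\poly_(i < d.+1) f`_(d - i)) * (1 * 'X^(W - d)))) _.
  apply: eqXM; first exact: eqX_le hv.
  apply: eqXM => //; rewrite -(expr1n _ (W - d)); apply: eqXX; exact: eqX_le hw.
rewrite mul1r => i _; rewrite coefMXn coef_vecp coef_poly; case: ltnP => iW.
  by have [iW2|//] := leqP i W; rewrite nth_default // sf; lia.
have [iW2|iW2] := leqP i W; have [h|h] := ltnP (i - (W - d)) d.+1; rewrite //; try lia.
by congr (f`_ _); lia.
Qed.

Hypothesis W0 : (0 < W)%N.
Hypothesis Wn : (W < n)%N.

(** The multiplier of a substitution, a homomorphism by [chiM]; for [smx v w] with [v * w = 1] it is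
    the constant coefficient of [w]. The whole diagonal is geometric with this ratio, see
    [isG_diag]. *)
Definition chi A : C := A (inord 1) (inord 1) / A ord0 ord0.

Lemma isG_diag A a : isG W A -> A a a = A ord0 ord0 * chi A ^+ a.
Proof.
move=> gA; case: (gA) => uA tA _ mA; have A0 := tri_diag uA tA ord0.
have key k l (kl : (k + l < N)%N) (kN : (k < N)%N) (lN : (l < N)%N) :
   A (Ordinal kN) (Ordinal kN) * A (Ordinal lN) (Ordinal lN) = A ord0 ord0 * A (Ordinal kl) (Ordinal kl).
  have tr m : (m < N)%N -> exists r, act A 'X^m = r * 'X^m /\ forall b : 'I_N, b = m :> nat -> A b b = r`_0.
    move=> mN; exists (drop_poly m (act A 'X^m)); split; last first.
      by move=> b bm; rewrite coef_drop_poly add0n -bm act_Xn.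
    rewrite -{1}(poly_take_drop m (act A 'X^m)) (_ : take_poly m _ = 0) ?add0r //.
    apply/polyP => i; rewrite coef_take_poly coef0; case: ltnP => // im.
    have iN : (i < N)%N by lia.
    by rewrite (act_Xn A (Ordinal mN) (Ordinal iN)) tA //= addn0.
  have [r1 [e1 f1]] := tr _ kN; have [r2 [e2 f2]] := tr _ lN; have [r3 [e3 f3]] := tr _ kl.
  have [r0 [e0 f0]] := tr 0%N isT.
  have := mA 'X^k 'X^l (k + l)%N kl; rewrite -exprD e1 e2 e3 -['X^0]/1 in e0 *.
  rewrite e0 mulr1 (_ : r1 * 'X^k * (r2 * 'X^l) = r1 * r2 * 'X^(k + l)); last by rewrite exprD; ring.
  rewrite mulrA !coefMXn ltnn subnn -!horner_coef0 !hornerM !horner_coef0.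
  by rewrite -(f1 (Ordinal kN)) // -(f2 (Ordinal lN)) // -(f3 (Ordinal kl)) // -(f0 ord0).
have h1 : (1 < N)%N by lia.
have chiE : chi A = A (Ordinal h1) (Ordinal h1) / A ord0 ord0.
  by rewrite /chi (_ : inord 1 = Ordinal h1) //; apply: val_inj; rewrite /= inordK.
case: a => a aN; elim: a aN => [|a IH] aN.
  by rewrite expr0 mulr1; congr (A _ _); apply: val_inj.
have aN' : (a < N)%N by lia.
have hs : (a + 1 < N)%N by lia.
have := key a 1%N hs aN' h1; rewrite (_ : Ordinal hs = Ordinal aN); last by apply: val_inj; rewrite /= addn1.
rewrite (IH aN') /= => /esym h; apply: (mulfI A0); rewrite h chiE exprS.
by field.
Qed.

Lemma isG_diagW A : isG W A -> A ord0 ord0 * chi A ^+ W = 1.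
Proof.
move=> gA; case: (gA) => uA tA wA mA; have WN : (W < N)%N by lia.
by rewrite -(isG_diag (Ordinal WN)) // -act_Xn wA // coefXn eqxx.
Qed.

Lemma chi_neq0 A : isG W A -> chi A != 0.
Proof.
move=> gA; apply: contra_eq_neq (isG_diagW gA) => ->.
by rewrite expr0n eqn0Ngt W0 mulr0 eq_sym oner_eq0.
Qed.

Lemma diagM A B a : isG W A -> isG W B -> (A *m B) a a = A a a * B a a.
Proof.
move=> [_ tA _ _] [_ tB _ _].
by rewrite (coef_shiftedM tA tB (_ : (a = a + 0 + 0 :> nat)%N) (k := a)) ?addn0.
Qed.

Lemma chiM A B : isG W A -> isG W B -> chi (A *m B) = chi A * chi B.
Proof. by move=> gA gB; rewrite /chi !diagM // mulf_div. Qed.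

Lemma chi1 : chi (1%:M : 'M[C]_N) = 1.
Proof. by rewrite /chi !mxE !eqxx divr1. Qed.

Lemma chiV A : isG W A -> chi (invmx A) = (chi A)^-1.
Proof.
move=> gA; have [uA _ _ _] := gA; apply: (mulfI (chi_neq0 gA)).
by rewrite divff ?chi_neq0 // -chiM ?mulmxV ?chi1 //; apply: isGV.
Qed.

Lemma chi1_shifted A : isG W A -> chi A = 1 -> shifted 1 (A - 1%:M).
Proof.
move=> gA h; have := isG_diagW gA; rewrite h expr1n mulr1 => A00.
case: (gA) => _ tA _ _ a b; rewrite addn1 ltnS leq_eqVlt => /orP[/eqP/val_inj ->|ba].
  by rewrite !mxE isG_diag // h expr1n mulr1 A00 eqxx subrr.
rewrite !mxE tA ?addn0 // (_ : (a == b) = false) ?subr0 //.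
by apply/eqP => e; move: ba; rewrite e ltnn.
Qed.

(** Climb one diagonal at a time: by [isG_usym] each new diagonal is governed by one symbol, and a
    zero symbol allows the next step. *)
Lemma depth_dichotomy A k : isG W A -> chi A = 1 -> (W + k <= N)%N ->
  shifted k (A - 1%:M) \/ exists i c, [/\ (0 < i < k)%N, c != 0 & usym W i c A].
Proof.
move=> gA h; elim: k => [|k IH] hk; first by left; apply: shiftedW (chi1_shifted gA h).
case: IH => [|sk|[i [c [hi c0 ui]]]]; first by lia.
  case: k => [|k] in hk sk *; first by left; apply: chi1_shifted.
  have [c hc] := isG_usym W0 gA (isT : (0 < k.+1)%N) ltac:(lia) sk.
  case: (eqVneq c 0) => [c0|c0]; first by left; rewrite c0 in hc; apply: usym0 hc.
  by right; exists k.+1, c; split=> //; rewrite ltnSn.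
by right; exists i, c; split=> //; lia.
Qed.
End Subst.

(** * Growth in the group of substitutions *)

Section Pivot.
Variable C : numFieldType.

(* A finite set of quotients cannot be stable under q -> q + 1; a pivot q with q + 1 outside the
   quotient set makes (x, y) -> x + (q + 1) y injective. *)
Lemma pivot (X : seq C) : (1 < size X)%N -> uniq X ->
  exists x1 x2 x3 x4, [/\ x1 \in X, x2 \in X, x3 \in X & x4 \in X] /\
    forall x y x' y', x \in X -> y \in X -> x' \in X -> y' \in X ->
      (x3 - x4) * x + (x1 - x2 + (x3 - x4)) * y = (x3 - x4) * x' + (x1 - x2 + (x3 - x4)) * y' ->
      x = x' /\ y = y'.
Proof.
move=> sX uX.
pose Ps := [seq p <- [seq (a, b) | a <- X, b <- X] | p.1 != p.2].
pose Qs := [seq (p.1 - p.2) / (r.1 - r.2) | p <- [seq (a, b) | a <- X, b <- X], r <- Ps].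
have QsP q : q \in Qs -> exists x1 x2 x3 x4, [/\ x1 \in X, x2 \in X, x3 \in X & x4 \in X] /\ (x3 != x4 /\ q = (x1 - x2) / (x3 - x4)).
  case/allpairsP => -[[a b] [a' b']] [/=]; case/allpairsP => -[a1 b1] [/= h1 h2 [-> ->]].
  rewrite mem_filter /=; case/andP => h5; case/allpairsP => -[a2 b2] [/= h3 h4 [e1 e2]].
  by rewrite e1 e2 in h5 * => ->; exists a1, b1, a2, b2.
have QsI x1 x2 x3 x4 : x1 \in X -> x2 \in X -> x3 \in X -> x4 \in X -> x3 != x4 -> (x1 - x2) / (x3 - x4) \in Qs.
  move=> h1 h2 h3 h4 h5; apply/allpairsP; exists ((x1, x2), (x3, x4)); split=> //=.
    by apply: allpairs_f.
  by rewrite mem_filter /= h5 allpairs_f.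
have [q qQ q1] : exists2 q, q \in Qs & q + 1 \notin Qs.
  case: (boolP (all (fun q => q + 1 \in Qs) Qs)) => [/allP h|]; last first.
    by rewrite -has_predC => /hasP [q h1 h2]; exists q.
  have hn k : (k%:R : C) \in Qs.
    elim: k => [|k IH]; last by rewrite -natr1; apply: h.
    have [a [b [aX bX ab]]] : exists a b, [/\ a \in X, b \in X & a != b].
      case: X sX uX {Ps Qs QsP QsI h} => [|a [|b s]] //= _ /andP[]; rewrite inE negb_or => /andP[ab _] _.
      by exists a, b; rewrite !inE !eqxx orbT.
    by rewrite -[0%:R](mul0r ((a - b)^-1)) -(subrr a); apply: QsI.
  have : (size [seq (k%:R : C) | k <- iota 0 (size Qs).+1] <= size Qs)%N.
    apply: uniq_leq_size; last by move=> x /mapP [k _ ->].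
    by rewrite map_inj_uniq ?iota_uniq // => k l /eqP; rewrite eqr_nat => /eqP.
  by rewrite size_map size_iota ltnn.
have [x1 [x2 [x3 [x4 [[h1 h2 h3 h4] [h5 hq]]]]]] := QsP q qQ.
exists x1, x2, x3, x4; split=> // x y x' y' hx hy hx' hy' e.
have d0 : x3 - x4 != 0 by rewrite subr_eq0.
case: (eqVneq y y') => [yy|yy].
  by split=> //; move: e; rewrite yy => /addIr /(mulfI d0).
have y0 : y' - y != 0 by rewrite subr_eq0 eq_sym.
case/negP: q1; rewrite (_ : q + 1 = (x - x') / (y' - y)); first by apply: QsI => //; rewrite eq_sym.
rewrite hq; apply: (mulfI d0); apply: (mulIf y0).
have -> : (x3 - x4) * ((x1 - x2) / (x3 - x4) + 1) * (y' - y) = (x1 - x2 + (x3 - x4)) * (y' - y) by field.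
rewrite -mulrA divfK //; apply/eqP; rewrite -subr_eq0; apply/eqP.
transitivity ((x3 - x4) * x' + (x1 - x2 + (x3 - x4)) * y' - ((x3 - x4) * x + (x1 - x2 + (x3 - x4)) * y)); first by ring.
by rewrite e subrr.
Qed.
End Pivot.

Lemma pigeonhole_fibre (T : Type) (U : eqType) (X : seq T) (q : T -> U) (Q : nat) :
  (Q < size (undup (map q X)))%N \/
  (X = [::] \/ exists2 y, y \in map q X & (size X <= Q * count (fun t => q t == y) X)%N).
Proof.
case: ltnP => h; first by left.
right; case: X h => [|t0 X0] h; first by left.
set X := t0 :: X0 in h *; right.
case: (boolP (has (fun y => size X <= Q * count (fun t => q t == y) X)%N (map q X))).
  by case/hasP => y h1 h2; exists y.
rewrite -all_predC => /allP hno; exfalso.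
pose m := ((size X).-1 %/ Q)%N.
have Q0 : (0 < Q)%N.
  have hq : q t0 \in undup (map q X) by rewrite mem_undup /X /= mem_head.
  rewrite lt0n; apply: contraTneq hq => Q0; rewrite Q0 leqn0 size_eq0 in h.
  by rewrite (eqP h).
have : (size X <= m * size (undup (map q X)))%N.
  apply: (size_le_fibre (q := q)).
    by rewrite -(all_map q (fun y => y \in undup (map q X))); apply/allP => y; rewrite mem_undup.
  move=> y; rewrite mem_undup => /hno /=; rewrite -ltnNge => hy.
  by rewrite /m leq_divRL // mulnC; move: hy; rewrite /X /=; lia.
move=> h1; have : (size X <= m * Q)%N by apply: leq_trans h1 _; rewrite leq_mul2l h orbT.
have := leq_trunc_div (size X).-1 Q; rewrite -/m /X /=; lia.
Qed.

(** * Words in a symmetric set *)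

Section WordSets.
Variable G : groupType.
Variable S : seq G.
Hypotheses (S1 : 1%g \in S) (SV : forall g, g \in S -> g^-1%g \in S).

Lemma wsetM l m a b : a \in wset S l -> b \in wset S m -> (a * b)%g \in wset S (l + m).
Proof.
elim: l a => [|l IH] a /=; first by rewrite inE => /eqP ->; rewrite mul1g.
case/prodsetP => u [v [uS vw ->]] bm; apply/prodsetP; exists u, (v * b)%g.
by rewrite uS IH // mulgA.
Qed.

Lemma mem_wset1 a : a \in S -> a \in wset S 1.
Proof. by move=> h; apply/prodsetP; exists a, 1%g; rewrite inE eqxx mulg1. Qed.

Lemma wset_one l : 1%g \in wset S l.
Proof. by elim: l => [|l IH] /=; [rewrite inE | apply/prodsetP; exists 1%g, 1%g; rewrite mulg1]. Qed.

Lemma wset_le l m a : (l <= m)%N -> a \in wset S l -> a \in wset S m.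
Proof. by move=> /subnKC <- h; rewrite -[a]mulg1; apply: wsetM => //; apply: wset_one. Qed.

Lemma wsetV l a : a \in wset S l -> a^-1%g \in wset S l.
Proof.
elim: l a => [|l IH] a /=; first by rewrite !inE => /eqP ->; rewrite invg1.
case/prodsetP => u [v [uS vw ->]].
by move: (wsetM (IH _ vw) (mem_wset1 (SV uS))); rewrite addn1 invgM.
Qed.

Lemma wset_sub (S' : seq G) k l : (forall a, a \in S' -> a \in wset S k) ->
  (size (wset S' l) <= size (wset S (k * l)))%N.
Proof.
move=> h; apply: uniq_leq_size; first by case: l => //= l; apply: undup_uniq.
move=> a; elim: l a => [|l IH] a /=; first by rewrite muln0.
case/prodsetP => u [v [uS vw ->]]; rewrite mulnS; apply: wsetM; [exact: h|exact: IH].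
Qed.
End WordSets.

Section Growth.
Variables (C : numClosedFieldType) (n W : nat).
Hypotheses (W0 : (0 < W)%N) (Wn : (W < n)%N).
Local Notation N := n.+1.
Variable S : seq (gl C n).
Hypotheses (S1 : 1%g \in S) (SV : forall g, g \in S -> g^-1%g \in S).
Hypothesis SG : forall g, g \in S -> isG W (glval g).

Lemma wset_isG l g : g \in wset S l -> isG W (glval g).
Proof.
elim: l g => [|l IH] g /=; first by rewrite inE => /eqP ->; apply: isG1.
by case/prodsetP => u [v [uS vw ->]]; apply: isGM; [exact: SG|exact: IH].
Qed.

Definition gcomm (g h : gl C n) : gl C n := (g^-1 * h^-1 * g * h)%g.
Lemma gcommE g h : glval (gcomm g h) = mcomm g h. Proof. by []. Qed.

Lemma wset_gcomm l m g h : g \in wset S l -> h \in wset S m -> gcomm g h \in wset S (2 * (l + m)).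
Proof.
move=> hg hh; rewrite (_ : 2 * (l + m) = l + m + l + m)%N; last by lia.
exact: (wsetM (wsetM (wsetM (wsetV SV hg) (wsetV SV hh)) hg) hh).
Qed.

Lemma chi_gcomm g h : isG W (glval g) -> isG W (glval h) -> chi (glval (gcomm g h)) = 1.
Proof.
move=> gg gh; have gg' := isGV gg; have gh' := isGV gh.
rewrite gcommE /mcomm !(@chiM _ _ W) ?(chiV W0 Wn) //; try by do ?apply: isGM.
by field; rewrite !(chi_neq0 W0 Wn).
Qed.

(** * Growth forced by many symbols at one depth *)

Section Unipotent.
Variables (T : eqType) (Rs : seq T) (e : T -> gl C n) (sym : T -> C) (j i : nat) (c : C) (w : gl C n).
Hypotheses (j0 : (0 < j)%N) (ji : (j < i)%N) (c0 : c != 0).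
Hypotheses (eS : forall f, f \in Rs -> e f \in S) (eu : forall f, f \in Rs -> usym W j (sym f) (e f)).
Hypotheses (wS : w \in wset S 4) (wu : usym W i c w).
Hypotheses (uRs : uniq (map sym Rs)).

(** Repeated commutators with [w] copy the symbols of the family, up to a common nonzero factor, to
    the depths [j], [i + j], [2 * i + j] and so on. *)
Fixpoint iter_comm (l : nat) (f : T) : gl C n := if l is l'.+1 then gcomm w (iter_comm l' f) else e f.
Fixpoint iter_len (l : nat) : nat := if l is l'.+1 then 2 * (4 + iter_len l') else 1.
Fixpoint iter_coef (l : nat) : C := if l is l'.+1 then (i%:R - (l' * i + j)%:R) * c * iter_coef l' else 1.

Lemma iter_comm_mem l f : f \in Rs -> iter_comm l f \in wset S (iter_len l).
Proof.
by move=> h; elim: l => [|l IH] /=; [apply: mem_wset1; apply: eS | exact: wset_gcomm wS IH].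
Qed.

Lemma iter_comm_usym l f : f \in Rs -> usym W (l * i + j) (iter_coef l * sym f) (iter_comm l f).
Proof.
move=> h; elim: l => [|l IH]; first by rewrite /= mul1r; apply: eu.
have lj : (0 < l * i + j)%N by lia.
have i0 : (0 < i)%N by lia.
have := usym_comm W0 (wset_isG wS) (wset_isG (iter_comm_mem l h)) i0 lj wu IH.
by rewrite mulrA addnA -mulSn.
Qed.

(** The factor [i - (l * i + j)] vanishes only if the two depths agree, which [0 < j < i]
    excludes. *)
Lemma iter_coef_neq0 l : iter_coef l != 0.
Proof.
elim: l => [|l IH] /=; first by rewrite oner_eq0.
rewrite !mulf_neq0 // subr_eq0 eqr_nat; case: l {IH} => [|l]; last by rewrite mulSn; lia.
by lia.
Qed.

Fixpoint tower (r m : nat) : seq (gl C n) :=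
  if m is m'.+1 then [seq (iter_comm r f * p)%g | f <- Rs, p <- tower r.+1 m'] else [:: 1%g].
Fixpoint tower_len (r m : nat) : nat := if m is m'.+1 then iter_len r + tower_len r.+1 m' else 0.

Lemma tower_mem r m g : g \in tower r m -> g \in wset S (tower_len r m).
Proof.
elim: m r g => [|m IH] r g /=; first by [].
case/allpairsP => -[f p] [/= fR pt ->]; apply: wsetM; [exact: iter_comm_mem|exact: IH].
Qed.

Lemma tower_shift r m g : g \in tower r m -> shifted (r * i + j) (glval g - 1%:M).
Proof.
elim: m r g => [|m IH] r g /=; first by rewrite inE => /eqP ->; rewrite subrr => a b _; rewrite mxE.
case/allpairsP => -[f p] [/= fR pt ->].
have h1 := IH _ _ pt; have [h2 _] := iter_comm_usym r fR.
have -> : glval (iter_comm r f * p)%g - 1%:M = (glval (iter_comm r f) - 1%:M) *m p + (glval p - 1%:M).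
  by rewrite mulmxBl mul1mx addrA subrK.
apply: shiftedD; last by apply: shiftedW h1; rewrite mulSn; lia.
rewrite -[(r * i + j)%N]addn0; apply: shiftedM => //.
by have [_ tp _ _] := wset_isG (tower_mem pt).
Qed.

(** All factors after the first are deeper, so the symbol at the lowest depth determines the first
    factor; cancel it and repeat. *)
Lemma tower_uniq r m : (r * i + m * i + j <= n)%N -> uniq (tower r m) /\ size (tower r m) = (size Rs ^ m)%N.
Proof.
elim: m r => [|m IH] r hn /=; first by rewrite expn0.
have [u s] := IH r.+1 ltac:(rewrite mulSn in hn; rewrite mulSn; lia).
split; last by rewrite size_allpairs s expnS.
apply: allpairs_uniq => //; first exact: map_uniq uRs.
move=> [f p] [f' p'] /allpairsP [[a1 b1] [/= fR pt [e1 e2]]] /allpairsP [[a2 b2] [/= fR' pt' [e3 e4]]] /= heq.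
rewrite -{a1}e1 in fR; rewrite -{b1}e2 in pt; rewrite -{a2}e3 in fR'; rewrite -{b2}e4 in pt'.
have us g q : g \in Rs -> q \in tower r.+1 m -> usym W (r * i + j) (iter_coef r * sym g) (glval (iter_comm r g * q)%g).
  move=> gR qt; rewrite -[iter_coef r * _]addr0 glME; refine (usym1 W0 _ _ _ (iter_comm_usym r gR) _).
  - exact: wset_isG (iter_comm_mem r gR).
  - exact: wset_isG (tower_mem qt).
  - by clear -j0; lia.
  have h := tower_shift qt; split; first by apply: shiftedW h; rewrite mulSn; clear -ji; lia.
  by move=> a b hb; rewrite mulr0 h // hb mulSn; clear -ji; lia.
have h1 := us _ _ fR pt; rewrite heq in h1.
have e1 := usym_inj W0 (_ : (r * i + j < N)%N) h1 (us _ _ fR' pt').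
have {}e1 : sym f = sym f' by apply: (mulfI (iter_coef_neq0 r)); apply: e1; clear -hn ji j0; rewrite mulSn in hn; lia.
have ef : f = f'.
  have h2 : nth f Rs (index f Rs) = f by rewrite nth_index.
  apply/eqP; rewrite -(nth_index f fR) -(nth_index f fR').
  rewrite nth_uniq ?index_mem ?(map_uniq uRs) //.
  have := nth_uniq (sym f) (s := map sym Rs) (i := index f Rs) (j := index f' Rs).
  rewrite !size_map !index_mem => /(_ fR fR' uRs) <-.
  by rewrite !(nth_map f) ?index_mem // !nth_index // e1.
by move: heq; rewrite ef => /mulgI ->.
Qed.

Lemma growth_unipotent t : (t * i + j <= n)%N -> (size Rs ^ t <= size (wset S (tower_len 0 t)))%N.
Proof.
move=> h; have [u <-] := tower_uniq (r := 0) (m := t) h.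
by apply: uniq_leq_size => // g; apply: tower_mem.
Qed.
End Unipotent.

(** * Growth forced by many multipliers *)

Section Multipliers.
Variables (i : nat) (c : C) (w : gl C n).
Hypotheses (i0 : (0 < i)%N) (iN : (i < N)%N) (c0 : c != 0) (wS : w \in wset S 4) (wu : usym W i c w).

Definition realised (l : nat) (mu : C) := exists2 g, g \in wset S l & usym W i (c * mu) (glval g).
(** Lengths multiply instead of adding, so that composing multipliers multiplies their costs while
    adding them adds the costs, and polynomial expressions in multipliers have a bounded cost. *)
Definition multiplier (l : nat) (x : C) :=
  forall l' mu, (0 < l')%N -> realised l' mu -> realised (l * l') (x * mu).

Lemma realisedD l l' x y : realised l x -> realised l' y -> realised (l + l') (x + y).
Proof.
move=> [g gw ug] [h hw uh]; exists (g * h)%g; first exact: wsetM.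
by rewrite mulrDr glME; apply: (usym1 W0 (wset_isG gw) (wset_isG hw) i0 ug).
Qed.

Lemma realisedN l x : realised l x -> realised l (- x).
Proof.
move=> [g gw ug]; exists (g^-1)%g; first exact: wsetV.
by rewrite mulrN glVE; apply: (usymV W0 (wset_isG gw) i0 ug).
Qed.

Lemma multiplierB l l' x y : multiplier l x -> multiplier l' y -> multiplier (l + l') (x - y).
Proof.
move=> hx hy k mu k0 hm; rewrite mulrBl mulnDl; apply: realisedD; first exact: hx.
by apply: realisedN; apply: hy.
Qed.

Lemma multiplierD l l' x y : multiplier l x -> multiplier l' y -> multiplier (l + l') (x + y).
Proof.
move=> hx hy k mu k0 hm; rewrite mulrDl mulnDl; apply: realisedD; [exact: hx|exact: hy].
Qed.

Lemma multiplierM l l' x y : (0 < l')%N -> multiplier l x -> multiplier l' y -> multiplier (l * l') (x * y).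
Proof.
by move=> l0 hx hy k mu k0 hm; rewrite -mulrA -mulnA; apply: hx; [rewrite muln_gt0 l0|apply: hy].
Qed.

(** Conjugation lengthens a word by 2, and [k + 2 <= 3 * k] for [k > 0]. *)
Lemma multiplier_chi g : g \in S -> multiplier 3 (chi (glval g) ^+ i).
Proof.
move=> gS k mu k0 [h hw uh]; exists (g^-1 * h * g)%g.
  apply: (@wset_le _ _ S1 (1 + k + 1)); first by lia.
  by do 2?apply: wsetM => //; apply: mem_wset1 => //; apply: SV.
rewrite [_ * mu]mulrC mulrA !glME glVE; apply: usym_conj => //; first exact: wset_isG hw.
  exact: SG.
move=> a b hb; have gg := SG gS.
by rewrite (isG_diag W0 Wn b gg) (isG_diag W0 Wn a gg) hb exprD; ring.
Qed.

Fixpoint pivot_len (r : nat) : nat := if r is r'.+1 then 6 * pivot_len r' ^ 2 else 3.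

Lemma pivot_len_gt0 r : (0 < pivot_len r)%N.
Proof. by elim: r => //= r IH; rewrite muln_gt0 expn_gt0 IH. Qed.

(** Sum-product growth: each pivot map squares the number of multipliers. For inputs of cost [l],
    its two terms [(x3 - x4) * x] and [(x1 - x2 + (x3 - x4)) * y] cost [2 * l * l] and [4 * l * l],
    whence [6 * l ^ 2]. *)
Lemma pivot_tower (X : seq C) r : uniq X -> (1 < size X)%N -> (forall x, x \in X -> multiplier 3 x) ->
  exists Y : seq C, [/\ uniq Y, size Y = (size X ^ (2 ^ r))%N & forall y, y \in Y -> multiplier (pivot_len r) y].
Proof.
move=> uX sX hX; elim: r => [|r [Y [uY sY hY]]]; first by exists X; rewrite expn0 expn1.
have sY1 : (1 < size Y)%N.
  by rewrite sY -{1}(exp1n (2 ^ r)) ltn_exp2r ?expn_gt0.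
have [x1 [x2 [x3 [x4 [[h1 h2 h3 h4] inj]]]]] := pivot sY1 uY.
exists [seq (x3 - x4) * x + (x1 - x2 + (x3 - x4)) * y | x <- Y, y <- Y]; split.
- apply: allpairs_uniq => // -[x y] [x' y'] /allpairsP [[? ?] [/= ? ? [-> ->]]] /allpairsP [[? ?] [/= ? ? [-> ->]]] /= h.
  by case: (inj _ _ _ _ _ _ _ _ h) => // -> ->.
- by rewrite size_allpairs sY -expnD addnn -mul2n -expnS.
move=> _ /allpairsP [[x y] [/= xY yY ->]]; set l := pivot_len r in hY *.
have l0 : (0 < l)%N := pivot_len_gt0 r.
rewrite (_ : 6 * l ^ 2 = (l + l) * l + (l + l + (l + l)) * l)%N; last by rewrite -mulnn; lia.
apply: multiplierD; apply: multiplierM => //; try exact: hY.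
  by apply: multiplierB; apply: hY.
by apply: multiplierD; apply: multiplierB; apply: hY.
Qed.

(** Apply the multipliers to the symbol of [w], a word of length 4 such as a commutator of two
    members of [S]: as [c] is nonzero, distinct multipliers give distinct symbols, hence distinct
    words. *)
Lemma growth_multipliers (X : seq C) r : uniq X -> (1 < size X)%N ->
  (forall x, x \in X -> exists2 g, g \in S & x = chi (glval g) ^+ i) ->
  (size X ^ (2 ^ r) <= size (wset S (pivot_len r * 4)))%N.
Proof.
move=> uX sX hX.
have [|Y [uY <- hY]] := pivot_tower r uX sX.
  by move=> x /hX [g gS ->]; apply: multiplier_chi.
have /choice [sel hsel] (y : C) : exists g, y \in Y -> g \in wset S (pivot_len r * 4) /\ usym W i (c * y) (glval g).
  case: (boolP (y \in Y)) => [|_]; last by exists 1%g.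
  move=> /hY /(_ 4%N 1 isT) [|g hg ug]; first by exists w => //; rewrite mulr1.
  by exists g; rewrite mulr1 in ug.
rewrite -(size_map sel); apply: uniq_leq_size; last by move=> _ /mapP [y /hsel [h _] ->].
rewrite map_inj_in_uniq // => y y' /hsel [_ h] /hsel [_ h'] e; rewrite e in h.
exact: (mulfI c0 (usym_inj W0 iN h h')).
Qed.
End Multipliers.
End Growth.

Lemma undup_reps (T U : eqType) (q : T -> U) (X : seq T) :
  exists Y : seq T, [/\ {subset Y <= X}, uniq (map q Y) & size Y = size (undup (map q X))].
Proof.
elim: X => [|x X [Y [h1 h2 h3]]] /=; first by exists [::].
case: ifP => hx; first by exists Y; split=> // y /h1; rewrite inE => ->; rewrite orbT.
exists (x :: Y); split.
- by move=> y; rewrite !inE => /orP[->//|/h1 ->]; rewrite orbT.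
- rewrite /= h2 andbT; apply: contraFN hx => /mapP [y /h1 yX ->]; exact: map_f.
by rewrite /= h3.
Qed.

Lemma size_power_values (C : numClosedFieldType) (X : seq C) (i : nat) : (0 < i)%N ->
  (size (undup X) <= i * size (undup [seq (x ^+ i)%R | x <- X]))%N.
Proof.
move=> i0; apply: (size_le_fibre (q := fun x : C => x ^+ i)).
  by apply/allP => x; rewrite !mem_undup => /= h; apply: (map_f (fun x : C => x ^+ i)).
move=> y _; rewrite -size_filter; set r := filter _ _.
have p0 : 'X^i - y%:P != 0 :> {poly C} by rewrite -size_poly_gt0 size_XnsubC.
have -> : i = (size ('X^i - y%:P : {poly C})).-1 by rewrite size_XnsubC.
rewrite -ltnS prednK ?size_poly_gt0 //; apply: max_poly_roots => //; last first.
  by rewrite filter_uniq ?undup_uniq.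
apply/allP => x; rewrite mem_filter => /andP[/eqP hx _].
by rewrite rootE !hornerE hx subrr.
Qed.

Lemma shifted_usym0 (C : numClosedFieldType) (n W i : nat) (A : 'M[C]_n.+1) : usym W i (0 : C) A <-> shifted i.+1 (A - 1%:M).
Proof.
split=> [[h1 h2] a b hb|h].
  case: (ltngtP b (a + i)%N) => h; [exact: h1| lia |by rewrite h2 // mulr0].
split; first by apply: shiftedW h.
by move=> a b hb; rewrite mulr0; apply: h; lia.
Qed.

(** * Ratios of a large subfamily commute to high order *)

Section Dichotomy.
Variables (C : numClosedFieldType) (n W : nat).
Hypotheses (W0 : (0 < W)%N) (Wn : (W < n)%N).
Local Notation N := n.+1.
Variables (T : eqType) (g : T -> gl C n) (d k t Q : nat).
Hypotheses (k0 : (0 < k)%N) (kn : (W + k <= n.+1)%N) (dk : (W + d.+1 <= n.+1)%N) (tn : (t * k + d <= n)%N) (Q0 : (0 < Q)%N).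
Variable S : seq (gl C n).
Hypotheses (S1 : 1%g \in S) (SV : forall g, g \in S -> g^-1%g \in S).
Hypothesis SG : forall g, g \in S -> isG W (glval g).
Hypotheses (grow1 : (size (wset S (tower_len 0 t)) <= Q ^ t)%N)
  (grow2 : (size (wset S (pivot_len t * 4)) <= Q ^ t)%N) (t0 : (0 < t)%N).

Definition lratio f f' : gl C n := ((g f)^-1 * g f')%g.

Lemma usym_exists (A : gl C n) j : (0 < j)%N -> (W + j.+1 <= n.+1)%N -> isG W (glval A) -> chi (glval A) = 1 ->
  shifted j (glval A - 1%:M) -> exists c, usym W j c (glval A).
Proof.
move=> j0 jn gA hA sA; case: (@depth_dichotomy _ _ _ W0 Wn _ j.+1 gA hA) => //.
  by move/shifted_usym0; exists 0.
case=> i [c [/andP[i0 ij] c0 u]]; case: (ltngtP i j) => h; [|lia|by exists c; rewrite -h].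
have : usym W i 0 (glval A) by apply/shifted_usym0; apply: shiftedW sA.
by move/(usym_inj W0 (_ : (i < N)%N) u) => e; rewrite e ?eqxx // in c0; lia.
Qed.

(** If [w] had a symbol at some depth [i < k], then [growth_unipotent] would produce more than
    [Q ^ t] words, against [grow1]. *)
Lemma comm_far (Rs : seq T) (sym : T -> C) j f0 w : (0 < j)%N -> (j <= d)%N ->
  {in Rs, forall f, lratio f0 f \in S} -> {in Rs, forall f, usym W j (sym f) (lratio f0 f)} ->
  uniq (map sym Rs) -> (Q < size Rs)%N -> w \in wset S 4 -> chi (glval w) = 1 ->
  shifted j.+1 (glval w - 1%:M) -> shifted k (glval w - 1%:M).
Proof.
move=> j0 jd hS hu uR sR wS chw shw.
have gw := wset_isG SG wS.
case: (@depth_dichotomy _ _ _ W0 Wn _ k gw chw) => // -[i [c [/andP[i0 ik] c0 u]]].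
have ji : (j < i)%N.
  rewrite ltnNge; apply/negP => ij.
  have : usym W i 0 (glval w) by apply/shifted_usym0; apply: shiftedW shw.
  by move/(usym_inj W0 (_ : (i < N)%N) u) => e; rewrite e ?eqxx // in c0; lia.
have h : (t * i + j <= n)%N.
  by apply: leq_trans tn; apply: leq_add => //; rewrite leq_mul2l (ltnW ik) orbT.
have := growth_unipotent W0 Wn S1 SV SG j0 ji c0 hS hu wS u uR h.
move=> h1; have := leq_trans h1 grow1.
by rewrite leqNgt ltn_exp2r // sR.
Qed.

Lemma lratioM f0 f f' : lratio f f' = ((lratio f0 f)^-1 * lratio f0 f')%g.
Proof. by rewrite /lratio invgM invgK -mulgA mulVKg. Qed.

(* Successive popular fibres of the symbol at depths j, j + 1, ..., d. *)
Lemma deep_fibres m j (Fs : seq T) : uniq Fs -> (0 < j)%N -> (j + m = d.+1)%N ->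
  {in Fs &, forall f f', lratio f f' \in S} ->
  {in Fs &, forall f f', chi (glval (lratio f f')) = 1} ->
  {in Fs &, forall f f', shifted j (glval (lratio f f') - 1%:M)} ->
  {in Fs &, forall f f', shifted d.+1 (glval (lratio f f') - 1%:M) -> f = f'} ->
  (size Fs <= Q ^ m)%N \/
  exists (Fs' : seq T) j f0 (sym : T -> C), [/\ uniq Fs', {subset Fs' <= Fs}, (0 < j <= d)%N,
    (size Fs <= Q ^ m * size Fs')%N & f0 \in Fs'] /\
   [/\ {in Fs', forall f, usym W j (sym f) (glval (lratio f0 f))}, (Q < size (undup (map sym Fs')))%N &
    {in Fs' & Fs', forall f1 f2, {in Fs' & Fs', forall f3 f4, shifted k (glval (gcomm (lratio f1 f2) (lratio f3 f4)) - 1%:M)}}].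
Proof.
elim: m j Fs => [|m IH] j Fs uF j0 jm hS hchi hsh hinj.
  left; rewrite addn0 in jm; rewrite expn0.
  case: Fs uF hS hchi hsh hinj => [|f [|f' Fs]] //= /andP[]; rewrite inE negb_or => /andP[ff' _] _ hS _ hsh hinj.
  by case/eqP: ff'; apply: hinj; rewrite ?inE ?eqxx ?orbT // -jm; apply: hsh; rewrite ?inE ?eqxx ?orbT.
case: (posnP (size Fs)) => [->|]; first by left.
case E: Fs => [|f0 Fs0] // _; rewrite -E; have f0F : f0 \in Fs by rewrite E mem_head.
have jd : (j <= d)%N by lia.
have hG f f' : f \in Fs -> f' \in Fs -> isG W (glval (lratio f f')) by move=> *; apply/SG/hS.
have /choice [sym hsym] (f : T) : exists c, f \in Fs -> usym W j c (glval (lratio f0 f)).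
  case: (boolP (f \in Fs)) => [fF|_]; last by exists 0.
  case: (@usym_exists (lratio f0 f) j) => //; [lia|exact: hG|exact: hchi|exact: hsh|].
  by move=> c hc; exists c.
have hcomm (f1 f2 f3 f4 : T) : f1 \in Fs -> f2 \in Fs -> f3 \in Fs -> f4 \in Fs ->
    [/\ gcomm (lratio f1 f2) (lratio f3 f4) \in wset S 4, chi (glval (gcomm (lratio f1 f2) (lratio f3 f4))) = 1 &
     shifted j.+1 (glval (gcomm (lratio f1 f2) (lratio f3 f4)) - 1%:M)].
  move=> h1 h2 h3 h4.
  have hh1 := hG _ _ h1 h2; have hh2 := hG _ _ h3 h4.
  split.
  - by apply: (wset_gcomm W0 Wn S1 SV (l := 1) (m := 1)); apply: mem_wset1; apply: hS.
  - exact: (chi_gcomm W0 Wn).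
  have [c1 u1] := @usym_exists _ j j0 ltac:(lia) hh1 (hchi _ _ h1 h2) (hsh _ _ h1 h2).
  have [c2 u2] := @usym_exists _ j j0 ltac:(lia) hh2 (hchi _ _ h3 h4) (hsh _ _ h3 h4).
  have := usym_comm W0 hh1 hh2 j0 j0 u1 u2; rewrite subrr !mul0r => /shifted_usym0.
  by apply: shiftedW; lia.
case: (pigeonhole_fibre Fs sym Q) => [many|[hF|[y _ hy]]].
- right; exists Fs, j, f0, sym; split; first by split=> //; rewrite ?jd ?j0 // leq_pmull // expn_gt0 Q0.
  split=> [f fF||f1 f2 h1 h2 f3 f4 h3 h4]; [exact: hsym|exact: many|].
  have [hw chw shw] := hcomm _ _ _ _ h1 h2 h3 h4.
  have [Y [YF uY sY]] := undup_reps sym Fs.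
  apply: (@comm_far Y sym j f0) => //.
  - by move=> f /YF fF; apply: hS.
  - by move=> f /YF fF; apply: hsym.
  - by rewrite sY.
- by rewrite hF in f0F.
pose Fs1 := [seq f <- Fs | sym f == y].
have sub1 : {subset Fs1 <= Fs} by move=> f; rewrite mem_filter => /andP[].
case: (IH j.+1 Fs1) => //; rewrite ?filter_uniq //; try by [lia|move=> f f' /sub1 h /sub1 h'; by [exact: hS|exact: hchi|exact: hinj]].
- move=> f f'; rewrite !mem_filter => /andP[/eqP e1 h1] /andP[/eqP e2 h2].
  apply/(shifted_usym0 W); rewrite (lratioM f0) glME glVE.
  have u1 := hsym _ h1; have u2 := hsym _ h2.
  have := usym1 W0 (isGV (hG _ _ f0F h1)) (hG _ _ f0F h2) j0 (usymV W0 (hG _ _ f0F h1) j0 u1) u2.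
  by rewrite e1 e2 addNr.
- move=> h; left; apply: leq_trans hy _; rewrite -size_filter expnS.
  by rewrite leq_mul2l h orbT.
case=> Fs' [j' [f1 [sym' [[h1 h2 h3 h4 h5] h6]]]].
right; exists Fs', j', f1, sym'; split=> //; split=> //.
  by move=> f /h2 /sub1.
apply: leq_trans hy _; rewrite -size_filter expnS -mulnA.
by rewrite leq_mul2l h4 orbT.
Qed.

(** More than [k * Q] multipliers still have more than [Q] distinct [i]-th powers for each [i < k],
    so a commutator with a symbol at depth [i] would contradict [grow2]. Otherwise some multiplier
    has a popular fibre, within which all ratios are unipotent and [deep_fibres] applies. *)
Lemma commuting_dichotomy (Fs : seq T) : uniq Fs ->
  {in Fs &, forall f f', lratio f f' \in S} ->
  {in Fs &, forall f f', shifted d.+1 (glval (lratio f f') - 1%:M) -> f = f'} ->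
  [\/ (size Fs <= k * Q * Q ^ d)%N,
   exists Fs' j f0 (sym : T -> C), [/\ uniq Fs', {subset Fs' <= Fs}, (0 < j <= d)%N,
    (size Fs <= k * Q * Q ^ d * size Fs')%N & f0 \in Fs'] /\
   [/\ {in Fs', forall f, usym W j (sym f) (glval (lratio f0 f))}, (Q < size (undup (map sym Fs')))%N &
    {in Fs' & Fs', forall f1 f2, {in Fs' & Fs', forall f3 f4, shifted k (glval (gcomm (lratio f1 f2) (lratio f3 f4)) - 1%:M)}}] |
   exists2 f0, f0 \in Fs & (k * Q < size (undup [seq chi (glval (lratio f0 f)) | f <- Fs]))%N /\
    {in Fs & Fs, forall f1 f2, {in Fs & Fs, forall f3 f4, shifted k (glval (gcomm (lratio f1 f2) (lratio f3 f4)) - 1%:M)}}].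
Proof.
move=> uF hS hinj.
case: (posnP (size Fs)) => [->|]; first by constructor 1.
case E: Fs => [|f0 Fs0] // _; rewrite -E; have f0F : f0 \in Fs by rewrite E mem_head.
have hG f f' : f \in Fs -> f' \in Fs -> isG W (glval (lratio f f')) by move=> *; apply/SG/hS.
case: (pigeonhole_fibre Fs (fun f => chi (glval (lratio f0 f))) (k * Q)) => [many|[hF|[y _ hy]]].
- constructor 3; exists f0 => //; split=> // f1 f2 h1 h2 f3 f4 h3 h4; set w := gcomm _ _.
  have hw : w \in wset S 4.
    by apply: (wset_gcomm W0 Wn S1 SV (l := 1) (m := 1)); apply: mem_wset1; apply: hS.
  have gw := wset_isG SG hw.
  have chw : chi (glval w) = 1 by apply: (chi_gcomm W0 Wn); apply: hG.
  case: (@depth_dichotomy _ _ _ W0 Wn _ k gw chw) => // -[i [c [/andP[i0 ik] c0 u]]].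
  set X := undup [seq x ^+ i | x <- [seq chi (glval (lratio f0 f)) | f <- Fs]].
  have QX : (Q < size X)%N.
    have h := @size_power_values _ [seq chi (glval (lratio f0 f)) | f <- Fs] i i0.
    have h' := leq_trans many h; rewrite ltnNge; apply/negP => h''; move: h'; apply/negP.
    rewrite -leqNgt; apply: leq_mul => //; exact: ltnW.
  have X1 : (1 < size X)%N := leq_ltn_trans Q0 QX.
  have iN : (i < N)%N by clear -ik kn; lia.
  have := @growth_multipliers _ _ _ W0 Wn S S1 SV SG i c w i0 iN c0 hw u X t (undup_uniq _) X1.
  have hX x : x \in X -> exists2 h, h \in S & x = chi (glval h) ^+ i.
    rewrite mem_undup => /mapP [_ /mapP [f fF ->] ->].
    by exists (lratio f0 f) => //; apply: hS.
  move/(_ hX) => h; have := leq_trans h grow2; rewrite leqNgt => /negP [].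
  apply: (@leq_ltn_trans (Q ^ 2 ^ t)); first by rewrite leq_pexp2l // ltnW // ltn_expl.
  by rewrite ltn_exp2r ?expn_gt0.
- by rewrite hF in f0F.
pose Fs1 := [seq f <- Fs | chi (glval (lratio f0 f)) == y].
have sub1 : {subset Fs1 <= Fs} by move=> f; rewrite mem_filter => /andP[].
have chi1 : {in Fs1 &, forall f f', chi (glval (lratio f f')) = 1}.
  move=> f f'; rewrite !mem_filter => /andP[/eqP e1 h1] /andP[/eqP e2 h2].
  have g1 := hG _ _ f0F h1; have g2 := hG _ _ f0F h2.
  rewrite (lratioM f0) glME glVE (@chiM _ _ W) ?(chiV W0 Wn) //; last exact: isGV.
  by rewrite e1 e2 mulVf // -e1; apply: (chi_neq0 W0 Wn).
case: (@deep_fibres d 1%N Fs1) => //; rewrite ?filter_uniq //; try by [lia|move=> f f' /sub1 h /sub1 h'; by [exact: hS|exact: hinj]].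
- move=> f f' h h'; apply: (chi1_shifted W0 Wn); last exact: chi1.
  by apply: hG; apply: sub1.
- move=> h; constructor 1; apply: leq_trans hy _; rewrite -size_filter.
  by rewrite leq_mul2l h orbT.
case=> Fs' [j' [f1 [sym' [[h1 h2 h3 h4 h5] h6]]]].
constructor 2; exists Fs', j', f1, sym'; split=> //; split=> //.
  by move=> f /h2 /sub1.
apply: leq_trans hy _; rewrite -size_filter -[leqRHS]mulnA.
by rewrite leq_mul2l h4 orbT.
Qed.
End Dichotomy.

(** * Commuting families with many multipliers *)

Section CommonBase.
Variable C : numClosedFieldType.

Lemma prod_flatten_nseq (s : seq C) k :
  \prod_(x <- flatten (nseq k s)) ('X - x%:P) = (\prod_(x <- s) ('X - x%:P)) ^+ k.
Proof. by elim: k => [|k IH] /=; rewrite ?big_nil // big_cat /= IH exprS. Qed.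

Lemma count_flatten_nseq (s : seq C) x k : count_mem x (flatten (nseq k s)) = (k * count_mem x s)%N.
Proof. by elim: k => [|k IH] //=; rewrite count_cat IH mulSn. Qed.

Lemma count_flatten_mult (c : C -> nat) (u : seq C) x : uniq u ->
  count_mem x (flatten [seq nseq (c r) r | r <- u]) = ((x \in u) * c x)%N.
Proof.
elim: u => //= r u IH /andP[ru uu]; rewrite count_cat IH // inE.
rewrite count_nseq /= eq_sym; case: eqVneq => [->|_] /=; first by rewrite (negbTE ru) addn0.
by rewrite mul0n.
Qed.

Lemma dvdn_foldr_gcd (E : seq nat) d c : (forall e, e \in E -> d %| e * c)%N -> (d %| foldr gcdn 0 E * c)%N.
Proof.
elim: E => [|e E IH] h /=; first by rewrite dvdn0.
by rewrite muln_gcdl dvdn_gcd h ?mem_head // IH // => e' h'; apply: h; rewrite inE h' orbT.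
Qed.

Lemma foldr_gcd_dvdn (E : seq nat) e : e \in E -> (foldr gcdn 0 E %| e)%N.
Proof.
elim: E => [|e' E IH] //=; rewrite inE => /orP[/eqP ->|h]; first exact: dvdn_gcdl.
exact: dvdn_trans (dvdn_gcdr _ _) (IH h).
Qed.

(** By unique factorisation the root multiplicities of [P e] are those of [P d] times [e / d]. Let
    [m] be the gcd of [E]: being an integral combination of the exponents, it makes [m / d] times
    each multiplicity integral, and these are the multiplicities of [h]. *)
Lemma common_base (P : nat -> {poly C}) (E : seq nat) d : (0 < d)%N -> d \in E ->
  {in E, forall e, P e \is monic /\ P e ^+ d = P d ^+ e} ->
  exists m (h : {poly C}), (0 < m)%N /\ {in E, forall e, (m %| e)%N /\ P e = h ^+ (e %/ m)}.
Proof.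
move=> d0 dE hP.
have /choice [s sP] (e : nat) : exists t : seq C, e \in E -> P e = \prod_(x <- t) ('X - x%:P).
  have [t ht] := closed_field_poly_normal (P e); exists t => /hP [/monicP m _].
  by rewrite m scale1r in ht.
have cnt_s e x : e \in E -> (d * count_mem x (s e) = e * count_mem x (s d))%N.
  move=> eE; have [_] := hP e eE; rewrite (sP e) // (sP d) // -!prod_flatten_nseq => /prod_XsubC_eq /seq.permP.
  by move=> /(_ (pred1 x)); rewrite !count_flatten_nseq.
set m := foldr gcdn 0 E.
have md : (m %| d)%N by apply: foldr_gcd_dvdn.
have m0 : (0 < m)%N by apply: dvdn_gt0 d0 md.
have dm x : (d %| m * count_mem x (s d))%N.
  by apply: dvdn_foldr_gcd => e eE; rewrite -cnt_s // dvdn_mulr.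
pose hs := flatten [seq nseq (m * count_mem r (s d) %/ d)%N r | r <- undup (s d)].
have chs x : (d * count_mem x hs = m * count_mem x (s d))%N.
  rewrite (count_flatten_mult _ _ (undup_uniq _)) mem_undup.
  case: (boolP (x \in s d)) => h; first by rewrite mul1n mulnC divnK.
  by rewrite mul0n (count_memPn h) !muln0.
exists m, (\prod_(x <- hs) ('X - x%:P)); split=> // e eE.
have me : (m %| e)%N by apply: foldr_gcd_dvdn.
split=> //; rewrite -prod_flatten_nseq sP //; apply: perm_big.
apply/allP => x _ /=; apply/eqP; rewrite count_flatten_nseq.
apply/eqP; rewrite -(eqn_pmul2l d0) cnt_s // mulnCA chs mulnA divnK //.
Qed.
End CommonBase.

Section Eigen.
Variables (C : numClosedFieldType) (n : nat).
Local Notation N := n.+1.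

(** For a triangular matrix the lowest nonzero coefficient of an eigenvector forces the eigenvalue
    to equal the diagonal entry at that place. *)
Lemma eigen_lowest (U : 'M[C]_N) (y : {poly C}) (lam : C) m L : shifted 0 U -> (L <= N)%N ->
  eqX m y 0 -> eqX L (act U y) (lam *: y) ->
  (forall b : 'I_N, (m <= b < L)%N -> U b b != lam) -> eqX L y 0.
Proof.
move=> tU LN y0 hy hU b; elim/ltn_ind: b => b IH bL.
case: (ltnP b m) => mb; first exact: y0.
have bN : (b < N)%N := leq_trans bL LN; pose b' := Ordinal bN.
have := hy b bL; rewrite (coef_act U y b') (bigD1 b') //= big1 ?addr0; last first.
  move=> a ab; case: (ltnP a b) => h; first by rewrite (IH a) ?coef0 ?mul0r // (ltn_trans h).
  by rewrite tU ?mulr0 // addn0 ltn_neqAle h andbT eq_sym.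
rewrite coefZ mulrC coef0 => /eqP; rewrite -subr_eq0 -mulrBl mulf_eq0 => /orP[|/eqP //].
by rewrite subr_eq0 (negbTE (hU b' _)) // mb.
Qed.

Lemma exists_eigenvector (U : 'M[C]_N) (a : 'I_N) : shifted 0 U ->
  (forall b : 'I_N, (a < b)%N -> U b b != U a a) ->
  exists z, [/\ eqX N (act U z) (U a a *: z), eqX a z 0 & z`_a = 1].
Proof.
move=> tU hU.
have step m : (m <= N - a)%N -> exists z, [/\ eqX (a + m) (act U z) (U a a *: z), eqX a z 0 & z`_a = 1].
  elim: m => [_|m IH hm].
    exists 'X^a; split; last by rewrite coefXn eqxx.
      move=> b; rewrite addn0 => ba; rewrite coefZ coefXn (ltn_eqF ba) mulr0.
      have bN : (b < N)%N := ltn_trans ba (ltn_ord a).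
      by rewrite (act_Xn U a (Ordinal bN)) tU // addn0.
    by move=> b ba; rewrite coefXn (ltn_eqF ba) coef0.
  have [z [h1 h2 h3]] := IH (ltnW hm).
  have bN : (a + m < N)%N by lia.
  pose b := Ordinal bN.
  case: m => [|m] in IH hm h1 bN b *.
    exists z; split=> // c hc; case: (ltnP c a) => ca; first by apply: h1; lia.
    have -> : c = a by lia.
    rewrite coef_act (bigD1 a) //= big1 ?addr0 ?coefZ ?h3 ?mulr1 ?mul1r // => a' /eqP a'a.
    case: (ltnP a' a) => h; first by rewrite h2 // coef0 mul0r.
    rewrite tU ?mulr0 // addn0 ltn_neqAle h andbT; apply/eqP => e; apply: a'a; exact: val_inj.
  have Ub : U b b - U a a != 0 by rewrite subr_eq0 hU //=; lia.
  pose t := (U a a * z`_b - (act U z)`_b) / (U b b - U a a).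
  exists (z + t *: 'X^b); split.
  - move=> c hc; rewrite linearD linearZ /= coefD !coefZ coefD coefZ.
    have cN : (c < N)%N by clear -hc bN; lia.
    rewrite (act_Xn U b (Ordinal cN)) coefXn.
    case: (ltnP c b) => cb.
      by rewrite tU ?addn0 // (ltn_eqF cb) !mulr0 !addr0 h1 ?coefZ //; exact: cb.
    have e : c = b by apply/eqP; rewrite eqn_leq cb andbT; move: hc; rewrite /b /=; lia.
    have -> : Ordinal cN = b by apply: val_inj.
    rewrite e eqxx mulr1 /t -(subrK (t * U b b) ((act U z)`_b)).
    field.
    exact: Ub.
  - move=> c ca; rewrite coefD h2 // coefZ coefXn (ltn_eqF _) /= ?mulr0 ?coef0 ?addr0 //.
    by apply: leq_trans ca _; rewrite leq_addr.
  by rewrite coefD h3 coefZ coefXn (ltn_eqF _) ?mulr0 ?addr0 //=; lia.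
have [z hz] := step (N - a)%N (leqnn _); exists z.
by rewrite subnKC in hz; last exact/ltnW.
Qed.

Lemma triangular_expansion (z : 'I_N -> {poly C}) (p : {poly C}) m :
  (forall a : 'I_N, eqX a (z a) 0 /\ (z a)`_a = 1) -> eqX m p 0 ->
  exists th : 'I_N -> C, (forall a : 'I_N, (a < m)%N -> th a = 0) /\ eqX N p (\sum_a th a *: z a).
Proof.
move=> hz.
elim: {m}(N - m)%N {-2}m (leqnn (N - m)) p => [|r IH] m hm p hp.
  exists (fun=> 0); split=> //; rewrite big1 => [|a _]; last by rewrite scale0r.
  by move=> b hb; apply: hp; lia.
case: (ltnP m N) => mN; last by apply: (IH m) => //; lia.
pose a := Ordinal mN; have [z1 z2] := hz a.
have [||th [h1 h2]] := IH m.+1 _ (p - p`_m *: z a).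
- lia.
- move=> b hb; rewrite coefB coefZ coef0; case: (ltnP b m) => bm; first by rewrite hp // z1 // !coef0 mulr0 subrr.
  have -> : b = a by rewrite /=; lia.
  by rewrite z2 mulr1 subrr.
exists (fun b => if b == a then p`_m else th b); split.
  move=> b bm; case: eqP => [e|_]; first by rewrite e /= ltnn in bm.
  by apply: h1; lia.
move=> b hb; rewrite (bigD1 a) //= eqxx (eq_bigr (fun a => th a *: z a)); last first.
  by move=> c /negbTE ->.
have := h2 b hb; rewrite (bigD1 a) //= h1 ?ltnSn // scale0r add0r coefB => e.
by rewrite coefD -e addrC subrK.
Qed.
End Eigen.

Lemma not_root_of_unity (C : numClosedFieldType) (X : seq C) n : uniq X -> (n * n.+1 < size X)%N ->
  exists2 x, x \in X & forall i, (0 < i <= n)%N -> x ^+ i != 1.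
Proof.
move=> uX sX; pose P := \prod_(i < n) ('X^(i.+1) - 1%:P : {poly C}).
have P0 : P != 0.
  by apply/prodf_neq0 => i _; rewrite -size_poly_gt0 size_XnsubC.
have sP : (size P <= (n * n.+1).+1)%N.
  apply: leq_trans (size_prod_leq _ _) _; rewrite cardT size_enum_ord.
  rewrite leq_subLR; have : (\sum_(i < n) size (('X^(i.+1) - 1%:P)%R : {poly C}) <= n * n.+1)%N.
    rewrite -[X in (_ <= X * _)%N]card_ord -sum_nat_const; apply: leq_sum => i _.
    by rewrite size_XnsubC // ltnS ltn_ord.
  by move=> h; apply: leq_ltn_trans h _; rewrite addnS ltnS leq_addl.
have [|h] := boolP (all (root P) X).
  by move=> /(max_poly_roots P0)/(_ uX) h; have := leq_trans h sP; rewrite ltnS leqNgt sX.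
move: h; rewrite -has_predC => /hasP [x xX /= hx]; exists x => // -[|i] //= hi.
apply: contraNneq hx => e; rewrite /root /P horner_prod (bigD1 (Ordinal hi)) //= !hornerE e subrr mul0r //.
Qed.

Section Reversal.
Variables (C : numClosedFieldType) (W : nat).

Lemma vecpK (p : {poly C}) : (size p <= W.+1)%N -> vecp W (vecp W p) = p.
Proof.
move=> sp; apply/polyP => i; rewrite !coef_vecp leq_subr.
case: leqP => iW; first by rewrite subKn.
by rewrite nth_default // (leq_trans sp).
Qed.

Lemma vecp_eqX (p q : {poly C}) : eqX W.+1 p q -> vecp W p = vecp W q.
Proof. by move=> h; apply/polyP => i; rewrite !coef_vecp h // ltnS leq_subr. Qed.

Lemma vecp_low (p : {poly C}) e : (size p <= e.+1)%N -> eqX (W - e) (vecp W p) 0.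
Proof.
move=> sp i hi; rewrite coef_vecp coef0; case: leqP => // iW.
by rewrite nth_default //; apply: leq_trans sp _; lia.
Qed.

Lemma vecp_monic (p : {poly C}) e : (e <= W)%N -> size p = e.+1 -> p \is monic -> (vecp W p)`_(W - e) = 1.
Proof. by move=> eW sp /monicP; rewrite /lead_coef coef_vecp leq_subr subKn // sp. Qed.

End Reversal.

(** * Simultaneous diagonalisation *)

Section Multiplicative.
Variables (C : numClosedFieldType) (n W d k : nat).
Hypotheses (W0 : (0 < W)%N) (Wn : (W < n)%N) (d0 : (0 < d)%N) (dW : (d * d <= W)%N).
Hypotheses (kn : (W + k <= n.+1)%N) (kW : (d.+1 * W + d < k)%N).
Local Notation N := n.+1.

(** Eigenvectors only up to order [L]: the ratios commute to finite order, and each product of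
    polynomials costs [W] more orders, since [vecp] is multiplicative up to the factor ['X^W]. *)
Definition eigp (U : 'M[C]_N) L (lam : C) (p : {poly C}) := eqX L (act U (vecp W p)) (lam *: vecp W p).

Lemma eigpM (U : 'M[C]_N) L lam lam' (p q : {poly C}) e e' : isG W U -> (L <= N)%N ->
  (size p <= e.+1)%N -> (size q <= e'.+1)%N -> (e + e' <= W)%N ->
  eigp U L lam p -> eigp U L lam' q -> eigp U (L - W) (lam * lam') (p * q).
Proof.
move=> gU LN sp sq ee hp hq; case: (ltnP L W) => LW; first by rewrite /eigp (eqP (ltnW LW)).
apply/(eqX_MXn (L - W) W); rewrite subnK //.
have := act_vecpM gU sp sq ee => /(eqX_le LN) h; rewrite mulrC.
apply: eqX_trans (eqX_sym h) _; apply: eqX_trans (eqXM hp hq) _.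
rewrite -scalerAl -scalerAr scalerA (vecpM sp sq ee) -scalerAl mulrC.
by rewrite [vecp _ _ * _]mulrC.
Qed.

Lemma eigpX (U : 'M[C]_N) L lam (p : {poly C}) e r : isG W U -> (L <= N)%N -> (size p <= e.+1)%N -> (r.+1 * e <= W)%N ->
  eigp U L lam p -> eigp U (L - r * W) (lam ^+ r.+1) (p ^+ r.+1).
Proof.
move=> gU LN sp; elim: r => [|r IH] hr hp; first by rewrite subn0 !expr1.
have h := IH ltac:(lia) hp.
rewrite mulSn addnC subnDA [lam ^+ _]exprS [p ^+ _]exprS.
apply: (@eigpM _ _ _ _ _ _ e (r.+1 * e)) => //; first by apply: leq_trans LN; apply: leq_subr.
- apply: leq_trans (size_poly_exp_leq _ _) _; rewrite ltnS mulnC leq_mul2l; lia.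
by apply: eqX_le hp; apply: leq_subr.
Qed.

Lemma eigp_unique (U : 'M[C]_N) L (a : 'I_N) (p q : {poly C}) e : shifted 0 U -> (W < L <= N)%N -> (a + e = W)%N ->
  (forall b : 'I_N, (a < b)%N -> U b b != U a a) ->
  size p = e.+1 -> size q = e.+1 -> p \is monic -> q \is monic ->
  eigp U L (U a a) p -> eigp U L (U a a) q -> p = q.
Proof.
move=> tU /andP[WL LN] ae hU sp sq mp mq hp hq.
have eW : (e <= W)%N by lia.
apply: (@vecp_inj _ W L) => //; try by rewrite ?sp ?sq; lia.
have : eqX L (vecp W p - vecp W q) 0.
  apply: (@eigen_lowest _ _ U _ (U a a) a.+1) => //.
  - move=> b hb; rewrite coefB coef0; case: (ltnP b a) => ba.
      by rewrite !(@vecp_low _ W _ e) ?sp ?sq ?subrr //; lia.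
    have -> : b = (W - e)%N by lia.
    by rewrite !vecp_monic // subrr.
  - by rewrite linearB /= scalerBr; apply: eqXB.
  by move=> b /andP[hb _]; apply: hU.
by move=> h i hi; apply/eqP; rewrite -subr_eq0 -coefB h // coef0.
Qed.

Variables (g : {poly C} -> gl C n) (Fs : seq {poly C}) (f0 : {poly C}).
Hypotheses (f0F : f0 \in Fs) (gG : {in Fs, forall f, isG W (glval (g f))}).
Hypothesis gf : {in Fs, forall f, eqX N (act (glval (g f)) 'X^(W - d)) (vecp W f)}.
Hypothesis sF : {in Fs, forall f : {poly C}, size f = d.+1}.
Hypothesis many : (n * n.+1 < size (undup [seq chi (glval (lratio g f0 f)) | f <- Fs]))%N.
Hypothesis comm : {in Fs & Fs, forall f1 f2, {in Fs & Fs, forall f3 f4,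
  shifted k (glval (gcomm (lratio g f1 f2) (lratio g f3 f4)) - 1%:M)}}.

Lemma lratio_isG f f' : f \in Fs -> f' \in Fs -> isG W (glval (lratio g f f')).
Proof. by move=> h h'; apply: isGM; [apply: isGV|]; apply: gG. Qed.

Lemma act_lratio f f' : f \in Fs -> f' \in Fs -> eqX N (act (glval (lratio g f f')) (vecp W f)) (vecp W f').
Proof.
move=> h h'; rewrite -(act_eqN _ (gf h)) -act_comp -glME /lratio mulgA mulgV mul1g; exact: gf.
Qed.

Lemma gcomm_shifted (A B : gl C n) i : isG W (glval A) -> isG W (glval B) ->
  shifted i (glval (gcomm A B) - 1%:M) -> shifted i (glval A *m glval B - glval B *m glval A).
Proof.
move=> [_ tA _ _] [_ tB _ _] h.
have -> : glval A *m glval B - glval B *m glval A = glval B *m glval A *m (glval (gcomm A B) - 1%:M).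
  rewrite mulmxBr mulmx1 -!glME /gcomm; congr (glval _ - _).
  by rewrite !mulgA -(mulgA B) mulgV mulg1 mulgV mul1g.
rewrite -(add0n i); apply: shiftedM => //; exact: (@shiftedM _ _ 0 0).
Qed.

(** In an eigenbasis of one ratio [U] whose multiplier is no root of unity of low order, all ratios
    are diagonal to high order. So each [f] arises from [f0] by rescaling its eigencomponents by
    powers of one number, and these components turn out to be powers of a common polynomial [h]. *)
Lemma multiplicative_structure : exists G h : {poly C}, {in Fs, forall f : {poly C}, exists a : C, f = G \Po (h * a%:P)}.
Proof.
have dW' : (d <= W)%N by apply: leq_trans dW; rewrite leq_pmulr.
have kW' : (W + d * W + d < k)%N by rewrite -mulSn.
have [x xX hx] := not_root_of_unity (undup_uniq _) many.
move: xX; rewrite mem_undup => /mapP [f1 f1F xE].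
set U := glval (lratio g f0 f1) in xE *.
have gU : isG W U := lratio_isG f0F f1F; have [_ tU _ _] := gU.
have U00 : U ord0 ord0 != 0.
  have := isG_diagW W0 Wn gU; apply: contra_eq_neq => ->; rewrite mul0r eq_sym; exact: oner_neq0.
have Udiag (a : 'I_N) : U a a = U ord0 ord0 * x ^+ a by rewrite (isG_diag W0 Wn a gU) xE.
have x0 : x != 0 by rewrite xE (chi_neq0 W0 Wn).
have Uneq (a b : 'I_N) : (a < b)%N -> U b b != U a a.
  move=> ab; rewrite (Udiag b) (Udiag a); apply/negP => /eqP /(mulfI U00).
  rewrite -(subnK (ltnW ab)) exprD -[RHS]mul1r => /(mulIf (expf_neq0 _ x0)) /eqP; apply/negP; apply: hx.
  by rewrite subn_gt0 ab /=; have := ltn_ord b; lia.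
have /choice [z hz] (a : 'I_N) : exists z, [/\ eqX N (act U z) (U a a *: z), eqX a z 0 & z`_a = 1].
  by apply: exists_eigenvector => // b; apply: Uneq.
have [||th [th1 th2]] := @triangular_expansion _ n z (vecp W f0) (W - d).
- by move=> a; have [_ h1 h2] := hz a.
- by apply: vecp_low; rewrite sF.
(* The vectors [vecp W f] start at order [W - d], and the ratios commute to order [k]. *)
pose L := (W - d + k)%N; have LN : (L <= N)%N by rewrite /L; lia.
have expand f : f \in Fs -> eqX L (vecp W f) (\sum_a (th a * glval (lratio g f0 f) a a) *: z a).
  move=> fF; set V := glval (lratio g f0 f); have gV : isG W V := lratio_isG f0F fF; have [_ tV _ _] := gV.
  apply: eqX_trans (eqX_le LN (eqX_sym (act_lratio f0F fF))) _.
  rewrite (act_eqN _ th2) linear_sum /= => b hb; rewrite !coef_sum; apply: eq_bigr => a _.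
  rewrite linearZ /= -scalerA !coefZ; case: (ltnP a (W - d)) => ad; first by rewrite th1 // !mul0r.
  congr (_ * _); rewrite -coefZ.
  have [h1 h2 h3] := hz a.
  (* As [V] and [U] commute to order [k], [y] is to that order an eigenvector of [U] for [U a a].
     Its coefficient at [a] vanishes and no later diagonal entry equals [U a a], so [y] is zero to
     that order. *)
  pose y := act V (z a) - V a a *: z a.
  have : eqX (minn (a + k) N) y 0.
    apply: (@eigen_lowest _ _ U _ (U a a) a.+1) => //; first exact: geq_minr.
    - move=> c hc; rewrite coefB coefZ coef0; have cN : (c < N)%N by have := ltn_ord a; lia.
      rewrite (coef_act V (z a) (Ordinal cN)) (bigD1 (Ordinal cN)) //= big1 ?addr0; last first.
        move=> a' a'c; case: (ltnP a' c) => h; first by rewrite h2 ?coef0 ?mul0r //; lia.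
        by rewrite tV ?mulr0 // addn0 ltn_neqAle h andbT eq_sym.
      case: (ltnP c a) => ca; first by rewrite h2 // coef0 mul0r mulr0 subrr.
      have e : c = a by lia.
      by rewrite {1}e h3 (_ : Ordinal cN = a) ?e ?h3; [rewrite mul1r mulr1 subrr|exact: val_inj].
    - rewrite /y linearB linearZ /= scalerBr scalerA [_ * V a a]mulrC -scalerA.
      apply: eqXB; last by apply: eqXZ; apply: eqX_le h1; apply: geq_minr.
      rewrite -act_comp.
      have hsh := gcomm_shifted gV gU (comm f0F fF f0F f1F).
      have := act_eqX (leq_trans (ltnW (ltn_ord a)) (leqnn _)) hsh h2.
      rewrite linear0 => h4.
      have -> : V *m U = U *m V + (V *m U - U *m V) by rewrite addrC subrK.
      have actD (A B : 'M[C]_N) p : act (A + B) p = act A p + act B p.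
        by rewrite /act mulmxDr linearD.
      rewrite actD -[X in eqX _ _ X]addr0; apply: eqXD h4.
      rewrite act_comp -linearZ /=; apply: eqX_le (geq_minr _ _) _.
      by rewrite (act_eqN _ h1).
    by move=> c /andP[hc _]; apply: Uneq.
  move=> /(_ b); rewrite coefB coef0 => hb'; apply/eqP; rewrite -subr_eq0 hb' //.
  by rewrite /L in hb LN; lia.
(* A coefficient between [W] and [L] vanishes in every [vecp W f]. Up to a nonzero factor it is a
   polynomial of degree at most [n] in the multiplier of the ratio, which takes more than [n]
   values, so each of its terms is zero: the eigenvectors that occur are polynomials in [x]. *)
have supp (a b : 'I_N) : (W < b < L)%N -> th a * (z a)`_b = 0.
  move=> /andP[Wb bL]; pose P := \poly_(a < N) (th (inord a) * (z (inord a))`_b).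
  have P0 : P = 0.
    apply: (@roots_geq_poly_eq0 _ _ (undup [seq chi (glval (lratio g f0 f)) | f <- Fs])); last 2 first.
    - exact: undup_uniq.
    - apply: leq_trans (size_poly _ _) _; apply: leq_trans many; rewrite ltnS.
      by rewrite -[X in (X <= _)%N]muln1 leq_mul //; lia.
    apply/allP => t; rewrite mem_undup => /mapP [f fF ->].
    have V00 : glval (lratio g f0 f) ord0 ord0 != 0.
      have := isG_diagW W0 Wn (lratio_isG f0F fF); apply: contra_eq_neq => ->; rewrite mul0r eq_sym; exact: oner_neq0.
    rewrite /root -(inj_eq (mulfI V00)) mulr0 horner_poly mulr_sumr.
    have := expand f fF b bL; rewrite coef_vecp leqNgt Wb /= coef_sum => e; rewrite [X in _ == X]e; apply/eqP.
    apply: eq_bigr => a' _; rewrite coefZ (isG_diag W0 Wn a' (lratio_isG f0F fF)) inord_val.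
    by ring.
  by have := coef0 C a; rewrite -P0 coef_poly ltn_ord inord_val.
pose ix e : 'I_N := inord (W - e).
have ixE e : ix e = (W - e)%N :> nat by rewrite inordK //; lia.
pose P e := vecp W (z (ix e)).
pose E := [seq e <- iota 0 d.+1 | th (ix e) != 0].
have Ed e : e \in E -> (e <= d)%N by rewrite mem_filter mem_iota => /andP[_ /=]; rewrite ltnS.
have sP e : (e <= d)%N -> (size (P e) <= e.+1)%N.
  move=> ed; apply/leq_sizeP => i hi; rewrite coef_vecp; case: leqP => // iW.
  by have [_ h2 _] := hz (ix e); rewrite h2 ?coef0 // ixE; lia.
have Pe e : (e <= d)%N -> (P e)`_e = 1.
  move=> ed; rewrite coef_vecp (leq_trans ed dW'); have [_ _ h3] := hz (ix e).
  by rewrite -ixE.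
have sPe e : (e <= d)%N -> size (P e) = e.+1.
  move=> ed; apply/eqP; rewrite eqn_leq sP //= ltnNge; apply/negP => /leq_sizeP /(_ e (leqnn _)).
  by rewrite Pe // => /eqP; rewrite oner_eq0.
have mP e : (e <= d)%N -> P e \is monic by move=> ed; rewrite monicE /lead_coef sPe //= Pe.
have eP e : e \in E -> eigp U L (U (ix e) (ix e)) (P e).
  move=> eE; have ed := Ed e eE; have [h1 _ _] := hz (ix e).
  have hPz : eqX L (vecp W (P e)) (z (ix e)).
    move=> i iL; rewrite !coef_vecp leq_subr; case: leqP => iW; first by rewrite subKn.
    have iN : (i < N)%N := leq_trans iL LN.
    have := supp (ix e) (Ordinal iN); rewrite /= iW iL => /(_ isT) /eqP.
    by rewrite mulf_eq0; move: eE; rewrite mem_filter => /andP[/negbTE -> _] /eqP.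
  have := act_eqX LN tU hPz; rewrite addn0 (minn_idPl LN) => h2.
  apply: eqX_trans h2 _; apply: eqX_trans (eqX_le LN h1) _.
  by apply: eqXZ; apply: eqX_sym.
have thd : th (ix d) != 0.
  have := th2 (W - d)%N ltac:(lia).
  rewrite coef_sum (bigD1 (ix d)) //= big1 ?addr0; last first.
    move=> a ad; rewrite coefZ; case: (ltnP a (W - d)) => h; first by rewrite th1 // mul0r.
    have [_ h2 _] := hz a; rewrite h2 ?coef0 ?mulr0 // ltn_neqAle h andbT.
    by apply: contra ad => /eqP e; apply/eqP/val_inj; rewrite /= -e; symmetry; apply: ixE.
  rewrite coefZ; have [_ _] := hz (ix d); rewrite ixE => -> ; rewrite mulr1 => <-.
  rewrite coef_vecp leq_subr subKn // -[X in _`_X]/(d.+1.-1) -(sF f0F) -/(lead_coef _) lead_coef_eq0 -size_poly_eq0 sF //.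
have dE : d \in E by rewrite mem_filter thd mem_iota /= ltnSn.
have U0W : U ord0 ord0 * x ^+ W = 1 by rewrite xE (isG_diagW W0 Wn).
have Uix e : (e <= W)%N -> U (ix e) (ix e) = x^-1 ^+ e.
  move=> eW; rewrite Udiag ixE; apply: (mulIf (expf_neq0 e x0)).
  by rewrite -mulrA -exprD subnK // U0W -exprMn mulVf // expr1n.
(* [P e ^+ d] and [P d ^+ e] are monic eigenpolynomials of the same degree for the same eigenvalue,
   hence equal. The precision left after at most [d] multiplications still exceeds [W]. *)
have [m [h [m0 hPh]]] : exists m (h : {poly C}), (0 < m)%N /\ {in E, forall e, (m %| e)%N /\ P e = h ^+ (e %/ m)}.
  apply: (common_base d0 dE) => e eE; have ed := Ed e eE; split; first exact: mP.
  case: e eE ed => [|e] eE ed.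
    have := sPe 0%N isT; move/eqP; rewrite size_poly_eq1 /eqp => _.
    have -> : P 0%N = 1 by have := sPe 0%N isT; move/eqP/size_poly1P => [c _ hc]; rewrite hc; have := Pe 0%N isT; rewrite hc coefC /= => ->.
    by rewrite expr0 expr1n.
  have edW : (e.+1 * d <= W)%N by apply: leq_trans dW; rewrite leq_mul2r ed orbT.
  have szX (p : {poly C}) (a b : nat) : size p = a.+1 -> p \is monic -> size (p ^+ b) = (a * b).+1.
    by move=> sp mp; rewrite -(prednK (n := size (p ^+ b))) ?size_exp ?sp // size_poly_gt0 expf_neq0 // monic_neq0.
  have k1 : ((W < L - d * W) && (L - d * W <= N))%N.
    apply/andP; split; first (rewrite /L; clear -kW' dW'; lia).
    by apply: leq_trans LN; apply: leq_subr.
  apply: (@eigp_unique U (L - d * W) (ix (e.+1 * d)) _ _ (e.+1 * d)) => //.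
  - by rewrite ixE subnK.
  - by move=> b; apply: Uneq.
  - by apply: szX; [exact: sPe|exact: mP].
  - by rewrite mulnC; apply: szX; [exact: sPe|exact: mP].
  - by apply: monic_exp; apply: mP.
  - by apply: monic_exp; apply: mP.
  - rewrite Uix // exprM -Uix; last by apply: leq_trans dW'.
    rewrite -[X in _ ^+ X](prednK d0) -[X in (P _) ^+ X](prednK d0).
    apply: (eqX_le _ (@eigpX U L _ _ e.+1 d.-1 gU LN (sP _ ed) _ (eP _ eE))); last by rewrite prednK // mulnC.
    by apply: leq_sub2l; rewrite leq_mul2r leq_pred orbT.
  - rewrite (_ : U _ _ = U (ix d) (ix d) ^+ e.+1); last by rewrite (Uix d) // (Uix _ edW) -exprM mulnC.
    apply: (eqX_le _ (@eigpX U L _ _ d e gU LN (sP _ (leqnn d)) edW (eP _ dE))).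
    by apply: leq_sub2l; rewrite leq_mul2r (ltnW ed) orbT.
exists (\sum_(e <- E) th (ix e) *: 'X^(e %/ m)), h => f fF.
set V := glval (lratio g f0 f); have gV : isG W V := lratio_isG f0F fF.
have V0W := isG_diagW W0 Wn gV; have V0 := chi_neq0 W0 Wn gV.
have Vix e : (e <= W)%N -> V (ix e) (ix e) = (chi V)^-1 ^+ e.
  move=> eW; rewrite (isG_diag W0 Wn _ gV) ixE; apply: (mulIf (expf_neq0 e V0)).
  by rewrite -mulrA -exprD subnK // V0W -exprMn mulVf // expr1n.
(* [V] scales [P e] by [(chi V)^-1 ^+ e], which is the effect on [h ^+ (e %/ m)] of scaling [h] by
   this number. *)
exists ((chi V)^-1 ^+ m).
have WL : (W < L)%N by rewrite /L; clear -kW' dW'; lia.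
rewrite -(@vecpK C W f) ?sF // (vecp_eqX (eqX_le WL (expand f fF))) linear_sum /=.
rewrite raddf_sum /= big_filter -(subn0 d.+1) -/(index_iota 0 d.+1) big_mkord.
transitivity (\sum_(e < d.+1) (th (ix e) * V (ix e) (ix e)) *: P e).
  rewrite (bigID (fun a : 'I_N => (W - d <= a <= W)%N)) /= [X in _ + X]big1 ?addr0; last first.
    move=> a; rewrite negb_and -!ltnNge => /orP[ad|aW].
      by rewrite th1 // mul0r scale0r linear0.
    rewrite (_ : vecp W (_ *: z a) = 0) //; have [_ h2 _] := hz a.
    apply/polyP => i; rewrite coef_vecp coef0; case: leqP => // iW.
    by rewrite coefZ h2 ?coef0 ?mulr0 //; clear -iW aW; lia.
  rewrite (reindex_onto (fun e : 'I_d.+1 => ix e) (fun a : 'I_N => inord (W - a))) /=; last first.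
    by move=> a /andP[h1 h2]; apply: ord_inj; rewrite ixE inordK ?subKn // ltnS leq_subLR; clear -h1; lia.
  apply: eq_big => [e|e _]; last exact: linearZ.
  have := ltn_ord e => he; rewrite ixE leq_subr andbT leq_sub2l //=.
  by apply/eqP/ord_inj; rewrite inordK subKn //; clear -he dW'; lia.
rewrite [RHS]big_mkcond; apply: eq_bigr => e _; have := ltn_ord e; rewrite ltnS => ed.
case: eqP => [->|/eqP the] /=; first by rewrite mul0r scale0r.
have eE : nat_of_ord e \in E by rewrite mem_filter the mem_iota.
have [me ->] := hPh e eE.
rewrite comp_polyZ comp_Xn_poly exprMn -scalerA Vix; last exact: leq_trans dW'.
by rewrite -polyC_exp -exprM [(m * _)%N]mulnC divnK // mulrC mul_polyC.
Qed.
End Multiplicative.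

(** * Commuting families of unipotent substitutions *)

Section BinomialPoly.
Variable C : numClosedFieldType.

(** The binomial coefficient ['X] choose [l], as a polynomial in its upper argument. *)
Definition binp l : {poly C} := (l`!%:R)^-1 *: \prod_(i < l) ('X - (i%:R)%:P).

Lemma binp0 : binp 0 = 1.
Proof. by rewrite /binp big_ord0 fact0 invr1 scale1r. Qed.

Lemma binp1 s : (binp 1).[s] = s.
Proof. by rewrite /binp big_ord1 hornerZ hornerXsubC subr0 invr1 mul1r. Qed.

Lemma binp_nat l m : (binp l).[m%:R] = 'C(m, l)%:R.
Proof.
rewrite /binp hornerZ horner_prod.
have -> : \prod_(i < l) ('X - (i%:R)%:P : {poly C}).[m%:R] = (m ^_ l)%:R.
  rewrite ffact_prod natr_prod; case: (ltnP m l) => lm.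
    rewrite (bigD1 (Ordinal lm)) //= hornerXsubC subrr mul0r.
    by rewrite (bigD1 (Ordinal lm)) //= subnn mul0r.
  by apply: eq_bigr => i _; rewrite hornerXsubC natrB // (leq_trans (ltnW (ltn_ord i))).
by rewrite -bin_ffact natrM mulrC mulfK // pnatr_eq0 -lt0n fact_gt0.
Qed.

Lemma poly_nat_zero (P : {poly C}) : (forall m : nat, P.[m%:R] = 0) -> P = 0.
Proof.
move=> h; apply: (@roots_geq_poly_eq0 _ P [seq m%:R | m <- iota 0 (size P)]).
- by apply/allP => _ /mapP [m _ ->]; apply/eqP.
- by rewrite map_inj_uniq ?iota_uniq // => a b /eqP; rewrite eqr_nat => /eqP.
by rewrite size_map size_iota.
Qed.

Lemma binp_free (c : nat -> C) N : \sum_(l < N) c l *: binp l = 0 -> forall l, (l < N)%N -> c l = 0.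
Proof.
move=> h; elim/ltn_ind => l IH lN.
have := congr1 (fun P : {poly C} => P.[l%:R]) h; rewrite horner0 horner_sum (bigD1 (Ordinal lN)) //= big1.
  by rewrite addr0 hornerZ binp_nat binn mulr1.
move=> i il; rewrite hornerZ; case: (ltngtP i l) => h'.
- by rewrite IH // ?mul0r // (ltn_trans h').
- by rewrite binp_nat bin_small // mulr0.
by case/eqP: il; apply: val_inj.
Qed.

Lemma size_binp l : (size (binp l) <= l.+1)%N.
Proof.
apply: leq_trans (size_scale_leq _ _) _.
by rewrite -[\prod_(i < l) _]big_enum size_prod_XsubC size_enum_ord.
Qed.
End BinomialPoly.

Lemma commmx_invmx (C : fieldType) (n : nat) (A P : 'M[C]_n) : P \in unitmx ->
  A *m P = P *m A -> A *m invmx P = invmx P *m A.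
Proof.
move=> uP h; transitivity (invmx P *m P *m A *m invmx P); first by rewrite mulVmx // mul1mx.
by rewrite -(mulmxA _ P) -h -!mulmxA mulmxV // mulmx1.
Qed.

Section BinomialPowers.
Variables (C : numClosedFieldType) (n W j : nat) (U : 'M[C]_n.+1).
Hypothesis j0 : (0 < j)%N.
Local Notation N := n.+1.
Hypotheses (gU : isG W U) (sU : shifted j (U - 1%:M)).

Let A : 'M[C]_N := U - 1%:M.

(* The one-parameter group of powers of the unipotent [U], with complex exponent. *)
Definition upow (s : C) : 'M[C]_N := \sum_(l < N) (binp C l).[s] *: A ^+ l.

Lemma shifted_pow l : shifted (l * j) (A ^+ l).
Proof.
elim: l => [|l IH]; first by rewrite mul0n; apply: shifted1.
by rewrite exprS mulSn; apply: shiftedM.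
Qed.

Lemma pow_big l : (N <= l)%N -> A ^+ l = 0.
Proof.
move=> h; apply: shifted_big; apply: shiftedW (@shifted_pow l).
by apply: leq_trans h _; rewrite leq_pmulr.
Qed.

Lemma upow_nat m : upow m%:R = U ^+ m.
Proof.
have -> : U = A + 1 by rewrite /A subrK.
rewrite exprDn_comm ?commr1 //; last exact: commr1.
rewrite /upow.
transitivity (\sum_(0 <= l < maxn N m.+1) (binp C l).[m%:R] *: A ^+ l).
  rewrite (big_cat_nat (n := N)) //= ?leq_maxl // [X in _ + X]big_nat_cond [X in _ + X]big1 ?addr0 ?big_mkord //.
  by move=> l /andP[/andP[h _] _]; rewrite pow_big // scaler0.
rewrite (big_cat_nat (n := m.+1)) //= ?leq_maxr // [X in _ + X]big_nat_cond [X in _ + X]big1 ?addr0 ?big_mkord; last first.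
  by move=> l /andP[/andP[h _] _]; rewrite binp_nat bin_small // scale0r.
rewrite (reindex_inj rev_ord_inj) /=; apply: eq_bigr => i _.
by rewrite binp_nat expr1n mulr1 scaler_nat subSS bin_sub ?subKn // -ltnS ltn_ord.
Qed.

(** One coefficient of [act (upow s) p] as a polynomial in [s]. For natural [s], [upow U s] is an
    honest power of [U]; a polynomial identity holding there holds for every [s]. *)
Definition pact (p : {poly C}) b : {poly C} := \sum_(l < N) (act (A ^+ l) p)`_b *: binp C l.

Lemma act_sum_mx (I : Type) (r : seq I) (F : I -> 'M[C]_N) p : act (\sum_(i <- r) F i) p = \sum_(i <- r) act (F i) p.
Proof.
elim: r => [|i r IH]; first by rewrite !big_nil /act mulmx0 linear0.
by rewrite !big_cons -IH /act mulmxDr linearD.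
Qed.

Lemma act_scale_mx c (B : 'M[C]_N) p : act (c *: B) p = c *: act B p.
Proof. by rewrite /act -scalemxAr linearZ. Qed.

Lemma pactE p b s : (pact p b).[s] = (act (upow s) p)`_b.
Proof.
rewrite /pact /upow horner_sum act_sum_mx coef_sum; apply: eq_bigr => l _.
by rewrite act_scale_mx hornerZ coefZ mulrC.
Qed.

Lemma upow_tri s : shifted 0 (upow s) /\ forall a, upow s a a = 1.
Proof.
have h : shifted 1 (upow s - 1%:M).
  rewrite /upow big_ord_recl /= binp0 hornerC scale1r expr0 addrC addrA addNr add0r.
  move=> a b hb; rewrite summxE big1 // => l _; rewrite mxE.
  have h : (1 <= l.+1 * j)%N by rewrite muln_gt0 j0.
  by rewrite (shiftedW h (@shifted_pow l.+1)) ?mulr0.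
split=> [a b hb|a].
  have := h a b ltac:(lia); rewrite !mxE (_ : a == b = false) ?subr0 //.
  by apply/eqP => e; rewrite e addn0 ltnn in hb.
by have := h a a ltac:(lia); rewrite !mxE eqxx => /eqP; rewrite subr_eq0 => /eqP.
Qed.

Lemma isG_expr m : isG W (U ^+ m).
Proof. by elim: m => [|m IH]; [apply: isG1 | rewrite exprS; apply: isGM]. Qed.

Lemma isG_upow s : isG W (upow s).
Proof.
have [tU dU] := upow_tri s; split=> //.
- rewrite unitmxE -det_tr det_trig; last first.
    by apply/is_trig_mxP => a b ab; rewrite mxE tU // addn0.
  by rewrite big1 ?unitr1 // => a _; rewrite mxE dU.
- move=> b hb; rewrite -pactE.
  have -> : pact 'X^W b = (('X^W)`_b)%:P; last by rewrite hornerC.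
  apply/eqP; rewrite -subr_eq0; apply/eqP/poly_nat_zero => m.
  rewrite hornerD hornerN hornerC pactE upow_nat.
  by have [_ _ h _] := isG_expr m; rewrite h // subrr.
move=> p q b hb.
pose P := \sum_(i < b.+1) pact p i * pact q (b - i) - \sum_(i < b.+1) pact 1 i * pact (p * q) (b - i).
have PE t : P.[t] = (act (upow t) p * act (upow t) q)`_b - (act (upow t) 1 * act (upow t) (p * q))`_b.
  rewrite /P hornerD hornerN !horner_sum !coefM.
  by congr (_ - _); apply: eq_bigr => i _; rewrite hornerM !pactE.
have : P = 0.
  apply: poly_nat_zero => m; rewrite PE !upow_nat.
  by have [_ _ _ h] := isG_expr m; rewrite h // subrr.
by move/(congr1 (fun Q : {poly C} => Q.[s])); rewrite PE horner0 => /eqP; rewrite subr_eq0 => /eqP.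
Qed.

Lemma upow_comm s : upow s *m U = U *m upow s.
Proof.
rewrite /upow mulmx_suml mulmx_sumr; apply: eq_bigr => l _.
rewrite -scalemxAl -scalemxAr; congr (_ *: _).
have -> : U = A + 1 by rewrite /A subrK.
by apply: commrD; [apply/commr_sym/commrX|apply: commr1].
Qed.

Lemma usym_upow c s : usym W j c U -> usym W j (s * c) (upow s).
Proof.
move=> [_ h].
have E : exists2 B, shifted j.+1 B & upow s - 1%:M = s *: A + B.
  rewrite /upow; case: {+}n A shifted_pow pow_big => [|n'] A' sp pb.
    exists 0; first by move=> a b _; rewrite mxE.
    rewrite big_ord1 /= binp0 hornerC scale1r expr0 subrr addr0.
    by have := pb 1%N isT; rewrite expr1 => ->; rewrite scaler0.
  rewrite 2!big_ord_recl /= binp0 hornerC scale1r expr0 binp1 expr1.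
  rewrite addrC addrA addNr add0r; eexists; last by [].
  move=> a b hb; rewrite summxE big1 // => l _; rewrite mxE.
  have h2 : (j.+1 <= l.+2 * j)%N by rewrite !mulSn; lia.
  by rewrite (shiftedW h2 (sp l.+2)) ?mulr0.
case: E => B sB E; split=> [|a b hb]; rewrite E.
  by apply: shiftedD; [move=> a b hb; rewrite mxE (sU hb) mulr0|apply: shiftedW sB].
have B0 : B a b = 0 by apply: sB; rewrite hb addnS.
by rewrite mxE B0 addr0 mxE mulrCA -(h a b hb).
Qed.
End BinomialPowers.

(** * Polynomial orbits of a one-parameter group *)

Section Additive.
Variables (C : numClosedFieldType) (n W d k j : nat).
Hypotheses (W0 : (0 < W)%N) (Wn : (W < n)%N) (d0 : (0 < d)%N) (dW : (d <= W)%N).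
Hypotheses (j0 : (0 < j)%N) (jd : (j <= d)%N).
Hypotheses (kn : (W + k <= n.+1)%N) (kW : (d * W + 3 * d < k)%N).
Local Notation N := n.+1.

Section OneParameter.
Variables (U : 'M[C]_N) (c : C).
Hypotheses (gU : isG W U) (uU : usym W j c U) (c0 : c != 0).
Let A : 'M[C]_N := U - 1%:M.
Let sU : shifted j A. Proof. by case: uU. Qed.
Local Notation up := (upow U).

(** Coefficient [b > W] belongs to the negative power [x^(W - b)]: the whole orbit of [P] consists
    of polynomials in [x], up to order [L]. *)
Definition good L (P : {poly C}) := forall s b, (W < b < L)%N -> (act (up s) (vecp W P))`_b = 0.

Lemma goodB L (P Q : {poly C}) : good L P -> good L Q -> good L (P - Q).
Proof. by move=> hP hQ s b hb; rewrite !linearB /= coefB hP ?hQ ?subrr. Qed.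

Lemma goodZ L a (P : {poly C}) : good L P -> good L (a *: P).
Proof. by move=> hP s b hb; rewrite !linearZ /= coefZ hP ?mulr0. Qed.

Lemma good_le L L' (P : {poly C}) : (L' <= L)%N -> good L P -> good L' P.
Proof. by move=> LL hP s b /andP[h1 h2]; apply: hP; rewrite h1 (leq_trans h2). Qed.

Lemma good_pow L (P : {poly C}) l b : good L P -> (W < b < L)%N -> (act (A ^+ l) (vecp W P))`_b = 0.
Proof.
move=> hP hb; case: (ltnP l N) => lN; last by rewrite (pow_big j0 sU lN) /act mulmx0 linear0 coef0.
apply: (@binp_free C (fun l => (act (A ^+ l) (vecp W P))`_b) N _ l lN).
by apply: poly_nat_zero => m; rewrite -[LHS]/((pact U (vecp W P) b).[_]) pactE hP.
Qed.

(** A difference operator: on a good polynomial of positive degree it lowers the degree by exactly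
    [j], see [size_delta]. *)
Definition delta (P : {poly C}) := vecp W (act A (vecp W P)).

Lemma vecp_delta L (P : {poly C}) : good L P -> eqX L (vecp W (delta P)) (act A (vecp W P)).
Proof.
move=> hP b bL; rewrite !coef_vecp leq_subr; case: leqP => bW; first by rewrite subKn.
by have := @good_pow L P 1 b hP; rewrite bW bL expr1 => ->.
Qed.

Lemma good_delta L (P : {poly C}) : (L <= N)%N -> good L P -> good L (delta P).
Proof.
move=> LN hP s b /andP[Wb bL].
have [tu _] := upow_tri j0 sU s.
have := act_eqX LN tu (vecp_delta hP); rewrite addn0 (minn_idPl LN) => -> //.
rewrite -act_comp /upow mulmx_sumr act_sum_mx coef_sum big1 // => l _.
rewrite -scalemxAr act_scale_mx coefZ -[A *m _]/(A * A ^+ l) -exprS.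
by rewrite (good_pow _ hP) ?mulr0 // Wb bL.
Qed.

Lemma act_A_lead (P : {poly C}) e : size P = e.+1 -> (0 < e <= W)%N -> (W - e + j <= n)%N ->
  (act A (vecp W P))`_(W - e + j) != 0 /\ eqX (W - e + j) (act A (vecp W P)) 0.
Proof.
move=> sP /andP[e0 eW] hn.
have low : eqX (W - e) (vecp W P) 0 by apply: vecp_low; rewrite sP.
split; last first.
  have := act_eqX (_ : (W - e <= N)%N) sU low; rewrite linear0 => h.
  by apply: eqX_le (h _); rewrite ?leq_min; lia.
have aN : (W - e < N)%N by lia.
have bN : (W - e + j < N)%N by lia.
rewrite (coef_act A _ (Ordinal bN)) (bigD1 (Ordinal aN)) //= big1 ?addr0.
  have [_ h] := uU; rewrite (h (Ordinal aN) (Ordinal bN)) //= coef_vecp leq_subr subKn //.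
  rewrite mulf_neq0 // ?mulf_neq0 //; first by rewrite -[X in _`_X]/(e.+1.-1) -sP -/(lead_coef P) lead_coef_eq0 -size_poly_eq0 sP.
  by rewrite subr_eq0 eqr_nat; lia.
move=> a ha; case: (ltnP a (W - e)) => h; first by rewrite low // coef0 mul0r.
rewrite sU ?mulr0 //= ltn_add2r ltn_neqAle h andbT.
by apply: contra ha => /eqP E; apply/eqP/val_inj.
Qed.

Lemma size_delta L (P : {poly C}) e : (W + j < L <= N)%N -> good L P -> size P = e.+1 -> (0 < e <= W)%N ->
  (j <= e)%N /\ size (delta P) = (e - j).+1.
Proof.
move=> /andP[hL LN] hP sP he; have := he => /andP[e0 eW].
have [|h1 h2] := act_A_lead sP he; first by lia.
have je : (j <= e)%N.
  rewrite leqNgt; apply/negP => ej; case/negP: h1; apply/eqP.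
  by have := @good_pow L P 1 (W - e + j) hP; rewrite expr1; apply; lia.
split=> //; apply/eqP; rewrite eqn_leq; apply/andP; split.
  apply/leq_sizeP => i hi; rewrite coef_vecp; case: leqP => // iW.
  by rewrite h2 ?coef0 //; lia.
rewrite ltnNge; apply/negP => /leq_sizeP /(_ (e - j)%N (leqnn _)) /eqP; apply/negP.
rewrite coef_vecp (_ : (e - j <= W)%N); last by lia.
by rewrite (_ : W - (e - j) = W - e + j)%N //; lia.
Qed.

(** Iterating [delta] lowers the degree by [j] until a constant is reached, so [j] divides [e]. The
    last polynomial before that constant, normalised, is [h], on which the group acts by
    translations. *)
Lemma primitive_exists L (P : {poly C}) e : (W + j < L <= N)%N -> good L P -> size P = e.+1 -> (0 < e <= W)%N ->
  (j %| e)%N /\ exists h, [/\ good L h, size h = j.+1 & delta h = 1].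
Proof.
move=> hL; elim/ltn_ind: e P => e IH P hP sP he.
have [je sD] := size_delta hL hP sP he; have LN : (L <= N)%N by case/andP: hL.
have := he => /andP[e0 eW].
case: (ltngtP j e) => je'; last first.
- split; first by rewrite je'.
  have [a a0 hD] : exists2 a, a != 0 & delta P = a%:P.
    by move: sD; rewrite je' subnn => /eqP/size_poly1P [a a0 ->]; exists a.
  exists (a^-1 *: P); split; first exact: goodZ.
    by rewrite size_scale ?invr_eq0 // sP je'.
  by rewrite /delta !linearZ /= -/(delta P) hD -mul_polyC -polyCM mulVf.
- by rewrite ltnNge je in je'.
have [||h1 h2] := IH (e - j)%N _ (delta P) (good_delta LN hP) sD; [lia|lia|].
by split=> //; rewrite -(subnK je) dvdn_addl.
Qed.

Section Primitive.
Variables (L : nat) (h : {poly C}).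
Hypotheses (hL : (W + j < L <= N)%N) (gh : good L h) (sh : size h = j.+1) (dh : delta h = 1).

Lemma vecp1 : vecp W (1 : {poly C}) = 'X^W.
Proof. by rewrite -[1]/('X^0) vecpXn // subn0. Qed.

Lemma act_upow_h s : eqX L (act (up s) (vecp W h)) (vecp W (h + s%:P)).
Proof.
have LN : (L <= N)%N by case/andP: hL.
have [_ tU XU _] := gU.
have hV : vecp W (h + s%:P) = vecp W h + s *: 'X^W.
  by rewrite linearD /= -[s%:P]mulr1 mul_polyC linearZ /= vecp1.
move=> b bL; rewrite hV -pactE.
have step m : eqX L (act (U ^+ m) (vecp W h)) (vecp W h + m%:R *: 'X^W).
  elim: m => [|m IH]; first by rewrite scale0r addr0 expr0; apply: eqX_le (act1 _).
  rewrite exprSr act_comp; have := act_eqX LN tU IH; rewrite addn0 (minn_idPl LN) => h1.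
  apply: eqX_trans h1 _; rewrite linearD linearZ /= -natr1 scalerDl scale1r addrA addrAC.
  apply: eqXD; last by apply: eqXZ; apply: eqX_le XU.
  have -> : act U (vecp W h) = act A (vecp W h) + act (1%:M : 'M[C]_N) (vecp W h).
    by rewrite /act -linearD -mulmxDr subrK.
  rewrite [X in eqX _ X _]addrC; apply: eqXD; first exact: eqX_le LN (act1 _).
  by apply: eqX_trans (eqX_sym (vecp_delta gh)) _; rewrite dh vecp1.
have : pact U (vecp W h) b - (((vecp W h)`_b)%:P + ('X^W)`_b *: 'X) = 0.
  apply: poly_nat_zero => m; rewrite hornerD hornerN pactE (upow_nat j0 sU) step //.
  by rewrite hornerD hornerC hornerZ hornerX coefD coefZ [_ * m%:R]mulrC subrr.
move/(congr1 (fun Q : {poly C} => Q.[s])); rewrite hornerD hornerN horner0 => /eqP; rewrite subr_eq0 => /eqP ->.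
by rewrite hornerD hornerC hornerZ hornerX coefD coefZ [_ * s]mulrC.
Qed.

Lemma size_shift s : size (h + s%:P) = j.+1.
Proof. by rewrite size_polyDl // sh size_polyC; case: (s != 0). Qed.

Lemma act_upow_hX r s : (r.+1 * j <= W)%N ->
  eqX (L - r * W) (act (up s) (vecp W (h ^+ r.+1))) (vecp W ((h + s%:P) ^+ r.+1)).
Proof.
have LN : (L <= N)%N by case/andP: hL.
have gu := isG_upow j0 gU sU s.
have szX r' (p : {poly C}) : size p = j.+1 -> (size (p ^+ r') <= (r' * j).+1)%N.
  by move=> sp; apply: leq_trans (size_poly_exp_leq _ _) _; rewrite sp mulnC.
elim: r => [|r IH] hr; first by rewrite subn0 !expr1; apply: act_upow_h.
case: (ltnP (L - r * W) W) => LW; first by rewrite mulSn addnC subnDA (eqP (ltnW LW)).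
apply/(eqX_MXn _ W); rewrite mulSn [(W + _)%N]addnC subnDA subnK //.
have jr : (j + r.+1 * j <= W)%N by rewrite -mulSn.
have := act_vecpM gu (leq_trans (eq_leq sh) (leqnn _)) (szX r.+1 h sh) jr.
rewrite -exprS => /(eqX_le (leq_trans (leq_subr (r * W) L) LN)) h1.
rewrite mulrC; apply: eqX_trans (eqX_sym h1) _.
have h2 := IH ltac:(lia).
apply: eqX_trans (eqXM (eqX_le (leq_subr _ _) (act_upow_h s)) h2) _.
rewrite (vecpM (leq_trans (eq_leq (size_shift s)) (leqnn _)) (szX r.+1 _ (size_shift s)) jr) -exprS mulrC.
by [].
Qed.

(** The degree of a good polynomial is a multiple of [j], the degree of [h], so a multiple of a
    power of [h] cancels its leading term. Powers of [h] being good, the difference is again good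
    and has smaller degree. *)
Lemma good_decompose L' (P : {poly C}) e : (W + j < L')%N -> (L' + d * W <= L)%N -> (e <= d)%N -> (size P <= e.+1)%N -> good L' P ->
  exists G : {poly C}, P = G \Po h /\ forall s, eqX L' (act (up s) (vecp W P)) (vecp W (G \Po (h + s%:P))).
Proof.
move=> hL' hLL; have LN : (L <= N)%N by case/andP: hL.
have L'N : (L' <= N)%N by lia.
elim/ltn_ind: e P => e IH P ed sP gP.
case: (ltngtP (size P) e.+1) => sP'; last first.
- case: (posnP e) => [e0|e0].
    have -> : P = (P`_0)%:P by apply: size1_polyC; rewrite sP' e0.
    exists (P`_0)%:P; rewrite comp_polyC; split=> // s; rewrite comp_polyC.
    rewrite -[(P`_0)%:P]mulr1 mul_polyC !linearZ /= vecp1.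
    apply: eqXZ; apply: eqX_le L'N _; by have [_ _ ] := isG_upow j0 gU sU s.
  have hL'' : (W + j < L' <= N)%N by rewrite hL' L'N.
  have [je _] := primitive_exists hL'' gP sP' ltac:(lia).
  have hn0 : h != 0 by rewrite -size_poly_eq0 sh.
  have [r re] : exists r, e = (r.+1 * j)%N.
    case/dvdnP: je => -[|r] er; first by rewrite er mul0n in e0.
    by exists r.
  have rd : (r <= d)%N by apply: leq_trans ed; rewrite re; rewrite mulSn; apply: leq_trans (leq_addl _ _); rewrite leq_pmulr.
  have shr : size (h ^+ r.+1) = e.+1.
    by rewrite -(prednK (n := size (h ^+ r.+1))) ?size_poly_gt0 ?expf_neq0 // size_exp sh re mulnC.
  have rW : (r.+1 * j <= W)%N by rewrite -re (leq_trans ed).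
  have hrE s : eqX L' (act (up s) (vecp W (h ^+ r.+1))) (vecp W ((h + s%:P) ^+ r.+1)).
    apply: eqX_le (act_upow_hX s rW); rewrite leq_subRL; last first.
      by apply: leq_trans LN' || (apply: leq_trans hLL; apply: leq_trans (leq_addl _ _); rewrite leq_mul2r rd orbT).
    by rewrite addnC; apply: leq_trans hLL; rewrite leq_add2l leq_mul2r rd orbT.
  pose a := lead_coef P / lead_coef (h ^+ r.+1).
  have gh' : good L' (h ^+ r.+1).
    by move=> s b /andP[h1 h2]; rewrite hrE // coef_vecp leqNgt h1.
  have e1 : e = e.-1.+1 by rewrite prednK.
  have [|||G [hG1 hG2]] := IH e.-1 _ (P - a *: h ^+ r.+1) _ _ (goodB gP (goodZ a gh')).
  - by rewrite prednK.
  - by apply: leq_trans ed; apply: leq_pred.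
  - rewrite prednK //; apply/leq_sizeP => i; rewrite leq_eqVlt => /orP[/eqP <-|ei].
      rewrite coefB coefZ /a.
      have -> : P`_e = lead_coef P by rewrite /lead_coef sP'.
      have -> : (h ^+ r.+1)`_e = lead_coef (h ^+ r.+1) by rewrite [in RHS]/lead_coef shr.
      by rewrite divfK ?subrr // lead_coef_eq0 expf_neq0.
    by rewrite coefB coefZ !nth_default ?mulr0 ?subrr // ?shr ?sP'.
  exists (G + a *: 'X^(r.+1)); split.
    by rewrite comp_polyD comp_polyZ comp_Xn_poly -hG1 subrK.
  move=> s; rewrite comp_polyD comp_polyZ comp_Xn_poly.
  have -> : vecp W P = vecp W (P - a *: h ^+ r.+1) + a *: vecp W (h ^+ r.+1) by rewrite -linearZ -linearD subrK.
  have -> : vecp W (G \Po (h + s%:P) + a *: (h + s%:P) ^+ r.+1) = vecp W (G \Po (h + s%:P)) + a *: vecp W ((h + s%:P) ^+ r.+1).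
    by rewrite linearD linearZ.
  have E p q : act (up s) (p + a *: q) = act (up s) p + a *: act (up s) q by rewrite linearD linearZ.
  rewrite E.
  by apply: eqXD; [exact: hG2|exact: eqXZ].
- by move: sP'; rewrite ltnNge sP.
case: (posnP e) => [e0|e0].
  have -> : P = 0 by apply/eqP; rewrite -size_poly_leq0 -ltnS -e0.
  by exists 0; rewrite comp_poly0; split=> // s; rewrite comp_poly0 !linear0.
apply: (IH e.-1) => //; first by rewrite prednK.
  by apply: leq_trans ed; apply: leq_pred.
by rewrite prednK.
Qed.
End Primitive.
End OneParameter.

Variables (g : {poly C} -> gl C n) (Fs : seq {poly C}) (f0 : {poly C}) (sym : {poly C} -> C).
Hypotheses (f0F : f0 \in Fs) (gG : {in Fs, forall f, isG W (glval (g f))}).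
Hypothesis gf : {in Fs, forall f, eqX N (act (glval (g f)) 'X^(W - d)) (vecp W f)}.
Hypothesis sF : {in Fs, forall f : {poly C}, size f = d.+1}.
Hypothesis usymF : {in Fs, forall f, usym W j (sym f) (glval (lratio g f0 f))}.
Hypothesis many : (n < size (undup [seq sym f | f <- Fs]))%N.
Hypothesis comm : {in Fs & Fs, forall f1 f2, {in Fs & Fs, forall f3 f4,
  shifted k (glval (gcomm (lratio g f1 f2) (lratio g f3 f4)) - 1%:M)}}.

Lemma gcomm_of_shifted (A B : gl C n) i : isG W (glval A) -> isG W (glval B) ->
  shifted i (glval A *m glval B - glval B *m glval A) -> shifted i (glval (gcomm A B) - 1%:M).
Proof.
move=> gA gB h; have [_ tA _ _] := isGV gA; have [_ tB _ _] := isGV gB.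
have -> : glval (gcomm A B) - 1%:M = glval (A^-1 * B^-1)%g *m (glval A *m glval B - glval B *m glval A).
  rewrite mulmxBr -!glME /gcomm; congr (_ - _); first by rewrite !mulgA.
  by rewrite -mulgA (mulgA B^-1%g) mulVg mul1g mulVg.
rewrite -(add0n i); apply: shiftedM => //; exact: (@shiftedM _ _ 0 0).
Qed.

(** Let [D] be the quotient of the ratio by the power of [U] with the same symbol. It is trivial at
    depth [j] and commutes with [U] to order [k]. A symbol [c'] of [D] at a depth [i < k - j] would
    give the commutator the nonzero symbol [(j - i) * sym f1 * c'] at depth [i + j < k]. *)
Lemma lratio_upow f1 f : f1 \in Fs -> f \in Fs -> sym f1 != 0 ->
  shifted (k - j) (glval (lratio g f0 f) - upow (glval (lratio g f0 f1)) (sym f / sym f1)).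
Proof.
move=> f1F fF c0; set U := lratio g f0 f1; set V := lratio g f0 f; set s := _ / _.
have gU : isG W (glval U) by apply: (lratio_isG gG).
have gV : isG W (glval V) by apply: (lratio_isG gG).
have uU := usymF f1F; have uV := usymF fF; have sU : shifted j (glval U - 1%:M) by case: uU.
have gP := isG_upow j0 gU sU s; have uP := usym_upow j0 sU s uU.
have [unitP tP _ _] := gP.
pose P := GL unitP; pose D := (P^-1 * V)%g.
have gD : isG W (glval D) by apply: isGM => //; apply: isGV.
have uD : usym W j 0 (glval D).
  have := usym1 W0 (isGV gP) gV j0 (usymV W0 gP j0 uP) uV.
  by rewrite divfK // addNr.
have VE : glval V - upow (glval U) s = upow (glval U) s *m (glval D - 1%:M).
  by rewrite mulmxBr mulmx1 -[upow _ _ in RHS]/(glval P) -glME /D mulgA mulgV mul1g.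
rewrite VE -[(k - j)%N]add0n; apply: shiftedM => //.
have chD : chi (glval D) = 1.
  have [h _] := uD; have dg a : glval D a a = 1.
    have := h a a; rewrite -{1}[nat_of_ord a]addn0 ltn_add2l => /(_ j0) /eqP.
    by rewrite !mxE eqxx subr_eq0 => /eqP.
  by rewrite /chi !dg divr1.
case: (@depth_dichotomy _ _ _ W0 Wn _ (k - j) gD chD) => [|//|[i [c' [/andP[i0 ik] c'0 uD']]]]; first by lia.
exfalso.
have ji : (j < i)%N.
  rewrite ltnNge; apply/negP => ij.
  have : usym W i 0 (glval D) by apply/shifted_usym0; have /shifted_usym0 h0 := uD; apply: (shiftedW _ h0).
  by move/(usym_inj W0 (_ : (i < N)%N) uD') => e; rewrite e ?eqxx // in c'0; lia.
have hU : glval U *m upow (glval U) s = upow (glval U) s *m glval U by rewrite upow_comm.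
have hUi : glval U *m invmx (glval P) = invmx (glval P) *m glval U.
  exact: commmx_invmx.
have comUD : shifted k (glval U *m glval D - glval D *m glval U).
  have -> : glval U *m glval D - glval D *m glval U = glval (P^-1)%g *m (glval U *m glval V - glval V *m glval U).
    have DE : glval D = invmx (glval P) *m glval V by [].
    rewrite DE glVE; move: hUi; move: (glval U) (glval V) (invmx (glval P)) => u v p hp.
    by rewrite mulmxBr !mulmxA hp.
  rewrite -[k]add0n; apply: shiftedM; first by have [_ h _ _] := isGV gP.
  exact: gcomm_shifted gU gV (comm f0F f1F f0F fF).
have jik : ((j + i).+1 <= k)%N by clear -ik; lia.
have /(shifted_usym0 W) hz := gcomm_of_shifted gU gD (shiftedW jik comUD).
have := usym_inj W0 (_ : (j + i < N)%N) (usym_comm W0 gU gD j0 i0 uU uD') hz.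
move=> /(_ ltac:(lia)) /eqP; apply/negP; rewrite !mulf_neq0 // subr_eq0 eqr_nat; lia.
Qed.

(** To high order all members lie on the orbit of [f0] under one one-parameter group. So many
    polynomial points make the whole orbit polynomial; then [f0] is [G] of [h], and moving along the
    orbit translates [h]. *)
Lemma additive_structure : exists G h : {poly C}, {in Fs, forall f : {poly C}, exists a : C, f = G \Po (h + a%:P)}.
Proof.
have [f1 f1F c0] : exists2 f1, f1 \in Fs & sym f1 != 0.
  case: (boolP (has (fun f => sym f != 0) Fs)) => [/hasP [f fF h]|]; first by exists f.
  rewrite -all_predC => /allP h; move: many.
  have : (size (undup [seq sym f | f <- Fs]) <= size [:: 0%R : C])%N.
    apply: uniq_leq_size; first exact: undup_uniq.
    move=> x; rewrite mem_undup => /mapP [f /h /=]; rewrite negbK => /eqP -> ->.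
    by rewrite inE.
  move=> h1 h2; have := leq_trans h2 h1; rewrite /= ltnS leqn0 => /eqP n0.
  by move: Wn; rewrite n0.
set U := glval (lratio g f0 f1); set c := sym f1 in c0 *.
have gU : isG W U by apply: (lratio_isG gG).
have uU : usym W j c U := usymF f1F; have sU : shifted j (U - 1%:M) by case: uU.
pose L := (W - d + (k - j))%N.
have LN : (L <= N)%N by rewrite /L; lia.
have kW' : (d * W + 2 * d + j < k)%N by lia.
have hL : (W + j + d * W < L)%N by rewrite /L; lia.
have approx f : f \in Fs -> eqX L (vecp W f) (act (upow U (sym f / c)) (vecp W f0)).
  move=> fF; apply: eqX_trans (eqX_le LN (eqX_sym (act_lratio gf f0F fF))) _.
  have sh := lratio_upow f1F fF c0.
  have low : eqX (W - d) (vecp W f0) 0 by apply: vecp_low; rewrite sF.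
  have h1 := act_eqX (_ : (W - d <= N)%N) sh low.
  have {}h1 := h1 ltac:(lia); rewrite linear0 in h1.
  have E : act (glval (lratio g f0 f)) (vecp W f0) = act (upow U (sym f / c)) (vecp W f0) +
      act (glval (lratio g f0 f) - upow U (sym f / c)) (vecp W f0).
    by rewrite /act -linearD -mulmxDr addrC subrK.
  rewrite E -[X in eqX _ _ X]addr0; apply: eqXD => //.
  by apply: eqX_le h1; rewrite leq_min leqnn LN.
(* As a polynomial in [s] of size at most [n.+1], the coefficient vanishes at the more than [n]
   distinct values [sym f / c], hence identically. *)
have good0 : good U L f0.
  move=> s b /andP[Wb bL]; rewrite -pactE.
  have -> : pact U (vecp W f0) b = 0; last by rewrite horner0.
  apply: (@roots_geq_poly_eq0 _ _ [seq x / c | x <- undup [seq sym f | f <- Fs]]).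
  - apply/allP => _ /mapP [x + ->]; rewrite mem_undup => /mapP [f fF ->].
    by rewrite rootE pactE -approx // coef_vecp leqNgt Wb.
  - by rewrite map_inj_uniq ?undup_uniq //; apply: mulIf; rewrite invr_eq0.
  rewrite size_map; apply: leq_trans many; apply: leq_trans (size_sum _ _ _) _.
  apply/bigmax_leqP => l _; apply: leq_trans (size_scale_leq _ _) _.
  by apply: leq_trans (size_binp _ _) _; rewrite ltn_ord.
have hL1 : (W + j < L <= N)%N by lia.
have [_ [h [gh sh dh]]] := primitive_exists uU c0 hL1 good0 (sF f0F) ltac:(lia).
(* Each multiplication by [h] costs [W] orders of precision, and powers up to [h ^+ d] may occur. *)
pose L' := (L - d * W)%N.
have [G [hG1 hG2]] := good_decompose gU uU c0 hL1 gh sh dh (L' := L') (e := d) ltac:(rewrite /L'; lia) ltac:(rewrite /L'; lia) (leqnn d) (eq_leq (sF f0F)) (good_le (leq_subr _ _) good0).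
exists G, h => f fF; exists (sym f / c).
apply: (@vecp_inj _ W L'); first by rewrite sF.
- have := congr1 (fun p : {poly C} => (size p).-1) hG1; rewrite size_comp_poly sF //= sh /=.
  move=> E; have := size_comp_poly G (h + (sym f / c)%:P); rewrite size_shift //= -E.
  by case: (size _) => //= m ->; rewrite !ltnS.
- by rewrite /L'; lia.
by apply: eqX_trans (eqX_le (leq_subr _ _) (approx f fF)) (hG2 _).
Qed.
End Additive.

(** * Closed chains of polynomial equations *)

Section BiPoly.
Variable C : numClosedFieldType.
Implicit Types F : C -> C -> C.

(** A bound on both degrees of a function of two variables; phrased for functions, so that sums,
    products and determinants can be treated pointwise. *)
Definition bipoly D F := exists P : {poly {poly C}},
  [/\ (size P <= D)%N, forall i, (size (P`_i)%R <= D)%N & forall c v, F c v = P.[v%:P].[c]].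

Lemma bipoly_le D D' F : (D <= D')%N -> bipoly D F -> bipoly D' F.
Proof.
move=> DD [P [h1 h2 h3]]; exists P; split=> //; first exact: leq_trans DD.
by move=> i; apply: leq_trans DD.
Qed.

Lemma bipoly_ext D F G : (forall c v, F c v = G c v) -> bipoly D F -> bipoly D G.
Proof. by move=> e [P [h1 h2 h3]]; exists P; split=> // c v; rewrite -e. Qed.

Lemma bipolyD D F G : bipoly D F -> bipoly D G -> bipoly D (fun c v => F c v + G c v).
Proof.
move=> [P [h1 h2 h3]] [Q [k1 k2 k3]]; exists (P + Q); split.
- by apply: leq_trans (size_polyD _ _) _; rewrite geq_max h1 k1.
- by move=> i; rewrite coefD; apply: leq_trans (size_polyD _ _) _; rewrite geq_max h2 k2.
by move=> c v; rewrite hornerD hornerD h3 k3.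
Qed.

Lemma bipolyM D D' F G : bipoly D F -> bipoly D' G -> bipoly (D + D') (fun c v => F c v * G c v).
Proof.
move=> [P [h1 h2 h3]] [Q [k1 k2 k3]]; exists (P * Q); split.
- by apply: leq_trans (size_polyMleq _ _) _; apply: leq_trans (leq_pred _) _; apply: leq_add.
- move=> i; rewrite coefM; apply: leq_trans (size_sum _ _ _) _; apply/bigmax_leqP => l _.
  by apply: leq_trans (size_polyMleq _ _) _; apply: leq_trans (leq_pred _) _; apply: leq_add.
by move=> c v; rewrite hornerM hornerM h3 k3.
Qed.

Lemma bipoly_fst (p : {poly C}) D : (0 < D)%N -> (size p <= D)%N -> bipoly D (fun c _ => p.[c]).
Proof.
move=> D0 sp; exists p%:P; split.
- by rewrite size_polyC; case: (p != 0).
- by move=> i; rewrite coefC; case: ifP => // _; rewrite size_poly0.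
by move=> c v; rewrite hornerC.
Qed.

Lemma bipoly_snd (p : {poly C}) D : (0 < D)%N -> (size p <= D)%N -> bipoly D (fun _ v => p.[v]).
Proof.
move=> D0 sp; exists (map_poly polyC p); split.
- by rewrite size_map_polyC.
- by move=> i; rewrite coef_map /= size_polyC; case: (_ != 0).
by move=> c v; rewrite horner_map /= hornerC.
Qed.

Lemma bipoly_const a : bipoly 1 (fun _ _ => a).
Proof.
by apply: bipoly_ext (@bipoly_fst a%:P 1 isT (size_polyC_leq1 _)) => c v; rewrite hornerC.
Qed.

Lemma bipoly_sum (I : Type) (r : seq I) D (F : I -> C -> C -> C) : (0 < D)%N -> (forall i, bipoly D (F i)) ->
  bipoly D (fun c v => \sum_(i <- r) F i c v).
Proof.
move=> D0 h; elim: r => [|i r IH].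
  by apply: bipoly_ext (bipoly_le D0 (bipoly_const 0)) => c v; rewrite big_nil.
by apply: bipoly_ext (bipolyD (h i) IH) => c v; rewrite big_cons.
Qed.

Lemma bipoly_prod (I : Type) (r : seq I) D (F : I -> C -> C -> C) : (forall i, bipoly D (F i)) ->
  bipoly (size r * D).+1 (fun c v => \prod_(i <- r) F i c v).
Proof.
move=> h; elim: r => [|i r IH].
  by apply: bipoly_ext (bipoly_const 1) => c v; rewrite big_nil.
have := bipolyM (h i) IH; rewrite addnS -mulSn.
by apply: bipoly_ext => c v; rewrite big_cons.
Qed.

Lemma bipoly_det r D (E : 'I_r -> 'I_r -> C -> C -> C) : (forall i j, bipoly D (E i j)) ->
  bipoly (r * D).+2 (fun c v => \det (\matrix_(i, j) E i j c v)).
Proof.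
move=> h; rewrite /determinant.
apply: (@bipoly_ext _ (fun c v => \sum_(s : 'S_r) (-1) ^+ s * \prod_i E i (s i) c v)).
  by move=> c v; apply: eq_bigr => s _; congr (_ * _); apply: eq_bigr => i _; rewrite mxE.
apply: bipoly_sum => // s; rewrite -add1n; apply: bipolyM; first exact: bipoly_const.
have := @bipoly_prod _ (enum 'I_r) D (fun i => E i (s i)) (fun i => h i (s i)).
by rewrite size_enum_ord; apply: bipoly_ext => c v; rewrite big_enum.
Qed.

(* Companion matrix of a monic polynomial X^(d+1) + sum_j q_j X^j. *)
Definition compan d (q : nat -> C) : 'M[C]_d.+1 :=
  \matrix_(i, j) if i == ord_max then - q j else ((j : nat) == i.+1)%:R.

Definition powcol d (z : C) : 'cV[C]_d.+1 := \col_i z ^+ i.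

Lemma compan_powcol d (q : nat -> C) (z : C) : z ^+ d.+1 + \sum_(j < d.+1) q j * z ^+ j = 0 ->
  compan d q *m powcol d z = z *: powcol d z.
Proof.
move=> h; apply/matrixP => i k; rewrite !mxE; case: (eqVneq i ord_max) => [->|im].
  rewrite (eq_bigr (fun j : 'I_d.+1 => - (q j * z ^+ j))); last by move=> j _; rewrite !mxE eqxx mulNr.
  by rewrite sumrN -exprS; apply/eqP; rewrite eq_sym -addr_eq0 h.
have id : (i.+1 < d.+1)%N.
  by rewrite ltnS ltn_neqAle -ltnS ltn_ord andbT; apply: contra im => /eqP e; apply/eqP/val_inj.
rewrite (bigD1 (Ordinal id)) //= big1 ?addr0.
  by rewrite !mxE (negbTE im) eqxx mul1r exprS.
move=> j ji; rewrite !mxE (negbTE im) (_ : (j : nat) == i.+1 = false) ?mul0r //.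
by apply: contraNF ji => /eqP e; apply/eqP/val_inj.
Qed.

Lemma compan_eigen d (q : nat -> C) (z : C) (x : 'cV[C]_d.+1) : x != 0 -> compan d q *m x = z *: x ->
  z ^+ d.+1 + \sum_(j < d.+1) q j * z ^+ j = 0.
Proof.
move=> x0 h.
have xi i (id : (i < d.+1)%N) : x (Ordinal id) ord0 = z ^+ i * x ord0 ord0.
  elim: i id => [|i IH] id; first by rewrite mul1r; congr (x _ _); apply: val_inj.
  have id' : (i < d.+1)%N := ltnW id.
  have := congr1 (fun M : 'cV[C]_d.+1 => M (Ordinal id') ord0) h; rewrite !mxE IH exprS -mulrA => <-.
  rewrite (bigD1 (Ordinal id)) //= big1 ?addr0.
    rewrite !mxE /= eqxx (_ : Ordinal id' == ord_max = false) ?mul1r //.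
    by apply/eqP => /(congr1 val) /= e; have := id; rewrite e ltnn.
  move=> j ji; rewrite !mxE /= (_ : Ordinal id' == ord_max = false).
    rewrite (_ : (j : nat) == i.+1 = false) ?mul0r //.
    by apply: contraNF ji => /eqP e; apply/eqP/val_inj.
  by apply/eqP => /(congr1 val) /= e; have := id; rewrite e ltnn.
have xE (i : 'I_d.+1) : x i ord0 = z ^+ i * x ord0 ord0.
  by rewrite -(xi i (ltn_ord i)); congr (x _ _); apply: val_inj.
have x00 : x ord0 ord0 != 0.
  apply: contraNneq x0 => e; apply/eqP/matrixP => i k; rewrite ord1 xE e mulr0 mxE //.
have := congr1 (fun M : 'cV[C]_d.+1 => M ord_max ord0) h; rewrite !mxE xE mulrA -exprS => e.
apply: (mulIf x00); rewrite mul0r mulrDl -e mulr_suml -big_split /= big1 // => j _.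
by rewrite !mxE eqxx xE mulrA !mulNr addNr.
Qed.

Lemma det_horner_mx d (A : 'M[C]_d.+1) (Q : {poly C}) : Q != 0 -> \det (horner_mx A Q) = 0 ->
  exists z (x : 'cV[C]_d.+1), [/\ root Q z, x != 0 & A *m x = z *: x].
Proof.
move=> Q0; have [r hr] := closed_field_poly_normal Q.
have rQ z : z \in r -> root Q z.
  by move=> zr; rewrite hr rootZ ?lead_coef_eq0 // root_prod_XsubC.
rewrite hr linearZ /= detZ => /eqP; rewrite mulf_eq0 expf_eq0 lead_coef_eq0 (negbTE Q0) andbF /=.
rewrite rmorph_prod /=.
have -> : \det (\prod_(i <- r) horner_mx A ('X - i%:P)) = \prod_(i <- r) \det (horner_mx A ('X - i%:P)).
  by elim: (r) => [|i s IH]; rewrite ?big_nil ?det1 // !big_cons -IH det_mulmx.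
rewrite prodf_seq_eq0 => /hasP [z zr /=]; rewrite rmorphB /= horner_mx_X horner_mx_C -det_tr => /det0P [x x0 hx].
exists z, x^T; split; [by rewrite -hr; apply: rQ| by rewrite trmx_eq0|].
apply/eqP; rewrite -subr_eq0 -mul_scalar_mx -mulmxBl -trmx_eq0 trmx_mul trmxK hx //.
Qed.

(** A resultant: the determinant of [F c] evaluated at the companion matrix of [f2 - f1.[v]] is the
    product of the values [F c y] over the roots [y]. Its entries are visibly polynomial in [c] and
    [v], which gives the degree bound. *)
Lemma elimination_step d D (f1 f2 : {poly C}) F : size f1 = d.+2 -> size f2 = d.+2 -> bipoly D F ->
  exists F', bipoly (d.+1 * (D + (D * d.+2).+1)).+2 F' /\
    forall c v, F' c v = 0 <-> exists y, f1.[v] = f2.[y] /\ F c y = 0.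
Proof.
move=> s1 s2 [P [hP1 hP2 hP3]].
have l0 : lead_coef f2 != 0 by rewrite lead_coef_eq0 -size_poly_eq0 s2.
pose q (v : C) (j : nat) := (f2`_j - (if j == 0%N then f1.[v] else 0)) / lead_coef f2.
pose M v := compan d (q v).
have qP v y : y ^+ d.+1 + \sum_(j < d.+1) q v j * y ^+ j = 0 <-> f1.[v] = f2.[y].
  have -> : y ^+ d.+1 + \sum_(j < d.+1) q v j * y ^+ j = (f2.[y] - f1.[v]) / lead_coef f2.
    rewrite horner_coef s2 [X in _ = (X - _) / _]big_ord_recr /= addrC.
    rewrite (eq_bigr (fun j : 'I_d.+1 => (f2`_j * y ^+ j) / lead_coef f2 - (if j == 0%N :> nat then f1.[v] / lead_coef f2 else 0))); last first.
      move=> j _; rewrite /q; case: eqP => [->|_]; first by rewrite !mulr1 mulrBl.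
      by rewrite !subr0 mulrAC.
    have Sa a : \sum_(j < d.+1) (if j == 0%N :> nat then a else 0) = a :> C.
      by rewrite big_ord_recl /= big1 ?addr0.
    rewrite sumrB -mulr_suml Sa.
    have -> : f2`_d.+1 = lead_coef f2 by rewrite /lead_coef s2.
    by field.
  split=> [/eqP|->]; last by rewrite subrr mul0r.
  by rewrite mulf_eq0 invr_eq0 (negbTE l0) orbF subr_eq0 eq_sym => /eqP.
pose Pc c := map_poly (horner_eval c) P.
have PcE c y : (Pc c).[y] = F c y.
  rewrite hP3 /Pc -[y in LHS](hornerC y c) -[(y%:P).[c]]/(horner_eval c y%:P) horner_map //.
pose F' c v := \det (\matrix_(i, j) (horner_mx (M v) (Pc c)) i j).
exists F'; split.
  apply: bipoly_det => i j.
  have hM : forall i j, bipoly d.+2 (fun _ v => M v i j).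
    move=> a b; rewrite /M /compan; case: (eqVneq a ord_max) => [->|am].
      pose p : {poly C} := (- (lead_coef f2)^-1) *: ((f2`_b)%:P - (if (b : nat) == 0%N then f1 else 0)).
      apply: bipoly_ext (@bipoly_snd p d.+2 isT _) => [c v|].
        rewrite mxE eqxx /q /p hornerZ hornerD hornerN hornerC; case: ifP => _; last by rewrite horner0 mulNr mulrC.
        by rewrite mulNr mulrC.
      apply: leq_trans (size_scale_leq _ _) _; apply: leq_trans (size_polyD _ _) _.
      rewrite geq_max size_polyN; apply/andP; split; first exact: leq_trans (size_polyC_leq1 _) _.
      by case: ifP => _; rewrite ?s1 ?size_poly0.
    apply: bipoly_ext (bipoly_le (isT : (1 <= d.+2)%N) (bipoly_const ((b : nat) == a.+1)%:R)) => c v.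
    by rewrite mxE (negbTE am).
  have hMX l : forall i j, bipoly (l * d.+2).+1 (fun _ v => (M v ^+ l) i j).
    elim: l => [|l IH] a b.
      by apply: bipoly_ext (bipoly_const ((a == b)%:R)) => c v; rewrite expr0 mxE.
    apply: (@bipoly_ext _ (fun _ v => \sum_k M v a k * (M v ^+ l) k b)).
      by move=> _ v; rewrite exprS mxE.
    apply: bipoly_sum => // k; rewrite mulSn -addnS; exact: bipolyM.
  apply: (@bipoly_ext _ (fun c v => \sum_(l < size P) (P`_l).[c] * (M v ^+ l) i j)).
    move=> c v; rewrite /horner_mx /horner_morph /=.
    rewrite (@horner_coef_wide _ (size P)); last by rewrite (leq_trans (size_poly _ _)) // (leq_trans (size_poly _ _)).
    rewrite summxE; apply: eq_bigr => l _.
    by rewrite coef_map /= coef_map /= /horner_eval -[_ * _ ^+ _]/(_ *m _) mul_scalar_mx mxE.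
  apply: bipoly_sum => [|l]; first by rewrite addnS.
  have D0 : (0 < D)%N by apply: leq_trans hP1; apply: leq_ltn_trans (ltn_ord l).
  apply: bipolyM; first exact: bipoly_fst.
  apply: bipoly_le (hMX l i j); rewrite ltnS leq_mul2r; apply/orP; right.
  by apply: leq_trans hP1; apply: ltnW.
move=> c v; rewrite /F'.
have -> : \matrix_(i, j) horner_mx (M v) (Pc c) i j = horner_mx (M v) (Pc c) by apply/matrixP => i j; rewrite mxE.
split=> [h|[y [hy Fy]]].
  case: (eqVneq (Pc c) 0) => [Pc0|Pc0].
    have [y hy] : exists y, root (f2 - (f1.[v])%:P) y.
      apply/closed_rootP; rewrite size_polyDl s2 // size_polyN size_polyC; by case: (_ != 0).
    exists y; split; last by rewrite -PcE Pc0 horner0.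
    by move: hy; rewrite rootE hornerD hornerN hornerC subr_eq0 => /eqP.
  have [z [x [hz x0 hx]]] := det_horner_mx Pc0 h.
  exists z; split; last by rewrite -PcE; apply/eqP.
  by apply/qP; apply: compan_eigen hx.
have ev : M v *m powcol d y = y *: powcol d y by apply: compan_powcol; apply/qP.
have evX l : M v ^+ l *m powcol d y = y ^+ l *: powcol d y.
  elim: l => [|l IH]; first by rewrite expr0 mul1mx scale1r.
  by rewrite exprSr -mulmxA ev -scalemxAr IH scalerA -exprS.
have evP : horner_mx (M v) (Pc c) *m powcol d y = (Pc c).[y] *: powcol d y.
  rewrite -[Pc c in LHS]coefK poly_def rmorph_sum mulmx_suml /= horner_coef scaler_suml.
  by apply: eq_bigr => l _; rewrite linearZ /= rmorphXn /= horner_mx_X -scalemxAl evX scalerA.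
rewrite PcE Fy scale0r in evP.
apply/eqP; rewrite -det_tr; apply/det0P; exists (powcol d y)^T.
  rewrite trmx_eq0; apply/eqP => /matrixP /(_ ord0 ord0); rewrite !mxE expr0 => /eqP.
  by rewrite oner_eq0.
by rewrite -trmx_mul evP trmx0.
Qed.
End BiPoly.

(** * Asymptotic bounds *)

Section BigO.
Variables (C : numClosedFieldType) (Om : Type) (rho : Om -> C) (P : Om -> Prop).
Implicit Types (u v : Om -> C) (e : int).

Definition isO e u := exists K R, [/\ 0 <= K, 1 <= R & forall w, P w -> R <= rho w -> `|u w| <= K * rho w ^ e].

Let rho0 w (R : C) : 1 <= R -> R <= rho w -> 0 < rho w.
Proof. by move=> h1 h2; apply: lt_le_trans h2; apply: lt_le_trans h1. Qed.

Lemma O_le e e' u : e <= e' -> isO e u -> isO e' u.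
Proof.
move=> ee [K [R [K0 R1 h]]]; exists K, R; split=> // w Pw Rw; apply: le_trans (h w Pw Rw) _.
apply: ler_wpM2l => //; have r0 := rho0 R1 Rw.
have -> : e' = e + `|e' - e|%N by rewrite gez0_abs ?subr_ge0 // [e + _]addrC subrK.
rewrite expfzDr ?gt_eqF // ler_peMr ?exprz_ge0 ?(ltW r0) // -exprnP exprn_ege1 //.
exact: le_trans Rw.
Qed.

Lemma O_dom e u v : (forall w, P w -> 1 <= rho w -> `|u w| <= `|v w|) -> isO e v -> isO e u.
Proof.
move=> uv [K [R [K0 R1 h]]]; exists K, R; split=> // w Pw Rw; apply: le_trans (h w Pw Rw).
by apply: uv => //; apply: le_trans Rw.
Qed.

Lemma O_eq e u v : (forall w, P w -> 1 <= rho w -> u w = v w) -> isO e v -> isO e u.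
Proof. by move=> uv; apply: O_dom => w Pw h; rewrite uv. Qed.

Lemma O_add e u v : isO e u -> isO e v -> isO e (fun w => u w + v w).
Proof.
move=> [K [R [K0 R1 h]]] [K' [R' [K0' R1' h']]]; exists (K + K'), (R + R'); split.
- exact: addr_ge0.
- by apply: le_trans R1 _; rewrite lerDl (le_trans ler01).
move=> w Pw Rw; apply: le_trans (ler_normD _ _) _; rewrite mulrDl; apply: lerD.
  by apply: h => //; apply: le_trans Rw; rewrite lerDl (le_trans ler01).
by apply: h' => //; apply: le_trans Rw; rewrite lerDr (le_trans ler01).
Qed.

Lemma O_opp e u : isO e u -> isO e (fun w => - u w).
Proof. by apply: O_dom => w _ _; rewrite normrN. Qed.

Lemma O_sub e u v : isO e u -> isO e v -> isO e (fun w => u w - v w).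
Proof. by move=> hu hv; apply: O_add => //; apply: O_opp. Qed.

Lemma O_mul e e' u v : isO e u -> isO e' v -> isO (e + e') (fun w => u w * v w).
Proof.
move=> [K [R [K0 R1 h]]] [K' [R' [K0' R1' h']]]; exists (K * K'), (R + R'); split.
- exact: mulr_ge0.
- by apply: le_trans R1 _; rewrite lerDl (le_trans ler01).
move=> w Pw Rw; rewrite normrM.
have hR : R <= rho w by apply: le_trans Rw; rewrite lerDl (le_trans ler01).
have hR' : R' <= rho w by apply: le_trans Rw; rewrite lerDr (le_trans ler01).
rewrite expfzDr ?gt_eqF ?(rho0 R1 hR) // mulrACA.
by apply: ler_pM => //; [apply: h|apply: h'].
Qed.

Lemma O_cst c : isO 0 (fun=> c).
Proof. by exists `|c|, 1; split=> // w _ _; rewrite expr0z mulr1. Qed.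

Lemma O_zero e : isO e (fun=> 0).
Proof. by exists 0, 1; split=> // w _ _; rewrite normr0 mul0r. Qed.

Lemma O_exp e u k : isO e u -> isO (e * k%:Z) (fun w => u w ^+ k).
Proof.
move=> hu; elim: k => [|k IH].
  by rewrite mulr0; apply: O_eq (O_cst 1) => w _ _; rewrite expr0.
rewrite -addn1 PoszD mulrDr mulr1 addrC; apply: O_eq (O_mul hu IH) => w _ _.
by rewrite addn1 exprS.
Qed.

Lemma O_sum e (I : Type) (r : seq I) (F : I -> Om -> C) : (forall i, isO e (F i)) ->
  isO e (fun w => \sum_(i <- r) F i w).
Proof.
move=> h; elim: r => [|i r IH]; first by apply: O_eq (O_zero e) => w _ _; rewrite big_nil.
by apply: O_eq (O_add (h i) IH) => w _ _; rewrite big_cons.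
Qed.

Lemma O_scale e c u : isO e u -> isO e (fun w => c * u w).
Proof. by move=> h; rewrite -[e]add0r; apply: O_mul (O_cst c) h. Qed.

Lemma O_root e u k : isO (e * k.+1%:Z) (fun w => u w ^+ k.+1) -> isO e u.
Proof.
move=> [K [R [K0 R1 h]]]; exists (K + 1), R; split=> //; first by rewrite addr_ge0.
move=> w Pw Rw; have r0 := rho0 R1 Rw.
have K1 : 1 <= K + 1 by rewrite lerDr.
rewrite -(@ler_pXn2r _ k.+1) ?nnegrE ?mulr_ge0 ?exprz_ge0 ?(ltW r0) ?(le_trans ler01 K1) //.
rewrite -normrX; apply: le_trans (h w Pw Rw) _.
rewrite exprMn -exprz_exp ler_wpM2r ?exprz_ge0 ?(ltW r0) //.
apply: le_trans (_ : K + 1 <= _); first by rewrite lerDl.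
by rewrite exprS ler_peMr ?(le_trans ler01 K1) // exprn_ege1.
Qed.

Lemma O_horner (p : {poly C}) u : isO 0 u -> isO 0 (fun w => p.[u w]).
Proof.
move=> hu; apply: O_eq (_ : isO 0 (fun w => \sum_(i < size p) p`_i * u w ^+ i)).
  by move=> w _ _; rewrite horner_coef.
by apply: O_sum => i; apply: O_scale; have := O_exp i hu; rewrite mul0r.
Qed.

Lemma O_hornerX (p q : {poly C}) M u : eqX M p q -> isO (-1) u -> isO (- M%:Z) (fun w => p.[u w] - q.[u w]).
Proof.
move=> /eqXP [s ->] hu; apply: O_eq (_ : isO _ (fun w => s.[u w] * u w ^+ M)).
  by move=> w _ _; rewrite hornerD hornerM hornerXn addrC addKr.
rewrite -[- M%:Z]add0r; apply: O_mul; first by apply: O_horner; apply: O_le hu.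
by rewrite -mulN1r; apply: O_exp.
Qed.

Lemma O_subX e u v k : isO 1 u -> isO 1 v -> isO e (fun w => u w - v w) ->
  isO (e + k%:Z) (fun w => u w ^+ k - v w ^+ k).
Proof.
move=> hu hv huv; elim: k => [|k IH].
  by apply: O_eq (O_zero _) => w _ _; rewrite !expr0 subrr.
apply: O_eq (_ : isO _ (fun w => u w * (u w ^+ k - v w ^+ k) + (u w - v w) * v w ^+ k)).
  by move=> w _ _; rewrite !exprS; ring.
apply: O_add; first by have := O_mul hu IH; rewrite addrCA -[k.+1]addn1 PoszD [1 + _]addrC.
apply: O_le (O_mul huv (O_exp k hv)); rewrite mul1r lerD2l lez_nat //.
Qed.

Lemma O_all (I : finType) e (F : I -> Om -> C) : (forall i, isO e (F i)) ->
  exists K R, [/\ 0 <= K, 1 <= R & forall w, P w -> R <= rho w -> forall i, `|F i w| <= K * rho w ^ e].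
Proof.
move=> /choice [K /choice [R h]]; exists (\sum_i K i), (1 + \sum_i R i).
have K0 i : 0 <= K i by have [] := h i.
have R0 i : 0 <= R i by have [_ h1 _] := h i; apply: le_trans h1.
split; first by rewrite sumr_ge0.
  by rewrite lerDl sumr_ge0.
move=> w Pw Rw i; have [_ R1 hi] := h i.
have Ri : R i <= rho w.
  apply: le_trans Rw; rewrite (bigD1 i) //= addrCA lerDl addr_ge0 // sumr_ge0 //.
apply: le_trans (hi w Pw Ri) _; apply: ler_wpM2r; first by rewrite exprz_ge0 // ltW // (rho0 R1 Ri).
by rewrite (bigD1 i) //= lerDl sumr_ge0.
Qed.
End BigO.

Section Basics.
Variable C : numClosedFieldType.

Lemma horner_upper (p : {poly C}) d : (size p <= d.+1)%N ->
  exists K, 0 <= K /\ forall x, (1 <= `|x| -> `|p.[x]| <= K * `|x| ^+ d) /\ (`|x| <= 1 -> `|p.[x]| <= K).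
Proof.
move=> sp; exists (\sum_(i < d.+1) `|p`_i|); split; first by apply: sumr_ge0.
move=> x; rewrite (horner_coef_wide _ sp); split=> hx.
  apply: le_trans (ler_norm_sum _ _ _) _; rewrite mulr_suml; apply: ler_sum => i _.
  by rewrite normrM normrX ler_wpM2l // ler_weXn2l // -ltnS ltn_ord.
apply: le_trans (ler_norm_sum _ _ _) _; apply: ler_sum => i _.
by rewrite normrM normrX ler_piMr // exprn_ile1.
Qed.

Lemma horner_lower (p : {poly C}) d : size p = d.+2 ->
  exists K, 1 <= K /\ forall x, K <= `|x| -> `|x| ^+ d.+1 <= K * `|p.[x]|.
Proof.
move=> sp; pose l := lead_coef p.
have l0 : 0 < `|l| by rewrite normr_gt0 lead_coef_eq0 -size_poly_eq0 sp.
have sq : (size (p - l *: 'X^(d.+1) : {poly C})%R <= d.+1)%N.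
  apply/leq_sizeP => j; rewrite leq_eqVlt => /orP[/eqP <-|hj].
    by rewrite coefB coefZ coefXn eqxx mulr1 /l /lead_coef sp subrr.
  by rewrite coefB coefZ coefXn nth_default ?sp // gtn_eqF // mulr0 subrr.
have [B [B0 hB]] := horner_upper sq.
pose K := 1 + 2%:R * B / `|l| + 2%:R / `|l|.
have h1 : 0 <= 2%:R * B / `|l| by apply: divr_ge0 => //; apply: mulr_ge0 => //; rewrite ler0n.
have h2 : 0 <= 2%:R / `|l| by apply: divr_ge0 => //; rewrite ler0n.
have K1 : 1 <= K by rewrite /K -addrA lerDl addr_ge0.
exists K; split=> // x hx.
have x1 : 1 <= `|x| by apply: le_trans hx.
have x0 : 0 <= `|x| by apply: le_trans x1.
have [hBx _] := hB x; have {}hBx := hBx x1.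
have e : l * x ^+ d.+1 = p.[x] - (p - l *: 'X^(d.+1)).[x].
  by rewrite hornerD hornerN hornerZ hornerXn opprB addrCA subrr addr0.
have h3 : `|l| * `|x| ^+ d.+1 <= `|p.[x]| + B * `|x| ^+ d.
  rewrite -normrX -normrM e; apply: le_trans (ler_normB _ _) _.
  by rewrite lerD2l.
have h4 : 2%:R * (B * `|x| ^+ d) <= `|l| * `|x| ^+ d.+1.
  rewrite exprS 2!mulrA ler_wpM2r ?exprn_ge0 // [X in _ <= X](mulrC `|l|) -ler_pdivrMr //.
  by apply: le_trans hx; rewrite /K -addrA addrCA lerDl addr_ge0.
have h5 : `|l| * `|x| ^+ d.+1 <= 2%:R * `|p.[x]|.
  have : 2%:R * (`|l| * `|x| ^+ d.+1) <= 2%:R * `|p.[x]| + `|l| * `|x| ^+ d.+1.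
    apply: le_trans (_ : 2%:R * (`|p.[x]| + B * `|x| ^+ d) <= _); first by rewrite ler_wpM2l.
    by rewrite mulrDr lerD2l.
  by rewrite [X in X <= _]mulr_natl mulr2n lerD2r.
rewrite -(ler_pM2l l0); apply: le_trans h5 _; rewrite mulrA ler_wpM2r // -ler_pdivrMl // mulrC.
by rewrite /K lerDr addr_ge0.
Qed.

(** Both polynomials grow like the same power, so along a step of a chain [x] and [x'] have the same
    order of magnitude; errors measured in [x] can then be measured in [x']. *)
Lemma poly_comparable d (f1 f2 : {poly C}) : size f1 = d.+2 -> size f2 = d.+2 ->
  exists K R, [/\ 1 <= K, 1 <= R & forall x x', R <= `|x| -> f1.[x] = f2.[x'] ->
    [/\ 1 <= `|x'|, `|x| <= K * `|x'| & `|x'| <= K * `|x|]].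
Proof.
move=> s1 s2.
have [B1 [B10 hB1]] := horner_upper (eq_leq s1); have [B2 [B20 hB2]] := horner_upper (eq_leq s2).
have [K1 [K11 hK1]] := horner_lower s1; have [K2 [K21 hK2]] := horner_lower s2.
have K10 := le_trans ler01 K11; have K20 := le_trans ler01 K21.
pose K := 1 + K1 * B2 + K2 * B1 + K2; pose R := 1 + K1 + K1 * B2.
have p1 : 0 <= K1 * B2 by apply: mulr_ge0.
have p2 : 0 <= K2 * B1 by apply: mulr_ge0.
have KK : 1 <= K by rewrite /K -!addrA lerDl !addr_ge0.
have K0 := le_trans ler01 KK.
have RR : 1 <= R by rewrite /R -addrA lerDl addr_ge0.
have KX : K <= K ^+ d.+1 by rewrite exprS ler_peMr // exprn_ege1.
exists K, R; split=> // x x' hx e.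
have x1 : 1 <= `|x| := le_trans RR hx; have x0 := le_trans ler01 x1.
have hxK1 : K1 <= `|x| by apply: le_trans hx; rewrite /R addrAC addrC lerDl addr_ge0.
have h1 := hK1 x hxK1.
have xX : `|x| <= `|x| ^+ d.+1 by rewrite exprS ler_peMr // exprn_ege1.
have x'1 : 1 <= `|x'|.
  rewrite real_leNgt ?num_real //; apply/negP => h; have [_ h2] := hB2 x'.
  have h3 : `|x| <= K1 * B2 by apply: le_trans xX _; apply: le_trans h1 _; rewrite e ler_wpM2l // h2 // ltW.
  have := le_trans hx h3; rewrite /R gerDr; apply/negP.
  rewrite -real_ltNge ?realE ?lexx //; last by rewrite addr_ge0.
  by rewrite ltr_pwDl.
have x'0 := le_trans ler01 x'1.
split=> //.
  rewrite -(@ler_pXn2r _ d.+1) ?nnegrE ?mulr_ge0 // exprMn; apply: le_trans h1 _.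
  apply: le_trans (_ : K * `|x'| ^+ d.+1 <= _); last by rewrite ler_wpM2r ?exprn_ge0.
  rewrite e; have [h2 _] := hB2 x'; apply: le_trans (_ : K1 * (B2 * `|x'| ^+ d.+1) <= _).
    by rewrite ler_wpM2l // h2.
  by rewrite mulrA ler_wpM2r ?exprn_ge0 // /K -!addrA addrCA lerDl !addr_ge0.
case: (real_leP (ger0_real K20) (ger0_real x'0)) => h.
  have h2 := hK2 x' h.
  rewrite -(@ler_pXn2r _ d.+1) ?nnegrE ?mulr_ge0 // exprMn; apply: le_trans h2 _.
  apply: le_trans (_ : K * `|x| ^+ d.+1 <= _); last by rewrite ler_wpM2r ?exprn_ge0.
  rewrite -e; have [h3 _] := hB1 x; apply: le_trans (_ : K2 * (B1 * `|x| ^+ d.+1) <= _).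
    by rewrite ler_wpM2l // h3.
  rewrite mulrA ler_wpM2r ?exprn_ge0 // /K -addrA addrC -addrA [X in _ <= _ + X]addrC.
  by rewrite lerDl !addr_ge0.
apply: le_trans (ltW h) _; apply: le_trans (_ : K2 * `|x| <= _); first by rewrite ler_peMr.
by rewrite ler_wpM2r // /K lerDr !addr_ge0.
Qed.

(** Serves to select, among the factors [a - z * b] of [a ^+ d.+1 - b ^+ d.+1], the root of unity
    [z] for which [z * b] is closest to [a]. *)
Lemma min_pow_prod (s : seq C) : (0 < size s)%N -> all (fun x => 0 <= x) s ->
  exists2 x, x \in s & x ^+ size s <= \prod_(y <- s) y.
Proof.
move=> s0 hs.
have [x xs hx] : exists2 x, x \in s & forall y, y \in s -> x <= y.
  elim: s s0 hs => // a [|b s] IH _ /= /andP[a0 hs].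
    by exists a; rewrite ?mem_head // => y; rewrite inE => /eqP ->.
  have [x xs hx] := IH isT hs.
  have x0 : 0 <= x by move: xs; apply/allP.
  case: (real_leP (ger0_real a0) (ger0_real x0)) => h.
    exists a; first exact: mem_head.
    by move=> y; rewrite inE => /orP[/eqP -> //|/hx]; apply: le_trans.
  exists x; first by rewrite inE xs orbT.
  by move=> y; rewrite inE => /orP[/eqP ->|/hx //]; apply: ltW.
exists x => //; have x0 : 0 <= x by move: xs; apply/allP.
elim: s hx hs {s0 xs} => [|a s IH] hx /= ; first by rewrite big_nil expr0.
move=> /andP[a0 hs]; rewrite big_cons exprS; apply: ler_pM => //; first exact: exprn_ge0.
  by apply: hx; rewrite mem_head.
by apply: IH => // y ys; apply: hx; rewrite inE ys orbT.
Qed.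

Lemma unity_roots d : exists rts : seq C, [/\ size rts = d.+1, all (fun z => z ^+ d.+1 == 1) rts, 1 \in rts &
  forall a b : C, a ^+ d.+1 - b ^+ d.+1 = \prod_(z <- rts) (a - z * b)].
Proof.
have [r hr] := closed_field_poly_normal ('X^(d.+1) - 1%:P : {poly C}).
have lc : lead_coef ('X^(d.+1) - 1%:P : {poly C}) = 1 by apply/monicP; apply: monicXnsubC.
rewrite lc scale1r in hr.
have sr : size r = d.+1.
  by have := congr1 (fun p : {poly C} => size p) hr; rewrite size_XnsubC // size_prod_XsubC => -[].
have rootr z : (z \in r) = (z ^+ d.+1 == 1).
  by rewrite -root_prod_XsubC -hr /root !hornerE subr_eq0.
exists r; split=> //; first by apply/allP => z; rewrite rootr.
  by rewrite rootr expr1n.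
move=> a b; case: (eqVneq b 0) => [->|b0].
  rewrite expr0n subr0 (eq_bigr (fun=> a)) => [|z _]; last by rewrite mulr0 subr0.
  by rewrite big_const_seq count_predT sr iter_mulr_1.
have := congr1 (fun p : {poly C} => p.[a / b] * b ^+ d.+1) hr; rewrite /= !hornerE horner_prod.
rewrite mulrBl mul1r expr_div_n divfK ?expf_neq0 // => ->.
rewrite -sr -[in X in _ * X](size_map id r) ?map_id.
elim: (r) => [|z s IH]; first by rewrite !big_nil mul1r.
rewrite !big_cons exprS -IH hornerXsubC -[a - z * b](mulfK b0) mulrBl.
by field.
Qed.
End Basics.

(** * One step of a chain near infinity *)

Section Step.
Variables (C : numClosedFieldType) (n W d : nat).
Hypothesis Wn : (W <= n)%N.
Local Notation N := n.+1.
Local Notation n2 := (2 * n).+1.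
Local Notation M := (d.+1 * n2.+1)%N.

Definition vec (x : C) : 'cV[C]_N := \col_a (x ^+ W * (x^-1) ^+ a).
Definition zmx (z : C) : 'M[C]_N := smx n W z%:P (z^-1)%:P.

Lemma zmxE z (u : 'cV[C]_N) a : (zmx z *m u) a ord0 = z ^+ W * z^-1 ^+ a * u a ord0.
Proof.
rewrite mxE (bigD1 a) //= big1 ?addr0 => [|b ba]; rewrite mxE exprMn -!polyC_exp !mul_polyC !coefZ coefXn.
  by rewrite eqxx mulr1.
by rewrite (_ : (b : nat) == a = false) ?mulr0 ?mul0r //; apply: negbTE.
Qed.

Variables (f1 f2 v1 w1 v2 w2 : {poly C}).
Hypotheses (s1 : size f1 = d.+2) (s2 : size f2 = d.+2).
Hypotheses (hv1 : eqX M (v1 ^+ d.+1) (\poly_(i < d.+2) f1`_(d.+1 - i))) (hw1 : eqX M (v1 * w1) 1).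
Hypotheses (hv2 : eqX M (v2 ^+ d.+1) (\poly_(i < d.+2) f2`_(d.+1 - i))) (hw2 : eqX M (v2 * w2) 1).
Hypothesis u2 : smx n W v2 w2 \in unitmx.

Lemma horner_rev (f : {poly C}) (x : C) : x != 0 -> size f = d.+2 ->
  x ^+ d.+1 * (\poly_(i < d.+2) f`_(d.+1 - i)).[x^-1] = f.[x].
Proof.
move=> x0 sf; rewrite horner_poly horner_coef sf mulr_sumr (reindex_inj rev_ord_inj) /=.
apply: eq_bigr => i _; rewrite subSS subKn; last by rewrite -ltnS.
rewrite mulrCA; congr (_ * _); have hi : (i <= d.+1)%N by rewrite -ltnS.
by rewrite -{1}(subnK hi) exprD mulrAC -exprMn mulfV // expr1n mul1r.
Qed.

Section OneSide.
Variables (Om : Type) (rho : Om -> C) (P : Om -> Prop) (X : Om -> C).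
Hypotheses (X0 : forall w, P w -> X w != 0) (OX : isO rho P 1 X) (OT : isO rho P (-1) (fun w => (X w)^-1)).
Variables (f v w : {poly C}).
Hypotheses (sf : size f = d.+2) (hv : eqX M (v ^+ d.+1) (\poly_(i < d.+2) f`_(d.+1 - i))) (hw : eqX M (v * w) 1).

Definition bigY o := X o * v.[(X o)^-1].
Definition smally o := (X o)^-1 * w.[(X o)^-1].

Lemma O_bigY : isO rho P 1 bigY.
Proof. by rewrite -[1]addr0; apply: O_mul => //; apply: O_horner; apply: O_le OT. Qed.

Lemma O_smally : isO rho P (-1) smally.
Proof. by rewrite -[-1]addr0; apply: O_mul => //; apply: O_horner; apply: O_le OT. Qed.

Lemma O_bigY_pow : isO rho P (d.+1%:Z - M%:Z) (fun o => bigY o ^+ d.+1 - f.[X o]).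
Proof.
apply: O_eq (_ : isO rho P _ (fun o => X o ^+ d.+1 * ((v ^+ d.+1).[(X o)^-1] - (\poly_(i < d.+2) f`_(d.+1 - i)).[(X o)^-1]))).
  by move=> o Po _; rewrite mulrBr horner_rev ?X0 // /bigY exprMn horner_exp.
apply: O_mul; first by rewrite -[d.+1%:Z]mul1r; apply: O_exp.
exact: O_hornerX.
Qed.

Lemma O_bigY_smally : isO rho P (- M%:Z) (fun o => bigY o * smally o - 1).
Proof.
apply: O_eq (_ : isO rho P _ (fun o => (v * w).[(X o)^-1] - (1 : {poly C}).[(X o)^-1])).
  move=> o Po _; rewrite hornerM -[1 in RHS]/(1%:P) hornerC /bigY /smally mulrACA mulfV ?X0 // mul1r //.
exact: O_hornerX.
Qed.

Lemma O_smx (a : 'I_N) : isO rho P (W%:Z - N%:Z)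
  (fun o => (smx n W v w *m vec (X o)) a ord0 - bigY o ^+ W * smally o ^+ a).
Proof.
pose p := v ^+ W * (w * 'X) ^+ a.
apply: O_eq (_ : isO rho P _ (fun o => X o ^+ W * ((\poly_(i < N) p`_i).[(X o)^-1] - p.[(X o)^-1]))).
  move=> o Po _; rewrite mulrBr; congr (_ - _).
    rewrite mxE horner_poly mulr_sumr; apply: eq_bigr => b _.
    by rewrite !mxE -/p mulrCA.
  rewrite /p hornerM !horner_exp hornerM hornerX /bigY /smally !exprMn.
  by rewrite -!mulrA; congr (_ * (_ * _)); rewrite mulrC.
apply: O_mul; first by rewrite -[W%:Z]mul1r; apply: O_exp.
by apply: O_hornerX => // i hi; rewrite coef_poly hi.
Qed.
End OneSide.

(** The series [Y1], [Y2] are approximate [d.+1]-th roots of the equal values [f1.[x]], [f2.[x']],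
    so [Y2] is close to [z * Y1] for some root of unity [z]. Extracting the root divides the
    exponent of the error by [d.+1], whence the precision [M]; the surplus order [(2 * n).+1] pays
    for the powers up to [W] that make up [vec]. *)
Lemma step_asymptotics : exists K R, [/\ 0 <= K, 1 <= R & forall x x', R <= `|x| -> f1.[x] = f2.[x'] ->
  exists z, [/\ z ^+ d.+1 = 1, `|x| <= K * `|x'|, `|x'| <= K * `|x| &
  forall a, `|(vec x' - invmx (smx n W v2 w2) *m zmx z *m smx n W v1 w1 *m vec x) a ord0| <= K * `|x| ^ (W%:Z - N%:Z)]].
Proof.
have [K [R [K1 R1 cmp]]] := poly_comparable s1 s2.
have K0 : 0 < K by apply: lt_le_trans K1.
have [rts [srts /allP rts1 rts11 rtsE]] := unity_roots C d.
pose rho (o : C * C) := `|o.1|.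
pose P (o : C * C) := R <= `|o.1| /\ f1.[o.1] = f2.[o.2].
have X0 o : P o -> o.1 != 0.
  by move=> [h _]; rewrite -normr_gt0; apply: lt_le_trans h; apply: lt_le_trans R1.
have X0' o : P o -> o.2 != 0.
  by move=> [h e]; have [h' _ _] := cmp _ _ h e; rewrite -normr_gt0; apply: lt_le_trans h'.
have OX : isO rho P 1 (fun o => o.1) by exists 1, 1; split=> // o _ _; rewrite mul1r.
have OT : isO rho P (-1) (fun o => (o.1)^-1).
  by exists 1, 1; split=> // o _ _; rewrite mul1r normfV.
have OX' : isO rho P 1 (fun o => o.2).
  exists K, 1; split; [exact: ltW|by []|move=> o [h e] _]; have [_ _] := cmp _ _ h e.
  by rewrite -exprnP expr1.
have OT' : isO rho P (-1) (fun o => (o.2)^-1).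
  exists K, 1; split; [exact: ltW|by []|move=> o Po _]; have [h e] := Po; have [_ h' _] := cmp _ _ h e.
  have x0 : 0 < `|o.1| by rewrite normr_gt0 X0.
  have x0' : 0 < `|o.2| by rewrite normr_gt0 X0'.
  by rewrite normfV exprN1 /rho ler_pdivlMr // mulrC ler_pdivrMr.
pose Y1 := bigY (@fst C C) v1; pose Y2 := bigY (@snd C C) v2.
pose y1 := smally (@fst C C) w1; pose y2 := smally (@snd C C) w2.
have /choice [z hz] (o : C * C) : exists z, z \in rts /\ `|Y2 o - z * Y1 o| ^+ d.+1 <= `|Y2 o ^+ d.+1 - Y1 o ^+ d.+1|.
  have := @min_pow_prod _ [seq `|Y2 o - z * Y1 o| | z <- rts]; rewrite size_map srts.
  case=> //; first by apply/allP => _ /mapP [z _ ->].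
  move=> _ /mapP [z zr ->] h; exists z; split=> //; apply: le_trans h _.
  by rewrite big_map rtsE normr_prod.
have z1 o : z o ^+ d.+1 = 1 by have [/rts1 /eqP] := hz o.
have nz o : `|z o| = 1.
  apply/eqP; rewrite -(@pexpr_eq1 _ _ d.+1) // -normrX z1 normr1 //.
have z0 o : z o != 0 by rewrite -normr_eq0 nz oner_eq0.
have Oz : isO rho P 0 z by exists 1, 1; split=> // o _ _; rewrite nz expr0z mulr1.
have Ozi : isO rho P 0 (fun o => (z o)^-1) by exists 1, 1; split=> // o _ _; rewrite normfV nz expr0z mulr1 invr1.
have OY1 : isO rho P 1 Y1 by apply: O_bigY.
have OY2 : isO rho P 1 Y2 by apply: O_bigY.
have Oy1 : isO rho P (-1) y1 by apply: O_smally.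
have Oy2 : isO rho P (-1) y2 by apply: O_smally.
have Oyy1 : isO rho P (- M%:Z) (fun o => Y1 o * y1 o - 1) by apply: O_bigY_smally.
have Oyy2 : isO rho P (- M%:Z) (fun o => Y2 o * y2 o - 1) by apply: O_bigY_smally.
have OYd : isO rho P (d.+1%:Z - M%:Z) (fun o => Y2 o ^+ d.+1 - Y1 o ^+ d.+1).
  have h1 : isO rho P (d.+1%:Z - M%:Z) (fun o => Y1 o ^+ d.+1 - f1.[o.1]) by apply: O_bigY_pow.
  have h2 : isO rho P (d.+1%:Z - M%:Z) (fun o => Y2 o ^+ d.+1 - f2.[o.2]) by apply: O_bigY_pow.
  by apply: O_eq (O_sub h2 h1) => o [_ e] _; rewrite e /Y1 /Y2; ring.
pose Y' o := z o * Y1 o; pose y' o := (z o)^-1 * y1 o.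
have OYY : isO rho P (- n2%:Z) (fun o => Y2 o - Y' o).
  apply: (@O_root _ _ _ _ _ _ d).
  have -> : - n2%:Z * d.+1%:Z = d.+1%:Z - M%:Z by rewrite PoszM -[n2.+1]addn1 PoszD; ring.
  by apply: O_dom OYd => o _ _; have [_] := hz o; rewrite normrX.
have OY' : isO rho P 1 Y' by rewrite -[1]add0r; apply: O_mul.
have Oy' : isO rho P (-1) y' by rewrite -[-1]add0r; apply: O_mul.
have Mn2 : - M%:Z <= - n2%:Z by rewrite lerN2 lez_nat mulSn; lia.
have Oyy : isO rho P (- n2%:Z) (fun o => y2 o - y' o).
  pose q o := Y' o * (y2 o - y' o).
  have Oq : isO rho P (- n2%:Z) q.
    apply: O_eq (_ : isO rho P _ (fun o => - ((Y2 o - Y' o) * y2 o) + ((Y2 o * y2 o - 1) - (Y1 o * y1 o - 1)))).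
      move=> o _ _; rewrite /q /Y' /y' mulrBr.
      have -> : z o * Y1 o * ((z o)^-1 * y1 o) = Y1 o * y1 o by rewrite mulrACA mulfV // mul1r.
      by ring.
    apply: O_add.
      by apply: O_opp; apply: O_le (O_mul OYY Oy2); rewrite gerDl.
    by apply: O_sub; [apply: O_le Oyy2|apply: O_le Oyy1].
  apply: O_eq (_ : isO rho P _ (fun o => y' o * q o - (y2 o - y' o) * (Y1 o * y1 o - 1))).
    move=> o _ _; rewrite /q /y' /Y'.
    have -> : (z o)^-1 * y1 o * (z o * Y1 o * (y2 o - (z o)^-1 * y1 o)) = (Y1 o * y1 o) * (y2 o - (z o)^-1 * y1 o).
      by field.
    by ring.
  apply: O_sub; first by apply: O_le (O_mul Oy' Oq); rewrite gerDr.
  apply: O_le (O_mul (O_le (_ : -1 <= 0) (O_sub Oy2 Oy')) Oyy1) => //.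
have OE (a : 'I_N) : isO rho P (W%:Z - N%:Z) (fun o => Y2 o ^+ W * y2 o ^+ a - Y' o ^+ W * y' o ^+ a).
  apply: O_eq (_ : isO rho P _ (fun o => (Y2 o ^+ W - Y' o ^+ W) * y2 o ^+ a + Y' o ^+ W * (y2 o ^+ a - y' o ^+ a))).
    by move=> o _ _; ring.
  have ha : (a < N)%N := ltn_ord a.
  apply: O_add.
    apply: O_le (O_mul (O_subX W OY2 OY' OYY) (O_exp a (O_le (_ : -1 <= 0) Oy2))) => //.
    by rewrite mul0r addr0; lia.
  apply: O_le (O_mul (O_exp W OY') (O_subX a (O_le (_ : -1 <= 1) Oy2) (O_le (_ : -1 <= 1) Oy') Oyy)) => //.
  by rewrite mul1r; lia.
have OD (a : 'I_N) : isO rho P (W%:Z - N%:Z)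
    (fun o => (smx n W v2 w2 *m vec o.2 - zmx (z o) *m (smx n W v1 w1 *m vec o.1)) a ord0).
  have h1 : isO rho P (W%:Z - N%:Z) (fun o => (smx n W v1 w1 *m vec o.1) a ord0 - Y1 o ^+ W * y1 o ^+ a) by apply: O_smx.
  have h2 : isO rho P (W%:Z - N%:Z) (fun o => (smx n W v2 w2 *m vec o.2) a ord0 - Y2 o ^+ W * y2 o ^+ a) by apply: O_smx.
  apply: O_eq (_ : isO rho P _ (fun o => ((smx n W v2 w2 *m vec o.2) a ord0 - Y2 o ^+ W * y2 o ^+ a)
     + (Y2 o ^+ W * y2 o ^+ a - Y' o ^+ W * y' o ^+ a)
     - z o ^+ W * (z o)^-1 ^+ a * ((smx n W v1 w1 *m vec o.1) a ord0 - Y1 o ^+ W * y1 o ^+ a))).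
    move=> o _ _.
    have -> : (smx n W v2 w2 *m vec o.2 - zmx (z o) *m (smx n W v1 w1 *m vec o.1)) a ord0 =
       (smx n W v2 w2 *m vec o.2) a ord0 - (zmx (z o) *m (smx n W v1 w1 *m vec o.1)) a ord0.
      by rewrite [LHS]mxE; congr (_ + _); rewrite mxE.
    rewrite zmxE /Y' /y' !exprMn.
    by move: (Y1 o ^+ W) (y1 o ^+ a) (Y2 o ^+ W) (y2 o ^+ a) (z o ^+ W) (_ ^+ a) (_ a ord0) (_ a ord0) => *; ring.
  apply: O_sub; first by apply: O_add; [exact: h2|exact: OE].
  rewrite -[_ - N%:Z]add0r; apply: O_mul; last exact: h1.
  by rewrite -[0]addr0; apply: O_mul; [have := O_exp W Oz|have := O_exp a Ozi]; rewrite mul0r.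
have [K' [R' [K'0 R'1 h']]] : exists K' R', [/\ 0 <= K', 1 <= R' & forall o, P o -> R' <= rho o -> forall a : 'I_N,
   `|(vec o.2 - invmx (smx n W v2 w2) *m zmx (z o) *m smx n W v1 w1 *m vec o.1) a ord0| <= K' * rho o ^ (W%:Z - N%:Z)].
  apply: O_all => a.
  apply: O_eq (_ : isO rho P _ (fun o => \sum_b invmx (smx n W v2 w2) a b *
      (smx n W v2 w2 *m vec o.2 - zmx (z o) *m (smx n W v1 w1 *m vec o.1)) b ord0)).
    move=> o _ _.
    have -> : vec o.2 - invmx (smx n W v2 w2) *m zmx (z o) *m smx n W v1 w1 *m vec o.1 =
       invmx (smx n W v2 w2) *m (smx n W v2 w2 *m vec o.2 - zmx (z o) *m (smx n W v1 w1 *m vec o.1)).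
      by rewrite [RHS]mulmxBr [X in _ = X - _]mulmxA mulVmx // mul1mx !mulmxA.
    by rewrite mxE.
  by apply: O_sum => b; apply: O_scale; apply: OD.
exists (K + K'), (R + R'); split.
- by rewrite addr_ge0 // ltW.
- by apply: le_trans R1 _; rewrite lerDl (le_trans ler01).
move=> x x' hx e.
have Rx : R <= `|x| by apply: le_trans hx; rewrite lerDl (le_trans ler01).
have R'x : R' <= `|x| by apply: le_trans hx; rewrite lerDr (le_trans ler01).
have [c1 c2 c3] := cmp _ _ Rx e.
exists (z (x, x')); split.
- exact: z1.
- by apply: le_trans c2 _; rewrite ler_wpM2r // lerDl.
- by apply: le_trans c3 _; rewrite ler_wpM2r // lerDl.
move=> a; apply: le_trans (h' (x, x') (conj Rx e) R'x a) _.
rewrite /rho; apply: ler_wpM2r; first by apply: exprz_ge0.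
by rewrite lerDr ltW.
Qed.
End Step.

(** * Closed chains lifted to closed walks of substitutions *)

Section Chains.
Variables (C : numClosedFieldType) (I : finType) (pol : I -> {poly C}) (d : nat).
Hypothesis spol : forall i, size (pol i) = d.+2.

(** The second half of the walk is run first, to agree with the order of the matrix product in
    [step]. *)
Fixpoint chain (m : nat) : walk I m -> C -> C -> Prop :=
  match m with
  | 0 => fun p x y => (pol p.2).[x] = (pol p.1).[y]
  | m'.+1 => fun p x z => exists y, @chain m' p.2 x y /\ @chain m' p.1 y z
  end.

Fixpoint chain_degree (m D : nat) : nat :=
  if m is m'.+1 then chain_degree m' (chain_degree m' D) else (d.+1 * (D + (D * d.+2).+1)).+2.

Lemma chain_elimination m : forall D (w : walk I m) F, bipoly D F ->
  exists F', bipoly (chain_degree m D) F' /\ forall c v, F' c v = 0 <-> exists y, chain w v y /\ F c y = 0.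
Proof.
elim: m => [|m IH] D w F hF; first exact: elimination_step.
have [F1 [hF1 e1]] := IH D w.1 F hF; have [F2 [hF2 e2]] := IH _ w.2 F1 hF1.
exists F2; split=> // c v; rewrite e2; split=> [[y [h1 /e1 [z [h2 h3]]]]|[z [[y [h1 h2]] h3]]].
  by exists z; split=> //; exists y.
by exists y; split=> //; apply/e1; exists z.
Qed.

(** Eliminating the end point [y] from the chain and the equation [y - c = 0], of bidegree below 2,
    leaves [F c v]. On the diagonal this is a polynomial in [c] of size at most
    [2 * chain_degree m 2], so too many zeros make it vanish identically. *)
Lemma chain_closed_everywhere m (w : walk I m) (s : seq C) : uniq s ->
  (2 * chain_degree m 2 < size s)%N -> (forall x, x \in s -> chain w x x) -> forall x, chain w x x.
Proof.
move=> us ss hs x; pose D := chain_degree m 2.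
have b0 : bipoly 2 (fun c y : C => y - c).
  have h1 : bipoly 2 (fun _ y : C => ('X : {poly C}).[y]) by apply: bipoly_snd; rewrite ?size_polyX.
  have h2 : bipoly 2 (fun c _ : C => (- 'X : {poly C}).[c]) by apply: bipoly_fst; rewrite ?size_polyN ?size_polyX.
  by apply: bipoly_ext (bipolyD h1 h2) => c y; rewrite hornerN !hornerX.
have [F [[P [P1 P2 P3]] hF]] := chain_elimination w b0.
pose Q := P.['X].
have QE c : Q.[c] = F c c.
  rewrite P3 /Q (horner_coef P 'X) (horner_coef P c%:P) !horner_sum; apply: eq_bigr => i _.
  by rewrite !hornerM !horner_exp hornerX hornerC.
have sQ : (size Q <= 2 * D)%N.
  rewrite /Q horner_coef; apply: leq_trans (size_sum _ _ _) _; apply/bigmax_leqP => i _.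
  apply: leq_trans (size_polyMleq _ _) _; rewrite size_polyXn addnS /= mul2n -addnn.
  by apply: leq_add; [apply: P2|apply: leq_trans P1; apply: ltnW].
have Q0 : Q = 0.
  apply: (roots_geq_poly_eq0 _ us); last by apply: leq_trans sQ (ltnW ss).
  apply/allP => y /hs hy; rewrite rootE QE; apply/eqP/hF; exists y; split=> //.
  by rewrite subrr.
have /hF [y [h1 h2]] : F x x = 0 by rewrite -QE Q0 horner0.
by move/eqP: h2; rewrite subr_eq0 => /eqP e; rewrite e in h1.
Qed.

Variables (n W : nat) (v w : I -> {poly C}) (S : I -> gl C n).
Hypothesis Wn : (W <= n)%N.
Local Notation N := n.+1.
Local Notation M := (d.+1 * (2 * n).+2)%N.
Hypothesis hv : forall i, eqX M (v i ^+ d.+1) (\poly_(j < d.+2) (pol i)`_(d.+1 - j)).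
Hypothesis hw : forall i, eqX M (v i * w i) 1.
Hypothesis hS : forall i, glval (S i) = smx n W (v i) (w i).
Variables (z : 'I_d.+1 -> C) (Z : 'I_d.+1 -> gl C n).
Hypothesis hZ : forall j, glval (Z j) = zmx n W (z j).
Hypothesis hz : forall x, x ^+ d.+1 = 1 -> exists j, z j = x.

Definition twisted (p : I * 'I_d.+1) : gl C n := (Z p.2 * S p.1)%g.

Fixpoint proj_walk (m : nat) : walk (I * 'I_d.+1)%type m -> walk I m :=
  match m with
  | 0 => fun p => (p.1.1, p.2.1)
  | m'.+1 => fun p => (@proj_walk m' p.1, @proj_walk m' p.2)
  end.

Local Notation k := (N - W)%N.

Lemma walk_asymptotics m (p : walk I m) : exists K R, [/\ 1 <= K, 1 <= R &
  forall x x', R <= `|x| -> chain p x x' -> exists p' : walk (I * 'I_d.+1)%type m,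
    [/\ proj_walk p' = p, `|x| <= K * `|x'|, `|x'| <= K * `|x| &
    forall a, `|(vec n W x' - glval (step twisted p') *m vec n W x) a ord0| * `|x| ^+ k <= K]].
Proof.
elim: m p => [|m IH] p.
  have u2 : smx n W (v p.1) (w p.1) \in unitmx by rewrite -hS glP.
  have [K [R [K0 R1 h]]] := step_asymptotics Wn (spol p.2) (spol p.1) (hv p.2) (hw p.2) (hv p.1) (hw p.1) u2.
  have K1 : 1 <= 1 + K by rewrite lerDl.
  exists (1 + K), R; split=> // x x' Rx e.
  have [y [y1 c1 c2 hy]] := h x x' Rx e.
  have x0 : 0 < `|x| by apply: lt_le_trans Rx; apply: lt_le_trans R1.
  have [j1 hj1] := hz y1; have [j2 hj2] := hz (expr1n _ d.+1).
  (* A quotient of two substitutions needs only one root of unity, so the twist of [p.1] is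
     trivial. *)
  exists ((p.1, j2), (p.2, j1)); split.
  - by case: (p).
  - by apply: le_trans c1 _; rewrite ler_wpM2r // lerDr.
  - by apply: le_trans c2 _; rewrite ler_wpM2r // lerDr.
  move=> a; apply: le_trans (_ : K <= _); last by rewrite lerDr.
  have Z1 : Z j2 = 1%g.
    apply: val_inj; rewrite /= hZ hj2 /zmx; apply/matrixP => b c.
    rewrite !mxE invr1 expr1n mul1r mul1r coefXn eq_sym; congr (_%:R).
  have -> : glval (step twisted (m := 0) ((p.1, j2), (p.2, j1))) =
      invmx (smx n W (v p.1) (w p.1)) *m zmx n W y *m smx n W (v p.2) (w p.2).
    have tE i j : twisted (i, j) = (Z j * S i)%g by [].
    by rewrite -[step _ _]/((twisted (p.1, j2))^-1 * twisted (p.2, j1))%g !tE Z1 mul1g !(glME, glVE) !hS hZ hj1 mulmxA.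
  have := hy a; rewrite -ler_pdivlMr ?exprn_gt0 //; congr (_ <= K * _).
  have -> : W%:Z - N%:Z = - k%:Z by rewrite -subzn ?opprB // (leq_trans Wn).
  by rewrite -exprnN.
have [Ka [Ra [Ka1 Ra1 ha]]] := IH p.1; have [Kb [Rb [Kb1 Rb1 hb]]] := IH p.2.
have Ka0 : 0 <= Ka := le_trans ler01 Ka1; have Kb0 : 0 <= Kb := le_trans ler01 Kb1.
have Ra0 : 0 <= Ra := le_trans ler01 Ra1; have Rb0 : 0 <= Rb := le_trans ler01 Rb1.
pose B := \sum_(q : walk (I * 'I_d.+1)%type m) \sum_a \sum_b `|glval (step twisted q) a b|.
have B0 : 0 <= B by do 3!(apply: sumr_ge0 => ? _).
have hB (q : walk (I * 'I_d.+1)%type m) a : \sum_b `|glval (step twisted q) a b| <= B.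
  apply: le_trans (_ : \sum_a \sum_b `|glval (step twisted q) a b| <= _).
    by rewrite [leRHS](bigD1 a) //= lerDl; do 2!(apply: sumr_ge0 => ? _).
  by rewrite /B [leRHS](bigD1 q) //= lerDl; do 3!(apply: sumr_ge0 => ? _).
pose K := Ka * Kb + Kb ^+ k * Ka + B * Kb.
have t1 : 0 <= Kb ^+ k * Ka by rewrite mulr_ge0 ?exprn_ge0.
have t2 : 0 <= B * Kb by apply: mulr_ge0.
have KK : Ka * Kb <= K by rewrite /K -addrA lerDl addr_ge0.
exists K, (Rb + Ra * Kb); split.
- by apply: le_trans KK; rewrite mulr_ege1.
- by apply: le_trans Rb1 _; rewrite lerDl mulr_ge0.
move=> x x' Rx [y [hxy hyx']].
have x1 : Rb <= `|x| by apply: le_trans Rx; rewrite lerDl mulr_ge0.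
have [qb [qb1 qb2 qb3 qb4]] := hb x y x1 hxy.
have y1 : Ra <= `|y|.
  have h1 : Ra * Kb <= Kb * `|y| by apply: le_trans qb2; apply: le_trans Rx; rewrite lerDr.
  by move: h1; rewrite mulrC ler_pM2l // (lt_le_trans _ Kb1).
have [qa [qa1 qa2 qa3 qa4]] := ha y x' y1 hyx'.
exists (qa, qb); split.
- by rewrite /= qa1 qb1; case: (p).
- apply: le_trans qb2 _; apply: le_trans (_ : Kb * (Ka * `|x'|) <= _); first by rewrite ler_wpM2l.
  by rewrite mulrA [Kb * Ka]mulrC ler_wpM2r.
- apply: le_trans qa3 _; apply: le_trans (_ : Ka * (Kb * `|x|) <= _); first by rewrite ler_wpM2l.
  by rewrite mulrA ler_wpM2r.
move=> a.
have -> : vec n W x' - glval (step twisted (m := m.+1) (qa, qb)) *m vec n W x =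
   (vec n W x' - glval (step twisted qa) *m vec n W y) +
   glval (step twisted qa) *m (vec n W y - glval (step twisted qb) *m vec n W x).
  by rewrite /= /xmul /= mulmxBr addrA subrK mulmxA.
move: (vec n W x' - _) (vec n W y - _) qa4 qb4 => u1 u2 hu1 hu2.
rewrite mxE; apply: le_trans (_ : (`|u1 a ord0| + `|(glval (step twisted qa) *m u2) a ord0|) * `|x| ^+ k <= _).
  by rewrite ler_wpM2r ?exprn_ge0 // ler_normD.
rewrite mulrDl /K -addrA; apply: le_trans (_ : Kb ^+ k * Ka + B * Kb <= _); last by rewrite lerDr mulr_ge0.
apply: lerD.
  apply: le_trans (_ : `|u1 a ord0| * (Kb * `|y|) ^+ k <= _).
    by rewrite ler_wpM2l // lerXn2r ?nnegrE ?mulr_ge0.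
  rewrite exprMn mulrCA ler_wpM2l ?exprn_ge0 //.
rewrite mxE; apply: le_trans (_ : (\sum_b `|glval (step twisted qa) a b| * `|u2 b ord0|) * `|x| ^+ k <= _).
  rewrite ler_wpM2r ?exprn_ge0 //; apply: le_trans (ler_norm_sum _ _ _) _.
  by apply: ler_sum => b _; rewrite normrM.
rewrite mulr_suml; apply: le_trans (_ : \sum_b `|glval (step twisted qa) a b| * Kb <= _).
  by apply: ler_sum => b _; rewrite -mulrA ler_wpM2l.
by rewrite -mulr_suml ler_wpM2r.
Qed.

Lemma poly_away_from_zero (q : {poly C}) : q != 0 -> exists c R, [/\ 0 < c, 1 <= R & forall x, R <= `|x| -> c <= `|q.[x]|].
Proof.
move=> q0; case E: (size q) => [|[|e]]; first by rewrite -size_poly_eq0 E in q0.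
  have [c c0 ->] : exists2 c, c != 0 & q = c%:P by apply/size_poly1P; rewrite E.
  by exists `|c|, 1; split=> //; [rewrite normr_gt0|move=> x _; rewrite hornerC].
have [K [K1 hK]] := horner_lower E; have K0 : 0 < K by apply: lt_le_trans K1.
exists K^-1, K; split=> //; first by rewrite invr_gt0.
move=> x hx; rewrite -[K^-1]mul1r ler_pdivrMr // mulrC; apply: le_trans (hK x hx).
by apply: exprn_ege1; apply: le_trans hx.
Qed.

(** By [walk_asymptotics], for each large [x] some lift fixes [vec x] up to an error of lower order
    than its last entry. A lift [A] other than the identity moves it further: a nonzero row of
    [1 - A], reversed, is a nonzero polynomial in [x], bounded below at infinity, and the rescaling
    by [x ^+ k] leaves one spare factor [x]. As there are finitely many lifts, one [x] defeats them
    all. *)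
Lemma closed_walk_lift m (p : walk I m) : (forall x, chain p x x) ->
  exists p' : walk (I * 'I_d.+1)%type m, proj_walk p' = p /\ step twisted p' = 1%g.
Proof.
move=> hp; apply: contrapT => hno.
have [K [R [K1 R1 hK]]] := walk_asymptotics p.
have K0 : 0 <= K := le_trans ler01 K1.
have /choice [Rq hRq] (q : walk (I * 'I_d.+1)%type m) : exists Rq, 0 <= Rq /\ (step twisted q != 1%g ->
   forall x, Rq <= `|x| -> 1 <= `|x| -> exists a, ~~ (`|(vec n W x - glval (step twisted q) *m vec n W x) a ord0| * `|x| ^+ k <= K)).
  case: (eqVneq (step twisted q) 1%g) => [_|q1]; first by exists 0.
  set A := glval (step twisted q).
  have [a [b ab]] : exists a b, (1%:M - A) a b != 0.
    apply: contrapT => h; case/eqP: q1; apply: val_inj; apply/eqP; rewrite -subr_eq0 -oppr_eq0 opprB.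
    apply/eqP/matrixP => a b; rewrite [RHS]mxE; apply: contrapT => /eqP h'; apply: h; exists a, b.
    exact: h'.
  pose Q := \poly_(i < N) (1%:M - A) a (inord (n - i)).
  have Q0 : Q != 0.
    apply: contraNneq ab => e; have := congr1 (fun p : {poly C} => p`_(n - b)) e.
    rewrite coef0 coef_poly ltnS leq_subr subKn ?inord_val; last by rewrite -ltnS.
    by move=> ->.
  have [c [R' [c0 R'1 hc]]] := poly_away_from_zero Q0.
  have R'0 : 0 <= R' := le_trans ler01 R'1.
  have Kc : 0 <= (K + 1) / c by rewrite divr_ge0 ?addr_ge0 // ltW.
  exists (R' + (K + 1) / c); split=> [|_ x hx x1]; first by rewrite addr_ge0.
  have x0 : 0 < `|x| by apply: lt_le_trans x1.
  have nx0 : x != 0 by rewrite -normr_gt0.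
  have h1 := hc x (le_trans (_ : R' <= _) hx); have {}h1 := h1 ltac:(by rewrite lerDl).
  exists a.
  have -> : `|(vec n W x - A *m vec n W x) a ord0| * `|x| ^+ k = `|Q.[x]| * `|x|.
    rewrite -normrX -!normrM; congr `|_|.
    have -> : vec n W x - A *m vec n W x = (1%:M - A) *m vec n W x by rewrite mulmxBl mul1mx.
    rewrite mxE mulr_suml horner_poly mulr_suml.
    rewrite (reindex_inj rev_ord_inj) /=; apply: eq_bigr => i _.
    have hi : (i <= n)%N by rewrite -ltnS.
    have -> : rev_ord i = inord (n - i) by apply: val_inj; rewrite /= subSS inordK // ltnS leq_subr.
    rewrite [vec _ _ _ _ _]mxE inordK ?ltnS ?leq_subr // -!mulrA; congr (_ * _).
    have e1 : x ^+ W * x ^+ k = x ^+ i * (x ^+ (n - i) * x).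
      by rewrite -exprSr -!exprD addnS !subnKC // (leq_trans Wn).
    rewrite mulrCA e1 mulrCA; congr (_ * _).
    by rewrite mulrA -exprMn mulVf // expr1n mul1r.
  apply/negP => h2.
  have h3 : (K + 1) <= c * `|x|.
    by rewrite mulrC -ler_pdivrMr //; apply: le_trans hx; rewrite lerDr.
  have h4 : K + 1 <= K.
    by apply: le_trans h3 _; apply: le_trans h2; rewrite ler_wpM2r.
  by move: h4; rewrite gerDl ler10.
pose x := R + \sum_q Rq q.
have sR : 0 <= \sum_q Rq q by apply: sumr_ge0 => q _; have [] := hRq q.
have x0 : 0 <= x by rewrite addr_ge0 // (le_trans ler01).
have nx : `|x| = x by rewrite ger0_norm.
have Rx : R <= `|x| by rewrite nx lerDl.
have [p' [p'1 _ _ hp']] := hK x x Rx (hp x).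
have [Rp0 hq] := hRq p'.
case: (eqVneq (step twisted p') 1%g) => [e|ne]; first by apply: hno; exists p'.
have [||a] := hq ne x; last by rewrite hp'.
  rewrite nx /x (bigD1 p') //= addrCA lerDl addr_ge0 // ?(le_trans ler01 R1) //.
  by apply: sumr_ge0 => q _; have [] := hRq q.
exact: le_trans Rx.
Qed.

Lemma card_closed_walks m : (#|[pred p : walk I m | `[< forall x, chain p x x >]]| <= cnt (@step _ _ twisted m) 1%g)%N.
Proof.
rewrite /cnt; apply: leq_trans (_ : #|[seq proj_walk q | q in [pred q | step twisted q == 1%g]]| <= _)%N.
  apply: subset_leq_card; apply/subsetP => p; rewrite inE => /asboolP /closed_walk_lift [q [<- hq]].
  by apply: image_f; rewrite inE hq.
by apply: leq_trans (card_size _) _; rewrite size_map -cardE.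
Qed.
End Chains.

(** * Counting closed walks *)

Section Counting.
Variables (C : numClosedFieldType) (I P : finType) (pol : I -> {poly C}) (d s : nat).
Hypothesis spol : forall i, size (pol i) = d.+2.
Variables (pt : P -> 'I_s.+1 -> C) (ET : finType) (e : I -> P -> option ET).
Hypotheses (pt_inj : forall a, injective (pt a)) (pt0_inj : injective (fun a => pt a ord0)).
Hypothesis he : forall i i' a b t, e i a = Some t -> e i' b = Some t ->
  forall j, (pol i).[pt a j] = (pol i').[pt b j].

(** Counts chains of tuples along a given walk: [e i a] is a code for the values of [pol i] at the
    points [pt a j], and [None] discards the pair. *)
Fixpoint pathcnt (m : nat) : walk I m -> P -> P -> nat :=
  match m with
  | 0 => fun p a b => ((e p.2 a != None) && (e p.2 a == e p.1 b) : nat)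
  | m'.+1 => fun p a c => (\sum_b @pathcnt m' p.2 a b * @pathcnt m' p.1 b c)%N
  end.

Lemma pathcnt_chain m (p : walk I m) a b : (0 < pathcnt p a b)%N -> forall j, chain pol p (pt a j) (pt b j).
Proof.
elim: m p a b => [|m IH] p a c /=.
  case E: (e p.2 a) => [t|] //=; case: eqP => // h _ j; exact: (he E (esym h)).
move=> h j.
have [b hb] : exists b, (0 < pathcnt p.2 a b * pathcnt p.1 b c)%N.
  apply/existsP; rewrite -[X in is_true X]negbK negb_exists; apply: contraL h => /forallP h.
  by rewrite -leqNgt leqn0 sum_nat_eq0; apply/forallP => b; rewrite -leqn0 leqNgt h.
move: hb; rewrite muln_gt0 => /andP[h1 h2].
by exists (pt b j); split; apply: IH.
Qed.

Lemma pathcnt_row m (p : walk I m) a : (\sum_b pathcnt p a b <= d.+1 ^ (2 ^ m))%N.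
Proof.
elim: m p a => [|m IH] p a /=.
  rewrite expn0 expn1; case E: (e p.2 a) => [t|]; last by rewrite big1.
  have -> : (\sum_b (Some t == e p.1 b : nat) = #|[pred b | Some t == e p.1 b]|)%N.
    by rewrite -[RHS]sum1_card [RHS]big_mkcond /=; apply: eq_bigr => b _; rewrite inE; case: (_ == _).
  pose q := pol p.1 - ((pol p.2).[pt a ord0])%:P.
  have sq : size q = d.+2.
    by rewrite size_polyDl spol // size_polyN size_polyC; case: (_ != 0).
  have q0 : q != 0 by rewrite -size_poly_eq0 sq.
  rewrite cardE -(size_map (fun b => pt b ord0)) -ltnS -sq; apply: max_poly_roots => //.
    apply/allP => _ /mapP [b + ->]; rewrite mem_enum inE => /eqP h.
    by rewrite rootE hornerD hornerN hornerC -(he E (esym h)) subrr.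
  by rewrite map_inj_uniq ?enum_uniq.
rewrite exchange_big /= expnS mul2n -addnn expnD.
apply: leq_trans (_ : \sum_b pathcnt p.2 a b * d.+1 ^ 2 ^ m <= _)%N.
  by apply: leq_sum => b _; rewrite -big_distrr /= leq_mul2l IH orbT.
by rewrite -big_distrl /= leq_mul2r IH orbT.
Qed.

Definition paths m a b := (\sum_(p : walk I m) pathcnt p a b)%N.

Lemma pathsS m a c : paths m.+1 a c = (\sum_b paths m a b * paths m b c)%N.
Proof.
rewrite /paths (eq_bigr (fun p : walk I m.+1 => \sum_b pathcnt p.2 a b * pathcnt p.1 b c)%N) // exchange_big.
apply: eq_bigr => b _; rewrite mulnC big_distrl.
rewrite -(pair_bigA _ (fun p1 p2 : walk I m => pathcnt p2 a b * pathcnt p1 b c)%N).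
by apply: eq_bigr => p1 _; rewrite big_distrr; apply: eq_bigr => p2 _; rewrite mulnC.
Qed.

Lemma paths_sym m a b : paths m a b = paths m b a.
Proof.
elim: m a b => [|m IH] a b; last first.
  by rewrite !pathsS; apply: eq_bigr => c _; rewrite mulnC IH (IH a).
rewrite /paths (reindex_inj (inv_inj (_ : involutive (fun p : walk I 0 => (p.2, p.1))))); last by case.
apply: eq_bigr => -[i j] _ /=; rewrite [e j b == e i a]eq_sym.
by case: (e i a =P e j b) => [->|_]; rewrite ?andbF.
Qed.

(** A walk contributes only if it closes up at all [s.+1] points of some tuple, hence identically.
    From a given start each of its [2 ^ m] equations leaves at most [d.+1] choices for the next
    first point, which determines the tuple. *)
Lemma trace_upper m : (2 * chain_degree d m 2 < s.+1)%N ->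
  (\sum_a paths m a a <= #|[pred p : walk I m | `[< forall x, chain pol p x x >]]| * #|P| * d.+1 ^ (2 ^ m))%N.
Proof.
move=> ds; rewrite /paths exchange_big /=.
rewrite -mulnA -[X in (_ <= X)%N]sum_nat_const [X in (_ <= X)%N]big_mkcond /=.
apply: leq_sum => p _; rewrite inE; case: asboolP => [_|hp].
  rewrite -sum_nat_const; apply: leq_sum => a _.
  by apply: leq_trans (pathcnt_row p a); rewrite (bigD1 a) //= leq_addr.
rewrite leqn0 sum_nat_eq0; apply/forallP => a /=; rewrite -leqn0 leqNgt; apply/negP => h.
apply: hp; have hc := pathcnt_chain h.
apply: (chain_closed_everywhere spol (s := [seq pt a j | j <- enum 'I_s.+1])).
- by rewrite map_inj_uniq ?enum_uniq.
- by rewrite size_map size_enum_ord.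
by move=> _ /mapP [j _ ->]; apply: hc.
Qed.

Section Lower.
Variable R : realFieldType.
Local Notation T m a b := ((paths m a b)%:R : R).
Let S m : R := \sum_a \sum_b T m a b.
Local Notation NP := (#|P|%:R : R).

Let S_ge0 m : 0 <= S m.
Proof. by apply: sumr_ge0 => a _; apply: sumr_ge0. Qed.

Let S_step m : S m ^+ 2 <= NP * S m.+1.
Proof.
have -> : S m.+1 = \sum_b (\sum_c T m b c) ^+ 2.
  rewrite /S (eq_bigr (fun a => \sum_c \sum_b T m a b * T m b c)); last first.
    by move=> a _; apply: eq_bigr => c _; rewrite pathsS natr_sum; apply: eq_bigr => b _; rewrite natrM.
  rewrite (eq_bigr (fun a => \sum_b T m a b * \sum_c T m b c)); last first.
    by move=> a _; rewrite exchange_big; apply: eq_bigr => b _; rewrite mulr_sumr.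
  rewrite exchange_big; apply: eq_bigr => b _ /=; rewrite -mulr_suml expr2; congr (_ * _).
  by apply: eq_bigr => a _; rewrite paths_sym.
exact: sum_sqr_ge.
Qed.

(** The matrix [paths m] is symmetric and [paths m.+1] is its square. Cauchy-Schwarz bounds the sum
    of its entries at each squaring; in the last one, the sum of squared entries is the trace of the
    next matrix. *)
Lemma trace_lower m : (0 < #|P|)%N -> (0 < m)%N ->
  (\sum_a \sum_b T 0 a b) ^+ (2 ^ m) <= NP ^+ (2 ^ m) * \sum_a T m a a.
Proof.
move=> P0; have NP0 : 0 < NP by rewrite ltr0n.
have hS k : S 0 ^+ (2 ^ k) * NP <= NP ^+ (2 ^ k) * S k.
  elim: k => [|k IH]; first by rewrite expn0 !expr1 mulrC.
  rewrite -(ler_pM2r NP0).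
  apply: le_trans (_ : (S 0 ^+ (2 ^ k) * NP) ^+ 2 <= _).
    by rewrite exprMn -exprM -expnSr expr2 mulrA.
  apply: le_trans (_ : (NP ^+ (2 ^ k) * S k) ^+ 2 <= _).
    by rewrite lerXn2r ?nnegrE ?mulr_ge0 ?exprn_ge0 // ltW.
  rewrite exprMn -exprM -expnSr -mulrA ler_wpM2l ?exprn_ge0 ?(ltW NP0) // mulrC.
  by apply: le_trans (S_step k) _; rewrite mulrC.
case: m => // m _; rewrite -/(S 0).
have tr : S m ^+ 2 <= NP ^+ 2 * \sum_a T m.+1 a a.
  have h := sum_sqr_ge (fun p : P * P => T m p.1 p.2).
  have e1 : \sum_p T m p.1 p.2 = S m by rewrite /S pair_bigA.
  have e2 : \sum_p T m p.1 p.2 ^+ 2 = \sum_a T m.+1 a a.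
    rewrite -(pair_bigA _ (fun a b => T m a b ^+ 2)) /=; apply: eq_bigr => a _.
    by rewrite pathsS natr_sum; apply: eq_bigr => b _; rewrite natrM expr2 {2}paths_sym.
  by rewrite e1 e2 card_prod natrM -expr2 in h.
have NP2 : 0 < NP ^+ 2 by apply: exprn_gt0.
rewrite -(ler_pM2r NP2).
apply: le_trans (_ : (S 0 ^+ (2 ^ m) * NP) ^+ 2 <= _).
  by rewrite exprMn -exprM -expnSr.
apply: le_trans (_ : (NP ^+ (2 ^ m) * S m) ^+ 2 <= _).
  by rewrite lerXn2r ?nnegrE ?mulr_ge0 ?exprn_ge0 // ltW.
rewrite exprMn -exprM -expnSr -mulrA ler_wpM2l ?exprn_ge0 ?(ltW NP0) //.
by apply: le_trans tr _; rewrite mulrC.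
Qed.

(** Cauchy-Schwarz over the codes: [paths 0 a b] counts pairs of indices giving the same code at [a]
    and at [b]. *)
Lemma start_lower : (#|[pred p : I * P | e p.1 p.2 != None]|%:R) ^+ 2 <= #|ET|%:R * \sum_a \sum_b T 0 a b.
Proof.
pose h t (p : I * P) : R := (e p.1 p.2 == Some t)%:R.
have -> : \sum_a \sum_b T 0 a b = \sum_t (\sum_p h t p) ^+ 2.
  pose g t a := \sum_i h t (i, a).
  have hg t : \sum_p h t p = \sum_a g t a.
    by rewrite /g exchange_big pair_bigA; apply: eq_bigr => -[].
  rewrite (eq_bigr (fun t => \sum_a \sum_b g t a * g t b)); last first.
    by move=> t _; rewrite hg expr2 mulr_suml; apply: eq_bigr => a _; rewrite mulr_sumr.
  rewrite [RHS]exchange_big; apply: eq_bigr => a _; rewrite [RHS]exchange_big; apply: eq_bigr => b _.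
  rewrite (eq_bigr (fun t => \sum_i2 \sum_i1 h t (i2, b) * h t (i1, a))); last first.
    by move=> t _; rewrite /g mulrC mulr_suml; apply: eq_bigr => i2 _; rewrite mulr_sumr.
  rewrite [RHS]exchange_big (eq_bigr (fun i2 => \sum_i1 \sum_t h t (i2, b) * h t (i1, a))); last first.
    by move=> i2 _; rewrite exchange_big.
  rewrite pair_bigA /paths natr_sum; apply: eq_bigr => -[i2 i1] _ /=.
  rewrite /h /=; case E: (e i1 a) => [t|] /=; last by rewrite big1 // => t _; rewrite mulr0.
  rewrite (bigD1 t) //= eqxx mulr1 big1 ?addr0 => [|t' tt']; first by rewrite eq_sym.
  by rewrite (_ : Some t == Some t' = false) ?mulr0 //; apply/eqP => -[] ett; rewrite ett eqxx in tt'.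
have -> : #|[pred p : I * P | e p.1 p.2 != None]|%:R = \sum_t \sum_p h t p.
  rewrite exchange_big /= -sum1_card natr_sum big_mkcond /=; apply: eq_bigr => -[i a] _ /=.
  rewrite inE /= /h /=; case E: (e i a) => [t|] /=; last by rewrite big1.
  rewrite (bigD1 t) //= eqxx big1 ?addr0 // => t' tt'.
  by rewrite (_ : Some t == Some t' = false) //; apply/eqP => -[] ett; rewrite ett eqxx in tt'.
exact: sum_sqr_ge.
Qed.

Lemma closed_walks_lower m : (0 < #|P|)%N -> (0 < m)%N -> (2 * chain_degree d m 2 < s.+1)%N ->
  (#|[pred p : I * P | e p.1 p.2 != None]|%:R ^+ 2) ^+ (2 ^ m) <=
  (#|ET|%:R * NP * d.+1%:R) ^+ (2 ^ m) * (#|[pred p : walk I m | `[< forall x, chain pol p x x >]]|%:R * NP) :> R.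
Proof.
move=> P0 m0 ds; have NP0 : 0 <= NP by [].
apply: le_trans (_ : (#|ET|%:R * \sum_a \sum_b T 0 a b) ^+ (2 ^ m) <= _).
  by rewrite lerXn2r ?nnegrE ?exprn_ge0 ?mulr_ge0 ?start_lower // -/(S 0).
rewrite !exprMn -!mulrA ler_wpM2l ?exprn_ge0 //.
apply: le_trans (trace_lower P0 m0) _; rewrite ler_wpM2l ?exprn_ge0 //.
have := trace_upper ds; rewrite -(ler_nat R) natr_sum !natrM natrX.
by rewrite [X in _ -> _ <= X]mulrC.
Qed.
End Lower.
End Counting.

(** * Planar geometry *)

Section SeqExtrema.
Variables (R : realDomainType) (T : eqType).

Lemma seq_argmax (s : seq T) (F : T -> R) : s != [::] -> exists2 x, x \in s & forall y, y \in s -> F y <= F x.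
Proof.
elim: s => // a [|b s] IH _; first by exists a; rewrite ?mem_head // => y; rewrite inE => /eqP ->.
have [//|x xs hx] := IH; case: (lerP (F x) (F a)) => h.
  exists a; first exact: mem_head.
  by move=> y; rewrite inE => /orP[/eqP -> //|/hx h']; apply: le_trans h.
exists x; first by rewrite inE xs orbT.
by move=> y; rewrite inE => /orP[/eqP ->|/hx //]; apply: ltW.
Qed.

Lemma seq_argmin (s : seq T) (F : T -> R) : s != [::] -> exists2 x, x \in s & forall y, y \in s -> F x <= F y.
Proof.
move=> /(seq_argmax (fun x => - F x)) [x xs hx]; exists x => // y /hx.
by rewrite lerN2.
Qed.

Lemma sub_count_in (X : seq T) (p q : pred T) : (forall x, x \in X -> p x -> q x) -> (count p X <= count q X)%N.
Proof.
elim: X => //= a X IH h; apply: leq_add; last by apply: IH => x xX; apply: h; rewrite inE xX orbT.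
by have := h a (mem_head _ _); case: (p a) => // ->.
Qed.

Lemma count_lt_exists (p q : pred T) (s : seq T) : (count q s < count p s)%N ->
  exists x, [/\ x \in s, p x & ~~ q x].
Proof.
move=> h; case: (boolP (has (fun x => p x && ~~ q x) s)) => [/hasP [x xs /andP[]]|]; first by exists x.
rewrite -all_predC => /allP h'; move: h; rewrite ltnNge => /negP []; apply: sub_count_in => x xs px.
by have := h' x xs; rewrite /= px /= negbK.
Qed.

Lemma size_le_count (s X : seq T) (p : pred T) : uniq s -> {subset s <= X} -> (forall x, x \in s -> p x) ->
  (size s <= count p X)%N.
Proof.
move=> us sX sp; rewrite -size_filter; apply: uniq_leq_size => // x xs.
by rewrite mem_filter sp // sX.
Qed.

End SeqExtrema.

Section Plane.
Variable R : realType.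
Local Notation C := R[i].
Implicit Types (x y z b : C) (X Y A : seq C).

(** The modulus with values in [R]: the order of [R[i]] is partial, and radii must be comparable. *)
Definition nrm x : R := ComplexField.Normc.normc x.
Definition dist x y : R := nrm (x - y).

Lemma nrm_ge0 x : 0 <= nrm x.
Proof. by case: x => a b; apply: sqrtr_ge0. Qed.

Lemma nrmM x y : nrm (x * y) = nrm x * nrm y.
Proof. exact: ComplexField.Normc.normcM. Qed.

Lemma nrmN x : nrm (- x) = nrm x.
Proof. by case: x => a b; rewrite /nrm /= !sqrrN. Qed.

Lemma nrmD x y : nrm (x + y) <= nrm x + nrm y.
Proof. exact: (@le_normcD R x y). Qed.

Lemma nrm0 : nrm 0 = 0. Proof. exact: ComplexField.Normc.normc0. Qed.
Lemma nrm1 : nrm 1 = 1. Proof. exact: ComplexField.Normc.normc1. Qed.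

Lemma nrm_eq0 x : (nrm x == 0) = (x == 0).
Proof. by apply/eqP/eqP => [|->]; [exact: ComplexField.Normc.eq0_normc|exact: nrm0]. Qed.

Lemma nrmX x n : nrm (x ^+ n) = nrm x ^+ n.
Proof. by elim: n => [|n IH]; [rewrite !expr0 nrm1|rewrite !exprS nrmM IH]. Qed.

Lemma nrm_real (r : R) : nrm (r%:C%C) = `|r|.
Proof. by rewrite /nrm /= expr0n /= addr0 sqrtr_sqr. Qed.

Lemma nrm_Re x : `|complex.Re x| <= nrm x.
Proof.
case: x => a b; rewrite /nrm /= -(sqrtr_sqr a); apply: ler_wsqrtr.
by rewrite lerDl sqr_ge0.
Qed.

Lemma nrm_Im x : `|complex.Im x| <= nrm x.
Proof.
case: x => a b; rewrite /nrm /= -(sqrtr_sqr b); apply: ler_wsqrtr.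
by rewrite lerDr sqr_ge0.
Qed.

Lemma nrm_le x : nrm x <= `|complex.Re x| + `|complex.Im x|.
Proof.
case: x => a b; rewrite /nrm /= -[leRHS]ger0_norm ?addr_ge0 // -sqrtr_sqr; apply: ler_wsqrtr.
rewrite sqrrD !real_normK ?num_real // -addrA lerD2l lerDr mulrn_wge0 // mulr_ge0 //.
Qed.

Lemma dist_ge0 x y : 0 <= dist x y. Proof. exact: nrm_ge0. Qed.
Lemma dist_sym x y : dist x y = dist y x. Proof. by rewrite /dist -nrmN opprB. Qed.
Lemma distxx x : dist x x = 0. Proof. by rewrite /dist subrr nrm0. Qed.
Lemma dist_eq0 x y : (dist x y == 0) = (x == y). Proof. by rewrite nrm_eq0 subr_eq0. Qed.
Lemma dist_tri y x z : dist x z <= dist x y + dist y z.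
Proof. by rewrite /dist -(subrKA y) nrmD. Qed.
Lemma dist_gt0 x y : (0 < dist x y) = (x != y).
Proof. by rewrite lt0r dist_eq0 dist_ge0 andbT. Qed.

Definition ann z (r1 r2 : R) : pred C := fun x => (r1 <= dist x z) && (dist x z <= r2).

(** The enlargement by 5 leaves room for the triangle inequalities of [linked_count]; [transport]
    controls the image annulus with the same factor. *)
Definition linked X (m : nat) b b' := exists z (r1 r2 : R),
  [/\ 0 < r1, ann z r1 r2 b, ann z r1 r2 b' & (count (ann z (r1 / 5%:R) (5%:R * r2)) X <= m)%N].

(* Among annuli through [b], those whose large disc is sparse are controlled by the farthest
   partner; the others have dense, hence pairwise meeting, cores, and an extremal one captures
   all the partners lying outside (resp. inside) its core. *)
Lemma linked_count X m b : uniq X -> (count (fun b' => `[< linked X m b b' >])%R X <= 4 * m)%N.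
Proof.
move=> uX; rewrite -size_filter; set L := filter _ _.
have uL : uniq L by apply: filter_uniq.
have LX : {subset L <= X} by move=> x; rewrite mem_filter => /andP[].
have /choice [Z hZ] (b' : C) : exists p : C * (R * R), b' \in L ->
    [/\ 0 < p.2.1, ann p.1 p.2.1 p.2.2 b, ann p.1 p.2.1 p.2.2 b' &
     (count (ann p.1 (p.2.1 / 5%:R) (5%:R * p.2.2)) X <= m)%N].
  case: (boolP (b' \in L)) => [|_]; last by exists (0, (0, 0)).
  by rewrite mem_filter => /andP[/asboolP [z [r1 [r2 h]]] _]; exists (z, (r1, r2)).
pose z b' := (Z b').1; pose r1 b' := (Z b').2.1; pose r2 b' := (Z b').2.2.
have h0 b' : b' \in L -> [/\ 0 < r1 b', r1 b' <= dist b (z b') <= r2 b', r1 b' <= dist b' (z b') <= r2 b' &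
   (count (ann (z b') (r1 b' / 5%:R) (5%:R * r2 b')) X <= m)%N] by move=> /hZ.
pose sparse b' := (count (fun x => dist x (z b') <= 5%:R * r2 b')%R X <= 2 * m)%N.
pose outer b' := dist b (z b') <= dist b' (z b').
have core b' : b' \in L -> ~~ sparse b' -> (m < count (fun x => dist x (z b') < r1 b' / 5%:R)%R X)%N.
  move=> bL; rewrite -ltnNge => hs; have [_ _ _ hc] := h0 _ bL.
  have : (count (fun x => dist x (z b') <= 5%:R * r2 b')%R X <=
    count (fun x => dist x (z b') < r1 b' / 5%:R)%R X + count (ann (z b') (r1 b' / 5%:R)%R (5%:R * r2 b')%R) X)%N.
    rewrite -count_predUI; apply: leq_trans (leq_addr _ _); apply: sub_count => x /= hx.
    by rewrite /ann hx andbT; case: ltrP.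
  by move=> h1; have := leq_trans hs h1; lia.
have meet b1 b2 : b1 \in L -> b2 \in L -> ~~ sparse b1 -> ~~ sparse b2 ->
   dist (z b1) (z b2) <= (r1 b1 + r1 b2) / 5%:R.
  move=> L1 L2 n1 n2.
  have [p1 /andP[a1 a1'] _ c1] := h0 _ L1; have [p2 /andP[a2 a2'] _ c2] := h0 _ L2.
  have [x [_ /= x1 x2]] := count_lt_exists (leq_ltn_trans c2 (core _ L1 n1)).
  have [y [_ /= y1 y2]] := count_lt_exists (leq_ltn_trans c1 (core _ L2 n2)).
  move: x2 y2; rewrite /ann !negb_and -!ltNge.
  have tx := dist_tri x (z b1) (z b2); rewrite (dist_sym (z b1) x) in tx.
  have ty := dist_tri y (z b1) (z b2); rewrite (dist_sym (z b1) y) in ty.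
  case/orP=> hx; first by lra.
  case/orP=> hy; first by lra.
  have t1 := dist_tri b x (z b2); have t2 := dist_tri (z b1) x b; rewrite (dist_sym (z b1) b) in t2.
  have t3 := dist_tri b y (z b1); have t4 := dist_tri (z b2) y b; rewrite (dist_sym (z b2) b) in t4.
  by lra.
clearbody L.
have -> : size L = (count sparse L + (count [predI predC sparse & outer] L + count [predI predC sparse & predC outer] L))%N.
  rewrite -(count_predC sparse L); congr (_ + _)%N.
  by rewrite -size_filter -(count_predC outer) !count_filter; congr (_ + _)%N; apply: eq_count => x /=; rewrite andbC.
have S1 : (count sparse L <= 2 * m)%N.
  rewrite -size_filter; case: (eqVneq (filter sparse L) [::]) => [-> //|/(seq_argmax (fun b' => dist b' b)) [b1]].
  rewrite mem_filter => /andP[s1 L1] hmax.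
  apply: leq_trans s1; apply: size_le_count; first exact: filter_uniq.
    by move=> x; rewrite mem_filter => /andP[_ /LX].
  move=> x xs; have hx := hmax x xs.
  have [p1 /andP[a1 a1'] /andP[a2 a2'] _] := h0 _ L1.
  have t1 := dist_tri b x (z b1); have t2 := dist_tri (z b1) b1 b; rewrite (dist_sym (z b1) b) in t2.
  by lra.
have S2 : (count [predI predC sparse & outer] L <= m)%N.
  rewrite -size_filter; case: (eqVneq (filter [predI predC sparse & outer] L) [::]) => [-> //|].
  move/(seq_argmax (fun b' => dist b' (z b'))) => [b1].
  rewrite mem_filter => /andP[/= /andP[n1 o1] L1] hmax.
  have [p1 /andP[a1 a1'] /andP[a2 a2'] c1] := h0 _ L1.
  apply: leq_trans c1; apply: size_le_count; first exact: filter_uniq.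
    by move=> x; rewrite mem_filter => /andP[_ /LX].
  move=> x xs; have hx := hmax x xs; move: xs; rewrite mem_filter => /andP[/= /andP[nx ox] Lx].
  have [q1 /andP[d1 d1'] /andP[d2 d2'] _] := h0 _ Lx.
  have hm := meet _ _ L1 Lx n1 nx; have {}o1 : dist b (z b1) <= dist b1 (z b1) := o1.
  have {}ox : dist b (z x) <= dist x (z x) := ox.
  have t1 := dist_tri (z x) x (z b1); have t2 := dist_tri (z b1) x (z x); have t3 := dist_tri (z x) b (z b1).
  rewrite (dist_sym (z x) (z b1)) in t1 t3.
  by rewrite /ann; apply/andP; split; lra.
have S3 : (count [predI predC sparse & predC outer] L <= m)%N.
  rewrite -size_filter; case: (eqVneq (filter [predI predC sparse & predC outer] L) [::]) => [-> //|].
  move/(seq_argmin (fun b' => dist b' (z b'))) => [b1].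
  rewrite mem_filter => /andP[/= /andP[n1 o1] L1] hmin.
  have [p1 /andP[a1 a1'] /andP[a2 a2'] c1] := h0 _ L1.
  apply: leq_trans c1; apply: size_le_count; first exact: filter_uniq.
    by move=> x; rewrite mem_filter => /andP[_ /LX].
  move=> x xs; have hx := hmin x xs; move: xs; rewrite mem_filter => /andP[/= /andP[nx ox] Lx].
  have [q1 /andP[d1 d1'] /andP[d2 d2'] _] := h0 _ Lx.
  have hm := meet _ _ L1 Lx n1 nx; have {}o1 : dist b1 (z b1) < dist b (z b1) by rewrite ltNge; exact: o1.
  have {}ox : dist x (z x) < dist b (z x) by rewrite ltNge; exact: ox.
  have t1 := dist_tri (z x) x (z b1); have t2 := dist_tri (z b1) x (z x); have t3 := dist_tri (z b1) b (z x).
  rewrite (dist_sym (z x) (z b1)) in t1.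
  by rewrite /ann; apply/andP; split; lra.
lia.
Qed.

(** Greedy covering: among the balls holding [m1] remaining points take one of least radius, record
    its centre and delete its points. A rich ball that is no longer rich afterwards has lost a point
    to this ball of no larger radius, so the two centres are within twice its own radius. *)
Lemma vitali A m1 : (0 < m1)%N -> exists Y, [/\ {subset Y <= A}, (m1 * size Y <= size A)%N &
  forall a r, a \in A -> (m1 <= count (fun x => dist x a <= r)%R A)%N -> exists2 y, y \in Y & dist a y <= 2%:R * r].
Proof.
move=> m10.
suff gen k A' : (size A' <= k)%N -> {subset A' <= A} -> exists Y, [/\ {subset Y <= A}, (m1 * size Y <= size A')%N &
  forall a r, a \in A -> (m1 <= count (fun x => dist x a <= r)%R A')%N -> exists2 y, y \in Y & dist a y <= 2%:R * r].
  exact: (gen (size A) A).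
elim: k A' => [|k IH] A' sk sA.
  exists [::]; split=> //; first by rewrite muln0.
  by move: sk; rewrite leqn0 size_eq0 => /eqP -> a r _ /=; rewrite leqNgt m10.
pose cand := [seq p <- [seq (a, x) | a <- A, x <- A'] | (m1 <= count (fun x => dist x p.1 <= dist p.2 p.1)%R A')%N].
have candP a r : a \in A -> (m1 <= count (fun x => dist x a <= r)%R A')%N -> exists2 x, (a, x) \in cand & dist x a <= r.
  move=> aA hr.
  have ne : filter (fun x => dist x a <= r) A' != [::].
    by rewrite -size_eq0 size_filter -lt0n; apply: leq_trans hr.
  have [x xs hx] := seq_argmax (fun x => dist x a) ne.
  move: (xs); rewrite mem_filter => /andP[xr xA]; exists x => //.
  rewrite mem_filter /= allpairs_f // andbT; apply: leq_trans hr _; apply: sub_count_in => y yA' yr.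
  by apply: hx; rewrite mem_filter yr.
case: (eqVneq cand [::]) => [e|ne].
  exists [::]; split=> //; first by rewrite muln0.
  by move=> a r aA hr; have [x] := candP a r aA hr; rewrite e.
have [[a0 x0] + hmin] := seq_argmin (fun p : C * C => dist p.2 p.1) ne.
rewrite mem_filter /= => /andP[h0 /allpairsP [[u v] [/= uA vA' [e1 e2]]]].
rewrite -{}e1 in uA; rewrite -{}e2 in vA'; set r0 := dist x0 a0 in h0 hmin.
pose A'' := filter (fun x => ~~ (dist x a0 <= r0)) A'.
have sA'' : (size A'' + count (fun x => dist x a0 <= r0)%R A' = size A')%N.
  by rewrite size_filter addnC; apply: count_predC.
have [||Y [YA sY hY]] := IH A''.
- by lia.
- by move=> x; rewrite mem_filter => /andP[_ /sA].
exists (a0 :: Y); split.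
- by move=> y; rewrite inE => /orP[/eqP ->|/YA].
- by rewrite /= mulnS; lia.
move=> a r aA hr; have [x xc xr] := candP a r aA hr; have rr := hmin _ xc; rewrite /= in rr.
case: (leqP m1 (count (fun x => dist x a <= r)%R A'')) => [/(hY a r aA) [y yY hy]|hlt].
  by exists y => //; rewrite inE yY orbT.
exists a0; first exact: mem_head.
have : (count (fun x => (dist x a <= r) && ~~ (dist x a0 <= r0))%R A' < count (fun x => dist x a <= r)%R A')%N.
  apply: leq_trans hr; move: hlt; rewrite count_filter; apply: leq_trans; rewrite ltnS.
  by apply: sub_count => y.
move/count_lt_exists => [y [_ /= y1]]; rewrite y1 /= negbK => y2.
have t := dist_tri y a a0; rewrite (dist_sym a y) in t; lra.
Qed.

(* Farthest-point ordering: [lam q] is the distance of [q] to the points listed before it. *)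
Lemma gonzalez Y : uniq Y -> exists lam : C -> R, forall ball : pred C,
  (exists y1 y2, [/\ y1 \in Y, y2 \in Y, ball y1, ball y2 & y1 != y2]) ->
  exists q w, [/\ q \in Y, w \in Y, ball q, ball w & 0 < lam q <= dist q w] /\
    forall y, y \in Y -> exists u, [/\ u \in Y, dist y u <= lam q & ball u -> u = w].
Proof.
suff gen k U V : (size V <= k)%N -> U != [::] -> uniq (U ++ V) -> exists lam : C -> R, forall ball : pred C,
    (forall u u', u \in U -> u' \in U -> ball u -> ball u' -> u = u') ->
    (exists y1 y2, [/\ y1 \in U ++ V, y2 \in U ++ V, ball y1, ball y2 & y1 != y2]) ->
    exists q w, [/\ q \in V, w \in U ++ V, ball q, ball w & 0 < lam q <= dist q w] /\
    forall y, y \in U ++ V -> exists u, [/\ u \in U ++ V, dist y u <= lam q & ball u -> u = w].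
  case: Y => [|y0 Y] uY; first by exists (fun=> 0) => ball [y1 [y2 []]].
  have [lam hlam] := gen (size Y) [:: y0] Y (leqnn _) isT uY.
  exists lam => ball hb; have [|q [w [[q1 q2 q3 q4 q5] h]]] := hlam ball _ hb.
    by move=> u u'; rewrite !inE => /eqP -> /eqP ->.
  by exists q, w; split=> //; split=> //; rewrite inE q1 orbT.
elim: k U V => [|k IH] U V sV U0 uUV.
  exists (fun=> 0) => ball h1 [y1 [y2 [y1U y2U b1 b2 ne]]].
  have V0 : V = [::] by apply/eqP; rewrite -size_eq0 -leqn0.
  by rewrite V0 cats0 in y1U y2U; rewrite (h1 y1 y2) ?eqxx in ne.
case: (eqVneq V [::]) => [V0|V0].
  exists (fun=> 0) => ball h1 [y1 [y2 [y1U y2U b1 b2 ne]]].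
  by rewrite V0 cats0 in y1U y2U; rewrite (h1 y1 y2) ?eqxx in ne.
have /choice [near hnear] (v : C) : exists u, u \in U /\ forall u', u' \in U -> dist v u <= dist v u'.
  by have [u uU hu] := seq_argmin (dist v) U0; exists u.
have [v vV hv] := seq_argmax (fun v => dist v (near v)) V0.
have perm : perm_eq (U ++ V) ((v :: U) ++ rem v V).
  by rewrite -cat1s -catA perm_sym perm_catCA perm_cat2l /= perm_sym perm_to_rem.
have memUV y : (y \in U ++ V) = (y \in (v :: U) ++ rem v V) by apply: perm_mem.
have [|//||lam hlam] := IH (v :: U) (rem v V).
- by rewrite size_rem //; case: (V) sV vV => // a s; rewrite /= ltnS.
- by rewrite -(perm_uniq perm).
have vU : v \notin U.
  move: uUV; rewrite cat_uniq => /and3P [_ /hasPn h _]; exact: h vV.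
have uV : uniq V by move: uUV; rewrite cat_uniq => /and3P [].
exists (fun q => if q == v then dist v (near v) else lam q) => ball h1 hb.
case: (boolP (ball v && has ball U)) => [/andP[bv /hasP [w wU bw]]|hno].
  exists v, w; rewrite eqxx; have [nU nmin] := hnear v; split.
    split=> //; first by rewrite mem_cat wU.
    by rewrite nmin // dist_gt0 andbT; apply: contraNneq vU => ->.
  move=> y; rewrite mem_cat => /orP[yU|yV].
    exists y; split; [by rewrite mem_cat yU|by rewrite distxx dist_ge0|by move=> by_; apply: h1].
  exists (near y); have [nyU _] := hnear y; split; [by rewrite mem_cat nyU|exact: hv|].
  by move=> bn; apply: h1.
have h1' u u' : u \in v :: U -> u' \in v :: U -> ball u -> ball u' -> u = u'.
  move: hno; rewrite negb_and => /orP hno.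
  rewrite !inE => /orP[/eqP ->|uU] /orP[/eqP ->|u'U] bu bu' //; last exact: h1.
    by case: hno => [/negP //|/hasPn /(_ u' u'U) /negP].
  by case: hno => [/negP //|/hasPn /(_ u uU) /negP].
have [|q [w [[q1 q2 q3 q4 q5] h]]] := hlam ball h1'.
  by case: hb => y1 [y2 [a1 a2 a3 a4 a5]]; exists y1, y2; split; rewrite -?memUV.
have qv : (q == v) = false.
  by apply: contraTF q1 => /eqP ->; rewrite mem_rem_uniq // inE eqxx.
exists q, w; rewrite qv; split.
  by split=> //; [exact: mem_rem q1|rewrite memUV].
move=> y; rewrite memUV => /h [u [u1 u2 u3]]; exists u; split=> //; by rewrite memUV.
Qed.
End Plane.

Lemma count_predU_le (T : Type) (p q : pred T) (s : seq T) :
  (count (predU p q) s <= count p s + count q s)%N.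
Proof. by rewrite -count_predUI leq_addr. Qed.

(** * Packing by grid cells *)

Section Packing.
Variable R : realType.
Local Notation C := R[i].
Implicit Types (x y z q : C) (X Y A : seq C).

(** Cells of side [tau / 2], so that two points of one cell are within [tau]; the shift by [2 * K]
    keeps the truncated number nonnegative when [r] is at most [K * tau] in absolute value. *)
Definition grid (K : nat) (tau r : R) : nat := Num.truncn (r / (tau / 2%:R) + 2%:R * K%:R).
Definition cell (K : nat) q (tau : R) x : nat * nat :=
  (grid K tau (complex.Re (x - q)), grid K tau (complex.Im (x - q))).

Lemma grid_lt K (tau r : R) : 0 < tau -> `|r| <= K%:R * tau -> (grid K tau r < (4 * K).+1)%N.
Proof.
move=> t0; rewrite ler_norml => /andP[h1 h2]; rewrite ltnS truncn_le_nat.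
have t2 : 0 < tau / 2%:R by rewrite divr_gt0.
have : r / (tau / 2%:R) <= 2%:R * K%:R by rewrite ler_pdivrMr //; lra.
rewrite (_ : (4 * K).+1%:R = 4%:R * K%:R + 1 :> R) -?natrM ?natr1 //; lra.
Qed.

Lemma grid_eq K (tau r r' : R) : 0 < tau -> `|r| <= K%:R * tau -> `|r'| <= K%:R * tau ->
  grid K tau r = grid K tau r' -> `|r - r'| <= tau / 2%:R.
Proof.
move=> t0 h h'; have t2 : 0 < tau / 2%:R by rewrite divr_gt0.
have pos u : `|u| <= K%:R * tau -> 0 <= u / (tau / 2%:R) + 2%:R * K%:R.
  rewrite ler_norml => /andP[h1 h2].
  have : - (2%:R * K%:R) <= u / (tau / 2%:R) by rewrite ler_pdivlMr //; lra.
  by lra.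
rewrite /grid => e; have := truncn_itv (pos _ h); have := truncn_itv (pos _ h').
rewrite -e; move: (Num.truncn _) => n /andP[a1 a2] /andP[b1 b2].
have : `|(r - r') / (tau / 2%:R)| <= 1.
  move: a2 b2; rewrite -natr1 mulrBl ler_norml => a2 b2; apply/andP; split; lra.
rewrite normrM [X in _ * X]gtr0_norm ?invr_gt0 // ler_pdivrMr ?mul1r //.
Qed.

Lemma cell_range K q (tau : R) x : 0 < tau -> dist x q <= K%:R * tau ->
  cell K q tau x \in [seq (i, j) | i <- iota 0 (4 * K).+1, j <- iota 0 (4 * K).+1].
Proof.
move=> t0 h; apply/allpairsP; exists (cell K q tau x).
by split=> //; rewrite mem_iota add0n leq0n; apply: grid_lt => //; apply: le_trans h; [exact: nrm_Re|exact: nrm_Im].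
Qed.

Lemma cell_close K q (tau : R) x y : 0 < tau -> dist x q <= K%:R * tau -> dist y q <= K%:R * tau ->
  cell K q tau x = cell K q tau y -> dist x y <= tau.
Proof.
move=> t0 hx hy [e1 e2]; apply: le_trans (nrm_le _) _.
have d1 := grid_eq t0 (le_trans (nrm_Re _) hx) (le_trans (nrm_Re _) hy) e1.
have d2 := grid_eq t0 (le_trans (nrm_Im _) hx) (le_trans (nrm_Im _) hy) e2.
move: d1 d2; rewrite -!raddfB /= !opprB !addrA !subrK; lra.
Qed.

Lemma packing K m1 q (tau : R) X : 0 < tau -> (forall x, x \in X -> dist x q <= K%:R * tau) ->
  (forall x, x \in X -> (count (fun x' => dist x' x <= tau)%R X <= m1)%N) ->
  (size X <= m1 * (4 * K).+1 ^ 2)%N.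
Proof.
move=> t0 hX hm.
have -> : ((4 * K).+1 ^ 2 = size [seq (i, j) | i <- iota 0 (4 * K).+1, j <- iota 0 (4 * K).+1])%N.
  by rewrite size_allpairs !size_iota expnS expn1.
apply: (@size_le_fibre _ _ _ (cell K q tau)).
  by apply/allP => x xX; apply: cell_range => //; apply: hX.
move=> y _; case: (boolP (has (fun t => cell K q tau t == y) X)) => [/hasP [x xX /eqP ex]|].
  apply: leq_trans (hm x xX); apply: sub_count_in => x' x'X /eqP ex'.
  by apply: (@cell_close K q); rewrite ?hX ?ex.
by rewrite has_count -leqNgt => h; apply: leq_trans h _.
Qed.
End Packing.

(** * Annuli that are rich but sparse after enlargement *)

Section Annuli.
Variable R : realType.
Local Notation C := R[i].
Implicit Types (x y z q : C) (X Y : seq C).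
Variables (A Y : seq C) (s m1 M1 : nat).
Hypothesis M10 : (0 < M1)%N.
Hypothesis vit : forall a (r : R), a \in A -> (m1 <= count (fun x => dist x a <= r)%R A)%N ->
  exists2 y, y \in Y & dist a y <= 2%:R * r.

Definition in_annulus m a := exists z (r1 r2 : R), [/\ 0 < r1, ann z r1 r2 a,
  (s < count (ann z r1 r2) A)%N & (count (ann z (r1 / M1%:R) (M1%:R * r2)) A <= m)%N].

(** Seen from [x], the part of [Y] in a large disc about [q] is a cluster of radius [2 * l], much
    smaller than the distance of [x]. *)
Definition lone q (l : R) x := [/\ 0 < dist x q, 4%:R * M1%:R * l <= dist x q &
  forall y, y \in Y -> dist y q <= 2%:R * M1%:R * dist x q -> dist y q <= 2%:R * l].

(** A small disc with more than [m1] points of [A] in this annulus would, by [vit], have a point of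
    [Y] nearby, in the region around [q] that [lone] leaves free. So small discs are poor and
    [packing] applies. *)
Lemma lone_pack q l x0 : lone q l x0 ->
  (count (ann q (dist x0 q / M1%:R) (M1%:R * dist x0 q)) A <= m1 * (4 * (8 * M1 ^ 2)).+1 ^ 2)%N.
Proof.
move=> [p0 p1 p2]; rewrite -size_filter; set X := filter _ _.
have M1R : 1 <= M1%:R :> R by rewrite ler1n.
have M0 : 0 < M1%:R :> R by rewrite ltr0n.
have t0 : 0 < dist x0 q / (8%:R * M1%:R) by rewrite divr_gt0 // mulr_gt0.
apply: (@packing R _ m1 q (dist x0 q / (8%:R * M1%:R)) X t0).
  move=> x; rewrite mem_filter => /andP[/andP[_ hx] _]; apply: le_trans hx _.
  rewrite natrM natrX le_eqVlt; apply/orP; left; apply/eqP; field.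
  by rewrite gt_eqF.
move=> x xX; move: (xX); rewrite mem_filter => /andP[/andP[hx1 hx2] xA].
rewrite leqNgt; apply/negP => /ltnW hlt.
have [|y yY hy] := vit (r := dist x0 q / (8%:R * M1%:R)) xA.
  apply: leq_trans hlt _; rewrite /X count_filter; apply: sub_count => x' /=.
  by case/andP.
have e1 : 2%:R * (dist x0 q / (8%:R * M1%:R)) = (dist x0 q / M1%:R) / 4%:R.
  by field; rewrite gt_eqF.
rewrite e1 in hy; have tr := dist_tri x y q; rewrite (dist_sym y x) in tr.
have tr' := dist_tri y x q.
set u := dist x0 q / M1%:R in hx1 hx2 hy e1.
have u0 : 0 < u by rewrite divr_gt0.
have eu : dist x0 q = M1%:R * u by rewrite mulrC divfK // gt_eqF.
have le1 : u <= M1%:R * u by rewrite ler_peMl // ltW.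
have le2 : M1%:R * u <= M1%:R * (M1%:R * u) by rewrite ler_pM2l.
have : dist y q <= 2%:R * l.
  apply: p2 => //; rewrite eu; rewrite eu in hx2; lra.
move=> hyl.
have : 4%:R * l <= u.
  by rewrite -(ler_pM2l M0) -eu mulrCA mulrA.
lra.
Qed.

(** Widen the annulus from the distance of [a] until more than [s] lone points are collected. All
    points of [A] met on the way are themselves lone, so at most [s] of them lie strictly inside the
    outer radius; the two enlarged rims are poor by [lone_pack]. *)
Lemma lone_annulus q l a : a \in A -> lone q l a ->
  (s < count (fun x => `[< lone q l x >] && (dist a q <= dist x q)%R) A)%N ->
  in_annulus (s + 2 * (m1 * (4 * (8 * M1 ^ 2)).+1 ^ 2)) a.
Proof.
move=> aA la hs; have M1R : 1 <= M1%:R :> R by rewrite ler1n.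
have M0 : 0 < M1%:R :> R by rewrite ltr0n.
set X := filter (fun x => `[< lone q l x >] && (dist a q <= dist x q)%R) A.
pose cand := filter (fun x => (s < count (fun x' => dist x' q <= dist x q)%R X)%N) X.
have X0 : X != [::].
  by apply: contraTneq hs => e; rewrite -size_filter -/X e.
have [xm xmX hxm] := seq_argmax (fun x => dist x q) X0.
have c0 : cand != [::].
  apply: contraTneq xmX => e; have : xm \notin cand by rewrite e.
  rewrite mem_filter negb_and => /orP[|//]; rewrite -leqNgt => h.
  suff : (s < count (fun x' => dist x' q <= dist xm q)%R X)%N by rewrite ltnNge h.
  apply: leq_trans hs _; rewrite -size_filter -/X -(count_predT X).
  by apply: sub_count_in => x xX _; apply: hxm.
have [x1 + hx1] := seq_argmin (fun x => dist x q) c0.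
rewrite mem_filter => /andP[cx1 x1X]; move: (x1X); rewrite mem_filter => /andP[/andP[/asboolP l1 a1] x1A].
have [a0 a4 aY] := la; have [b0 b4 bY] := l1.
exists q, (dist a q), (dist x1 q); split=> //; first by rewrite /ann lexx a1.
  apply: leq_trans cx1 _; rewrite /X count_filter; apply: sub_count_in => x xA /= /andP[h1 /andP[_ h2]].
  by rewrite /ann h2.
have inX x : x \in A -> (dist a q <= dist x q)%R -> (dist x q <= dist x1 q)%R -> x \in X.
  move=> xA h1 h2; rewrite mem_filter xA h1 !andbT; apply/asboolP; split.
  - by apply: lt_le_trans a0 h1.
  - by apply: le_trans a4 h1.
  - move=> y yY hy; apply: bY => //; apply: le_trans hy _; rewrite ler_pM2l //; lra.
have few : (count (fun x => dist a q <= dist x q < dist x1 q)%R A <= s)%N.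
  rewrite leqNgt; apply/negP => hgt.
  have [z0|z0] := eqVneq (filter (fun x => dist a q <= dist x q < dist x1 q)%R A) [::].
    by move: hgt; rewrite -size_filter z0.
  have [x2 + hx2] := seq_argmax (fun x => dist x q) z0.
  rewrite mem_filter => /andP[/andP[h1 h2] x2A].
  have x2X : x2 \in X by apply: inX => //; apply: ltW.
  have : x2 \in cand.
    rewrite mem_filter x2X andbT; apply: leq_trans hgt _.
    rewrite /X count_filter; apply: sub_count_in => x xA /= hx; have /andP[h3 h4] := hx.
    rewrite hx2; last by rewrite mem_filter hx xA.
    by have := inX x xA h3 (ltW h4); rewrite mem_filter => /andP[].
  by move/hx1; rewrite leNgt h2.
have hp1 := lone_pack la; have hp2 := lone_pack l1.
have : (count (ann q (dist a q / M1%:R) (M1%:R * dist x1 q)) A <=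
   count (fun x => dist a q <= dist x q < dist x1 q)%R A +
   (count (ann q (dist a q / M1%:R) (M1%:R * dist a q)) A +
   count (ann q (dist x1 q / M1%:R) (M1%:R * dist x1 q)) A))%N.
  apply: leq_trans (_ : _ <= count (predU (fun x => dist a q <= dist x q < dist x1 q)%R
    (predU (ann q (dist a q / M1%:R) (M1%:R * dist a q)) (ann q (dist x1 q / M1%:R) (M1%:R * dist x1 q)))) A)%N _.
    apply: sub_count => x /andP[h1 h2] /=; rewrite /ann h1 h2 andbT /=.
    have i1 : dist a q <= M1%:R * dist a q by rewrite ler_peMl // ltW.
    have i2 : dist x1 q / M1%:R <= dist x1 q by rewrite ler_pdivrMr // ler_peMr // ltW.
    case: (leP (dist a q) (dist x q)) => [h3|h3] /=; last by rewrite (le_trans (ltW h3)).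
    case: (ltP (dist x q) (dist x1 q)) => [//|h4] /=; by rewrite (le_trans i2) // orbT.
  by apply: leq_trans (count_predU_le _ _ _) _; rewrite leq_add2l; apply: count_predU_le.
move=> h; apply: leq_trans h _; rewrite mul2n -addnn; apply: leq_add few _; exact: leq_add.
Qed.

Lemma lone_bad q l (B : seq C) m : (s + 2 * (m1 * (4 * (8 * M1 ^ 2)).+1 ^ 2) <= m)%N ->
  uniq B -> {subset B <= A} -> (forall a, a \in B -> ~ in_annulus m a) ->
  (forall a, a \in B -> lone q l a) -> (size B <= s)%N.
Proof.
move=> hm uB BA bad hl; case: (eqVneq B [::]) => [-> //|B0].
have [a aB ha] := seq_argmin (fun x => dist x q) B0.
rewrite leqNgt; apply/negP => hs; apply: (bad a aB).
have [|z [r1 [r2 [h1 h2 h3 h4]]]] := lone_annulus (BA a aB) (hl a aB).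
  apply: leq_trans hs _; apply: size_le_count => // x xB; rewrite ha // andbT; apply/asboolP; exact: hl.
by exists z, r1, r2; split=> //; apply: leq_trans h4 hm.
Qed.

(** A cluster of diameter [tau] lies in an annulus centred at distance [2 * tau] from one of its
    points. The enlarged annulus lies in a disc that is poor, since otherwise [vit] would place a
    point of [Y] too close. *)
Lemma cell_bad (tau : R) (B : seq C) m : (m1 <= m)%N -> 0 < tau ->
  uniq B -> {subset B <= A} -> (forall a, a \in B -> ~ in_annulus m a) ->
  (forall a, a \in B -> forall y, y \in Y -> 2%:R * (3%:R * M1%:R + 2%:R) * tau < dist a y) ->
  (forall a b, a \in B -> b \in B -> dist a b <= tau) -> (size B <= s)%N.
Proof.
move=> hm t0 uB BA bad far close; case: B uB BA bad far close => [//|a B] uB BA bad far close.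
rewrite leqNgt; apply/negP => hs; have aB : a \in a :: B by rewrite mem_head.
apply: (bad a aB).
have za : dist a (a + 2%:R * tau%:C%C) = 2%:R * tau.
  rewrite /dist opprD addrA subrr add0r nrmN nrmM nrm_real gtr0_norm //; congr (_ * _).
  have -> : (2%:R : C) = (2%:R : R)%:C%C by rewrite rmorph_nat.
  by rewrite nrm_real gtr0_norm.
exists (a + 2%:R * tau%:C%C), tau, (3%:R * tau); split=> //.
- by rewrite /ann za; apply/andP; split; lra.
- apply: leq_trans hs _; apply: size_le_count => // x xB; have cx := close _ _ xB aB.
  have t1 := dist_tri x a (a + 2%:R * tau%:C%C); have t2 := dist_tri a x (a + 2%:R * tau%:C%C).
  rewrite za in t1 t2; rewrite (dist_sym a x) in t1.
  by rewrite /ann; apply/andP; split; lra.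
apply: leq_trans hm; rewrite leqNgt; apply/negP => /ltnW hlt.
have [|y yY hy] := vit (r := (3%:R * M1%:R + 2%:R) * tau) (BA a aB).
  apply: leq_trans hlt _; apply: sub_count => x /andP[_ h].
  have t1 := dist_tri (a + 2%:R * tau%:C%C) x a; rewrite (dist_sym (a + 2%:R * tau%:C%C) a) za in t1.
  by rewrite mulrDl -mulrA [_ * (_ * tau)]mulrCA; lra.
have := far a aB y yY; lra.
Qed.
End Annuli.

Section GoodAnnuli.
Variable R : realType.
Local Notation C := R[i].
Variables (s M1 : nat).
Hypothesis M10 : (0 < M1)%N.

(** [lam q / E] is the diameter of the cells, small enough for [cell_bad], and [K2] of these cover
    the relevant disc about [q]. The list [tags] enumerates the ways a point can be attached to some
    [q] in [Y], and [m1] is large enough for the exceptional points to fill at most half of [A]. *)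
Let E := (8 * (3 * M1 + 2) * (4 * M1 + 3))%N.
Let K2 := (16 * M1 * (4 * M1 + 3) * E)%N.
Let tags : seq (bool + nat * nat) :=
  [:: inl true; inl false] ++ [seq inr p | p <- [seq (i, j) | i <- iota 0 (4 * K2).+1, j <- iota 0 (4 * K2).+1]].
Let m1 := (2 * (1 + s * (2 + (4 * K2).+1 ^ 2)))%N.
Let m := maxn m1 (s + 2 * (m1 * (4 * (8 * M1 ^ 2)).+1 ^ 2)).

Let size_tags : size tags = (2 + (4 * K2).+1 ^ 2)%N.
Proof. by rewrite size_cat size_map size_allpairs !size_iota expnS expn1. Qed.

Let ER0 : E%:R = 8%:R * (3%:R * M1%:R + 2%:R) * (4%:R * M1%:R + 3%:R) :> R.
Proof. by rewrite -!natrM -!natrD -!natrM. Qed.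

Let K2R0 : K2%:R = 16%:R * M1%:R * (4%:R * M1%:R + 3%:R) * E%:R :> R.
Proof. by rewrite -!natrM -!natrD -!natrM. Qed.

Definition key_prop (Y : seq C) (lam : C -> R) (k : C * (bool + nat * nat)) (a : C) : Prop :=
  match k.2 with
  | inl b => lone Y M1 k.1 (if b then 0 else lam k.1) a
  | inr p => [/\ 0 < lam k.1, dist a k.1 <= K2%:R * (lam k.1 / E%:R), cell K2 k.1 (lam k.1 / E%:R) a = p &
     forall y, y \in Y -> 2%:R * (3%:R * M1%:R + 2%:R) * (lam k.1 / E%:R) < dist a y]
  end.

(* Either all points of [Y] within [(4 M1 + 2) d] of [a] are close to the nearest one, at distance [d],
   and [a] sees [Y] as one isolated cluster, or the Gonzalez radius is comparable with [d]. *)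
Lemma key_exists (Y : seq C) : uniq Y -> Y != [::] -> exists lam : C -> R, forall a, a \notin Y ->
  exists2 k, k \in [seq (q, t) | q <- Y, t <- tags] & key_prop Y lam k a.
Proof.
move=> uY Y0; have [lam hlam] := gonzalez uY; exists lam => a aY.
have M1R : 1 <= M1%:R :> R by rewrite ler1n.
have [yn ynY hyn] := seq_argmin (fun y => dist y a) Y0.
have d0 : 0 < dist yn a by rewrite dist_gt0; apply: contraNneq aY => <-.
set d := dist yn a in hyn d0; set X : R := M1%:R in M1R *.
have E0 : 0 < E%:R :> R by rewrite ltr0n /E !muln_gt0 !addn_gt0 !orbT.
have ER : E%:R = 8%:R * (3%:R * X + 2%:R) * (4%:R * X + 3%:R) :> R := ER0.
have K2R : K2%:R = 16%:R * X * (4%:R * X + 3%:R) * E%:R :> R := K2R0.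
have Xd : d <= X * d by rewrite ler_peMl // ltW.
case: (boolP (has (fun y => (dist y a <= (4%:R * X + 2%:R) * d) && (d < 8%:R * X * dist y yn)) Y)) => [|/hasPn near].
  case/hasP => y1 y1Y /andP[y1a y1n].
  have [|q [w [[qY wY qb wb /andP[l0 lqw]] hq]]] := hlam (fun y => dist y a <= (4%:R * X + 3%:R) * d).
    exists yn, y1; split=> //; rewrite -/d; try lra.
    apply: contraTneq y1n => <-; rewrite distxx mulr0 -leNgt; exact: ltW.
  have lup : lam q <= 2%:R * (4%:R * X + 3%:R) * d.
    have t1 := dist_tri a q w; rewrite (dist_sym a w) in t1; rewrite /= in qb wb; lra.
  have llow : d <= 16%:R * X * lam q.
    case: (lerP d (lam q)) => [h|h].
      have := ler_peMl (ltW l0) M1R; lra.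
    have [u [_ u2 u3]] := hq yn ynY; have [v [_ v2 v3]] := hq y1 y1Y.
    have eu : u = w.
      by apply: u3 => /=; have t1 := dist_tri yn u a; rewrite (dist_sym u yn) -/d in t1; lra.
    have ev : v = w.
      by apply: v3 => /=; have t1 := dist_tri y1 v a; rewrite (dist_sym v y1) in t1; lra.
    have t1 := dist_tri w y1 yn; rewrite (dist_sym w yn) in t1; rewrite eu in u2; rewrite ev in v2.
    have : X * dist y1 yn <= X * (lam q + lam q) by rewrite ler_pM2l; lra.
    lra.
  have aq : dist a q <= K2%:R * (lam q / E%:R).
    rewrite K2R -mulrA [E%:R * _]mulrC divfK ?gt_eqF //.
    rewrite /= in qb; rewrite dist_sym; apply: le_trans qb _.
    have : (4%:R * X + 3%:R) * d <= (4%:R * X + 3%:R) * (16%:R * X * lam q) by rewrite ler_pM2l //; lra.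
    lra.
  exists (q, inr (cell K2 q (lam q / E%:R) a)).
    apply: allpairs_f => //; rewrite mem_cat; apply/orP; right; apply: map_f; apply: cell_range => //; exact: divr_gt0.
  split=> //=.
  move=> y yY; rewrite dist_sym; apply: lt_le_trans (hyn y yY).
  have -> : 2%:R * (3%:R * M1%:R + 2%:R) * (lam q / E%:R) = lam q / (4%:R * (4%:R * X + 3%:R)).
    rewrite ER -/X; field; apply/andP; split; rewrite gt_eqF //; lra.
  by rewrite ltr_pdivrMr ?mulr_gt0 //; lra.
have {}near y : y \in Y -> dist y a <= (4%:R * X + 2%:R) * d -> 8%:R * X * dist y yn <= d.
  by move=> yY h; have := near y yY; rewrite h /= -leNgt.
case: (boolP (has (fun y => (dist y a <= (4%:R * X + 2%:R) * d) && (y != yn)) Y)) => [|/hasPn single].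
  case/hasP => y1 y1Y /andP[y1a y1n].
  have [|q [w [[qY wY qb wb /andP[l0 lqw]] hq]]] := hlam (fun y => dist y a <= (4%:R * X + 2%:R) * d).
    by exists yn, y1; split=> //; rewrite -/d; [lra|rewrite eq_sym].
  have nq := near q qY qb; have nw := near w wY wb.
  have t1 := dist_tri yn q w; rewrite (dist_sym yn w) in t1.
  have qd : d <= dist a q by rewrite dist_sym hyn.
  have qup : dist a q <= d + dist q yn.
    by have t2 := dist_tri yn a q; rewrite (dist_sym a yn) (dist_sym yn q) -/d in t2.
  have x1 := ler_peMl (dist_ge0 q yn) M1R; have x2 := ler_peMl (ltW l0) M1R.
  have x3 : X * lam q <= X * (dist q yn + dist w yn) by rewrite ler_pM2l; lra.
  have x4 : X * dist a q <= X * (d + dist q yn) by rewrite ler_pM2l; lra.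
  exists (q, inl false); first by apply: allpairs_f => //; rewrite mem_cat !inE.
  split=> /=; [lra|rewrite -/X; lra|].
  move=> y yY hy; rewrite -/X in hy.
  have [u [_ u2 u3]] := hq y yY; have [v [_ v2 v3]] := hq q qY.
  have ev : v = w.
    by apply: v3 => /=; have t2 := dist_tri q v a; rewrite (dist_sym v q) (dist_sym q a) in t2; lra.
  have eu : u = w.
    apply: u3 => /=; have t2 := dist_tri y u a; have t3 := dist_tri q y a.
    rewrite (dist_sym u y) in t2; rewrite (dist_sym q a) in t3; lra.
  rewrite eu in u2; rewrite ev in v2.
  have t2 := dist_tri w y q; rewrite (dist_sym w q) in t2; lra.
exists (yn, inl true); first by apply: allpairs_f => //; rewrite mem_cat !inE.
split=> /=; [by rewrite dist_sym|by rewrite mulr0 dist_ge0|].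
move=> y yY; rewrite -/X (dist_sym a) -/d => hy; have := single y yY.
have t1 := dist_tri yn y a; rewrite -/d in t1.
rewrite (_ : _ <= _) /= ?negbK; last by lra.
by move/eqP ->; rewrite distxx mulr0.
Qed.

(** By [lone_bad] and [cell_bad] at most [s] bad points outside [Y] share a key. So the bad points
    number at most [1 + s * size tags] times the size of [Y], which the choice of [m1] keeps below
    half of [A]. *)
Theorem good_annuli : exists m', forall A : seq C, uniq A -> (m' <= size A)%N ->
  (size A <= 2 * count (fun a => `[< in_annulus A s M1 m' a >]) A)%N.
Proof.
exists m => A uA mA; have m10 : (0 < m1)%N by rewrite muln_gt0.
have [Y0 [Y0A sY0 hY0]] := @vitali R A m1 m10.
pose Y := undup Y0; have uY : uniq Y by apply: undup_uniq.
have sY : (m1 * size Y <= size A)%N by apply: leq_trans sY0; rewrite leq_mul2l size_undup orbT.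
have vit a (r : R) : a \in A -> (m1 <= count (fun x => dist x a <= r)%R A)%N ->
  exists2 y, y \in Y & dist a y <= 2%:R * r.
  by move=> aA /(hY0 a r aA) [y yY hy]; exists y => //; rewrite mem_undup.
have Yn : Y != [::].
  have m1A : (m1 <= size A)%N by apply: leq_trans mA; rewrite leq_maxl.
  case: (A) m1A vit => [|a A'] m1A vit; first by move: m1A; rewrite leqNgt m10.
  have [x xA hx] := seq_argmax (fun x => dist x a) (isT : a :: A' != [::]).
  have [||y] := vit a (dist x a) _ _; rewrite ?mem_head //; last by case: (Y).
  rewrite -(count_predT (a :: A')) in m1A.
  by apply: leq_trans m1A _; apply: sub_count_in => x' /hx.
have [lam hlam] := key_exists uY Yn.
have /choice [key hkey] (a : C) : exists k, a \notin Y ->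
    k \in [seq (q, t) | q <- Y, t <- tags] /\ key_prop Y lam k a.
  case: (boolP (a \in Y)) => [_|/hlam [k k1 k2]]; first by exists (0, inl true).
  by exists k.
pose bad := [pred a | ~~ `[< in_annulus A s M1 m a >]].
pose Bd := filter (fun a => bad a && (a \notin Y)) A.
have sBd : (size Bd <= s * size [seq (q, t) | q <- Y, t <- tags])%N.
  apply: (@size_le_fibre _ _ Bd key).
    by apply/allP => a; rewrite mem_filter => /andP[/andP[_ aY] _]; have [] := hkey a aY.
  move=> [q t] _; rewrite -size_filter; set B := filter _ Bd.
  have BP a : a \in B -> [/\ a \in A, ~ in_annulus A s M1 m a & key_prop Y lam (q, t) a].
    rewrite !mem_filter => /andP[/eqP <- /andP[/andP[/asboolPn ba aY] aA]]; split=> //.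
    by have [] := hkey a aY.
  have uB : uniq B by rewrite !filter_uniq.
  have BA : {subset B <= A} by move=> a /BP [].
  have Bb a : a \in B -> ~ in_annulus A s M1 m a by move=> /BP [].
  have Bk a : a \in B -> key_prop Y lam (q, t) a by move=> /BP [].
  case: t @B BP uB BA Bb Bk => [b|p] B BP uB BA Bb Bk.
    by apply: (@lone_bad R A Y s m1 M1 M10 vit q (if b then 0 else lam q) B m _ uB BA Bb) => //; rewrite leq_maxr.
  have E0 : 0 < E%:R :> R by rewrite ltr0n /E !muln_gt0 !addn_gt0 !orbT.
  case: (eqVneq B [::]) => [-> //|B0]; have [a0 a0B _] := seq_argmin (fun=> 0 : R) B0.
  have t0 : 0 < lam q / E%:R by have [l0 _ _ _] := Bk a0 a0B; exact: divr_gt0.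
  apply: (@cell_bad R A Y s m1 M1 vit (lam q / E%:R) B m _ t0 uB BA Bb).
  - by rewrite leq_maxl.
  - by move=> a /Bk [].
  by move=> a b /Bk [_ a1 a2 _] /Bk [_ b1 b2 _]; apply: (@cell_close _ K2 q); rewrite //= a2.
have cb : (count bad A <= size Y + size Bd)%N.
  rewrite size_filter; apply: leq_trans (_ : _ <= count (predU (mem Y) (fun a => bad a && (a \notin Y))) A)%N _.
    by apply: sub_count => a /= ->; case: (a \in Y).
  apply: leq_trans (count_predU_le _ _ _) _; rewrite leq_add2r -size_filter.
  by apply: uniq_leq_size; rewrite ?filter_uniq // => a; rewrite mem_filter => /andP[].
have cA := count_predC bad A.
have -> : count (fun a => `[< in_annulus A s M1 m a >]) A = count (predC bad) A.
  by apply: eq_count => a; rewrite /= negbK.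
move: sBd; rewrite size_allpairs size_tags; move: (2 + _)%N @m1 sY => N0 m1' sY sBd.
move: (size Y) (size Bd) sY sBd cb cA => y b; rewrite /m1'.
move: (count bad A) (count (predC bad) A) (size A) => u v w h1 h2 h3 h4.
lia.
Qed.
End GoodAnnuli.

#[global] Arguments nrm : simpl never.
#[global] Arguments dist : simpl never.

(** * Polynomials on annuli free of critical points *)

Section Transport.
Variable R : realType.
Local Notation C := R[i].
Implicit Types (x y z s : C) (p : {poly C}).

Lemma nrm_sum (I : Type) (r : seq I) (P : pred I) (F : I -> C) :
  nrm (\sum_(i <- r | P i) F i) <= \sum_(i <- r | P i) nrm (F i).
Proof.
elim/big_ind2: _ => [|x1 x2 y1 y2 h1 h2|//]; first by rewrite nrm0.
by apply: le_trans (nrmD _ _) _; apply: lerD.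
Qed.

Lemma nrmMn x n : nrm (x *+ n) = n%:R * nrm x.
Proof.
rewrite -[x *+ n]mulr_natl nrmM; congr (_ * _).
have -> : (n%:R : C) = (n%:R : R)%:C%C by rewrite rmorph_nat.
by rewrite nrm_real ger0_norm.
Qed.

Lemma nrmB_ge x y : nrm x - nrm y <= nrm (x - y).
Proof. by rewrite lerBlDr; have := nrmD (x - y) y; rewrite subrK. Qed.

(** A Newton polygon condition: for moduli between [r] and [T] the monomial of degree [e] majorises
    every other one up to the factor [B]. The two inequalities are the instances at the ends of the
    range and imply those between. *)
Definition dominant p e (B r T : R) := [/\ p`_e != 0,
  forall k, (k <= e)%N -> nrm p`_k <= B * nrm p`_e * r ^+ (e - k) &
  forall k, (e <= k)%N -> nrm p`_k * T ^+ (k - e) <= B * nrm p`_e].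

Definition lshift p k : C := if k is k'.+1 then p`_k' else 0.

Lemma coefM_XsubC p s k : (p * ('X - s%:P))`_k = lshift p k - p`_k * s.
Proof. by rewrite mulrBr coefB coefMX coefMC; case: k. Qed.

Lemma dominant_small_root p e B r T s : 0 < r -> 1 <= B -> 2%:R * B * r <= T ->
  dominant p e B r T -> nrm s < r -> dominant (p * ('X - s%:P)) e.+1 (4%:R * B) r T.
Proof.
move=> r0 B1 rT [pe lo hi] sr; set N := nrm p`_e in lo hi; set t := nrm s in sr.
have N0 : 0 < N by rewrite lt0r nrm_ge0 nrm_eq0 pe.
have t0 : 0 <= t by apply: nrm_ge0.
have rT1 : r <= B * r by rewrite ler_peMl // ltW.
have T0 : 0 < T by lra.
have BN : N <= B * N by rewrite ler_peMl // ltW.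
have h1 : nrm p`_e.+1 * t <= N / 2%:R.
  have h := hi e.+1 (leqnSn _); rewrite subSnn expr1 in h.
  have h' : nrm p`_e.+1 * t <= nrm p`_e.+1 * r by rewrite ler_wpM2l ?nrm_ge0 // ltW.
  rewrite -(ler_pM2r T0); apply: le_trans (_ : B * N * r <= _).
    apply: le_trans (_ : nrm p`_e.+1 * r * T <= _); first by rewrite ler_pM2r.
    by rewrite mulrAC ler_pM2r.
  have : N * (2%:R * B * r) <= N * T by rewrite ler_pM2l.
  lra.
have eq1 : N <= 2%:R * nrm (p * ('X - s%:P))`_e.+1.
  rewrite coefM_XsubC /=; have := nrmB_ge p`_e (p`_e.+1 * s); rewrite nrmM -/t -/N; lra.
set Q := nrm _ in eq1; have BNQ u : 0 <= u -> 2%:R * (B * N * u) <= 4%:R * B * Q * u.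
  move=> u0; have -> : 2%:R * (B * N * u) = 2%:R * (N * (B * u)) by ring.
  have -> : 4%:R * B * Q * u = 2%:R * (2%:R * Q * (B * u)) by ring.
  rewrite ler_pM2l // ler_wpM2r //; apply: mulr_ge0 => //; lra.
split.
- rewrite -nrm_eq0; rewrite -/Q gt_eqF //; lra.
- move=> k ke; rewrite coefM_XsubC; apply: le_trans (nrmD _ _) _; rewrite nrmN nrmM -/t.
  apply: le_trans (_ : B * N * r ^+ (e.+1 - k) + B * N * r ^+ (e.+1 - k) <= _); last first.
    by have := BNQ (r ^+ (e.+1 - k)); rewrite mulr2n mulrDl mul1r; apply; rewrite exprn_ge0 // ltW.
  apply: lerD.
    case: k ke => [|k] ke /=; last by rewrite subSS lo.
    by rewrite nrm0 mulr_ge0 ?exprn_ge0 ?mulr_ge0 //; lra.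
  move: ke; rewrite leq_eqVlt => /orP[/eqP ->|ke]; first by rewrite subnn expr0 mulr1; lra.
  rewrite ltnS in ke; rewrite subSn // exprSr mulrA; apply: ler_pM; rewrite ?nrm_ge0 ?lo //; exact: ltW.
- case=> // j; rewrite ltnS => ej; rewrite subSS coefM_XsubC /=.
  have Tj : 0 <= T ^+ (j - e) by rewrite exprn_ge0 // ltW.
  apply: le_trans (_ : (nrm p`_j + nrm p`_j.+1 * t) * T ^+ (j - e) <= _).
    by rewrite ler_wpM2r //; apply: le_trans (nrmD _ _) _; rewrite nrmN nrmM.
  have := BNQ 1 ler01; rewrite !mulr1; apply: le_trans; rewrite mulrDl mulr2n mulrDl mul1r.
  apply: lerD; first exact: hi.
  have h := hi j.+1 (leqW ej); rewrite subSn // exprS mulrA in h; apply: le_trans h.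
  by rewrite ler_wpM2r // ler_wpM2l ?nrm_ge0 //; lra.
Qed.

Lemma dominant_large_root p e B r T s : 0 < r -> 1 <= B -> 2%:R * B * r <= T ->
  dominant p e B r T -> T < nrm s -> dominant (p * ('X - s%:P)) e (4%:R * B) r T.
Proof.
move=> r0 B1 rT [pe lo hi] sT; set N := nrm p`_e in lo hi; set t := nrm s in sT.
have N0 : 0 < N by rewrite lt0r nrm_ge0 nrm_eq0 pe.
have rT1 : r <= B * r by rewrite ler_peMl // ltW.
have T0 : 0 < T by lra.
have t0 : 0 < t by lra.
have BN : N <= B * N by rewrite ler_peMl // ltW.
have sh k : (k <= e)%N -> nrm (lshift p k) <= B * N * r * r ^+ (e - k).
  case: k => [|k] ke /=; first by rewrite nrm0 !mulr_ge0 ?exprn_ge0 //; lra.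
  by have := lo k (ltnW ke); rewrite -(subnSK ke) exprS mulrA.
have BNr : B * N * r <= N * t / 2%:R.
  have : N * (2%:R * B * r) <= N * t by rewrite ler_pM2l //; lra.
  lra.
have eq1 : t * N <= 2%:R * nrm (p * ('X - s%:P))`_e.
  have h := sh e (leqnn _); rewrite subnn expr0 mulr1 in h.
  rewrite coefM_XsubC -opprB nrmN; have := nrmB_ge (p`_e * s) (lshift p e); rewrite nrmM -/t -/N; lra.
have tN0 : 0 < t * N by rewrite mulr_gt0.
set Q := nrm _ in eq1; have BNQ u : 0 <= u -> 2%:R * (B * N * t * u) <= 4%:R * B * Q * u.
  move=> u0; have -> : 2%:R * (B * N * t * u) = 2%:R * (t * N * (B * u)) by ring.
  have -> : 4%:R * B * Q * u = 2%:R * (2%:R * Q * (B * u)) by ring.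
  rewrite ler_pM2l // ler_wpM2r //; apply: mulr_ge0 => //; lra.
split.
- rewrite -nrm_eq0; rewrite -/Q gt_eqF //; lra.
- move=> k ke; rewrite coefM_XsubC; apply: le_trans (nrmD _ _) _; rewrite nrmN nrmM -/t.
  have rk : 0 <= r ^+ (e - k) by rewrite exprn_ge0 // ltW.
  have := BNQ _ rk; apply: le_trans; rewrite mulr2n mulrDl mul1r; apply: lerD.
    apply: le_trans (sh k ke) _; rewrite ler_wpM2r // ler_wpM2l ?mulr_ge0 //; lra.
  by rewrite [_ * t * _]mulrAC ler_wpM2r ?lo // ltW.
- move=> k ek; rewrite coefM_XsubC.
  have Tk : 0 <= T ^+ (k - e) by rewrite exprn_ge0 // ltW.
  apply: le_trans (_ : (nrm (lshift p k) + nrm p`_k * t) * T ^+ (k - e) <= _).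
    by rewrite ler_wpM2r //; apply: le_trans (nrmD _ _) _; rewrite nrmN nrmM.
  have := BNQ 1 ler01; rewrite !mulr1; apply: le_trans; rewrite mulrDl mulr2n mulrDl mul1r.
  apply: lerD; last by rewrite mulrAC ler_wpM2r ?hi // ltW.
  move: ek; rewrite leq_eqVlt => /orP[/eqP ek|ek].
    rewrite -ek subnn expr0 mulr1; have h := sh e (leqnn _); rewrite subnn expr0 mulr1 in h.
    apply: le_trans h _; rewrite ler_wpM2l ?mulr_ge0 //; lra.
  case: k ek {Tk} => // j; rewrite ltnS => ej /=; rewrite subSn // exprSr mulrA.
  apply: ler_pM; rewrite ?hi ?mulr_ge0 ?exprn_ge0 ?nrm_ge0 //; lra.
Qed.

(** Multiply in the roots one at a time: a root of modulus below [r] raises the dominant degree by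
    one, a root of modulus above [T] keeps it, and either costs a factor 4. *)
Lemma dominant_exists n p r T : size p = n.+1 -> 0 < r -> 2%:R * 4%:R ^+ n * r <= T ->
  (forall x, root p x -> ~~ (r <= nrm x <= T)) -> exists e, dominant p e (4%:R ^+ n) r T.
Proof.
elim: n p => [|n IH] p sp r0 rT hp.
  have [c cn0 ->] := size_poly1P _ (introT eqP sp).
  exists 0%N; split; first by rewrite coefC.
    by move=> k; rewrite leqn0 => /eqP ->; rewrite mul1r subnn expr0 mulr1.
  move=> [|k] _; first by rewrite expr0 mul1r mulr1.
  by rewrite coefC /= nrm0 mul0r mul1r nrm_ge0.
have [s ps] : exists s, root p s by apply/closed_rootP; rewrite sp.
have [q eq] := factor_theorem p s ps; have pn0 : p != 0 by rewrite -size_poly_eq0 sp.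
have qn0 : q != 0 by apply: contraNneq pn0 => q0; rewrite eq q0 mul0r.
have sq : size q = n.+1.
  by move: sp; rewrite eq size_Mmonic ?monicXsubC // size_XsubC addn2 => -[].
have B1 : 1 <= 4%:R ^+ n :> R by rewrite exprn_ege1 // ler1n.
have rT' : 2%:R * 4%:R ^+ n * r <= T.
  apply: le_trans rT; rewrite ler_pM2r // ler_pM2l // exprS; lra.
have [|e he] := IH q sq r0 rT'.
  by move=> x qx; apply: hp; rewrite eq rootM qx.
have := hp s ps; rewrite negb_and -!ltNge => /orP[sr|sT].
  by exists e.+1; rewrite eq exprS; apply: dominant_small_root.
by exists e; rewrite eq exprS; apply: dominant_large_root.
Qed.

(** The hypothesis available concerns critical points, hence the derivative; integration keeps the
    dominance once the constant term is removed, the factors [k.+1] costing at most [n.+1]. *)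
Lemma dominant_antideriv (g : {poly C}) e B r T n : 0 < r -> 0 <= B -> size g = n.+2 -> 0 < T ->
  dominant g^`() e B r T -> dominant (g - (g`_0)%:P) e.+1 (n.+1%:R * B) r T.
Proof.
move=> r0 B0 sg T0 [pe lo hi].
have cE k : (g - (g`_0)%:P)`_k.+1 = g`_k.+1 by rewrite coefB coefC subr0.
have c0 : (g - (g`_0)%:P)`_0 = 0 by rewrite coefB coefC subrr.
have dE k : nrm (g^`())`_k = k.+1%:R * nrm g`_k.+1 by rewrite coef_deriv nrmMn.
have en : (e < n.+1)%N.
  rewrite ltnNge; apply/negP => h; move: pe; rewrite coef_deriv nth_default ?mul0rn ?eqxx //.
  by rewrite sg ltnS.
have le1 k : nrm g`_k.+1 <= nrm (g^`())`_k.
  by rewrite dE ler_peMl ?nrm_ge0 // ler1n.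
have le2 : B * nrm (g^`())`_e <= n.+1%:R * B * nrm g`_e.+1.
  by rewrite dE mulrA [n.+1%:R * _]mulrC ler_wpM2r ?nrm_ge0 // ler_wpM2l // ler_nat.
split.
- by rewrite cE; apply: contraNneq pe => h; rewrite coef_deriv h mul0rn.
- case=> [|k] ke; first by rewrite c0 nrm0 !mulr_ge0 ?nrm_ge0 ?exprn_ge0 // ltW.
  rewrite !cE subSS; apply: le_trans (le1 k) _; apply: le_trans (lo k ke) _.
  by rewrite ler_wpM2r ?exprn_ge0 // ltW.
- case=> // k; rewrite ltnS => ek; rewrite !cE subSS; apply: le_trans le2.
  by apply: le_trans (hi k ek); rewrite ler_wpM2r ?exprn_ge0 // ltW.
Qed.

(** At a factor [M] from both ends of the range, the other monomials together amount to at most half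
    of the dominant one. *)
Lemma dominant_value p E B (M r T : R) y : 0 < r -> 0 <= B -> 1 <= M ->
  2%:R * (size p)%:R * B <= M -> dominant p E B r T ->
  M * r <= nrm y -> M * nrm y <= T ->
  nrm p`_E * nrm y ^+ E <= 2%:R * nrm p.[y] /\ 2%:R * nrm p.[y] <= 3%:R * (nrm p`_E * nrm y ^+ E).
Proof.
move=> r0 B0 M1 BM [pe lo hi] ry yT; set Y := nrm y in ry yT *; set N := nrm p`_E in lo hi *.
have Mr : 0 < M * r by rewrite mulr_gt0 //; lra.
have Y0 : 0 < Y by lra.
have M0 : 0 < M by lra.
have N0 : 0 <= N by apply: nrm_ge0.
have Esz : (E < size p)%N by rewrite ltnNge; apply: contra pe => h; rewrite nth_default.
pose u := \sum_(i < size p | i != Ordinal Esz) p`_i * y ^+ i.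
have eu : p.[y] = p`_E * y ^+ E + u.
  by rewrite horner_coef (bigD1 (Ordinal Esz)).
have term i : i != E -> M * nrm (p`_i * y ^+ i) <= B * (N * Y ^+ E).
  move=> iE; rewrite nrmM nrmX -/Y; have [iE'|Ei] := leqP i E.
    have iE'' : (0 < E - i)%N by rewrite subn_gt0 ltn_neqAle iE.
    have e1 : Y ^+ E = Y ^+ (E - i) * Y ^+ i by rewrite -exprD subnK.
    rewrite e1 !mulrA ler_wpM2r ?exprn_ge0 //; first exact: ltW.
    apply: le_trans (_ : B * N * (M * r ^+ (E - i)) <= _).
      rewrite [X in _ <= X]mulrCA ler_pM2l //; exact: lo.
    apply: ler_wpM2l; first exact: mulr_ge0.
    apply: le_trans (_ : (M * r) ^+ (E - i) <= _); last by apply: lerXn2r; rewrite ?nnegrE // ltW.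
    rewrite exprMn ler_pM2r ?exprn_gt0 //; rewrite -[X in X <= _]expr1; exact: ler_weXn2l.
  have Ei' : (0 < i - E)%N by rewrite subn_gt0.
  have e1 : Y ^+ i = Y ^+ (i - E) * Y ^+ E by rewrite -exprD subnK // ltnW.
  rewrite e1 !mulrA ler_wpM2r ?exprn_ge0 //; first exact: ltW.
  apply: le_trans (hi i (ltnW Ei)); rewrite [M * _]mulrC -mulrA ler_wpM2l ?nrm_ge0 //.
  apply: le_trans (_ : (M * Y) ^+ (i - E) <= _); last first.
    by apply: lerXn2r; rewrite ?nnegrE // ?mulr_ge0 //; try lra; apply: le_trans yT; rewrite mulr_ge0 // ltW.
  rewrite exprMn ler_pM2r ?exprn_gt0 //; rewrite -[X in X <= _]expr1; exact: ler_weXn2l.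
have hu : 2%:R * nrm u <= N * Y ^+ E.
  rewrite -(ler_pM2l M0); apply: le_trans (_ : 2%:R * ((size p)%:R * (B * (N * Y ^+ E))) <= _); last first.
    rewrite -!mulrA in BM; rewrite !mulrA in BM *; rewrite ler_wpM2r ?exprn_ge0 //; first exact: ltW.
    by rewrite ler_wpM2r // BM.
  rewrite mulrCA ler_pM2l //; apply: le_trans (_ : M * \sum_(i < size p | i != Ordinal Esz) nrm (p`_i * y ^+ i) <= _).
    by rewrite ler_pM2l // nrm_sum.
  rewrite mulr_sumr; apply: le_trans (_ : \sum_(i < size p | i != Ordinal Esz) B * (N * Y ^+ E) <= _).
    by apply: ler_sum => i iE; apply: term.
  rewrite sumr_const -[X in X <= _]mulr_natl ler_wpM2r //.
    by rewrite !mulr_ge0 ?exprn_ge0 // ltW.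
  by rewrite ler_nat; apply: leq_trans (max_card _) _; rewrite card_ord.
have h1 := nrmD (p`_E * y ^+ E) u; have h2 := nrmB_ge (p`_E * y ^+ E) (- u).
rewrite opprK nrmN -eu nrmM nrmX -/N -/Y in h2; rewrite -eu nrmM nrmX -/N -/Y in h1.
split; lra.
Qed.

(* If the value [v] were not attained, [p - v] would again be dominated by one coefficient, which the
   dominance of [p] at the scale of [v] rules out. *)
Lemma dominant_attained p n E B (M rho sig : R) v : size p = n.+2 -> p`_0 = 0 -> (0 < E)%N -> 1 <= B ->
  4%:R ^+ n.+1 <= B -> 10%:R * (B * B) < M -> 0 < rho -> rho <= sig ->
  dominant p E B (rho / M) (M * sig) ->
  nrm p`_E * rho ^+ E <= 10%:R * nrm v -> 2%:R * nrm v <= 15%:R * (nrm p`_E * sig ^+ E) ->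
  exists2 y, rho / M <= nrm y <= M * sig & p.[y] = v.
Proof.
move=> sp p0 E0 B1 Bn BM rho0 rs [pe lo hi] v1 v2.
have BB : B <= B * B by rewrite ler_peMl //; lra.
have M0 : 0 < M by lra.
have r0 : 0 < rho / M by rewrite divr_gt0.
have N0 : 0 < nrm p`_E by rewrite lt0r nrm_ge0 nrm_eq0 pe.
set N := nrm p`_E in lo hi v1 v2 N0.
have s0 : 0 < sig by lra.
apply: contrapT => no; pose h := p - v%:P.
have hk k : h`_k.+1 = p`_k.+1 by rewrite coefB coefC subr0.
have h0 : nrm h`_0 = nrm v by rewrite coefB coefC p0 sub0r nrmN.
have sh : size h = n.+2.
  by rewrite size_polyDl ?sp // size_polyN; apply: leq_ltn_trans (size_polyC_leq1 _) _.
have M1 : 1 <= M by lra.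
have rM : rho / M <= rho / M * M by rewrite ler_peMr // ltW.
have rs1 : (rho / M) * (M * M) <= M * sig by rewrite mulrA divfK ?gt_eqF // mulrC ler_pM2l.
have [|x rx|e [he lo' hi']] := @dominant_exists n.+1 h (rho / M) (M * sig) sh r0.
- apply: le_trans rs1; rewrite [X in X <= _]mulrC ler_pM2l //.
  apply: le_trans (_ : 2%:R * B <= _); first by rewrite ler_pM2l.
  apply: le_trans (_ : M <= _); first by lra.
  by rewrite ler_peMl //; lra.
- apply/negP => hx; apply: no; exists x => //.
  by move: rx; rewrite /root hornerD hornerN hornerC subr_eq0 => /eqP.
have MM u : (0 < u)%N -> M <= M ^+ u by move=> u0; rewrite -[X in X <= _]expr1; apply: ler_weXn2l.
case: e he lo' hi' => [|e] he lo' hi'.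
  have hE := hi' E (leq0n E); rewrite h0 subn0 -[E]prednK // hk prednK // -/N exprMn in hE.
  have : M * (N * sig ^+ E) <= B * nrm v.
    apply: le_trans (_ : 4%:R ^+ n.+1 * nrm v <= _); last by rewrite ler_wpM2r ?nrm_ge0.
    apply: le_trans hE; rewrite [X in _ <= X]mulrCA; apply: ler_wpM2r; last exact: MM.
    by rewrite mulr_ge0 ?exprn_ge0 // ltW.
  have NS : 0 < N * sig ^+ E by rewrite mulr_gt0 ?exprn_gt0.
  have : 2%:R * (B * nrm v) <= 15%:R * (B * (N * sig ^+ E)).
    by rewrite mulrCA [X in _ <= X]mulrCA ler_wpM2l //; lra.
  have : 10%:R * (B * (N * sig ^+ E)) < M * (N * sig ^+ E).
    by rewrite mulrA ltr_pM2r //; lra.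
  have : 0 < B * (N * sig ^+ E) by rewrite mulr_gt0 //; lra.
  lra.
rewrite hk in he; have e0 : 0 < nrm p`_e.+1 by rewrite lt0r nrm_ge0 nrm_eq0 he.
have {}lo' k : (k <= e.+1)%N -> nrm h`_k <= B * nrm p`_e.+1 * (rho / M) ^+ (e.+1 - k).
  move=> ke; apply: le_trans (lo' k ke) _; rewrite hk ler_wpM2r ?exprn_ge0 ?(ltW r0) //.
  by rewrite ler_wpM2r ?nrm_ge0.
have {}hi' k : (e.+1 <= k)%N -> nrm h`_k * (M * sig) ^+ (k - e.+1) <= B * nrm p`_e.+1.
  by move=> ke; apply: le_trans (hi' k ke) _; rewrite hk ler_wpM2r ?nrm_ge0.
have pow u : (0 < u)%N -> (rho / M) ^+ u * (B * B) < (M * sig) ^+ u.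
  move=> u0; apply: lt_le_trans (_ : (rho / M) ^+ u * M ^+ u <= _).
    rewrite ltr_pM2l ?exprn_gt0 //; apply: lt_le_trans (MM u u0).
    have : 0 < B * B by rewrite mulr_gt0 //; lra.
    lra.
  rewrite -exprMn divfK ?gt_eqF //; apply: lerXn2r; rewrite ?nnegrE; try lra.
    by rewrite mulr_ge0 //; lra.
  apply: le_trans rs _; rewrite ler_peMl //; lra.
have [eE|Ee|eE] := ltngtP e.+1 E.
- have a1 := hi' E (ltnW eE); rewrite -{1}[E]prednK // hk prednK // -/N in a1.
  have a2 := lo e.+1 (ltnW eE); have u0 : (0 < E - e.+1)%N by rewrite subn_gt0.
  have := pow _ u0; rewrite -(ltr_pM2l N0) ltNge => /negP; apply.
  apply: le_trans a1 _; rewrite (mulrC _ (B * B)) mulrA.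
  apply: le_trans (_ : B * (B * N * (rho / M) ^+ (E - e.+1)) <= _); first by rewrite ler_wpM2l //; lra.
  by rewrite le_eqVlt; apply/orP; left; apply/eqP; ring.
- have a1 := lo' E (ltnW Ee); rewrite -{1}[E]prednK // hk prednK // -/N in a1.
  have a2 := hi e.+1 (ltnW Ee); have u0 : (0 < e.+1 - E)%N by rewrite subn_gt0.
  have := pow _ u0; rewrite -(ltr_pM2l e0) ltNge => /negP; apply.
  apply: le_trans a2 _; apply: le_trans (_ : B * (B * nrm p`_e.+1 * (rho / M) ^+ (e.+1 - E)) <= _).
    by rewrite ler_wpM2l //; lra.
  by rewrite le_eqVlt; apply/orP; left; apply/eqP; ring.
have a1 := lo' 0%N isT; rewrite h0 subn0 eE -/N in a1.
have : N * rho ^+ E <= 10%:R * (B * N * (rho / M) ^+ E) by lra.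
have -> : rho ^+ E = M ^+ E * (rho / M) ^+ E by rewrite -exprMn mulrC divfK ?gt_eqF.
have rE : 0 < (rho / M) ^+ E by rewrite exprn_gt0.
have NrE : 0 < N * (rho / M) ^+ E by rewrite mulr_gt0.
have -> : N * (M ^+ E * (rho / M) ^+ E) = M ^+ E * (N * (rho / M) ^+ E) by ring.
have -> : 10%:R * (B * N * (rho / M) ^+ E) = 10%:R * B * (N * (rho / M) ^+ E) by ring.
rewrite ler_pM2r // leNgt => /negP; apply; apply: lt_le_trans (MM E E0); lra.
Qed.

Lemma dominant_le p e B B' r T : 0 < r -> B <= B' -> dominant p e B r T -> dominant p e B' r T.
Proof.
move=> r0 BB [pe lo hi]; split=> // k ke.
  apply: le_trans (lo k ke) _; rewrite ler_wpM2r ?exprn_ge0 //; first exact: ltW.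
  by rewrite ler_wpM2r ?nrm_ge0.
by apply: le_trans (hi k ke) _; rewrite ler_wpM2r ?nrm_ge0.
Qed.

Lemma size_derivC (g : {poly C}) n : size g = n.+2 -> size g^`() = n.+1.
Proof.
move=> sg; have g0 : g != 0 by rewrite -size_poly_eq0 sg.
apply/eqP; rewrite eqn_leq; apply/andP; split; first by have := lt_size_deriv g0; rewrite sg ltnS.
rewrite ltnNge; apply/negP => h.
have : (g^`())`_n = 0 by apply: nth_default.
have lc : g`_n.+1 != 0 by have := lead_coef_eq0 g; rewrite lead_coefE sg /= => ->.
by rewrite coef_deriv => /eqP; rewrite mulrn_eq0 (negPf lc).
Qed.

(** On the annulus [f] is a constant plus a function within factors [1 / 2] and [3 / 2] of a
    monomial, which gives the radii of the image. Enlarging by 5 turns these factors into [1 / 10]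
    and [15 / 2], the bounds under which [dominant_attained] still finds preimages. *)
Theorem transport n : exists M : nat, (0 < M)%N /\ forall (f : {poly C}) z (rho sig : R),
  size f = n.+2 -> 0 < rho -> rho <= sig ->
  (forall x, root f^`() x -> ~~ ann z (rho / M%:R) (M%:R * sig) x) ->
  exists w (r1 r2 : R), [/\ 0 < r1, forall x, ann z rho sig x -> ann w r1 r2 f.[x] &
    forall y, ann w (r1 / 5%:R) (5%:R * r2) y -> exists2 x, ann z (rho / M%:R) (M%:R * sig) x & f.[x] = y].
Proof.
(* [B] combines the factors 4 of the roots with the [n.+1] lost by integration; [M] adds up what
   [dominant_attained] and [dominant_value] require. *)
pose B := (n.+1 * 4 ^ n.+1)%N; pose M := (10 * (B * B) + 2 * n.+2 * B + 1)%N.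
exists M; split=> [|f z rho sig sf rho0 rs hroot]; first by rewrite /M addn1.
have B1 : 1 <= B%:R :> R by rewrite ler1n muln_gt0 expn_gt0.
have eM : M%:R = 10%:R * (B%:R * B%:R) + 2%:R * n.+2%:R * B%:R + 1 :> R.
  by rewrite /M natrD natrD !natrM.
have nB : 0 <= n.+2%:R * B%:R :> R by rewrite mulr_ge0.
have BB : B%:R <= B%:R * B%:R :> R by rewrite ler_peMl //; lra.
have M0 : 0 < M%:R :> R by lra.
have M1 : 1 <= M%:R :> R by lra.
have MM : M%:R <= M%:R * M%:R :> R by rewrite ler_peMl //; lra.
have r0 : 0 < rho / M%:R by rewrite divr_gt0.
have s0 : 0 < sig by lra.
have T0 : 0 < M%:R * sig by rewrite mulr_gt0.
have B4 : 4%:R ^+ n <= 4%:R ^+ n.+1 :> R by rewrite ler_weXn2l // ler1n.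
have B4' : 4%:R ^+ n.+1 <= B%:R :> R by rewrite /B natrM natrX ler_peMl ?exprn_ge0 // ler1n.
pose g := f \Po ('X + z%:P).
have gE y : g.[y] = f.[y + z] by rewrite horner_comp hornerD hornerX hornerC.
have sg : size g = n.+2 by rewrite /g size_comp_poly2 // size_XaddC.
have dg : g^`() = f^`() \Po ('X + z%:P).
  by rewrite /g deriv_comp derivD derivX derivC addr0 mulr1.
have sdg : size g^`() = n.+1 by apply: size_derivC.
have [||e he] := dominant_exists sdg r0 (T := M%:R * sig).
- apply: le_trans (_ : rho / M%:R * (M%:R * M%:R) <= _); last first.
    by rewrite mulrA divfK ?gt_eqF // mulrC ler_pM2l.
  by rewrite [X in _ <= X]mulrC ler_pM2r //; lra.
- move=> x; rewrite dg /root horner_comp hornerD hornerX hornerC => hx.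
  by have := hroot _ hx; rewrite /ann /dist addrK.
have {}he := dominant_le r0 B4 he.
have B40 : 0 <= 4%:R ^+ n.+1 :> R by rewrite exprn_ge0.
have := dominant_antideriv r0 B40 sg T0 he; rewrite -natrX -natrM -/B.
set P := g - _ => hP; set N := nrm P`_e.+1.
have sP : size P = n.+2.
  by rewrite size_polyDl ?sg // size_polyN; apply: leq_ltn_trans (size_polyC_leq1 _) _.
have P0 : P`_0 = 0 by rewrite coefB coefC subrr.
have PE y : P.[y] = f.[y + z] - g`_0 by rewrite hornerD hornerN hornerC gE.
have N0 : 0 < N by case: hP => pe _ _; rewrite lt0r nrm_ge0 nrm_eq0 pe.
exists g`_0, (N * rho ^+ e.+1 / 2%:R), (3%:R / 2%:R * (N * sig ^+ e.+1)).
split; first by rewrite divr_gt0 // mulr_gt0 // exprn_gt0.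
  move=> x /andP[x1 x2]; have B0 : 0 <= B%:R :> R by [].
  have c1 : 2%:R * (size P)%:R * B%:R <= M%:R :> R by rewrite sP; lra.
  have [||h1 h2] := dominant_value r0 B0 M1 c1 hP (y := x - z).
  - by rewrite mulrC divfK ?gt_eqF.
  - by rewrite ler_pM2l.
  rewrite PE subrK -/N in h1 h2; rewrite /ann /dist.
  have y0 : 0 <= nrm (x - z) by apply: nrm_ge0.
  have p1 : rho ^+ e.+1 <= nrm (x - z) ^+ e.+1 by apply: lerXn2r; rewrite ?nnegrE // ltW.
  have p2 : nrm (x - z) ^+ e.+1 <= sig ^+ e.+1 by apply: lerXn2r; rewrite ?nnegrE // ltW.
  have {}p1 : N * rho ^+ e.+1 <= N * nrm (x - z) ^+ e.+1 by rewrite ler_pM2l.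
  have {}p2 : N * nrm (x - z) ^+ e.+1 <= N * sig ^+ e.+1 by rewrite ler_pM2l.
  by apply/andP; split; lra.
move=> y /andP[y1 y2]; rewrite /dist in y1 y2.
have c1 : 10%:R * (B%:R * B%:R) < M%:R :> R by lra.
have [||y' hy' ey] := dominant_attained sP P0 (ltn0Sn e) B1 B4' c1 rho0 rs hP (v := y - g`_0).
- by rewrite -/N; lra.
- by rewrite -/N; lra.
exists (y' + z); first by rewrite /ann /dist addrK.
by apply: (addIr (- g`_0)); rewrite -PE.
Qed.
End Transport.

Lemma count_has_le (T U : Type) (P : T -> pred U) (L : seq U) (G : seq T) :
  (count (fun a => has (P a) L) G <= \sum_(c <- L) count (fun a => P a c) G)%N.
Proof.
elim: L => [|c L IH]; first by rewrite big_nil (eq_count (a2 := pred0)) ?count_pred0.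
rewrite big_cons; apply: leq_trans (leq_add (leqnn _) IH); exact: count_predU_le.
Qed.

Lemma count_exchange (T U : Type) (P : T -> pred U) (L : seq U) (G : seq T) :
  (\sum_(a <- G) count (P a) L = \sum_(c <- L) count (fun a => P a c) G)%N.
Proof.
rewrite (eq_bigr (fun a => \sum_(c <- L | P a c) 1)%N); last by move=> a _; rewrite sum1_count.
by rewrite (exchange_big_dep xpredT) //=; apply: eq_bigr => c _; rewrite sum1_count.
Qed.

Lemma count_mul_le (T : Type) (F : T -> nat) (m : nat) (G : seq T) :
  (count (fun a => m < F a)%N G * m.+1 <= \sum_(a <- G) F a)%N.
Proof.
elim: G => [|a G IH]; first by rewrite big_nil.
by rewrite big_cons /= mulnDl; apply: leq_add IH; case: ltnP => // h; rewrite mul1n.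
Qed.

Lemma big_seq_le (T : eqType) (F : T -> nat) (k : nat) (L : seq T) :
  (forall c, c \in L -> F c <= k)%N -> (\sum_(c <- L) F c <= size L * k)%N.
Proof.
elim: L => [|c L IH] h; first by rewrite big_nil.
rewrite big_cons mulSn leq_add ?h ?mem_head //; apply: IH => x xL; apply: h.
by rewrite inE xL orbT.
Qed.

(** * Images of sparse annuli *)

Section Incidence.
Variables (R : realType) (n : nat).
Local Notation C := R[i].
Variables (M m0 : nat) (A B : seq C).
Hypotheses (M0 : (0 < M)%N) (uA : uniq A).
Hypothesis trans : forall (f : {poly C}) z (rho sig : R),
  size f = n.+2 -> 0 < rho -> rho <= sig ->
  (forall x, root f^`() x -> ~~ ann z (rho / M%:R) (M%:R * sig) x) ->
  exists w (r1 r2 : R), [/\ 0 < r1, forall x, ann z rho sig x -> ann w r1 r2 f.[x] &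
    forall y, ann w (r1 / 5%:R) (5%:R * r2) y -> exists2 x, ann z (rho / M%:R) (M%:R * sig) x & f.[x] = y].
Variables (G : seq C) (z : C -> C) (r1 r2 : C -> R).
Hypothesis GA : subseq G A.
Hypothesis hG : forall a, a \in G -> [/\ 0 < r1 a, ann (z a) (r1 a) (r2 a) a &
  (count (ann (z a) (r1 a / (5 * M)%:R) ((5 * M)%:R * r2 a)) A <= m0)%N].

Let core a x := ann (z a) (r1 a / M%:R) (M%:R * r2 a) x.

Lemma core_linked a x : a \in G -> core a x -> linked A m0 x a.
Proof.
move=> aG cx; have [r0 /andP[h1 h2] hc] := hG aG; have M1 : 1 <= M%:R :> R by rewrite ler1n.
have M0' : 0 < M%:R :> R by rewrite ltr0n.
have d0 := dist_ge0 a (z a).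
exists (z a), (r1 a / M%:R), (M%:R * r2 a); split=> //; first exact: divr_gt0.
  rewrite /ann; apply/andP; split; first by rewrite ler_pdivrMr //; apply: (le_trans h1); rewrite ler_peMr.
  by apply: (le_trans h2); rewrite ler_peMl // (le_trans d0 h2).
rewrite (_ : r1 a / M%:R / 5%:R = r1 a / (5 * M)%:R); last by rewrite natrM invfM mulrA mulrAC.
by rewrite mulrA -natrM.
Qed.

Lemma root_list (f : {poly C}) k : size f = k.+1 -> exists2 rs : seq C, size rs = k & forall x, root f x -> x \in rs.
Proof.
move=> sf; have f0 : f != 0 by rewrite -size_poly_eq0 sf.
have [rs e] := closed_field_poly_normal f; have lc : lead_coef f != 0 by rewrite lead_coef_eq0.
exists rs; first by move: sf; rewrite e size_scale // size_prod_XsubC => -[].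
by move=> x; rewrite e rootZ // root_prod_XsubC.
Qed.

Let N := size A.
Let m' := (32 * n.+1 * m0 * size B %/ N)%N.

(** Two kinds of points of [G] are lost: those with a critical point of [f] in their enlarged
    annulus, at most [4 * m0] for each critical point by [linked_count], and those whose enlarged
    annulus reaches more than [m'] points of [B]. The latter are few by double counting, a value
    having at most [n.+1] preimages, each linked to at most [4 * m0] points. *)
Lemma incident_points (f : {poly C}) : size f = n.+2 -> (0 < N)%N -> (forall a, a \in A -> f.[a] \in B) ->
  (8 * size G <= 8 * count (fun a => `[< forall x, x \in A -> ann (z a) (r1 a) (r2 a) x -> linked B m' f.[a] f.[x] >]) G
     + 32 * m0 * n + N)%N.
Proof.
move=> sf N0 fB; set good := fun a => _.
have [rs srs hrs] := root_list (size_derivC sf).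
pose crit a := has (core a) rs.
pose cntB a := count (fun y => `[< exists2 x, f.[x] = y & linked A m0 x a >]) B.
have ccrit : (count crit G <= n * (4 * m0))%N.
  apply: leq_trans (count_has_le _ _ _) _; rewrite -srs; apply: big_seq_le => c _.
  apply: leq_trans (linked_count m0 c uA).
  apply: leq_trans (leq_count_subseq _ GA); apply: sub_count_in => a aG h; apply/asboolP; exact: core_linked.
have csum : (\sum_(a <- G) cntB a <= size B * (n.+1 * (4 * m0)))%N.
  rewrite /cntB count_exchange; apply: big_seq_le => y _.
  have sfy : size (f - y%:P) = n.+2.
    by rewrite size_polyDl ?sf // size_polyN; apply: leq_ltn_trans (size_polyC_leq1 _) _.
  have [ys sys hys] := root_list sfy.
  apply: leq_trans (_ : count (fun a => has (fun x => `[< linked A m0 x a >]) ys) G <= _)%N.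
    apply: sub_count => a /asboolP [x fx lx]; apply/hasP; exists x; last by apply/asboolP.
    by apply: hys; rewrite /root hornerD hornerN hornerC fx subrr.
  apply: leq_trans (count_has_le _ _ _) _; rewrite -sys; apply: big_seq_le => x _.
  apply: leq_trans (linked_count m0 x uA); exact: leq_count_subseq.
have cbig : (8 * count (fun a => m' < cntB a)%N G <= N)%N.
  have h1 := leq_trans (count_mul_le cntB m' G) csum.
  have h2 : (32 * n.+1 * m0 * size B < m'.+1 * N)%N by apply: ltn_ceil.
  rewrite leqNgt; apply/negP => h3; have : (N * m'.+1 <= 8 * count (fun a => m' < cntB a)%N G * m'.+1)%N.
    by rewrite leq_mul2r ltnW ?orbT.
  rewrite -mulnA => h4; have := leq_trans h4 (leq_mul (leqnn 8) h1); rewrite leqNgt => /negP; apply.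
  by move: h2; rewrite [(m'.+1 * N)%N]mulnC; apply: leq_trans; rewrite ltnS; apply: eq_leq; ring.
have cover : (size G <= count good G + (count crit G + count (fun a => m' < cntB a)%N G))%N.
  rewrite -(count_predT G); apply: leq_trans (_ : count (predU good (predU crit (fun a => m' < cntB a)%N)) G <= _)%N; last first.
    by apply: leq_trans (count_predU_le _ _ _) _; rewrite leq_add2l; apply: count_predU_le.
  apply: sub_count_in => a aG _ /=; case: (boolP (crit a)) => [|/hasPn nc]; first by rewrite orbT.
  case: ltnP => hc; rewrite ?orbT // !orbF; apply/asboolP => x xA hx.
  have [p0 ha _] := hG aG; have ha' := ha; case/andP: ha' => ha1 ha2.
  have [|w [q1 [q2 [q0 tr1 tr2]]]] := trans sf p0 (le_trans ha1 ha2) (z := z a).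
    by move=> c /hrs /nc.
  exists w, q1, q2; split=> //; [exact: tr1|exact: tr1|].
  apply: leq_trans hc; apply: sub_count => y /tr2 [x' h1 h2]; apply/asboolP; exists x' => //.
  exact: core_linked.
have {}cover := leq_mul (leqnn 8) cover.
apply: leq_trans cover _; rewrite !mulnDr -addnA leq_add2l; apply: leq_add; last exact: cbig.
by apply: leq_trans (leq_mul (leqnn 8) ccrit) _; apply: eq_leq; ring.
Qed.
End Incidence.

Lemma card_pred_pair (I P : finType) (Q : I -> pred P) : #|[pred p : I * P | Q p.1 p.2]| = (\sum_i #|[pred a | Q i a]|)%N.
Proof.
rewrite -sum1_card (eq_bigr (fun i => \sum_(a | Q i a) 1)%N); last by move=> i _; rewrite sum1_card.
by rewrite pair_big_dep.
Qed.

Lemma card_pred_nth (T : Type) (x0 : T) (q : pred T) (G : seq T) : #|[pred a : 'I_(size G) | q (nth x0 G a)]| = count q G.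
Proof. by rewrite -sum1_card -sum1_count (big_nth x0) big_mkord. Qed.

(** The size of [A] enters only to the first power, for every [m]; it is the number of starting
    tuples in the trace. The other powers of it cancel between incidences, tuples and codes. *)
Theorem closed_walks_many (R : realType) n m : (0 < m)%N -> exists C0 N0 s : nat,
  forall (A B : seq R[i]) (I : finType) (pol : I -> {poly R[i]}) (K : R),
  uniq A -> (0 < size A)%N -> (N0 <= size A)%N -> (forall i, size (pol i) = n.+2) ->
  (forall i a, a \in A -> (pol i).[a] \in B) -> 1 <= K -> (size B)%:R <= K * (size A)%:R ->
  #|I|%:R ^+ (2 ^ m.+1) <= (C0%:R * K ^+ s) ^+ (2 ^ m) *
    (#|[pred p : walk I m | `[< forall x, chain pol p x x >]]|%:R * (size A)%:R) :> R.
Proof.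
move=> m1; have [M [M0 trans]] := transport R n; pose s := (2 * chain_degree n m 2)%N.
have M50 : (0 < 5 * M)%N by rewrite muln_gt0.
have [m0 good] := @good_annuli R s (5 * M) M50.
pose D := (128 * n.+1 * m0 + 1)%N.
exists (32 * n.+1 * D ^ s.+1)%N, (maxn m0 (32 * m0 * n)), s.+2 => A B I pol K uA A0 hN spol hB K1 hK.
set N := size A in A0 hN hK *.
pose G := filter (fun a => `[< in_annulus A s (5 * M) m0 a >]) A.
have GA : subseq G A by apply: filter_subseq.
have uG : uniq G by apply: filter_uniq.
have sG : (N <= 2 * size G)%N.
  by rewrite size_filter; apply: good => //; apply: leq_trans hN; rewrite leq_maxl.
have /choice [Z hZ] (a : R[i]) : exists p : R[i] * (R * R), a \in G ->
    [/\ 0 < p.2.1, ann p.1 p.2.1 p.2.2 a, (s < count (ann p.1 p.2.1 p.2.2) A)%N &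
     (count (ann p.1 (p.2.1 / (5 * M)%:R) ((5 * M)%:R * p.2.2)) A <= m0)%N].
  case: (boolP (a \in G)) => [|_]; last by exists (0, (0, 0)).
  by rewrite mem_filter => /andP[/asboolP [z [r1 [r2 h]]] _]; exists (z, (r1, r2)).
pose z a := (Z a).1; pose r1 a := (Z a).2.1; pose r2 a := (Z a).2.2.
have hG a : a \in G -> [/\ 0 < r1 a, ann (z a) (r1 a) (r2 a) a &
  (count (ann (z a) (r1 a / (5 * M)%:R) ((5 * M)%:R * r2 a)) A <= m0)%N] by move=> /hZ [].
pose m' := (32 * n.+1 * m0 * size B %/ N)%N.
pose L b := filter (fun b' => `[< linked (undup B) m' b b' >]) (undup B).
have sL b : (size (L b) <= 4 * m')%N by rewrite size_filter; apply: linked_count; exact: undup_uniq.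
pose P : finType := 'I_(size G).
pose base (a : P) := nth 0 G a.
have baseG a : base a \in G by apply: mem_nth.
(* The base point comes first, so that distinct tuples have distinct first points. *)
pose pts a := a :: rem a (filter (ann (z a) (r1 a) (r2 a)) A).
have pts_perm a : a \in G -> perm_eq (pts a) (filter (ann (z a) (r1 a) (r2 a)) A).
  move=> aG; rewrite perm_sym; apply: perm_to_rem; have [_ ha _] := hG a aG.
  by rewrite mem_filter ha (mem_subseq GA).
have pts_size a : a \in G -> (s < size (pts a))%N.
  by move=> aG; rewrite (perm_size (pts_perm a aG)) size_filter; have [_ _ h _] := hZ a aG.
pose pt (a : P) (j : 'I_s.+1) := nth 0 (pts (base a)) j.
have pt0 a : pt a ord0 = base a by [].
have lt_pt a (j : 'I_s.+1) : (j < size (pts (base a)))%N by apply: leq_trans (pts_size _ (baseG a)); rewrite ltn_ord.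
have ptP a j : (pt a j \in A) /\ ann (z (base a)) (r1 (base a)) (r2 (base a)) (pt a j).
  have : pt a j \in pts (base a) by apply: mem_nth.
  by rewrite (perm_mem (pts_perm _ (baseG a))) mem_filter => /andP[].
have pt_inj a : injective (pt a).
  move=> i j /eqP; rewrite nth_uniq //; first by move/eqP => h; apply: ord_inj.
  by rewrite (perm_uniq (pts_perm _ (baseG a))) filter_uniq.
have pt0_inj : injective (fun a => pt a ord0).
  by move=> a b /eqP; rewrite !pt0 nth_uniq // => /eqP h; apply: ord_inj.
(* A code records the image of the base point and, for every point of the tuple, the rank of its
   image among the at most [4 * m'] points linked to that image. Thus the number of codes is linear
   in [|B|], up to powers of [K]. *)
pose ET : finType := ('I_(size (undup B)).+1 * {ffun 'I_s.+1 -> 'I_(4 * m').+1})%type.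
pose ok i a := `[< forall x, x \in A -> ann (z a) (r1 a) (r2 a) x -> linked (undup B) m' (pol i).[a] (pol i).[x] >].
pose e (i : I) (a : P) : option ET := if ok i (base a) then
  Some (inord (index (pol i).[base a] (undup B)),
    [ffun j : 'I_s.+1 => inord (index (pol i).[pt a j] (L (pol i).[base a]))]) else None.
have decode i a t : e i a = Some t -> forall j, (pol i).[pt a j] = nth 0 (L (nth 0 (undup B) t.1)) (t.2 j).
  rewrite /e; case: ifP => // /asboolP hok [<-] j /=.
  have bA : base a \in A by apply: (mem_subseq GA).
  rewrite inordK ?ltnS ?index_size // nth_index ?mem_undup ?hB // ffunE.
  have [ptA pta] := ptP a j.
  have inL : (pol i).[pt a j] \in L (pol i).[base a].
    by rewrite mem_filter mem_undup hB // andbT; apply/asboolP; apply: hok.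
  rewrite inordK ?nth_index // ltnS; apply: leq_trans (sL (pol i).[base a]); exact: index_size.
have he i i' a b t : e i a = Some t -> e i' b = Some t -> forall j, (pol i).[pt a j] = (pol i').[pt b j].
  by move=> h1 h2 j; rewrite (decode _ _ _ h1) (decode _ _ _ h2).
have sP : (0 < #|P|)%N by rewrite card_ord; lia.
have := closed_walks_lower spol pt_inj pt0_inj he R sP m1 (leqnn _); rewrite card_ord.
set cl := #|_|; set edges := #|_|.
have hedges : (#|I| * N <= 4 * edges)%N.
  rewrite /edges (card_pred_pair (fun i a => e i a != None)) -sum_nat_const big_distrr /=; apply: leq_sum => i _.
  have -> : #|[pred a | e i a != None]| = count (ok i) G.
    by rewrite -(card_pred_nth 0); apply: eq_card => a; rewrite !inE /e; case: ifP.
  have hB' a : a \in A -> (pol i).[a] \in undup B by rewrite mem_undup; apply: hB.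
  have h := incident_points (B := undup B) M0 uA trans GA hG (spol i) A0 hB'.
  have hm : (32 * n.+1 * m0 * size (undup B) %/ N <= m')%N.
    by apply: leq_div2r; rewrite leq_mul2l size_undup orbT.
  have h' : (8 * size G <= 8 * count (ok i) G + 32 * m0 * n + N)%N.
    apply: leq_trans h _; rewrite !leq_add2r leq_mul2l /=; apply: sub_count => a /asboolP h; apply/asboolP => x xA hx.
    by have [w [q1 [q2 [a1 a2 a3 a4]]]] := h x xA hx; exists w, q1, q2; split=> //; apply: leq_trans a4 hm.
  have : (32 * m0 * n <= N)%N by apply: leq_trans hN; rewrite leq_maxr.
  move: h' sG; move: (count _ _) (size G) (32 * m0 * n)%N => u v w; lia.
have hET : #|ET|%:R <= 2%:R * K * N%:R * (D%:R * K) ^+ s.+1 :> R.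
  rewrite card_prod card_ffun !card_ord natrM natrX; have N1 : 1 <= N%:R :> R by rewrite ler1n.
  have KN : K <= K * N%:R by rewrite ler_peMr //; lra.
  apply: ler_pM => //; first by rewrite exprn_ge0.
    have : (size (undup B))%:R <= (size B)%:R :> R by rewrite ler_nat size_undup.
    by rewrite -natr1; lra.
  apply: lerXn2r; rewrite ?nnegrE //; first by rewrite mulr_ge0 //; lra.
  have N0 : 0 < N%:R :> R by lra.
  have hm : m'%:R <= 32%:R * n.+1%:R * m0%:R * K.
    rewrite -(ler_pM2r N0); apply: le_trans (_ : (32 * n.+1 * m0 * size B)%:R <= _).
      by rewrite -natrM ler_nat; apply: leq_divM.
    rewrite natrM [(32 * n.+1 * m0)%:R]natrM [(32 * n.+1)%:R]natrM -[X in _ <= X]mulrA.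
    by rewrite ler_wpM2l // !mulr_ge0.
  rewrite -natr1 natrM /D natrD !natrM mulrDl mul1r; lra.
have sGN : (size G)%:R <= N%:R :> R by rewrite ler_nat size_subseq.
set S := (2 ^ m)%N; set t := _ * _ => hmain.
have NN : 0 < (N%:R ^+ 2) ^+ S :> R by rewrite !exprn_gt0 // ltr0n.
rewrite -(ler_pM2r NN) /= expnS exprM -exprMn -exprMn.
apply: le_trans (_ : (16%:R * edges%:R ^+ 2) ^+ S <= _).
  apply: lerXn2r; rewrite ?nnegrE ?mulr_ge0 ?exprn_ge0 //.
  by rewrite (_ : 16%:R = 4%:R ^+ 2) -?exprMn ?lerXn2r ?nnegrE -?natrM ?ler_nat // -natrX.
rewrite exprMn; apply: le_trans (ler_wpM2l _ hmain) _; first by rewrite exprn_ge0.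
have -> : 16%:R ^+ S * t = (16%:R * (#|ET|%:R * (size G)%:R * n.+1%:R)) ^+ S * (cl%:R * (size G)%:R).
  by rewrite [in RHS](exprMn S 16%:R) /t [in LHS]mulrA.
have eN u v : u ^+ S * v * (N%:R ^+ 2) ^+ S = (u * N%:R ^+ 2) ^+ S * v :> R by rewrite (exprMn S u) mulrAC.
rewrite eN; apply: ler_pM.
- by rewrite exprn_ge0 // !mulr_ge0.
- by rewrite mulr_ge0.
- apply: lerXn2r; rewrite ?nnegrE.
  + by rewrite !mulr_ge0.
  + have K0 : 0 <= K by lra.
    by rewrite mulr_ge0 ?exprn_ge0 // mulr_ge0 ?exprn_ge0.
  have -> : (32 * n.+1 * D ^ s.+1)%:R * K ^+ s.+2 * N%:R ^+ 2 =
     16%:R * (2%:R * K * N%:R * (D%:R * K) ^+ s.+1 * N%:R * n.+1%:R).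
    by rewrite natrM [(32 * n.+1)%:R]natrM natrX exprMn [K ^+ s.+2]exprS; ring.
  rewrite ler_pM2l // ler_wpM2r //; apply: ler_pM => //.
- by rewrite ler_wpM2l.
Qed.

(** * Structured subfamilies *)

Lemma leq_precision n nn : (nn.+1 <= n.+1 * (2 * nn).+2)%N.
Proof. by rewrite mulSn; apply: leq_trans (leq_addr _ _); lia. Qed.

Section Lifts.
Variables (C : numClosedFieldType) (n nn W : nat).
Hypothesis Wn : (W <= nn)%N.
Local Notation L := (n.+1 * (2 * nn).+2)%N.

Lemma gl_lift (f : {poly C}) : size f = n.+2 -> exists p : {poly C} * {poly C} * gl C nn,
  [/\ eqX L (p.1.1 ^+ n.+1) (\poly_(j < n.+2) f`_(n.+1 - j)), eqX L (p.1.1 * p.1.2) 1 & glval p.2 = smx nn W p.1.1 p.1.2].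
Proof.
move=> sf; have [|v [v0 hv]] := @root_series C (\poly_(j < n.+2) f`_(n.+1 - j)) n L.
  by rewrite coef_poly subn0; have := lead_coef_eq0 f; rewrite lead_coefE sf /= => ->; rewrite -size_poly_eq0 sf.
have [w hw] := inv_series L v0.
have hw' : eqX nn.+1 (v * w) 1 by apply: eqX_le hw; apply: leq_precision.
have [U _ _ _] := isG_smx hw' Wn.
by exists (v, w, GL U).
Qed.

Lemma gl_unity : exists z : 'I_n.+1 -> C, exists Z : 'I_n.+1 -> gl C nn,
  (forall j, glval (Z j) = zmx nn W (z j)) /\ (forall x, x ^+ n.+1 = 1 -> exists j, z j = x).
Proof.
have [rts [srts /allP hrts _ prod]] := unity_roots C n.
pose z (j : 'I_n.+1) := nth 0 rts j.
have zr j : z j \in rts by apply: mem_nth; rewrite srts ltn_ord.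
have z0 j : z j != 0.
  by apply/eqP => h; have := hrts _ (zr j); rewrite h expr0n /= eq_sym oner_eq0.
have /choice [Z hZ] (j : 'I_n.+1) : exists U : gl C nn, glval U = zmx nn W (z j).
  have hw : eqX nn.+1 ((z j)%:P * ((z j)^-1)%:P) 1 by rewrite -polyCM divff.
  by have [U _ _ _] := isG_smx hw Wn; exists (GL U).
exists z, Z; split=> // x hx; have := prod x 1.
rewrite hx expr1n subrr => /esym /eqP; rewrite prodf_seq_eq0 => /hasP [y yr /= ].
rewrite mulr1 subr_eq0 => /eqP ->.
have iy : (index y rts < n.+1)%N by rewrite -srts index_mem.
by exists (Ordinal iy); rewrite /z nth_index.
Qed.
End Lifts.

Lemma card_pred_pair_swap (I P : finType) (Q : I -> pred P) :
  #|[pred p : I * P | Q p.1 p.2]| = (\sum_a #|[pred i | Q i a]|)%N.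
Proof.
rewrite (card_pred_pair Q) (eq_bigr (fun i => \sum_(a | Q i a) 1)%N); last by move=> i _; rewrite sum1_card.
by rewrite (exchange_big_dep xpredT) //=; apply: eq_bigr => a _; rewrite sum1_card.
Qed.

Lemma popular_column (I : finType) (n : nat) (Q : I -> pred 'I_n.+1) :
  exists j, (#|[pred p : I * 'I_n.+1 | Q p.1 p.2]| <= n.+1 * #|[pred i | Q i j]|)%N.
Proof.
rewrite card_pred_pair_swap; case: (@arg_maxnP _ ord0 xpredT (fun j => #|[pred i | Q i j]|)) => // j _ hj.
by exists j; rewrite -[X in (_ <= X * _)%N]card_ord -sum_nat_const; apply: leq_sum => i _; apply: hj.
Qed.

Lemma twist_cancel (G : groupType) (a b x y : G) : (x^-1 * y = (a * (b * x))^-1 * (a * (b * y)))%g.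
Proof. by rewrite !invgM -!mulgA !mulKg. Qed.

(* A popular twist [Z j] cancels in the ratios, so the ratios of the corresponding [g f] lie in [S^2]. *)
Lemma popular_ratios (R : realType) (n nn W M : nat) : (W <= nn)%N -> (n.+1 <= W)%N -> (0 < M)%N ->
  exists C0 N0 s : nat, forall (A B : seq R[i]) (Fl : seq {poly R[i]}) (K Y : R),
  uniq A -> (0 < size A)%N -> (N0 <= size A)%N -> uniq Fl -> (0 < size Fl)%N ->
  (forall f : {poly R[i]}, f \in Fl -> size f = n.+2) ->
  (forall (f : {poly R[i]}) a, f \in Fl -> a \in A -> f.[a] \in B) ->
  1 <= K -> (size B)%:R <= K * (size A)%:R -> 1 <= Y ->
  (n.+1%:R ^+ 2 * (C0%:R * K ^+ s)) ^+ (2 ^ (2 * M).+1) * (size A)%:R <= Y ^+ M ->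
  exists (g : {poly R[i]} -> gl R[i] nn) (S : seq (gl R[i] nn)) (Fs : seq {poly R[i]}),
    [/\ uniq Fs, {subset Fs <= Fl}, (size Fl)%:R <= 2%:R ^+ 32 * Y ^+ 12 * (size Fs)%:R,
      {in Fs, forall f : {poly R[i]}, isG W (glval (g f))} &
      {in Fs, forall f : {poly R[i]}, eqX nn.+1 (act (glval (g f)) 'X^(W - n.+1)) (vecp W f)}] /\
    [/\ 1%g \in S, forall h, h \in S -> h^-1%g \in S, forall h, h \in S -> isG W (glval h),
      {in Fs &, forall f f', lratio g f f' \in S} &
      forall m, (size (wset S m))%:R <= (2%:R ^+ 55 * Y ^+ 20) ^+ (2 * m) * (4%:R * Y * Y ^+ M)].
Proof.
move=> Wn dW M0; have [C0 [N0 [s hcw]]] := @closed_walks_many R n (2 * M).+1 isT.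
exists C0, N0, s => A B Fl K Y uA A0 hN uFl Fl0 sF hB K1 hK Y1 num.
have /choice [p hp] (f : {poly R[i]}) : exists p : {poly R[i]} * {poly R[i]} * gl R[i] nn, size f = n.+2 ->
  [/\ eqX (n.+1 * (2 * nn).+2) (p.1.1 ^+ n.+1) (\poly_(j < n.+2) f`_(n.+1 - j)),
      eqX (n.+1 * (2 * nn).+2) (p.1.1 * p.1.2) 1 & glval p.2 = smx nn W p.1.1 p.1.2].
  case: (eqVneq (size f) n.+2) => [/(gl_lift Wn) [p hp]|ne]; first by exists p.
  by exists (0, 0, 1%g) => h; rewrite h eqxx in ne.
have [z [Z [hZ hz]]] := gl_unity R[i] n Wn.
pose g f := (p f).2; pose I : finType := 'I_(size Fl).
pose pol (i : I) : {poly R[i]} := nth 0 Fl i.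
have polF i : pol i \in Fl by apply: mem_nth.
have spol i : size (pol i) = n.+2 by apply: sF.
have gG f : f \in Fl -> isG W (glval (g f)).
  move=> /sF /hp [h1 h2 h3]; rewrite /g h3; apply: isG_smx => //; apply: eqX_le h2; apply: leq_precision.
have gf f : f \in Fl -> eqX nn.+1 (act (glval (g f)) 'X^(W - n.+1)) (vecp W f).
  move=> fF; have [h1 h2 h3] := hp f (sF f fF); rewrite /g h3.
  by apply: (vecp_root (sF f fF) dW _ h1 h2); apply: leq_precision.
pose v i := (p (pol i)).1.1; pose w i := (p (pol i)).1.2.
have hv i : eqX (n.+1 * (2 * nn).+2) (v i ^+ n.+1) (\poly_(j < n.+2) (pol i)`_(n.+1 - j)).
  by have [] := hp _ (spol i).
have hw i : eqX (n.+1 * (2 * nn).+2) (v i * w i) 1 by have [] := hp _ (spol i).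
have hg i : glval (g (pol i)) = smx nn W (v i) (w i) by have [] := hp _ (spol i).
have hcl := card_closed_walks spol Wn hv hw hg hZ hz (2 * M).+1.
have hcw' := hcw A B I pol K uA A0 hN spol (fun i a => hB _ a (polF i)) K1 hK.
pose th := twisted (fun i => g (pol i)) Z.
have cI : #|{: I * 'I_n.+1}| = (size Fl * n.+1)%N by rewrite card_prod !card_ord.
have I0 : (0 < #|{: I * 'I_n.+1}|)%N by rewrite cI muln_gt0 Fl0.
(* Twisting multiplies the number of walks by [n.+1 ^ (2 ^ (2 * M).+2)], which the factor
   [n.+1%:R ^+ 2] in [num] absorbs. *)
have hyp : #|walk (I * 'I_n.+1)%type (2 * M).+1|%:R <= Y ^+ M * (cnt (@step _ _ th (2 * M).+1) 1%g)%:R.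
  rewrite card_walk cI natrX natrM exprMn; rewrite card_ord in hcw'.
  have d0 : 0 <= n.+1%:R ^+ (2 ^ (2 * M).+2) :> R by rewrite exprn_ge0.
  apply: le_trans (ler_wpM2r d0 hcw') _.
  have -> : n.+1%:R ^+ (2 ^ (2 * M).+2) = (n.+1%:R ^+ 2) ^+ (2 ^ (2 * M).+1) :> R by rewrite [in LHS]expnS exprM.
  move: num; rewrite (exprMn (2 ^ (2 * M).+1) (n.+1%:R ^+ 2)) => num.
  have cn0 : 0 <= (cnt (@step _ _ th (2 * M).+1) 1%g)%:R :> R by [].
  apply: le_trans (ler_wpM2r cn0 num).
  have hcl' : #|[pred p | `[< forall x, chain pol (m := (2 * M).+1) p x x >]]|%:R <= (cnt (@step _ _ th (2 * M).+1) 1%g)%:R :> R.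
    by rewrite ler_nat.
  move: hcl'; set a := #|_|%:R; set b := (cnt _ _)%:R => hab.
  set u := (_ * _) ^+ _; set x := (_ ^+ 2) ^+ _; have u0 : 0 <= u.
    by rewrite /u exprn_ge0 // mulr_ge0 // exprn_ge0 //; lra.
  have x0 : 0 <= x by rewrite exprn_ge0 // exprn_ge0.
  have -> : u * (a * (size A)%:R) * x = x * u * (size A)%:R * a by ring.
  by rewrite ler_wpM2l // mulr_ge0 // mulr_ge0.
have [S0 [z0 [S1 SV hpop hgrow]]] := flattening I0 Y1 M0 hyp.
have [j hj] := popular_column (fun i j => (z0^-1 * th (i, j))%g \in S0).
pose Q := [pred i | (z0^-1 * th (i, j))%g \in S0].
pose Fs := [seq pol i | i <- enum Q].
have FsF : {subset Fs <= Fl} by move=> f /mapP [i _ ->].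
have FsP f : f \in Fs -> (z0^-1 * (Z j * g f))%g \in S0.
  by case/mapP => i iQ ->; move: iQ; rewrite mem_enum inE.
(* The ratios themselves are taken instead of [S0], because they are known to satisfy [isG]. *)
pose S := 1%g :: [seq lratio g f f' | f <- Fs, f' <- Fs].
have Slr : {in Fs &, forall f f', lratio g f f' \in S}.
  by move=> f f' fF f'F; rewrite inE allpairs_f ?orbT.
exists g, S, Fs; split; split.
- rewrite map_inj_uniq ?enum_uniq // => i i' /eqP; rewrite nth_uniq // => /eqP h; exact: ord_inj.
- exact: FsF.
- rewrite size_map -cardE; have n0 : 0 < n.+1%:R :> R by rewrite ltr0n.
  rewrite -(ler_pM2r n0) -natrM -cI; apply: le_trans hpop _.
  have Y0 : 0 <= Y by lra.
  have c0 : 0 <= 2%:R ^+ 32 * Y ^+ 12 :> R by rewrite mulr_ge0 ?exprn_ge0.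
  rewrite -[X in _ <= X]mulrA; apply: (ler_wpM2l c0).
  rewrite -natrM ler_nat [(#|Q| * _)%N]mulnC; apply: leq_trans hj.
  by apply: eq_leq; apply: eq_card => -[i i']; rewrite !inE.
- by move=> f /FsF /gG.
- by move=> f /FsF /gf.
- exact: mem_head.
- move=> h; rewrite inE => /orP[/eqP ->|/allpairsP [[f f'] /= [fF f'F ->]]]; first by rewrite invg1 mem_head.
  by rewrite /lratio invgM invgK; apply: Slr.
- move=> h; rewrite inE => /orP[/eqP ->|/allpairsP [[f f'] /= [fF f'F ->]]]; first by rewrite gl1E; apply: isG1.
  rewrite /lratio glME glVE; apply: isGM; last by apply: gG; apply: FsF.
  by apply: isGV; apply: gG; apply: FsF.
- exact: Slr.
move=> m; apply: le_trans (hgrow (2 * m)%N); rewrite ler_nat; apply: wset_sub => a.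
rewrite inE => /orP[/eqP ->|/allpairsP [[f f'] /= [fF f'F ->]]]; first exact: wset_one.
have -> : lratio g f f' = ((z0^-1 * (Z j * g f))^-1 * (z0^-1 * (Z j * g f')))%g.
  exact: twist_cancel.
by apply: (@wsetM _ S0 1 1); apply: mem_wset1 => //; [apply: SV|]; apply: FsP.
Qed.

Lemma act_sub (C : numClosedFieldType) (n : nat) (A B : 'M[C]_n.+1) (p : {poly C}) : act (A - B) p = act A p - act B p.
Proof. by rewrite /act mulmxBr linearB. Qed.

(** The vector [vecp W f] starts at order [W - d], so a ratio trivial below depth [d.+1] fixes its
    coefficients up to order [W], and these determine the polynomial. *)
Lemma deep_ratio_eq (C : numClosedFieldType) (nn W d : nat) (g : {poly C} -> gl C nn) (Fs : seq {poly C}) :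
  (W < nn)%N -> (d <= W)%N ->
  {in Fs, forall f : {poly C}, eqX nn.+1 (act (glval (g f)) 'X^(W - d)) (vecp W f)} ->
  {in Fs, forall f : {poly C}, size f = d.+1} ->
  {in Fs &, forall f f', shifted d.+1 (glval (lratio g f f') - 1%:M) -> f = f'}.
Proof.
move=> Wn dW gf sF f f' fF f'F hs.
have h1 := act_lratio gf fF f'F.
have low : eqX (W - d) (vecp W f) 0 by apply: vecp_low; rewrite (sF f fF).
have kN : (W - d <= nn.+1)%N by lia.
have := act_eqX kN hs low; rewrite linear0 act_sub => h2.
have W1 : (W < minn (W - d + d.+1) nn.+1)%N by rewrite leq_min; apply/andP; split; lia.
apply: (@vecp_inj C W W.+1) => //; try by rewrite sF // ltnS.
apply: eqX_trans (_ : eqX _ (act (glval (lratio g f f')) (vecp W f)) _); last by apply: eqX_le h1; lia.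
move=> i iW; have := h2 i (leq_trans iW W1); rewrite coefB coef0 => /eqP; rewrite subr_eq0 => /eqP ->.
by rewrite act1 //; apply: leq_trans iW _; lia.
Qed.

Lemma mul_le_of_sqr (R : realFieldType) (a b N : R) : 0 <= a -> 0 <= b -> a ^+ 2 <= N -> b ^+ 2 <= N -> a * b <= N.
Proof.
move=> a0 b0 h1 h2; have := sqr_ge0 (a - b); rewrite sqrrB => h.
have e : a * b *+ 2 = 2%:R * (a * b) by rewrite mulr_natl.
lra.
Qed.

Lemma commuting_family (R : realType) (n nn W k t Q : nat) (g : {poly R[i]} -> gl R[i] nn) (S : seq (gl R[i] nn)) (Fs : seq {poly R[i]}) :
  (n.+1 * n.+1 <= W)%N -> (n.+2 * W + 3 * n.+1 < k)%N -> (t * k + n.+1 + W + k <= nn)%N -> (0 < t)%N ->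
  (nn * nn.+1 <= Q)%N -> uniq Fs -> (0 < size Fs)%N ->
  {in Fs, forall f : {poly R[i]}, size f = n.+2} ->
  {in Fs, forall f : {poly R[i]}, isG W (glval (g f))} ->
  {in Fs, forall f : {poly R[i]}, eqX nn.+1 (act (glval (g f)) 'X^(W - n.+1)) (vecp W f)} ->
  1%g \in S -> (forall h, h \in S -> h^-1%g \in S) -> (forall h, h \in S -> isG W (glval h)) ->
  {in Fs &, forall f f', lratio g f f' \in S} ->
  (size (wset S (tower_len 0 t)) <= Q ^ t)%N -> (size (wset S (pivot_len t * 4)) <= Q ^ t)%N ->
  exists Fs', [/\ uniq Fs', {subset Fs' <= Fs}, (size Fs <= k * Q * Q ^ n.+1 * size Fs')%N &
    (exists G h : {poly R[i]}, {in Fs', forall f : {poly R[i]}, exists a : R[i], f = G \Po (h + a%:P)}) \/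
    (exists G h : {poly R[i]}, {in Fs', forall f : {poly R[i]}, exists a : R[i], f = G \Po (h * a%:P)})].
Proof.
move=> dW kW tn t0 nQ uFs Fs0 sF gG gf S1 SV SG lS gr1 gr2.
have W0 : (0 < W)%N by apply: leq_trans dW.
have k0 : (0 < k)%N by apply: leq_ltn_trans kW.
have Wn : (W < nn)%N by move: tn k0; clear; lia.
have kn : (W + k <= nn.+1)%N by move: tn; clear; lia.
have dk : (W + n.+2 <= nn.+1)%N by move: tn k0; clear; lia.
have tn' : (t * k + n.+1 <= nn)%N by move: tn; clear; lia.
have nn0 : (nn <= nn * nn.+1)%N by rewrite leq_pmulr.
have Q0 : (0 < Q)%N by apply: leq_trans nQ; rewrite muln_gt0 (leq_ltn_trans _ Wn).
have d1W : (n.+1 <= W)%N by apply: leq_trans dW; rewrite leq_pmulr.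
have dist := deep_ratio_eq Wn d1W gf sF.
have QQ : (0 < k * Q * Q ^ n.+1)%N by rewrite !muln_gt0 k0 Q0 expn_gt0 Q0.
have [h|[Fs' [j [f0 [sym [[uF' F'F /andP[j0 jd] sz f0F] [us many comm]]]]]]|[f0 f0F [many comm]]] :=
  commuting_dichotomy W0 Wn k0 kn dk tn' Q0 S1 SV SG gr1 gr2 t0 uFs lS dist.
- have [f fF] : exists f, f \in Fs by case: (Fs) Fs0 => // f s _; exists f; rewrite mem_head.
  exists [:: f]; split=> //; first by move=> f'; rewrite inE => /eqP ->.
    by rewrite muln1.
  (* In the first case the family is so small that one polynomial, additive with [h = 'X] and
     [a = 0], meets the required density. *)
  left; exists f, 'X => f'; rewrite inE => /eqP ->; exists 0.
  by rewrite addr0 comp_polyXr.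
- exists Fs'; split=> //; left.
  have kW' : (n.+1 * W + 3 * n.+1 < k)%N by apply: leq_ltn_trans kW; rewrite leq_add2r leq_mul2r leqnSn orbT.
  have gG' : {in Fs', forall f : {poly R[i]}, isG W (glval (g f))} by move=> f /F'F /gG.
  have gf' : {in Fs', forall f : {poly R[i]}, eqX nn.+1 (act (glval (g f)) 'X^(W - n.+1)) (vecp W f)}.
    by move=> f /F'F /gf.
  have sF' : {in Fs', forall f : {poly R[i]}, size f = n.+2} by move=> f /F'F /sF.
  have many' := leq_ltn_trans (leq_trans nn0 nQ) many.
  exact: (additive_structure W0 Wn (ltn0Sn n) d1W j0 jd kn kW' f0F gG' gf' sF' us many' comm).
exists Fs; split=> //; first by rewrite leq_pmull.
right; apply: (multiplicative_structure W0 Wn _ dW kn _ f0F gG gf sF _ comm) => //.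
  by apply: leq_ltn_trans kW; rewrite leq_add2l leq_pmull.
by apply: leq_ltn_trans many; apply: leq_trans nQ _; rewrite leq_pmull.
Qed.

Lemma bound_split a b c e f N : (a + b + c + e + f + 1 <= N)%N ->
  [/\ (a <= N)%N, (b <= N)%N, (c <= N)%N, (e <= N)%N & (f <= N)%N /\ (0 < N)%N].
Proof. by split; lia. Qed.

(** * Bookkeeping of exponents *)

Section Numerics.
Variable R : realFieldType.

Lemma walk_bound (X N : R) (a c s w q : nat) : 1 <= X -> 0 <= N -> X ^+ q = N ->
  ((a ^ 2 * c) ^ (2 ^ w.+1))%:R <= N -> (2 ^ w * s * 2 <= q)%N ->
  (a%:R ^+ 2 * (c%:R * X ^+ s)) ^+ (2 ^ w) * N <= N * N.
Proof.
move=> X1 N0 XN hc hq; have X0 : 0 <= X by apply: le_trans X1.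
rewrite ler_wpM2r // mulrA exprMn; apply: mul_le_of_sqr; rewrite -?exprM.
- by rewrite exprn_ge0 // mulr_ge0 // exprn_ge0.
- by rewrite exprn_ge0.
- by rewrite -expnSr; apply: le_trans hc; rewrite natrX natrM natrX.
by rewrite -XN; apply: ler_weXn2l => //; rewrite mulnA [(s * _)%N]mulnC.
Qed.

(** The budget is [N ^+ 5]: one factor [N] pays for all powers of 2, including the passage from [V]
    to [Q], and the powers of [Y] have exponent at most [4 * y], that is, cost at most [N ^+ 4]. *)
Lemma growth_bound (Y V Q N : R) (c len y t l : nat) : 1 <= Y -> 0 <= V -> 1 <= N -> Y ^+ y = N ->
  V ^+ t = N ^+ 5 -> V <= 2%:R * Q -> (2 ^ (t + c * len + 2))%:R <= N -> (20 * len + 1 <= y)%N -> (l <= len)%N ->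
  (2%:R ^+ c * Y ^+ 20) ^+ l * (4%:R * Y * Y ^+ (2 * y)) <= Q ^+ t.
Proof.
move=> Y1 V0 N1 YN VN VQ hc hl ll; have Y0 : 0 <= Y by apply: le_trans Y1.
have N0 : 0 <= N by apply: le_trans N1.
have c1 : 1 <= 2%:R ^+ c * Y ^+ 20 by rewrite mulr_ege1 ?exprn_ege1 // ler1n.
apply: le_trans (_ : (2%:R ^+ c * Y ^+ 20) ^+ len * (4%:R * Y * Y ^+ (2 * y)) <= _).
  by rewrite ler_wpM2r ?ler_weXn2l // !mulr_ge0 ?exprn_ge0.
have -> : (2%:R ^+ c * Y ^+ 20) ^+ len * (4%:R * Y * Y ^+ (2 * y)) = 2%:R ^+ (c * len + 2) * Y ^+ (20 * len + 1 + 2 * y).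
  have e4 : 4%:R = 2%:R ^+ 2 :> R by rewrite -natrX.
  rewrite (exprMn len (2%:R ^+ c)) -!exprM (exprD 2%:R (c * len)) (exprD Y (20 * len + 1)) (exprD Y (20 * len)) expr1 -e4.
  by move: (_ ^+ (c * len)) (_ ^+ (20 * len)) (_ ^+ (2 * y)) => p p' u; ring.
have t2 : 0 < 2%:R ^+ t :> R by rewrite exprn_gt0.
rewrite -(ler_pM2l t2) -exprMn mulrA -exprD.
apply: le_trans (_ : V ^+ t <= _); last by apply: lerXn2r; rewrite ?nnegrE //; apply: le_trans VQ.
rewrite VN exprS; apply: ler_pM; rewrite ?exprn_ge0 //.
  by rewrite -natrX addnA.
apply: le_trans (_ : Y ^+ (y * 4) <= _); last by rewrite exprM YN.
by apply: ler_weXn2l => //; apply: leq_trans (leq_add hl (leqnn _)) _; lia.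
Qed.

Lemma density_bound (Y V N f h : R) (c k r d : nat) : 0 <= f -> 0 <= h -> 0 <= Y -> 0 <= V ->
  f <= 2%:R ^+ c * k%:R * (Y ^+ 12 * V ^+ d) * h -> Y ^+ (12 * r * 2) <= N -> V ^+ (d * r * 2) <= N ->
  f ^+ r <= ((2 ^ c * k) ^ r)%:R * N * h ^+ r.
Proof.
move=> f0 h0 Y0 V0 hf hY hV.
have p0 : 0 <= 2%:R ^+ c * k%:R :> R by rewrite mulr_ge0 ?exprn_ge0.
have q0 : 0 <= Y ^+ 12 * V ^+ d by rewrite mulr_ge0 ?exprn_ge0.
apply: le_trans (_ : (2%:R ^+ c * k%:R * (Y ^+ 12 * V ^+ d) * h) ^+ r <= _).
  by apply: lerXn2r => //; rewrite nnegrE // mulr_ge0 // mulr_ge0.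
rewrite (exprMn r _ h) (exprMn r (2%:R ^+ c * k%:R)).
apply: ler_wpM2r; first exact: exprn_ge0.
rewrite natrX natrM natrX; apply: ler_wpM2l; first exact: exprn_ge0.
rewrite (exprMn r (Y ^+ 12)); apply: mul_le_of_sqr; rewrite -!exprM ?mulnA //; exact: exprn_ge0.
Qed.

Lemma mulr_shuffle (a b c d e : R) : a * b * (c * d * e) = a * c * (b * d) * e.
Proof. ring. Qed.
End Numerics.

(** With [N = |A|], everything is a power of [N]: [V = N ^ (1 / v)], whose integer part [Q] is the
    threshold of the dichotomy; [Y = N ^ (1 / y)], the loss allowed in [flattening]; and
    [X = N ^ (1 / q)], the expansion. The exponents must be chosen in this order, since word lengths
    depend on [v] and the length of the walk on [y]. *)
Theorem structured_subset (R : realType) (n r : nat) : (0 < r)%N -> exists q C1 : nat, (0 < q)%N /\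
  forall (A B : seq R[i]) (Fl : seq {poly R[i]}) (X : R),
  uniq A -> 1 <= X -> X ^+ q = (size A)%:R -> (C1 <= size A)%N -> (size B)%:R <= X * (size A)%:R ->
  uniq Fl -> (0 < size Fl)%N -> (forall f : {poly R[i]}, f \in Fl -> size f = n.+2) ->
  (forall (f : {poly R[i]}) a, f \in Fl -> a \in A -> f.[a] \in B) ->
  exists Fs, [/\ uniq Fs, {subset Fs <= Fl}, (size Fl)%:R ^+ r <= C1%:R * (size A)%:R * (size Fs)%:R ^+ r :> R &
    (exists G h : {poly R[i]}, {in Fs, forall f : {poly R[i]}, exists a : R[i], f = G \Po (h + a%:P)}) \/
    (exists G h : {poly R[i]}, {in Fs, forall f : {poly R[i]}, exists a : R[i], f = G \Po (h * a%:P)})].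
Proof.
(* [W] has room for polynomials of degree [d * d], [k] for the precision lost in the two structure
   theorems, and [v] makes the [r]-th power of [V ^+ d.+1] equal to the square root of [N]. *)
move=> r0; pose d := n.+1; pose W := (d * d)%N; pose k := (d.+1 * W + 3 * d).+1; pose v := (2 * r * d.+1)%N.
(* So [V ^+ t] is [N ^+ 5], which exceeds the size of the word sets. *)
pose t := (5 * v)%N; pose nn := (t * k + d + W + k)%N.
pose len := (2 * (tower_len 0 t + pivot_len t * 4))%N; pose y1 := (20 * len + 25)%N.
pose y := (v * y1)%N; pose M := (2 * y)%N.
have v0 : (0 < v)%N by rewrite !muln_gt0 r0.
have v4 : (4 * r <= v)%N.
  have -> : (4 * r = 2 * r * 2)%N by clear; lia.
  by rewrite leq_mul2l orbT.
have y0 : (0 < y)%N by rewrite muln_gt0 v0 /y1 addn_gt0 orbT.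
have M0 : (0 < M)%N by rewrite muln_gt0.
have Wnn : (W <= nn)%N by rewrite /nn; move: (t * k)%N; lia.
have dW : (d <= W)%N by rewrite leq_pmulr.
have [C0 [N0 [s pop]]] := @popular_ratios R n nn W M Wnn dW M0.
(* Chosen so that [X ^+ s], raised to the number of steps of the walk, stays below the square root
   of [N]. *)
pose e := (2 ^ (2 * M).+1 * s.+1 * 2)%N.
pose cb := ((d ^ 2 * C0) ^ (2 ^ (2 * M).+2))%N.
pose cc := (2 ^ (t + 55 * len + 2))%N.
pose cd := ((nn * nn.+1) ^ v)%N.
pose ce := ((2 ^ 32 * k) ^ r)%N.
exists (y * e)%N, (N0 + cb + cc + cd + ce + 1)%N; split.
  by rewrite muln_gt0 y0 /e !muln_gt0 expn_gt0.
move=> A B Fl X uA X1 XN hN hB uFl Fl0 sF hF.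
set N := (size A)%:R in XN hB *.
have [hN0 hcb hcc hcd [hce A0]] := bound_split hN.
have N1 : 1 <= N by rewrite ler1n.
have N0' : 0 <= N := ler0n _ _.
pose Y := X ^+ e; pose V := Y ^+ y1.
have Y1 : 1 <= Y by apply: exprn_ege1.
have V1 : 1 <= V by apply: exprn_ege1.
have Y0 : 0 <= Y := le_trans ler01 Y1.
have V0 : 0 <= V := le_trans ler01 V1.
have YN : Y ^+ y = N by rewrite -exprM mulnC XN.
have VN : V ^+ v = N by rewrite -exprM mulnC YN.
have walkN : (n.+1%:R ^+ 2 * (C0%:R * X ^+ s)) ^+ (2 ^ (2 * M).+1) * (size A)%:R <= Y ^+ M.
  have -> : Y ^+ M = N * N by rewrite /M mulnC exprM YN expr2.
  apply: (walk_bound X1 N0' XN); first by rewrite ler_nat.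
  by apply: leq_trans (leq_pmull e y0); rewrite /e leq_mul2r leq_mul2l leqnSn !orbT.
have [g [S [Fs [[uFs FsF sz gG gf] [S1 SV SG lS grow]]]]] :=
  pop A B Fl X Y uA A0 hN0 uFl Fl0 sF hF X1 hB Y1 walkN.
pose Q := Num.truncn V.
have /andP[QV VQ] := truncn_itv V0; rewrite -/Q in QV VQ.
have Q1 : (1 <= Q)%N by rewrite truncn_ge_nat.
have VQ2 : V <= 2%:R * Q%:R.
  apply: le_trans (ltW VQ) _; rewrite -natrM ler_nat mul2n -addnn -add1n leq_add2r; exact: Q1.
have nQ : (nn * nn.+1 <= Q)%N.
  rewrite truncn_ge_nat // leNgt; apply/negP => h.
  have : V ^+ v < (nn * nn.+1)%:R ^+ v by rewrite ltrXn2r // -lt0n.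
  by rewrite VN -natrX ltr_nat ltnNge hcd.
have Vt : V ^+ t = N ^+ 5 by rewrite /t mulnC exprM VN.
have hcc' : (2 ^ (t + 55 * len + 2))%:R <= N by rewrite ler_nat.
have yl : (20 * len + 1 <= y)%N.
  by apply: leq_trans (leq_pmull y1 v0); rewrite /y1 leq_add2l.
have growQ l : (2 * l <= len)%N -> (size (wset S l) <= Q ^ t)%N.
  move=> hl; rewrite -(ler_nat R) natrX; apply: le_trans (grow l) _.
  exact: (growth_bound Y1 V0 N1 YN Vt VQ2 hcc' yl hl).
have Fs0 : (0 < size Fs)%N.
  rewrite lt0n; apply/negP => /eqP h; move: sz; rewrite h mulr0 leNgt => /negP; apply.
  by rewrite ltr0n.
have gr1 : (size (wset S (tower_len 0 t)) <= Q ^ t)%N by apply: growQ; rewrite /len leq_mul2l leq_addr.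
have gr2 : (size (wset S (pivot_len t * 4)) <= Q ^ t)%N by apply: growQ; rewrite /len leq_mul2l leq_addl.
have t0 : (0 < t)%N by rewrite muln_gt0.
have sF' : {in Fs, forall f : {poly R[i]}, size f = n.+2} by move=> f /FsF /sF.
have [Fs' [uFs' Fs'F sz' fam]] :=
  commuting_family (leqnn W) (ltnSn _) (leqnn nn) t0 nQ uFs Fs0 sF' gG gf S1 SV SG lS gr1 gr2.
exists Fs'; split; [exact: uFs'|by move=> f /Fs'F /FsF| |exact: fam].
have szr : (size Fl)%:R <= 2%:R ^+ 32 * k%:R * (Y ^+ 12 * V ^+ d.+1) * (size Fs')%:R :> R.
  apply: le_trans sz _; have c0 : 0 <= 2%:R ^+ 32 * Y ^+ 12 :> R by apply: mulr_ge0; apply: exprn_ge0.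
  have h : (size Fs)%:R <= k%:R * V ^+ d.+1 * (size Fs')%:R :> R.
    apply: le_trans (_ : (k * Q * Q ^ n.+1 * size Fs')%:R <= _); first by rewrite ler_nat.
    rewrite natrM; apply: ler_wpM2r; first exact: ler0n.
    rewrite -mulnA -expnS natrM natrX; apply: ler_wpM2l; first exact: ler0n.
    by apply: lerXn2r; rewrite ?nnegrE.
  apply: le_trans (ler_wpM2l c0 h) _.
  by rewrite mulr_shuffle.
have hY : Y ^+ (12 * r * 2) <= N.
  rewrite -YN; apply: ler_weXn2l => //; rewrite /y /y1.
  apply: leq_trans (_ : v * 25 <= _)%N; last by rewrite leq_mul2l leq_addl orbT.
  by move: v4; clear; lia.
have hV : V ^+ (d.+1 * r * 2) <= N.
  have -> : (d.+1 * r * 2 = v)%N by rewrite /v mulnC mulnA mulnAC.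
  by rewrite VN.
apply: le_trans (density_bound (ler0n _ _) (ler0n _ _) Y0 V0 szr hY hV) _.
apply: ler_wpM2r; first exact: exprn_ge0.
apply: ler_wpM2r => //; rewrite ler_nat addn1; apply: leq_trans (leqnSn _); exact: leq_addl.
Qed.

Local Open Scope fset_scope.
Local Open Scope ring_scope.

Lemma size_le_card_fset (T : choiceType) (s : seq T) (X : {fset T}) : uniq s -> {subset s <= X} -> (size s <= #|` X|)%N.
Proof. by move=> us sX; apply: uniq_leq_size. Qed.

Lemma popular_degree (R : realType) (F : {fset {poly R[i]}}) (D : nat) : (0 < D)%N ->
  (forall f : {poly R[i]}, f \in F -> (1 < size f < D.+2)%N) ->
  exists2 n, (n < D)%N & (#|` F| <= D * size (filter (fun f : {poly R[i]} => size f == n.+2) F))%N.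
Proof.
move=> D0 hF; have nz : iota 0 D != [::] by case: (D) D0.
have [n nD hn] := seq_argmax (fun n => (size (filter (fun f : {poly R[i]} => size f == n.+2) F))%:R : R) nz.
rewrite mem_iota add0n in nD; exists n => //.
rewrite mulnC -[X in (_ <= _ * X)%N](size_iota 0 D); apply: (@size_le_fibre _ _ _ (fun f : {poly R[i]} => (size f).-2)).
  by apply/allP => f /hF; rewrite mem_iota; lia.
move=> n' n'D; rewrite -(ler_nat R); apply: le_trans (hn n' n'D); rewrite ler_nat size_filter.
by apply: sub_count_in => f /hF hf /eqP <-; apply/eqP; lia.
Qed.

Lemma rootR_pow (R : realType) (N : R) (q : nat) : 0 <= N -> (0 < q)%N -> (N `^ (q%:R^-1)) ^+ q = N.
Proof.
move=> N0 q0; rewrite -powR_mulrn ?powR_ge0 // -powRrM mulVf ?powRr1 //.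
by rewrite pnatr_eq0 -lt0n.
Qed.

(* If [Fs] had fewer than [F ^ (1 - eps)] elements, then [F ^ (r eps)], which is at least [N ^ 2],
   would be at most a constant times [N]. *)
Lemma large_family (R : realType) (eps : R) (r c : nat) (F N S : R) : 0 < eps ->
  2%:R <= eps * eps * r%:R -> 1 <= N -> 1 <= F -> N `^ eps <= F -> c%:R < N -> 0 <= S ->
  F ^+ r <= c%:R * N * S ^+ r -> F `^ (1 - eps) <= S.
Proof.
move=> e0 er N1 F1 NF cN S0 hF; rewrite leNgt; apply/negP => hS.
have c0 : 0 <= c%:R :> R by rewrite ler0n.
have N0 : 0 < N by apply: lt_le_trans N1.
have F0 : 0 < F by apply: lt_le_trans F1.
have Fr : F ^+ r <= c%:R * N * (F `^ (1 - eps)) ^+ r.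
  apply: le_trans hF _; apply: ler_wpM2l; first by rewrite mulr_ge0 // ltW.
  by apply: lerXn2r; rewrite ?nnegrE ?powR_ge0 // ltW.
have FE : F ^+ r = F `^ (eps * r%:R) * (F `^ (1 - eps)) ^+ r.
  rewrite -(powR_mulrn r (powR_ge0 F (1 - eps))) -powRrM -powRD; last by apply/implyP => _; rewrite gt_eqF.
  by rewrite -mulrDl addrC subrK mul1r powR_mulrn // ltW.
have p0 : 0 < (F `^ (1 - eps)) ^+ r by rewrite exprn_gt0 // powR_gt0.
move: Fr; rewrite FE ler_pM2r // leNgt => /negP; apply.
apply: lt_le_trans (_ : N * N <= _); first by rewrite ltr_pM2r.
rewrite -expr2 -powR_mulrn ?(ltW N0) //; apply: le_trans (_ : N `^ (eps * (eps * r%:R)) <= _).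
  by apply: ler_powR => //; rewrite mulrA.
rewrite powRrM; apply: ge0_ler_powR; rewrite ?nnegrE ?powR_ge0 ?(ltW F0) //.
by rewrite mulr_ge0 // ltW.
Qed.

Theorem theorem1p3 (R : realType) (eps : R) (eps_gt0 : 0 < eps) :
  exists c eta : R, 0 < c /\ 0 < eta /\
    forall (F : {fset {poly R[i]}}) (A : {fset R[i]}),
      (forall f : {poly R[i]}, f \in F ->
         (1 < size f)%N /\ ((size f).-1%:R : R) <= 1 / eps) ->
      ~ eps_additive eps F ->
      ~ eps_multiplicative eps F ->
      (#|` F|%:R : R) >= (#|` A|%:R : R) `^ eps ->
      (#|` eval_fset F A|%:R : R) >= c * (#|` A|%:R : R) `^ (1 + eta).
Proof.
(* [D] bounds the degrees, and [r] satisfies [eps * eps * r >= 2], which makes [|F| ^ (eps * r)] at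
   least [|A| ^ 2]. *)
pose D := (Num.bound (1 / eps)).+1; pose r := (Num.bound (2%:R / (eps * eps))).+1.
have ee0 : 0 < eps * eps by rewrite mulr_gt0.
have er : 2%:R <= eps * eps * r%:R.
  have b0 : 0 <= 2%:R / (eps * eps) by rewrite divr_ge0 // ltW.
  rewrite mulrC -ler_pdivrMr //; apply: le_trans (ltW (archi_boundP b0)) _.
  by rewrite ler_nat leqnSn.
have /choice [q /choice [C1 hq]] (n : nat) := @structured_subset R n r isT.
(* The degree is selected only after [F] is given, so the constants must serve all degrees up to [D]
   at once. *)
pose qm := (\sum_(n < D) q n).+1; pose N1 := (\sum_(n < D) (D ^ r + 1) * C1 n).+1.
have N10 : 0 < N1%:R :> R by rewrite ltr0n.
have qm0 : 0 < qm%:R :> R by rewrite ltr0n.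
exists (N1%:R ^+ 2)^-1, (qm%:R)^-1; split; first by rewrite invr_gt0 exprn_gt0.
split=> [|F A hF nadd nmul FA]; first by rewrite invr_gt0.
have e1 : (qm%:R)^-1 <= 1 :> R by rewrite invf_le1 // ler1n.
have e0 : 0 < (qm%:R)^-1 :> R by rewrite invr_gt0.
case: (posnP #|` A|) => [->|A0].
  by rewrite powR0 ?mulr0 // gt_eqF // addr_gt0.
have NR1 : 1 <= #|` A|%:R :> R by rewrite ler1n.
have F1 : 1 <= #|` F|%:R :> R by apply: le_trans FA; rewrite -[X in X <= _](powRr0 (#|` A|%:R : R)) ler_powR // ltW.
have [f0 f0F] : exists f0, f0 \in F.
  by apply/fset0Pn; rewrite -cardfs_gt0 -(ltr_nat R); apply: lt_le_trans F1.
have [a0 a0A] : exists a0, a0 \in A by apply/fset0Pn; rewrite -cardfs_gt0.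
have B1 : 1 <= #|` eval_fset F A|%:R :> R.
  by rewrite ler1n cardfs_gt0; apply/fset0Pn; exists f0.[a0]; apply: in_imfset2.
(* For [|A| < N1] the bound [1 <= |F(A)|] suffices: [1 + eta] is at most 2, and [c] is the inverse
   square of [N1]. *)
case: (ltnP #|` A| N1) => [small|big].
  apply: le_trans B1; rewrite ler_pdivrMl ?exprn_gt0 // mulr1.
  apply: le_trans (_ : #|` A|%:R `^ 2%:R <= _).
    by apply: ler_powR => //; lra.
  by rewrite powR_mulrn // lerXn2r ?nnegrE // ler_nat ltnW.
have [|n nD hpop] := @popular_degree R F D isT.
  move=> f /hF [-> sf] /=; rewrite ltnS /D.
  have : (size f).-1%:R < (Num.bound (1 / eps))%:R :> R.
    by apply: le_lt_trans sf _; apply: archi_boundP; rewrite divr_ge0 // ltW.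
  by rewrite ltr_nat; move: (size f) (Num.bound _) => u b; clear; lia.
set Fl := filter _ _ in hpop.
have [q0 {}hq] := hq n; pose X := (#|` A|%:R : R) `^ ((q n)%:R^-1).
have XN : X ^+ q n = #|` A|%:R by apply: rootR_pow.
have X1 : 1 <= X by rewrite -[X in X <= _](powRr0 (#|` A|%:R : R)) ler_powR // invr_ge0.
have qn : (q n <= qm)%N.
  by apply: leqW; rewrite (bigD1 (Ordinal nD)) //= leq_addr.
have hN : (((D ^ r + 1) * C1 n).+1 <= N1)%N.
  by rewrite ltnS (bigD1 (Ordinal nD)) //= leq_addr.
(* Expansion by more than [X = |A| ^ (1 / q n)] already gives the conclusion, as [q n <= qm]; only
   the opposite case calls for structure. *)
case: (lerP (#|` eval_fset F A|%:R : R) (X * #|` A|%:R)) => [hB|hB]; last first.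
  apply: le_trans (ltW hB); apply: le_trans (_ : #|` A|%:R `^ (1 + qm%:R^-1) <= _).
    rewrite ler_piMl ?powR_ge0 // invf_le1 ?exprn_gt0 //; apply: exprn_ege1.
    by rewrite ler1n.
  rewrite powRD; last by apply/implyP => _; rewrite gt_eqF // (lt_le_trans ltr01).
  rewrite powRr1 // mulrC ler_wpM2r // ler_powR //.
  by rewrite lef_pV2 ?posrE ?ltr0n ?ler_nat.
have uF : uniq Fl by rewrite filter_uniq // fset_uniq.
have FlF (f : {poly R[i]}) : f \in Fl -> f \in F by rewrite mem_filter => /andP[].
have sF (f : {poly R[i]}) : f \in Fl -> size f = n.+2 by rewrite mem_filter => /andP[/eqP].
have Fl0 : (0 < size Fl)%N.
  by rewrite lt0n; apply/negP => /eqP h; move: hpop; rewrite h muln0 leqn0 => /eqP h'; move: F1; rewrite h' ler1n.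
have hFA (f : {poly R[i]}) a : f \in Fl -> a \in enum_fset A -> f.[a] \in enum_fset (eval_fset F A).
  by move=> /FlF fF aA; apply: in_imfset2.
have hC1 : (C1 n <= size (enum_fset A))%N.
  by apply: leq_trans big; apply: leq_trans hN; apply: leqW; rewrite leq_pmull // addn1.
have [Fs [uFs FsF hsz fam]] := hq (enum_fset A) (enum_fset (eval_fset F A)) Fl X (fset_uniq _) X1 XN hC1 hB uF Fl0 sF hFA.
have hr : #|` F|%:R ^+ r <= (D ^ r * C1 n)%N%:R * #|` A|%:R * (size Fs)%:R ^+ r :> R.
  apply: le_trans (_ : (D%:R * (size Fl)%:R) ^+ r <= _).
    by apply: lerXn2r; rewrite ?nnegrE ?mulr_ge0 // -natrM ler_nat.
  have -> : (D ^ r * C1 n)%N%:R = D%:R ^+ r * (C1 n)%:R :> R by rewrite -natrX -natrM.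
  have p0 : 0 <= D%:R ^+ r :> R := exprn_ge0 _ (ler0n _ _).
  by rewrite (exprMn r (D%:R : R)); apply: le_trans (ler_wpM2l p0 hsz) _; rewrite !mulrA.
have cN : (D ^ r * C1 n)%N%:R < #|` A|%:R :> R.
  by rewrite ltr_nat; apply: leq_trans big; apply: leq_trans hN; rewrite ltnS leq_mul2r leq_addr orbT.
have dens := large_family eps_gt0 er NR1 F1 FA cN (ler0n _ _) hr.
case: fam => [[G [h hG]]|[G [h hG]]]; [case: nadd|case: nmul]; exists G, h; apply: le_trans dens _; rewrite ler_nat;
  apply: size_le_card_fset => // f fFs; rewrite !inE /= FlF ?FsF //=; apply/asboolP; exact: hG.
Qed.
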